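(* Let $G$ be a compactly generated locally compact group with Kazhdan's property (T). Then there exists $\varepsilon>0$ such that $\mathcal C_{\mathcal F(\mathcal E(\varepsilon),\varepsilon\ell)}(G)$ has a central Kazhdan projection and every continuous affine action of $G$ with linear part in $\mathcal F(\mathcal E(\varepsilon),\varepsilon\ell)$ has a fixed point, where $\mathcal E(\varepsilon)$ is the class of all Banach spaces $E$ satisfying $$\tfrac12\left(\|x+y\|^2+\|x-y\|^2\right)\le(1+\varepsilon)\left(\|x\|^2+\|y\|^2\right)\quad\forall x,y\in E.$$
   Context: Standing assumptions: $G$ is compactly generated, locally compact, separable and infinite; $S\subset G$ is a compact symmetric generating set containing the identity; $\ell(g)=\min\{n:g\in S^n\}$; $\int f$ is integration against a left Haar measure. A representation $(\pi,E)$ is a strongly continuous homomorphism from $G$ to the bounded invertible operators of a Banach space $E$; $\pi(f)=\int f(g)\pi(g)\,dg$ for $f\in C_c(G)$. A continuous affine action with linear part $(\pi,E)$ is $\sigma(g)x=\pi(g)x+b(g)$ with $b:G\to E$ continuous, $b(gh)=b(g)+\pi(g)b(h)$. For a class $\mathcal E$ of Banach spaces and a function $m$ on $G$, $\mathcal F(\mathcal E,m)$ is the collection of representations $(\pi,E)$ of $G$ with $E$ isometric to a space in $\mathcal E$ and $\|\pi(g)\|_{B(E)}\le e^{m(g)}$ for all $g\in G$. $\mathcal C_{\mathcal F}(G)$ is the (Hausdorff) completion of $C_c(G)$ for $\|f\|_{\mathcal F}=\sup_{(\pi,E)\in\mathcal F}\|\pi(f)\|_{B(E)}$, a Banach algebra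 for convolution. A Kazhdan projection in it is an idempotent $p$ in the closure of $\{f\in C_c(G):\int f=1\}$ such that $\pi(p)$ is a projection onto $E^\pi=\{x:\pi(g)x=x\ \forall g\}$ for every $(\pi,E)\in\mathcal F$; it is central if it lies in the center of $\mathcal C_{\mathcal F}(G)$. *)

(* Defs.v *)
From HB Require Import structures.
From mathcomp Require Import all_boot all_order all_algebra.
From mathcomp Require Import all_classical all_reals all_analysis.
From mathcomp Require Import complex sesquilinear.

Set Implicit Arguments.
Unset Strict Implicit.
Unset Printing Implicit Defensive.

Import Order.TTheory GRing.Theory Num.Theory.
Import numFieldNormedType.Exports.

Local Open Scope classical_set_scope.
Local Open Scope ring_scope.
Local Open Scope complex_scope.

(* The distinguished point is only there because measurableType requires one. *)
HB.mixin Record isTopologicalGroup G & Topological G & Group G := {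
  mulg_continuous : continuous (fun x : G * G => (x.1 * x.2)%g) ;
  invg_continuous : continuous (fun x : G => (x^-1)%g)
}.

#[short(type="topologicalGroupType")]
HB.structure Definition TopologicalGroup :=
  {G of PointedTopological G & Group G & isTopologicalGroup G}.

Definition separable (T : topologicalType) : Prop :=
  exists2 D : set T, countable D & dense D.

Section Generators.
Variables (G : topologicalGroupType) (S : set G).

Fixpoint setpow (n : nat) : set G :=
  if n is m.+1 then [set (x * y)%g | x in S & y in setpow m] else [set 1%g].

Definition compact_generating : Prop :=
  [/\ compact S, forall x, S x -> S (x^-1)%g, S 1%g &
      \bigcup_n setpow n = [set: G]].

(* The default value 0 is irrelevant when S generates G. *)
Definition word_length (g : G) : nat :=
  if pselect (exists n, `[< setpow n g >]) is left h then ex_minn h else 0%N.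

End Generators.

Definition borel (G : topologicalGroupType) := g_sigma_algebraType (@open G).

Section Haar.
Variables (R : realType) (G : topologicalGroupType).
Variable mu : {measure set (borel G) -> \bar R}.

Definition left_haar : Prop :=
  [/\ mu [set: G] != 0%E,
      forall (g : G) (A : set (borel G)), measurable A ->
        mu [set (g * x)%g | x in (A : set G)] = mu A,
      forall A : set G, compact A -> (mu A < +oo)%E,
      forall A : set (borel G), measurable A ->
        mu A = ereal_inf [set mu U | U in [set U : set G | open U /\ A `<=` U]] &
      forall U : set G, open U ->
        mu U = ereal_sup [set mu A | A in [set A : set G | compact A /\ A `<=` U]]].

End Haar.

(* Banach spaces may be real or complex; C_c(G) has values in the same field. *)
Inductive scalars := RealScalars | ComplexScalars.

Section Scalars.
Variables (R : realType) (s : scalars).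

Definition scalar_field : numFieldType :=
  match s with RealScalars => R | ComplexScalars => R[i] end.

Definition of_real : R -> scalar_field :=
  match s return R -> match s with RealScalars => R : numFieldType
                                 | ComplexScalars => R[i] end with
  | RealScalars => id | ComplexScalars => fun x => x%:C end.

Definition re_scalar : scalar_field -> R :=
  match s return match s with RealScalars => R : numFieldType
                            | ComplexScalars => R[i] end -> R with
  | RealScalars => id | ComplexScalars => @complex.Re R end.

(* In the library the norm of a normedModType K takes values in K. *)
Definition rnorm (E : normedModType scalar_field) (x : E) : R := re_scalar `|x|.

(* Value +oo exactly when the linear map T is unbounded. *)
Definition opnorm (E : normedModType scalar_field) (T : E -> E) : \bar R :=
  ereal_sup [set (rnorm (T x))%:E | x in [set x | rnorm x <= 1]].

End Scalars.

Section Bochner.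
Variables (R : realType) (s : scalars) (G : topologicalGroupType).
Variable mu : {measure set (borel G) -> \bar R}.
Variable E : normedModType (scalar_field R s).

(* A list of pairs (A, v) encodes the simple function \sum 1_A v. *)
Definition simple_fun (t : seq (set (borel G) * E)) (x : G) : E :=
  \sum_(a <- t) \1_(a.1) x *: a.2.

Definition simple_integral (t : seq (set (borel G) * E)) : E :=
  \sum_(a <- t) of_real s (fine (mu a.1)) *: a.2.

Definition is_bochner_integral (F : G -> E) (v : E) : Prop :=
  exists t : nat -> seq (set (borel G) * E),
    [/\ forall n a, a \in t n -> measurable a.1 /\ (mu a.1 < +oo)%E,
        forall n, measurable_fun [set: borel G]
          (fun x : borel G => rnorm (F x - simple_fun (t n) x)),
        (fun n => \int[mu]_x (rnorm (F x - simple_fun (t n) x))%:E)%E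
          @ \oo --> 0%E &
        simple_integral (t n) @[n --> \oo] --> v].

Definition bochner_integral (F : G -> E) : E :=
  xget 0 [set v | is_bochner_integral F v].

End Bochner.

Section Representations.
Variables (R : realType) (G : topologicalGroupType) (s : scalars).
Local Notation K := (scalar_field R s).

Record representation (E : completeNormedModType K) := Representation {
  rep_op :> G -> {linear E -> E} ;
  rep_bounded : forall g, continuous (rep_op g) ;
  rep1 : forall x, rep_op 1%g x = x ;
  repM : forall g h x, rep_op (g * h)%g x = rep_op g (rep_op h x) ;
  rep_continuous : forall x, continuous (fun g => rep_op g x)
}.

Definition invariants (E : completeNormedModType K) (pi : representation E) :
  set E := [set x | forall g, pi g x = x].

Definition banach_class := completeNormedModType K -> Prop.

Definition rep_class := forall E : completeNormedModType K,
  representation E -> Prop.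

Definition isometric (E E' : completeNormedModType K) : Prop :=
  exists T : {linear E -> E'},
    (forall x, rnorm (T x) = rnorm x) /\ (forall y, exists x, T x = y).

Definition reps_of_growth (C : banach_class) (m : G -> R) : rep_class :=
  fun E pi => (exists2 E', C E' & isometric E E') /\
    (forall g, (opnorm (pi g) <= (expR (m g))%:E)%E).

Definition almost_parallelogram (e : R) : banach_class := fun E =>
  forall x y : E,
    2^-1 * (rnorm (x + y) ^+ 2 + rnorm (x - y) ^+ 2)
      <= (1 + e) * (rnorm x ^+ 2 + rnorm y ^+ 2).

Definition cocycle (E : completeNormedModType K) (pi : representation E)
    (b : G -> E) : Prop :=
  continuous b /\ forall g h, b (g * h)%g = b g + pi g (b h).

Definition affine_action (E : completeNormedModType K) (pi : representation E)
    (b : G -> E) (g : G) (x : E) : E := pi g x + b g.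

End Representations.

Section PropertyT.
Variables (R : realType) (G : topologicalGroupType).
Local Notation C := (scalar_field R ComplexScalars).

(* pi is unitary for an inner product inducing the norm of H; in particular H
   is a Hilbert space. *)
Definition unitary (H : completeNormedModType C)
    (pi : representation G H) : Prop :=
  exists ip : {dot H for (@Num.conj R[i])},
    (forall x, `|x| ^+ 2 = ip x x) /\
    (forall g x y, ip (pi g x) (pi g y) = ip x y).

Definition property_T : Prop :=
  exists (Q : set G) (d : R), [/\ compact Q, 0 < d &
    forall (H : completeNormedModType C) (pi : representation G H),
      unitary pi ->
      (exists x : H, forall q, Q q -> rnorm (pi q x - x) < d * rnorm x) ->
      exists2 x : H, x != 0 & invariants pi x].

End PropertyT.

Section KazhdanProjections.
Variables (R : realType) (G : topologicalGroupType) (s : scalars).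
Variable mu : {measure set (borel G) -> \bar R}.
Local Notation K := (scalar_field R s).

Definition Cc : set (G -> K) := [set f | continuous f /\
  exists2 A, compact A & forall x, ~ A x -> f x = 0].

Definition haar_integral (f : G -> K) : K :=
  bochner_integral mu (f : G -> K^o).

Definition convolution (f h : G -> K) : G -> K :=
  fun x => haar_integral (fun y => f y * h (y^-1 * x)%g).

Definition rep_integral (E : completeNormedModType K)
    (pi : representation G E) (f : G -> K) : E -> E :=
  fun x => bochner_integral mu (fun g => f g *: pi g x).

Variable F : rep_class R G s.

Definition Fnorm (f : G -> K) : \bar R :=
  ereal_sup [set r | exists (E : completeNormedModType K)
    (pi : representation G E), F pi /\ r = opnorm (rep_integral pi f)].

(* The completion of C_c(G) is realized as the set of classes of Fnorm-Cauchy
   sequences modulo Fnorm-null sequences. *)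
Definition Fcauchy : set (nat -> G -> K) := [set u |
  (forall n, Cc (u n)) /\
  (forall e : R, 0 < e -> exists N, forall m n, (N <= m)%N -> (N <= n)%N ->
     (Fnorm (u m \- u n)%R < e%:E)%E)].

Definition Fequiv (u v : nat -> G -> K) : Prop :=
  Fnorm (u n \- v n) @[n --> \oo] --> 0%E.

Definition Fclass (u : nat -> G -> K) : set (nat -> G -> K) :=
  [set v | Fcauchy v /\ Fequiv v u].

Definition completion : set (set (nat -> G -> K)) :=
  [set Fclass u | u in Fcauchy].

Definition completion_mul (p q : set (nat -> G -> K)) : set (nat -> G -> K) :=
  [set w | exists u v, [/\ p u, q v & Fclass (fun n => convolution (u n) (v n)) w]].

Definition in_closure (p : set (nat -> G -> K)) (A : set (G -> K)) : Prop :=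
  forall e : R, 0 < e -> exists2 f, A f &
    forall u, p u -> (limn (fun n => Fnorm (u n \- f)%R) < e%:E)%E.

(* T is the image of p under the extension of pi to the completion. *)
Definition completion_rep (E : completeNormedModType K)
    (pi : representation G E) (p : set (nat -> G -> K))
    (T : {linear E -> E}) : Prop :=
  continuous T /\ forall u, p u ->
    opnorm (fun x => rep_integral pi (u n) x - T x) @[n --> \oo] --> 0%E.

Definition kazhdan_projection (p : set (nat -> G -> K)) : Prop :=
  [/\ completion p,
      completion_mul p p = p,
      in_closure p [set f | Cc f /\ haar_integral f = 1] &
      forall (E : completeNormedModType K) (pi : representation G E), F pi ->
        exists T : {linear E -> E}, [/\ completion_rep pi p T,
          forall x, T (T x) = T x & range T = invariants pi]].

Definition central (p : set (nat -> G -> K)) : Prop :=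
  forall q, completion q -> completion_mul p q = completion_mul q p.

End KazhdanProjections.

(* Main.v *)
(* For small eps there is a compactly supported function f of integral 1 such
   that, for every cocycle b over a representation in the class, moving the
   origin of the affine action to y = \int f b halves the maximum of |b| on S.
   Iterating gives fixed points.  For b(g) = pi(g)x - x the iteration says that
   the powers of pi(f) converge geometrically, uniformly over the class, to
   projections onto the invariant vectors; the convolution powers of f therefore
   define a Kazhdan projection.

   Halving is proved by contradiction.  Counterexamples for eps -> 0 have an
   ultralimit satisfying the parallelogram law, so the smoothed cocycles yield a
   conditionally negative definite function psi on G.  For t > 0 subtract from
   exp(-t psi) the largest constant that keeps it positive definite: the
   associated unitary representation has no invariant vectors, so property (T)
   makes averaging operators contract it, and t -> 0 gives an estimate for psi
   that contradicts the choice of the counterexamples.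

   For centrality, the orbit-continuous functionals on a space of the class form
   a representation of the class again; projecting a functional to the invariant
   ones shows that P pi(g) = P for the projection P onto invariant vectors. *)
Require Import Defs.
From HB Require Import structures.
From mathcomp Require Import all_boot all_order all_algebra.
From mathcomp Require Import finmap.
From mathcomp Require Import all_classical all_reals all_analysis.
From mathcomp Require Import measurable_realfun complex sesquilinear ring lra.

Set Implicit Arguments.
Unset Strict Implicit.
Unset Printing Implicit Defensive.

Import Order.TTheory GRing.Theory Num.Theory.
Import numFieldNormedType.Exports.

Local Open Scope classical_set_scope.
Local Open Scope ring_scope.

(** * Real-valued norms *)

(** The order of choices is what makes the contradiction work. [averaging_weights] fixes one finite
    family of weights [nu] that serves every kernel with a given bound on [Q] and a given modulus of
    continuity; the counterexamples are chosen only afterwards. The family is finite because the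
    ultralimit is a bare kernel on [G], to which finite combinations pass but integrals do not.
    Cocycles over the class have no common modulus of continuity. Averaging them against a fixed
    bump provides one, at the price of a change of origin only. A conditionally negative definite
    function describes an affine isometric action, while property (T) speaks of unitary ones;
    [exp(-t psi)] linearises the action. Once the largest constant is removed, the vector of the
    identity has norm O(sqrt t), so after division by [t] the bound no longer depends on [t]. The
    contradiction yields one eps for each group element. Compactness of [S] and equicontinuity make
    it uniform: a quarter comes from finitely many points of [S], another from moving to a nearby
    point, and together they give the half. *)

Section ScalarTheory.
Variables (R : realType) (s : scalars).
Local Notation K := (scalar_field R s).
Local Notation r2k := (@of_real R s).
Local Notation re := (@re_scalar R s).

Lemma of_realK (x : R) : re (r2k x) = x. Proof. by rewrite /re_scalar /of_real; case: s. Qed.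
Lemma of_realD (x y : R) : r2k (x + y) = r2k x + r2k y.
Proof. by rewrite /of_real; case: s => //=; rewrite -rmorphD. Qed.
Lemma of_realM (x y : R) : r2k (x * y) = r2k x * r2k y.
Proof. by rewrite /of_real; case: s => //=; rewrite -rmorphM. Qed.
Lemma of_realN (x : R) : r2k (- x) = - r2k x.
Proof. by rewrite /of_real; case: s => //=; rewrite -rmorphN. Qed.
Lemma of_real0 : r2k 0 = 0. Proof. by rewrite /of_real; case: s. Qed.
Lemma of_real1 : r2k 1 = 1. Proof. by rewrite /of_real; case: s. Qed.
Lemma of_realB (x y : R) : r2k (x - y) = r2k x - r2k y.
Proof. by rewrite of_realD of_realN. Qed.
Lemma re_scalarD (x y : K) : re (x + y) = re x + re y.
Proof. by move: x y; rewrite /re_scalar; case: s => //= -[a b] [c d]. Qed.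
Lemma re_scalar_ge0 (x : K) : 0 <= x -> 0 <= re x.
Proof. by move: x; rewrite /re_scalar; case: s => //= -[a b]; rewrite lecE => /andP[]. Qed.
Lemma of_real_re (x : K) : 0 <= x -> r2k (re x) = x.
Proof.
move: x; rewrite /re_scalar /of_real; case: s => //= -[a b].
by rewrite lecE => /andP[/eqP /= -> _].
Qed.
Lemma of_real_le (x y : R) : (r2k x <= r2k y) = (x <= y).
Proof. by rewrite /of_real; case: s => //=; rewrite lecR. Qed.
Lemma of_real_lt (x y : R) : (r2k x < r2k y) = (x < y).
Proof. by rewrite /of_real; case: s => //=; rewrite ltcR. Qed.
Lemma of_real_inj (x y : R) : r2k x = r2k y -> x = y.
Proof. by move=> /(congr1 re); rewrite !of_realK. Qed.
Lemma normr_of_real (x : R) : `|r2k x| = r2k `|x|.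
Proof.
case: (leP 0 x) => x0.
  by rewrite !ger0_norm// -of_real0 of_real_le.
by rewrite !ltr0_norm ?of_realN// -of_real0 of_real_lt.
Qed.
Lemma re_scalar_le (x y : K) : x <= y -> re x <= re y.
Proof.
by move=> xy; rewrite -(subrK x y) re_scalarD lerDr re_scalar_ge0// subr_ge0.
Qed.

Section Norm.
Variable E : normedModType K.
Implicit Types x y : E.

Lemma normE x : `|x| = r2k (rnorm x).
Proof. by rewrite /rnorm of_real_re. Qed.
Lemma rnorm_ge0 x : 0 <= rnorm x. Proof. exact/re_scalar_ge0/normr_ge0. Qed.
Lemma rnorm0 : rnorm (0 : E) = 0.
Proof. by apply: of_real_inj; rewrite -normE normr0 of_real0. Qed.
Lemma rnorm_eq0 x : rnorm x = 0 -> x = 0.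
Proof. by move=> h; apply/normr0_eq0; rewrite normE h of_real0. Qed.
Lemma rnormN x : rnorm (- x) = rnorm x. Proof. by rewrite /rnorm normrN. Qed.
Lemma rnormD x y : rnorm (x + y) <= rnorm x + rnorm y.
Proof. by rewrite -re_scalarD; apply: re_scalar_le; exact: ler_normD. Qed.
Lemma rnormB x y : rnorm (x - y) <= rnorm x + rnorm y.
Proof. by rewrite -(rnormN y) rnormD. Qed.
Lemma rnormBC x y : rnorm (x - y) = rnorm (y - x).
Proof. by rewrite -rnormN opprB. Qed.
Lemma rnorm_triangle x y z : rnorm (x - z) <= rnorm (x - y) + rnorm (y - z).
Proof. by rewrite -[x - z](subrKA y) rnormD. Qed.
Lemma rnorm_dist x y : `|rnorm x - rnorm y| <= rnorm (x - y).
Proof.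
rewrite ler_norml; apply/andP; split.
  by rewrite lerNl opprB lerBlDr rnormBC -{1}(subrK x y) rnormD.
by rewrite lerBlDr -{1}(subrK y x) rnormD.
Qed.
Lemma rnormZ (a : K) x : rnorm (a *: x) = rnorm (a : K^o) * rnorm x.
Proof.
apply: of_real_inj; rewrite of_realM -[in LHS]normE normrZ; congr (_ * _).
  by rewrite /rnorm of_real_re.
by rewrite normE.
Qed.
Lemma rnormZr (a : R) x : rnorm (r2k a *: x) = `|a| * rnorm x.
Proof. by apply: of_real_inj; rewrite of_realM -[in LHS]normE normrZ normr_of_real normE. Qed.
Lemma rnorm_sum I (r : seq I) (P : pred I) (F : I -> E) :
  rnorm (\sum_(i <- r | P i) F i) <= \sum_(i <- r | P i) rnorm (F i).
Proof.
elim/big_rec2 : _ => [|i y x _ h]; first by rewrite rnorm0.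
by apply: le_trans (rnormD _ _) _; rewrite lerD2l.
Qed.
Lemma rnorm_gt0 x : x != 0 -> 0 < rnorm x.
Proof.
by move=> x0; rewrite lt_def rnorm_ge0 andbT; apply: contra_neq x0; exact: rnorm_eq0.
Qed.

Lemma nbhs_rnormP x (A : set E) :
  nbhs x A <-> exists2 e : R, 0 < e & forall y, rnorm (x - y) < e -> A y.
Proof.
apply: (iff_trans (nbhs_ballP _ _)); split=> -[e /= e0 h].
  exists (re e); first by rewrite -of_real_lt of_real0 of_real_re// ltW.
  by move=> y yx; apply: h; rewrite -ball_normE/= normE -(of_real_re (ltW e0)) of_real_lt.
exists (r2k e) => /=; first by rewrite -of_real0 of_real_lt.
by move=> y; rewrite -ball_normE/= normE of_real_lt => /h.
Qed.

Lemma cvg_rnormP T (F : set_system T) (FF : Filter F) (f : T -> E) (l : E) :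
  f @ F --> l <-> forall e : R, 0 < e -> F [set x | rnorm (l - f x) < e].
Proof.
split => [h e e0|h A /nbhs_rnormP[e e0 eA]].
  have /h : nbhs l [set y | rnorm (l - y) < e] by apply/nbhs_rnormP; exists e.
  by [].
by rewrite /nbhs /=; apply: (@filterS _ F FF _ _ _ (h e e0)) => x; exact: eA.
Qed.

Definition rcvg (u : nat -> E) (l : E) :=
  forall e : R, 0 < e -> exists N, forall n, (N <= n)%N -> rnorm (u n - l) < e.
Definition rcauchy (u : nat -> E) :=
  forall e : R, 0 < e -> exists N, forall m n, (N <= m)%N -> (N <= n)%N ->
    rnorm (u m - u n) < e.

Lemma rcvgP u l : rcvg u l <-> u @ \oo --> l.
Proof.
split=> [h|/cvg_rnormP h e /h [N _ hN]].
  apply/cvg_rnormP => e /h [N hN]; exists N => // n /= /hN.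
  by rewrite rnormBC.
by exists N => n /hN /=; rewrite rnormBC.
Qed.

Lemma rcvg_le u l (c : R) : rcvg u l -> (forall n, rnorm (u n) <= c) -> rnorm l <= c.
Proof.
move=> ul uc; apply/ler_addgt0Pr => e /ul [N /(_ N (leqnn _)) h].
rewrite -[l](subKr (u N)); apply: le_trans (rnormB _ _) _.
by rewrite lerD// ltW.
Qed.

Lemma rcvg_uniq u l l' : rcvg u l -> rcvg u l' -> l = l'.
Proof.
move=> ul ul'; apply/eqP; rewrite -subr_eq0; apply/eqP/rnorm_eq0/le_anti.
rewrite rnorm_ge0 andbT; apply/ler_addgt0Pr => e e0; rewrite add0r.
have e2 : 0 < e / 2 by rewrite divr_gt0.
have [N hN] := ul _ e2; have [M hM] := ul' _ e2.
apply: le_trans (rnorm_triangle _ (u (maxn N M)) _) _.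
rewrite (splitr e) lerD// ltW//; first by rewrite rnormBC hN// leq_maxl.
by rewrite hM// leq_maxr.
Qed.

End Norm.

Lemma rcvgD (E : normedModType K) (u v : nat -> E) l m :
  rcvg u l -> rcvg v m -> rcvg (fun n => u n + v n) (l + m).
Proof.
by move=> /rcvgP h /rcvgP g; apply/rcvgP; exact: cvgD.
Qed.

Lemma rcvgN (E : normedModType K) (u : nat -> E) l :
  rcvg u l -> rcvg (fun n => - u n) (- l).
Proof. by move=> /rcvgP h; apply/rcvgP; exact: cvgN. Qed.

Lemma rcvgZ (E : normedModType K) (a : K) (u : nat -> E) l :
  rcvg u l -> rcvg (fun n => a *: u n) (a *: l).
Proof. by move=> /rcvgP h; apply/rcvgP; exact: cvgZr. Qed.

Lemma rcvg_cst (E : normedModType K) (l : E) : rcvg (fun=> l) l.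
Proof. by move=> e e0; exists 0%N => n _; rewrite subrr rnorm0. Qed.

Lemma rcauchy_cvg (E : completeNormedModType K) (u : nat -> E) :
  rcauchy u -> exists l, rcvg u l.
Proof.
move=> h; have /cauchy_cvgP/cvg_ex[l ul] : cauchy (u @ \oo); last first.
  by exists l; apply/rcvgP.
apply/cauchyP => e e0.
have /h [N hN] : 0 < re e by rewrite -of_real_lt of_real0 of_real_re// ltW.
exists (u N); exists N => // n /= Nn.
rewrite -ball_normE/= normE -(of_real_re (ltW e0)) of_real_lt.
exact: hN.
Qed.

Lemma continuous_linear_bounded (E F : normedModType K) (T : {linear E -> F}) :
  continuous T <-> exists2 c : R, 0 <= c & forall x, rnorm (T x) <= c * rnorm x.
Proof.
split=> [h|[c c0 h]].
  have /(h 0) : nbhs (T 0) [set y | rnorm (T 0 - y) < 1].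
    by apply/nbhs_rnormP; exists 1.
  move=> /nbhs_rnormP[e e0 he]; exists (2 / e); first by rewrite divr_ge0// ltW.
  move=> x; have [->|x0] := eqVneq x 0; first by rewrite linear0 !rnorm0 mulr0.
  have nx := rnorm_gt0 x0.
  set a := e / 2 / rnorm x.
  have a0 : 0 < a by rewrite !divr_gt0.
  have /he : rnorm (0 - r2k a *: x) < e.
    rewrite sub0r rnormN rnormZr gtr0_norm// /a divfK ?gt_eqF//.
    by rewrite ltr_pdivrMr// ltr_pMr// ltr1n.
  rewrite /= linear0 sub0r rnormN linearZ/= rnormZr gtr0_norm// => {}he.
  have -> : 2 / e * rnorm x = a^-1 by rewrite /a; field; rewrite !gt_eqF.
  by rewrite -[a^-1]mul1r ler_pdivlMr// mulrC ltW.
move=> x; apply/cvg_rnormP => e e0.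
apply/nbhs_rnormP; exists (e / (c + 1)); first by rewrite divr_gt0// ltr_wpDl.
move=> y /= yx; rewrite -linearB; apply: le_lt_trans (h _) _.
have c1 : 0 < c + 1 by rewrite ltr_wpDl.
move: yx; rewrite ltr_pdivlMr//; apply: le_lt_trans.
by rewrite mulrC ler_wpM2l ?rnorm_ge0// lerDl.
Qed.

(** [T] is a bare function because [rep_integral] and its differences are not packaged as linear
    maps; homogeneity under real scalars suffices to rescale a vector to norm 1. *)
Lemma opnorm_leP (E : normedModType K) (T : E -> E) (c : R) :
  0 <= c -> (forall a x, T (r2k a *: x) = r2k a *: T x) ->
  (opnorm T <= c%:E)%E <-> (forall x, rnorm (T x) <= c * rnorm x).
Proof.
move=> c0 homT; split=> [h x|h]; last first.
  apply: ge_ereal_sup => _ [x /= x1 <-]; rewrite lee_fin.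
  by apply: le_trans (h x) _; rewrite ler_piMr.
have [->|x0] := eqVneq x 0.
  by have := homT 0 0; rewrite of_real0 !scale0r => ->; rewrite !rnorm0 mulr0.
have nx := rnorm_gt0 x0.
rewrite -ler_pdivrMr//; have : (rnorm (T (r2k (rnorm x)^-1 *: x)))%:E%E \in
    [set (rnorm (T x))%:E | x in [set x | rnorm x <= 1]].
  rewrite inE; exists (r2k (rnorm x)^-1 *: x) => //=.
  by rewrite rnormZr ger0_norm ?invr_ge0 ?rnorm_ge0// mulVf ?gt_eqF.
rewrite inE => /ereal_sup_ubound /le_trans /(_ h); rewrite lee_fin homT rnormZr.
by rewrite ger0_norm ?invr_ge0 ?rnorm_ge0// mulrC.
Qed.

Lemma opnorm_ge0 (E : normedModType K) (T : E -> E) : (0 <= opnorm T)%E.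
Proof.
apply: (@le_trans _ _ (rnorm (T 0))%:E); first by rewrite lee_fin rnorm_ge0.
by apply: ereal_sup_ubound; exists 0 => //=; rewrite rnorm0.
Qed.

End ScalarTheory.

Section Completeness.
Variables (R : realType) (s : scalars).
Local Notation K := (scalar_field R s).

(** A hypothesis rather than a structure, so that the integral theory also covers [K^o], whose
    completeness is proved separately by cases on [s]. *)
Definition rcomplete (E : normedModType K) :=
  forall u : nat -> E, rcauchy u -> exists l, rcvg u l.

Lemma completeNormedMod_rcomplete (E : completeNormedModType K) : rcomplete E.
Proof. by move=> u /rcauchy_cvg. Qed.

(** A Cauchy filter is shadowed by a sequence: pick centres of balls of radius [1/(n+1)] that belong
    to the filter. Any two of these balls meet, so the centres form a Cauchy sequence, and its limit
    is the limit of the filter. *)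
Lemma rcomplete_cauchy_cvg (E : normedModType K) : rcomplete E ->
  forall F : set_system E, ProperFilter F -> cauchy F -> cvg F.
Proof.
move=> cE F FF /cauchyP cF.
have ballP n : exists x : E, F [set y | rnorm (x - y) < n.+1%:R^-1].
  have e0 : (0 : K) < of_real s n.+1%:R^-1 by rewrite -(@of_real0 R s) of_real_lt invr_gt0.
  have [x Fx] := cF _ e0; exists x; apply: filterS Fx => y.
  by rewrite -ball_normE/= normE of_real_lt.
have [u Fu] := choice ballP.
have meet m n : rnorm (u m - u n) < m.+1%:R^-1 + n.+1%:R^-1.
  have [y [/= my ny]] := filter_ex (filterI (Fu m) (Fu n)).
  by apply: le_lt_trans (rnorm_triangle _ y _) _; rewrite ltrD// rnormBC.
have small (e : R) : 0 < e -> exists N, forall n, (N <= n)%N -> n.+1%:R^-1 < e.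
  move=> e0; exists (Num.truncn e^-1) => n Nn.
  rewrite invf_plt ?posrE//; apply: lt_le_trans (truncnS_gt _) _.
  by rewrite ler_nat ltnS.
have [l ul] : exists l, rcvg u l.
  apply: cE => e e0; have /small[N hN] : 0 < e / 2 by rewrite divr_gt0.
  exists N => m n Nm Nn; apply: lt_trans (meet m n) _.
  by rewrite (splitr e) ltrD// hN.
apply/cvg_ex; exists l => A /nbhs_rnormP[e e0 eA].
have e2 : 0 < e / 2 by rewrite divr_gt0.
have [N hN] := small _ e2; have [M hM] := ul _ e2.
apply: (filterS _ (Fu (maxn N M))) => y /= uy; apply: eA.
apply: le_lt_trans (rnorm_triangle _ (u (maxn N M)) _) _.
rewrite (splitr e) ltrD//; first by rewrite rnormBC hM// leq_maxr.
by apply: lt_trans uy _; rewrite hN// leq_maxl.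
Qed.

Definition complete_normed_of (E : normedModType K) (cE : rcomplete E) :
    completeNormedModType K :=
  HB.pack_for (completeNormedModType K) (NormedModule.sort E) (NormedModule.class E)
    (Uniform_isComplete.Build (NormedModule.sort E) (rcomplete_cauchy_cvg cE)).

End Completeness.

Lemma rcomplete_scalar (R : realType) (s : scalars) :
  @rcomplete R s ((scalar_field R s)^o).
Proof.
have cR (u : nat -> R) : (forall e : R, 0 < e -> exists N, forall m n,
    (N <= m)%N -> (N <= n)%N -> `|u m - u n| < e) ->
    exists l, forall e : R, 0 < e -> exists N, forall n, (N <= n)%N -> `|u n - l| < e.
  exact: (@rcauchy_cvg R RealScalars (R^o : completeNormedModType R)).
case: s => //= u cu.
have nC (z : R[i]) : @rnorm R ComplexScalars (R[i]^o) z = Num.sqrt (complex.Re z ^+ 2 + complex.Im z ^+ 2).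
  by case: z => a b; rewrite /rnorm /= /Num.norm/=.
have nRe (z : R[i]) : `|complex.Re z| <= @rnorm R ComplexScalars (R[i]^o) z.
  by rewrite nC -sqrtr_sqr ler_wsqrtr// lerDl sqr_ge0.
have nIm (z : R[i]) : `|complex.Im z| <= @rnorm R ComplexScalars (R[i]^o) z.
  by rewrite nC -sqrtr_sqr ler_wsqrtr// lerDr sqr_ge0.
have nle (z : R[i]) : @rnorm R ComplexScalars (R[i]^o) z <= `|complex.Re z| + `|complex.Im z|.
  rewrite nC -[leRHS]ger0_norm ?addr_ge0// -sqrtr_sqr ler_wsqrtr// sqrrD.
  by rewrite !real_normK ?num_real// lerD2r lerDl mulrn_wge0// mulr_ge0.
have reB (z w : R[i]) : complex.Re (z - w) = complex.Re z - complex.Re w by case: z; case: w.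
have imB (z w : R[i]) : complex.Im (z - w) = complex.Im z - complex.Im w by case: z; case: w.
have [a ha] : exists l, forall e : R, 0 < e -> exists N, forall n, (N <= n)%N -> `|complex.Re (u n) - l| < e.
  apply: cR => e /cu[N hN]; exists N => m n Nm Nn.
  by rewrite -reB; apply: le_lt_trans (nRe _) _; exact: hN.
have [b hb] : exists l, forall e : R, 0 < e -> exists N, forall n, (N <= n)%N -> `|complex.Im (u n) - l| < e.
  apply: cR => e /cu[N hN]; exists N => m n Nm Nn.
  by rewrite -imB; apply: le_lt_trans (nIm _) _; exact: hN.
exists (a +i* b)%C => e e0; have e2 : 0 < e / 2 by rewrite divr_gt0.
have [N hN] := ha _ e2; have [M hM] := hb _ e2.
exists (maxn N M) => n; rewrite geq_max => /andP[Nn Mn].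
apply: le_lt_trans (nle _) _; rewrite reB imB (splitr e) ltrD//=; first exact: hN.
exact: hM.
Qed.

Definition scalar_complete R s : completeNormedModType (scalar_field R s) :=
  complete_normed_of (@rcomplete_scalar R s).

(** * Topological groups *)

Section TopGroup.
Variable G : topologicalGroupType.
Implicit Types (x y g h : G) (A B : set G).
Local Open Scope group_scope.

Lemma mulg_cvg (T : Type) (F : set_system T) (FF : Filter F) (a b : T -> G) x y :
  a @ F --> x -> b @ F --> y -> (fun t => a t * b t)%g @ F --> (x * y)%g.
Proof.
move=> ax bx; apply: (@cvg_comp _ _ _ (fun t => (a t, b t)) (fun z => (z.1 * z.2)%g)).
  exact: (cvg_pair ax bx).
exact: (@mulg_continuous G (x, y)).
Qed.

Lemma invg_cvg (T : Type) (F : set_system T) (FF : Filter F) (a : T -> G) x :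
  a @ F --> x -> (fun t => (a t)^-1)%g @ F --> (x^-1)%g.
Proof. by move=> ax; apply: cvg_comp ax _; exact: (@invg_continuous G x). Qed.

Lemma lmulg_continuous g : continuous (fun x => g * x)%g.
Proof. by move=> x; apply: mulg_cvg; [exact: cvg_cst|exact: cvg_id]. Qed.

Lemma nbhs_lmulg g (W : set G) :
  nbhs 1%g W -> nbhs g [set x | W (g^-1 * x)%g].
Proof.
move=> W1; apply: (@lmulg_continuous g^-1 g) => /=.
by rewrite mulVg.
Qed.

Lemma nbhs1_conj g (W : set G) :
  nbhs 1%g W -> nbhs 1%g [set x | W (g^-1 * (x * g))%g].
Proof.
move=> W1; have h : continuous (fun x => g^-1 * (x * g))%g.
  move=> x; apply: mulg_cvg; first exact: cvg_cst.
  by apply: mulg_cvg; [exact: cvg_id|exact: cvg_cst].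
by apply: (h 1%g); rewrite /= mul1g mulVg.
Qed.

Lemma nbhs1_inv (W : set G) : nbhs 1%g W -> nbhs 1%g [set x | W x^-1]%g.
Proof.
by move=> W1; apply: (@invg_continuous G 1%g); rewrite /= invg1.
Qed.

Lemma lmulg_image g A : [set (g * x)%g | x in A] = [set x | A (g^-1 * x)%g].
Proof.
rewrite eqEsubset; split => x /=; first by move=> [y Ay <-]; rewrite mulKg.
by move=> Ax; exists (g^-1 * x)%g => //; rewrite mulVKg.
Qed.

Lemma open_lmulg g A : open A -> open [set (g * x)%g | x in A].
Proof.
move=> oA; rewrite lmulg_image; apply: open_comp => // x _.
exact: lmulg_continuous.
Qed.

Lemma compact_mulg A B : compact A -> compact B ->
  compact [set (x * y)%g | x in A & y in B].
Proof.
move=> cA cB.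
have -> : [set (x * y)%g | x in A & y in B] = (fun z : G * G => z.1 * z.2)%g @` (A `*` B).
  rewrite eqEsubset; split => z /=.
    by move=> [x Ax [y By <-]]; exists (x, y).
  by move=> [[x y] /= [Ax By] <-]; exists x => //; exists y.
apply: continuous_compact; last exact: compact_setX.
by apply: continuous_subspaceT; exact: mulg_continuous.
Qed.

Lemma compact_lmulg g A : compact A -> compact [set (g * x)%g | x in A].
Proof.
move=> cA; apply: continuous_compact => //.
by apply: continuous_subspaceT; exact: lmulg_continuous.
Qed.

Lemma compact_nbhs1 : locally_compact [set: G] ->
  exists2 W, nbhs (1%g : G) W & compact W.
Proof.
move=> /(_ 1%g I) [V V1 [cV _]].
exists V => //; move: V1; rewrite /within/= => V1.
by apply: (filterS _ V1) => x; exact.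
Qed.

Lemma compact_open_cover (A : set G) (P : G -> set G) : compact A ->
  (forall x, A x -> nbhs x (P x)) ->
  exists t : seq G, (forall x, x \in t -> A x) /\
    forall x, A x -> exists2 y, y \in t & P y x.
Proof.
move=> cA nP.
have : compact A by [].
rewrite compact_cover => /(_ _ A (fun x => (P x)^°)) [].
- by move=> x _; exact: open_interior.
- by move=> x Ax; exists x => //; exact: nP.
move=> D DA AD; exists (enum_fset D); split.
  by move=> x xD; have /set_mem := DA x xD.
by move=> x /AD [y yD /interior_subset Pyx]; exists y.
Qed.

End TopGroup.

Section UniformContinuity.
Variables (R : realType) (s : scalars) (G : topologicalGroupType).
Variable E : normedModType (scalar_field R s).
Hypothesis lcG : locally_compact [set: G].

(** For [g] in a compact neighbourhood [W] of 1, both [f] and its translate vanish off the compact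
    set [W A]; on that set the estimate is a tube argument at each [(x, 1)]. *)
Lemma Cc_unif_continuous (f : G -> E) (A : set G) :
  continuous f -> compact A -> (forall x, ~ A x -> f x = 0) ->
  forall e : R, 0 < e -> nbhs (1%g : G)
    [set g | forall x, rnorm (f (g^-1 * x)%g - f x) <= e].
Proof.
move=> cf cA fA e e0; have [W W1 cW] := compact_nbhs1 lcG.
pose A' := [set (x * y)%g | x in W & y in A].
have cA' : compact A' by exact: compact_mulg.
have : nbhs (1%g : G) [set g | A' `<=` [set x | rnorm (f (g^-1 * x)%g - f x) <= e]].
  move/compact_near_coveringP : cA' => /(_ G (nbhs 1%g)
    (fun g x => rnorm (f (g^-1 * x)%g - f x) <= e)) /=; apply.
  move=> x _.
  have h : f (z.2^-1 * z.1)%g @[z --> (x, 1%g : G)] --> f x.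
    rewrite (_ : f x = f (1^-1 * x)%g); last by rewrite invg1 mul1g.
    apply: (@cvg_comp _ _ _ (fun z : G * G => z.2^-1 * z.1)%g f); last exact: cf.
    by apply: mulg_cvg; [apply: invg_cvg; exact: cvg_snd|exact: cvg_fst].
  have k : f z.1 @[z --> (x, 1%g : G)] --> f x.
    by apply: (@cvg_comp _ _ _ (@fst G G) f); [exact: cvg_fst|exact: cf].
  have e2 : 0 < e / 2 by rewrite divr_gt0.
  move/cvg_rnormP: h => /(_ _ e2); move/cvg_rnormP: k => /(_ _ e2).
  apply: filterS2 => -[y g] /= ky hy; apply/ltW.
  apply: le_lt_trans (rnorm_triangle _ (f x) _) _.
  by rewrite (splitr e) ltrD// rnormBC.
move=> /(filterI W1) /filterS; apply => g /= [Wg h] x.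
have [/h//|nA'] := pselect (A' x).
have nAx : ~ A x.
  by move=> Ax; apply: nA'; exists 1%g; [exact: nbhs_singleton|exists x => //; rewrite mul1g].
have nAgx : ~ A (g^-1 * x)%g.
  by move=> Ax; apply: nA'; exists g => //; exists (g^-1 * x)%g => //; rewrite mulVKg.
by rewrite !fA// subrr rnorm0 ltW.
Qed.

End UniformContinuity.

Section Bump.
Variables (R : realType) (G : topologicalGroupType).
Hypotheses (hausG : hausdorff_space G) (lcG : locally_compact [set: G]).

(** Urysohn's function separating 1 from the complement of the interior of a compact neighbourhood
    vanishes at 1, hence the reflection [1 - u]. *)
Lemma bump_function : exists (phi : G -> R) (A : set G),
  [/\ continuous phi, forall x, 0 <= phi x, compact A,
      forall x, ~ A x -> phi x = 0 & phi 1%g = 1].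
Proof.
have [A A1 cA] := compact_nbhs1 lcG.
have cl : closed (~` (A^°)) by apply: open_closedC; exact: open_interior.
have sep : uniform_separator [set (1%g : G)] (~` (A^°)).
  apply: (@locally_compact_completely_regular G R lcG hausG) => //.
pose u := @Urysohn G R [set 1%g] (~` (A^°)).
exists (fun x => 1 - u x), A; split => //.
- move=> x; apply: cvgB; first exact: cvg_cst.
  exact: Urysohn_continuous.
- move=> x; have : range u (u x) by exists x.
  by move=> /(@Urysohn_range G R _ _) /=; rewrite in_itv/= subr_ge0 => /andP[].
- move=> x nAx; have : (u @` (~` (A^°))) (u x).
    by exists x => // /interior_subset.
  by move=> /(Urysohn_sub1 sep) ->; rewrite subrr.
- have : (u @` [set 1%g]) (u 1%g) by exists 1%g.
  by move=> /(Urysohn_sub0 sep) ->; rewrite subr0.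
Qed.

End Bump.

Section WordLength.
Variables (G : topologicalGroupType) (S : set G).
Hypothesis genS : compact_generating S.

Let cS : compact S. Proof. by case: genS. Qed.
Let symS x : S x -> S (x^-1)%g. Proof. by case: genS => _ + _ _; apply. Qed.
Let S1 : S 1%g. Proof. by case: genS. Qed.

Lemma setpow_compact n : compact (setpow S n).
Proof.
by elim: n => [|n IH] /=; [exact: compact_set1|exact: compact_mulg].
Qed.

Lemma setpowD m n x y : setpow S m x -> setpow S n y -> setpow S (m + n) (x * y)%g.
Proof.
elim: m x => [x -> yn|m IH x [a Sa [b Sb <-]] yn]; first by rewrite mul1g.
by exists a => //; exists (b * y)%g; [exact: IH|rewrite mulgA].
Qed.

Lemma setpow1P x : setpow S 1 x <-> S x.
Proof.
split=> [[a Sa [b /= -> <-]]|Sx]; first by rewrite mulg1.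
by exists x => //; exists 1%g => //; rewrite mulg1.
Qed.

Lemma setpow_1 n : setpow S n 1%g.
Proof. by elim: n => //= n IH; exists 1%g => //; exists 1%g => //; rewrite mul1g. Qed.

Lemma setpow_le m n : (m <= n)%N -> setpow S m `<=` setpow S n.
Proof.
move=> mn x xm; rewrite -(subnKC mn) -(mulg1 x).
by apply: setpowD => //; exact: setpow_1.
Qed.

Lemma setpow_inv n x : setpow S n x -> setpow S n (x^-1)%g.
Proof.
elim: n x => [x /= ->|n IH x [a Sa [b Sb <-]]]; first by rewrite invg1.
rewrite invgM -addn1; apply: setpowD; first exact: IH.
by apply/setpow1P; exact: symS.
Qed.

Lemma word_lengthP g : setpow S (word_length S g) g.
Proof.
rewrite /word_length; case: pselect => [h|nh].
  by case: ex_minnP => m /asboolP.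
exfalso; apply: nh; have : (\bigcup_n setpow S n) g by case: genS => _ _ _ ->.
by move=> [n _ gn]; exists n; apply/asboolP.
Qed.

Lemma word_length_le n g : setpow S n g -> (word_length S g <= n)%N.
Proof.
move=> gn; rewrite /word_length; case: pselect => // h.
by case: ex_minnP => m _; apply; apply/asboolP.
Qed.

Lemma word_lengthV g : word_length S (g^-1)%g = word_length S g.
Proof.
have le h : (word_length S (h^-1)%g <= word_length S h)%N.
  by apply/word_length_le/setpow_inv/word_lengthP.
by apply/eqP; rewrite eqn_leq le/= -{1}(invgK g) le.
Qed.

End WordLength.

(** * Integration of compactly supported functions *)

Section BorelSets.
Variables (R : realType) (G : topologicalGroupType).

Lemma open_borel (A : set (borel G)) : @open G A -> measurable A.
Proof. by move=> oA; apply: sub_sigma_algebra. Qed.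

Lemma closed_borel (A : set (borel G)) : @closed G A -> measurable A.
Proof.
move=> cA; rewrite -[A]setCK; apply: measurableC; apply: open_borel.
exact: (@closed_openC G).
Qed.

Lemma compact_borel (A : set (borel G)) :
  hausdorff_space G -> @compact G A -> measurable A.
Proof. by move=> hG cA; apply: closed_borel; exact: (@compact_closed G). Qed.

Lemma continuous_borel (f : G -> R) :
  continuous f -> measurable_fun [set: borel G] (f : borel G -> R).
Proof.
move=> /continuousP cf; apply: (measurability _ (RGenOpens.measurableE R)).
move=> _ [_ [a [b ->] <-]]; rewrite setTI.
by apply: open_borel; apply: cf; exact: interval_open.
Qed.

End BorelSets.

Section SimpleFunctions.
Variables (R : realType) (s : scalars) (G : topologicalGroupType).
Variable mu : {measure set (borel G) -> \bar R}.
Variable E : normedModType (scalar_field R s).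
Local Notation r2k := (@of_real R s).
Local Notation sets := (seq (set (borel G) * E)).

Definition integrable_list (t : sets) :=
  forall a, a \in t -> measurable a.1 /\ (mu a.1 < +oo)%E.

Lemma integrable_list_cons a t : integrable_list (a :: t) ->
  [/\ measurable a.1, (mu a.1 < +oo)%E & integrable_list t].
Proof.
move=> h; have [m1 m2] := h a (mem_head _ _).
by split => // b bt; apply: h; rewrite inE bt orbT.
Qed.

Lemma integrable_list_cat t u :
  integrable_list t -> integrable_list u -> integrable_list (t ++ u).
Proof. by move=> h k a; rewrite mem_cat => /orP[/h|/k]. Qed.

Definition scale_list (c : scalar_field R s) (t : sets) : sets :=
  [seq (a.1, c *: a.2) | a <- t].

Lemma integrable_scale_list c t :
  integrable_list t -> integrable_list (scale_list c t).
Proof. by move=> h a /mapP[b /h bt ->]. Qed.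

Lemma simple_fun_cat (t u : sets) x :
  simple_fun (t ++ u) x = simple_fun t x + simple_fun u x.
Proof. by rewrite /simple_fun big_cat. Qed.

Lemma simple_fun_scale c (t : sets) x :
  simple_fun (scale_list c t) x = c *: simple_fun t x.
Proof.
rewrite /simple_fun big_map scaler_sumr; apply: eq_bigr => a _ /=.
by rewrite !scalerA mulrC.
Qed.

Lemma simple_integral_cat (t u : sets) :
  simple_integral mu (t ++ u) = simple_integral mu t + simple_integral mu u.
Proof. by rewrite /simple_integral big_cat. Qed.

Lemma simple_integral_scale c (t : sets) :
  simple_integral mu (scale_list c t) = c *: simple_integral mu t.
Proof.
rewrite /simple_integral big_map scaler_sumr; apply: eq_bigr => a _ /=.
by rewrite !scalerA mulrC.
Qed.

Lemma indic_scale (A : set (borel G)) x (v : E) :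
  \1_A x *: v = if x \in A then v else 0.
Proof. by rewrite indicE; case: (x \in A); rewrite ?scale1r ?scale0r. Qed.

Lemma simple_fun_cons a (t : sets) x :
  simple_fun (a :: t) x = (if x \in a.1 then a.2 else 0) + simple_fun t x.
Proof. by rewrite /simple_fun big_cons indic_scale. Qed.

Lemma measurable_mem (A : set (borel G)) :
  measurable A -> measurable_fun [set: borel G] (fun x => x \in A).
Proof.
move=> mA; apply: (measurable_fun_bool true); rewrite setTI.
by rewrite (_ : _ @^-1` _ = A)// eqEsubset; split=> x /=; [exact: set_mem|exact: mem_set].
Qed.

(** Peeling off [(A, v)] turns [F] into the continuous function [F - v] on [A] and leaves it alone
    elsewhere; the induction is therefore general in [F]. Only real-valued functions are ever tested
    for measurability. *)
Lemma measurable_rnorm_simple (F : G -> E) (t : sets) : continuous F ->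
  (forall a, a \in t -> measurable a.1) ->
  measurable_fun [set: borel G] (fun x : borel G => rnorm (F x - simple_fun t x)).
Proof.
elim: t F => [|[A v] t IH] F cF mt.
  apply: continuous_borel => x; apply/cvgrPdist_lt => e e0.
  have /cvg_rnormP/(_ _ e0) := cF x.
  apply: filterS => y h; apply: le_lt_trans (rnorm_dist _ _) _.
  by rewrite /simple_fun !big_nil !subr0.
have mt' a : a \in t -> measurable a.1 by move=> h; apply: mt; rewrite inE h orbT.
have -> : (fun x : borel G => rnorm (F x - simple_fun ((A, v) :: t) x)) =
  (fun x : borel G => if x \in A then rnorm (F x - v - simple_fun t x)
     else rnorm (F x - simple_fun t x)).
  apply/funext => x; rewrite simple_fun_cons /=.
  by case: ifP => _; rewrite ?add0r// opprD addrA.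
apply: measurable_fun_ifT; first by apply: measurable_mem; apply: (mt (A, v)); rewrite mem_head.
  by apply: IH => // x; apply: cvgB; [exact: cF|exact: cvg_cst].
exact: IH.
Qed.

Lemma measurable_rnorm_simpleD (w : E) (t : sets) :
  (forall a, a \in t -> measurable a.1) ->
  measurable_fun [set: borel G] (fun x : borel G => (rnorm (simple_fun t x + w))%:E).
Proof.
move=> mt; apply/measurable_EFinP.
have /measurable_rnorm_simple : continuous (fun _ : G => - w) by move=> x; exact: cvg_cst.
by move=> /(_ _ mt); apply: eq_measurable_fun => x _; rewrite /= -opprD rnormN addrC.
Qed.

(* Induction on the list splits B along the first set, so that overlapping
   sets need not be decomposed into atoms. *)
Lemma rnorm_simple_integral_on (t : sets) (B : set (borel G)) (w : E) :
  integrable_list t -> measurable B -> (mu B < +oo)%E ->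
  ((rnorm (\sum_(a <- t) r2k (fine (mu (a.1 `&` B))) *: a.2 + r2k (fine (mu B)) *: w))%:E
   <= \int[mu]_(x in B) (rnorm (simple_fun t x + w))%:E)%E.
Proof.
elim: t B w => [|[A v] t IH] B w ht mB fB.
  rewrite big_nil add0r rnormZr ger0_norm ?fine_ge0//.
  under eq_integral do rewrite /simple_fun big_nil add0r.
  by rewrite integral_cst// muleC EFinM fineK// ge0_fin_numE.
have [/= mA fA ht'] := integrable_list_cons ht.
have mt' a : a \in t -> measurable a.1 by move=> /ht'[].
have mt a : a \in (A, v) :: t -> measurable a.1 by move=> /ht[].
have mBA : measurable (B `&` A) by exact: measurableI.
have mBnA : measurable (B `\` A) by exact: measurableD.
have le_fin (C D : set (borel G)) : measurable C -> measurable D -> C `<=` D ->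
    (mu D < +oo)%E -> (mu C < +oo)%E.
  by move=> mC mD CD; apply: le_lt_trans; apply: le_measure => //; apply: mem_set.
have fBA : (mu (B `&` A) < +oo)%E by apply: le_fin fB.
have fBnA : (mu (B `\` A) < +oo)%E by apply: le_fin fB => //; exact: subDsetl.
have muB (C : set (borel G)) : measurable C ->
    fine (mu (C `&` B)) = fine (mu (C `&` (B `&` A))) + fine (mu (C `&` (B `\` A))).
  move=> mC; have mC1 : measurable (C `&` (B `&` A)) by exact: measurableI.
  have mC2 : measurable (C `&` (B `\` A)) by exact: measurableI.
  have f1 : mu (C `&` (B `&` A)) \is a fin_num.
    by rewrite ge0_fin_numE//; apply: (le_fin _ (B `&` A)) => //; exact: subIsetr.
  have f2 : mu (C `&` (B `\` A)) \is a fin_num.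
    by rewrite ge0_fin_numE//; apply: (le_fin _ (B `\` A)) => //; exact: subIsetr.
  rewrite -fineD// -measureU//.
    by rewrite -setIUr setUIDK.
  by rewrite -subset0 => x [[_ [_ xA]] [_ [_ nxA]]].
have -> : \sum_(a <- (A, v) :: t) r2k (fine (mu (a.1 `&` B))) *: a.2 + r2k (fine (mu B)) *: w =
    (\sum_(a <- t) r2k (fine (mu (a.1 `&` (B `&` A)))) *: a.2 + r2k (fine (mu (B `&` A))) *: (v + w)) +
    (\sum_(a <- t) r2k (fine (mu (a.1 `&` (B `\` A)))) *: a.2 + r2k (fine (mu (B `\` A))) *: w).
  have -> : fine (mu B) = fine (mu (B `&` A)) + fine (mu (B `\` A)).
    by have := muB setT measurableT; rewrite !setTI.
  rewrite big_cons /= [A `&` B]setIC (eq_big_seq (fun a => r2k (fine (mu (a.1 `&` (B `&` A)))) *: a.2 +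
     r2k (fine (mu (a.1 `&` (B `\` A)))) *: a.2)); last first.
    by move=> a at_ /=; rewrite -scalerDl -of_realD muB//; exact: mt'.
  rewrite big_split/= of_realD scalerDl scalerDr.
  have zm (a b c S1 S2 : E) : a + (S1 + S2) + (b + c) = S1 + (a + b) + (S2 + c).
    by rewrite [RHS]addrACA [a + (S1 + S2)]addrC -!addrA.
  exact: zm.
apply: (@le_trans _ _ ((rnorm (\sum_(a <- t) r2k (fine (mu (a.1 `&` (B `&` A)))) *: a.2 + r2k (fine (mu (B `&` A))) *: (v + w)))%:E +
  (rnorm (\sum_(a <- t) r2k (fine (mu (a.1 `&` (B `\` A)))) *: a.2 + r2k (fine (mu (B `\` A))) *: w))%:E)%E).
  by rewrite -EFinD lee_fin rnormD.
have IH1 := IH _ (v + w) ht' mBA fBA.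
have IH2 := IH _ w ht' mBnA fBnA.
apply: le_trans (leeD IH1 IH2) _.
rewrite -{3}(setUIDK B A) ge0_integral_setU//; last 3 first.
- by apply: measurable_funTS; exact: measurable_rnorm_simpleD.
- by move=> x _; rewrite lee_fin rnorm_ge0.
- by apply/disj_setPS => x [[_ xA] [_ nxA]].
rewrite le_eqVlt; apply/orP; left; apply/eqP; congr (_ + _)%E.
  apply: eq_integral => x /set_mem [_ xA].
  by rewrite simple_fun_cons /= mem_set// addrCA addrA.
apply: eq_integral => x /set_mem [_ xA].
by rewrite simple_fun_cons /= memNset// add0r.
Qed.

Lemma rnorm_simple_integral (t : sets) : integrable_list t ->
  ((rnorm (simple_integral mu t))%:E <= \int[mu]_x (rnorm (simple_fun t x))%:E)%E.
Proof.
move=> ht; pose B := \big[setU/set0]_(a <- t) a.1.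
have mB : measurable B.
  rewrite /B big_seq_cond; apply: bigsetU_measurable => a /andP[at_ _].
  by have [] := ht _ at_.
have fB : (mu B < +oo)%E.
  rewrite /B; elim: t ht {B mB} => [|a t IH] ht; first by rewrite big_nil measure0.
  have [ma fa ht'] := integrable_list_cons ht.
  rewrite big_cons; apply: le_lt_trans (measureU2 _ _ _) _ => //.
    rewrite big_seq_cond; apply: bigsetU_measurable => b /andP[bt _].
    by have [] := ht' _ bt.
  by rewrite lte_add_pinfty// IH.
have := rnorm_simple_integral_on 0 ht mB fB.
rewrite scaler0 addr0 => h.
rewrite /simple_integral (eq_big_seq (fun a => r2k (fine (mu (a.1 `&` B))) *: a.2)); last first.
  move=> a at_; rewrite setIidl// /B (big_rem _ at_)/=; exact: subsetUl.
apply: le_trans h _.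
have mt a : a \in t -> measurable a.1 by move=> /ht[].
under eq_integral do rewrite addr0.
apply: ge0_subset_integral => //; last by move=> x _; rewrite lee_fin rnorm_ge0.
have := measurable_rnorm_simpleD 0 mt.
by apply: eq_measurable_fun => x _ /=; rewrite addr0.
Qed.

(** Two approximations of the same [F] are compared by concatenating one list with the negative of
    the other. This makes integrals of approximating lists Cauchy and their limit independent of the
    lists. *)
Lemma rnorm_simple_integralB (F : G -> E) (t u : sets) : continuous F ->
  integrable_list t -> integrable_list u ->
  ((rnorm (simple_integral mu t - simple_integral mu u))%:E <=
   \int[mu]_x (rnorm (F x - simple_fun t x))%:E +
   \int[mu]_x (rnorm (F x - simple_fun u x))%:E)%E.
Proof.
move=> cF ht hu.
have -> : simple_integral mu t - simple_integral mu u =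
    simple_integral mu (t ++ scale_list (-1) u).
  by rewrite simple_integral_cat simple_integral_scale scaleN1r.
have htu : integrable_list (t ++ scale_list (-1) u).
  by apply: integrable_list_cat => //; exact: integrable_scale_list.
apply: le_trans (rnorm_simple_integral htu) _.
have mt a : a \in t -> measurable a.1 by move=> /ht[].
have mu_ a : a \in u -> measurable a.1 by move=> /hu[].
have mtu a : a \in t ++ scale_list (-1) u -> measurable a.1 by move=> /htu[].
rewrite -ge0_integralD//; last 4 first.
- by move=> x _; rewrite lee_fin rnorm_ge0.
- by apply/measurable_EFinP; exact: measurable_rnorm_simple.
- by move=> x _; rewrite lee_fin rnorm_ge0.
- by apply/measurable_EFinP; exact: measurable_rnorm_simple.
apply: ge0_le_integral => //.
- by move=> x _; rewrite lee_fin rnorm_ge0.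
- have := measurable_rnorm_simpleD 0 mtu.
  by apply: eq_measurable_fun => x _ /=; rewrite addr0.
- by apply: emeasurable_funD; apply/measurable_EFinP; exact: measurable_rnorm_simple.
move=> x _; rewrite -EFinD lee_fin simple_fun_cat simple_fun_scale scaleN1r.
by rewrite [rnorm (F x - simple_fun t x)]rnormBC rnorm_triangle.
Qed.

Lemma integral_rnorm_le (F : G -> E) (t : sets) (B : set (borel G)) (e : R) :
  0 <= e -> continuous F -> integrable_list t -> measurable B ->
  (forall x, rnorm (F x - simple_fun t x) <= e) ->
  (forall x, ~ B x -> F x = simple_fun t x) ->
  (\int[mu]_x (rnorm (F x - simple_fun t x))%:E <= e%:E * mu B)%E.
Proof.
move=> e0 cF ht mB he hB.
have mt a : a \in t -> measurable a.1 by move=> /ht[].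
have mF : measurable_fun [set: borel G] (fun x : borel G => (rnorm (F x - simple_fun t x))%:E).
  by apply/measurable_EFinP; exact: measurable_rnorm_simple.
rewrite -(integral_cst mu mB) [X in (_ <= X)%E]integral_mkcond.
apply: ge0_le_integral => //.
- by move=> x _; rewrite lee_fin rnorm_ge0.
- by apply: measurable_fun_ifT => //; exact: measurable_mem.
- move=> x _; rewrite /patch; case: ifPn => [_|]; first by rewrite lee_fin.
  by rewrite notin_setE => /hB ->; rewrite subrr rnorm0.
Qed.

End SimpleFunctions.

(** * Disjoint tagged partitions of compact sets *)

Section Partitions.
Variables (G : topologicalGroupType).
Hypothesis hausG : hausdorff_space G.
Local Notation pieces := (seq (set (borel G) * G)).

(** Splitting the list at the piece of [x] expresses that exactly one position of the list contains
    [x], which also excludes repeated pieces and lets a simple function be evaluated by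
    concatenation. *)
Definition tagged_partition (A : set G) (P : pieces) :=
  (forall a, a \in P -> [/\ measurable a.1, (a.1 : set G) `<=` A & A a.2]) /\
  (forall x, A x -> exists P1 a P2, [/\ P = P1 ++ a :: P2, a.1 x &
    forall b, b \in P1 ++ P2 -> ~ b.1 x]).

Lemma exists_tagged_partition (A : set G) (N : G -> set G) :
  compact A -> (forall x, A x -> nbhs x (N x)) ->
  exists P, tagged_partition A P /\ forall a, a \in P -> (a.1 : set G) `<=` N a.2.
Proof.
move=> cA nN.
have [t [tA tN]] : exists t : seq G, (forall x, x \in t -> A x) /\
    forall x, A x -> exists2 y, y \in t & (N y)^° x.
  by apply: compact_open_cover => // x Ax; exact/nbhs_interior/nN.
(* [D] is the union of the neighbourhoods already used; subtracting it makes the pieces disjoint. *)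
pose build := fix build (D : set (borel G)) (t : seq G) : pieces :=
  if t is y :: t' then ((A `&` (N y)^°) `\` D, y) :: build (D `|` (N y)^°) t' else [::].
have mA : measurable (A : set (borel G)) by exact: compact_borel.
have mN y : measurable ((N y)^° : set (borel G)).
  by apply: open_borel; exact: open_interior.
have b1 (u : seq G) (D : set (borel G)) : measurable D -> forall a, a \in build D u ->
    [/\ measurable a.1, (a.1 : set G) `<=` A, a.2 \in u, (a.1 : set G) `<=` N a.2 &
        forall x, a.1 x -> ~ D x].
  elim: u D => //= y u IH D mD a; rewrite inE => /orP[/eqP ->|/IH[]] /=.
  - split; [|by move=> x [[]]|exact: mem_head| |by move=> x []].
    + by apply: measurableD => //; exact: measurableI.
    + by move=> x [[_ /interior_subset]].
  - exact: measurableU.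
  - move=> m1 aA au aN aD; split => //; first by rewrite inE au orbT.
    by move=> x /aD nD Dx; apply: nD; left.
exists (build set0 t); split; last by move=> a /(b1 _ _ measurable0)[].
split; first by move=> a /(b1 _ _ measurable0)[? ? /tA].
move=> x Ax; have [y0 y0t Ny0] := tN _ Ax.
suff : forall (u : seq G) (D : set (borel G)), measurable D -> ~ D x -> y0 \in u -> exists P1 a P2, [/\ build D u = P1 ++ a :: P2, a.1 x &
    forall b, b \in P1 ++ P2 -> ~ b.1 x] by apply.
elim=> //= y u IH D mD nD; have mDN : measurable (D `|` (N y)^°) by exact: measurableU.
have [Ny|nNy] := pselect ((N y)^° x).
  move=> _; exists [::], ((A `&` (N y)^°) `\` D, y), (build (D `|` (N y)^°) u); split => //=.
  by move=> b /(b1 _ _ mDN)[_ _ _ _ h] /h; apply; right.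
rewrite inE => /orP[/eqP yy|y0u]; first by rewrite -yy in nNy.
have [|P1 [a [P2 [-> ax h]]]] := IH _ mDN _ y0u; first by case.
exists (((A `&` (N y)^°) `\` D, y) :: P1), a, P2; split => // b.
by rewrite /= inE => /orP[/eqP ->|/h//] /= [[]].
Qed.

End Partitions.

Section BochnerIntegral.
Variables (R : realType) (s : scalars) (G : topologicalGroupType).
Variable mu : {measure set (borel G) -> \bar R}.
Hypothesis hausG : hausdorff_space G.
Hypothesis finmu : forall A : set G, compact A -> (mu A < +oo)%E.
Local Notation K := (scalar_field R s).
Local Notation r2k := (@of_real R s).
Local Notation pieces := (seq (set (borel G) * G)).

Definition supported (E : normedModType K) (F : G -> E) (A : set G) :=
  [/\ continuous F, compact A & forall x, ~ A x -> F x = 0].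

Definition tagged_list (E : normedModType K) (P : pieces) (F : G -> E) :=
  [seq (a.1, F a.2) | a <- P].

Definition riemann (E : normedModType K) (P : pieces) (F : G -> E) : E :=
  \sum_(a <- P) r2k (fine (mu a.1)) *: F a.2.

Section Fixed.
Variable E : normedModType K.
Implicit Types F : G -> E.

Lemma riemannE P F : riemann P F = simple_integral mu (tagged_list P F).
Proof. by rewrite /simple_integral big_map. Qed.

Lemma tagged_list_integrable A P F : compact A -> tagged_partition A P ->
  integrable_list mu (tagged_list P F).
Proof.
move=> cA [hP _] a /mapP[b /hP[mb bA _] ->] /=; split => //.
apply: le_lt_trans (finmu cA); apply: le_measure => //; apply/mem_set => //.
exact: compact_borel.
Qed.

Lemma simple_fun_tagged A P F x : tagged_partition A P ->
  (~ A x /\ simple_fun (tagged_list P F) x = 0) \/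
  exists a, [/\ a \in P, a.1 x & simple_fun (tagged_list P F) x = F a.2].
Proof.
move=> [hP hx]; have sf0 Q : (forall b, b \in Q -> ~ b.1 x) ->
    simple_fun (tagged_list Q F) x = 0.
  move=> h; rewrite /simple_fun big_map big_seq big1// => a /h na.
  by rewrite indic_scale memNset.
have [Ax|nA] := pselect (A x); last first.
  left; split => //; apply: sf0 => b /hP[_ bA _] bx.
  exact/nA/bA.
right; have [P1 [a [P2 [PE ax h]]]] := hx _ Ax; exists a; split => //.
  by rewrite PE mem_cat mem_head orbT.
rewrite PE /tagged_list map_cat /= simple_fun_cat simple_fun_cons /= mem_set//.
rewrite !sf0 ?add0r ?addr0// => b bP; apply: h; by rewrite mem_cat bP ?orbT.
Qed.

Lemma tagged_list_close A P F (e : R) : 0 <= e ->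
  tagged_partition A P -> (forall x, ~ A x -> F x = 0) ->
  (forall a, a \in P -> forall x, a.1 x -> rnorm (F x - F a.2) <= e) ->
  forall x, rnorm (F x - simple_fun (tagged_list P F) x) <= e.
Proof.
move=> e0 tP FA Fe x.
have [[nA ->]|[a [aP ax ->]]] := simple_fun_tagged F x tP.
  by rewrite FA// subrr rnorm0.
exact: Fe.
Qed.

Lemma simple_fun_tagged_out A P F x : tagged_partition A P -> ~ A x ->
  simple_fun (tagged_list P F) x = 0.
Proof.
move=> tP nA; have [[_ ->//]|[a [aP ax _]]] := simple_fun_tagged F x tP.
by case: tP => /(_ a aP)[_ /(_ x ax)].
Qed.

(** Together with existence, this estimate is the only access that later proofs have to the
    definition of the Bochner integral: every identity below is checked on simple functions that are
    uniformly close to [F]. *)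
Lemma is_bochner_integral_close F v (t : seq (set (borel G) * E)) (B : set (borel G)) (e : R) :
  is_bochner_integral mu F v -> continuous F ->
  0 <= e -> integrable_list mu t -> measurable B -> (mu B < +oo)%E ->
  (forall x, rnorm (F x - simple_fun t x) <= e) ->
  (forall x, ~ B x -> F x = simple_fun t x) ->
  rnorm (v - simple_integral mu t) <= e * fine (mu B).
Proof.
move=> [u [hu mF intu cvu]] cF e0 ht mB fB he hB.
apply/ler_addgt0Pr => d d0; have d2 : 0 < d / 2 by rewrite divr_gt0.
have /rcvgP/(_ _ d2)[N hN] := cvu.
have /fine_cvgP[_] := intu; move=> /cvgrPdist_lt/(_ _ d2)[M _ hM].
have /fine_cvgP[[M' _ hM'] _] := intu.
pose n := maxn N (maxn M M').
have Nn : (N <= n)%N by rewrite leq_maxl.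
have Mn : (M <= n)%N by rewrite (leq_trans (leq_maxl M M'))// leq_maxr.
have M'n : (M' <= n)%N by rewrite (leq_trans (leq_maxr M M'))// leq_maxr.
have := @rnorm_simple_integralB R s G mu E F (u n) t cF (hu n) ht.
have := integral_rnorm_le e0 cF ht mB he hB.
have := hM n Mn; rewrite sub0r normrN => h1.
have /fineK := hM' n M'n; move=> <- h2 h3.
have {h2}h3 := le_trans h3 (leeD2l _ h2).
rewrite -(fineK (x := mu B)) in h3; last by rewrite ge0_fin_numE.
rewrite -EFinM -EFinD lee_fin in h3.
apply: le_trans (rnorm_triangle _ (simple_integral mu (u n)) _) _.
have h4 := hN n Nn; rewrite rnormBC in h4.
have h5 := le_lt_trans (ler_norm _) h1.
rewrite [leRHS]addrC (splitr d) -addrA lerD//; first exact: ltW.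
by apply: le_trans h3 _; rewrite lerD2r ltW.
Qed.

(** Partitions on whose pieces [F] oscillates by at most [1/(n+1)] give simple functions within
    [1/(n+1)] of [F]; since the support has finite measure, they converge in mean and their
    integrals are Cauchy. *)
Lemma bochner_exists F A : rcomplete E -> supported F A ->
  exists v, is_bochner_integral mu F v.
Proof.
move=> cE [cF cA FA].
have mA : measurable (A : set (borel G)) by exact: compact_borel.
have fA := finmu cA.
have eps0 n : (0 : R) < n.+1%:R^-1 by rewrite invr_gt0.
have /choice[P hP] n : exists P : pieces, tagged_partition A P /\
    forall a, a \in P -> forall x, a.1 x -> rnorm (F x - F a.2) <= n.+1%:R^-1.
  have [x _|P [tP h]] := exists_tagged_partition hausG
      (N := fun x => [set y | rnorm (F x - F y) < n.+1%:R^-1]) cA.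
    by have /cvg_rnormP/(_ _ (eps0 n)) := cF x.
  by exists P; split => // a aP x /(h _ aP) /= /ltW; rewrite rnormBC.
pose t n := tagged_list (P n) F.
have ht n : integrable_list mu (t n) by exact: tagged_list_integrable (hP n).1.
have close n x : rnorm (F x - simple_fun (t n) x) <= n.+1%:R^-1.
  by apply: (tagged_list_close _ (hP n).1 FA (hP n).2).
have int_le n : (\int[mu]_x (rnorm (F x - simple_fun (t n) x))%:E <= n.+1%:R^-1%:E * mu A)%E.
  apply: integral_rnorm_le => // x nA.
  by rewrite FA// (simple_fun_tagged_out _ (hP n).1).
have small (e : R) : 0 < e -> exists N, forall n, (N <= n)%N -> n.+1%:R^-1 * fine (mu A) < e.
  move=> e0; exists (Num.truncn (e^-1 * fine (mu A))) => n Nn.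
  rewrite mulrC ltr_pdivrMr// mulrC -ltr_pdivrMr// mulrC.
  apply: lt_le_trans (truncnS_gt _) _.
  by rewrite ler_nat ltnS.
have int_fin n : (\int[mu]_x (rnorm (F x - simple_fun (t n) x))%:E <= (n.+1%:R^-1 * fine (mu A))%:E)%E.
  by rewrite EFinM fineK// ge0_fin_numE.
have [v hv] : exists v, rcvg (fun n => simple_integral mu (t n)) v.
  apply: cE => e e0; have /small[N hN] : 0 < e / 2 by rewrite divr_gt0.
  exists N => m n Nm Nn.
  have := @rnorm_simple_integralB R s G mu E F _ _ cF (ht m) (ht n).
  move=> /le_trans/(_ (leeD (int_fin m) (int_fin n))).
  rewrite -EFinD lee_fin => /le_lt_trans; apply.
  by rewrite (splitr e) ltrD// hN.
exists v, t; split => //.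
- move=> n; apply: measurable_rnorm_simple => // a.
  by move=> /ht[].
- apply: (@squeeze_cvge _ _ _ _ (cst 0%E) _ (fun n => (n.+1%:R^-1 * fine (mu A))%:E)).
  + by apply: nearW => n; rewrite int_fin andbT; apply: integral_ge0 => x _; rewrite lee_fin rnorm_ge0.
  + exact: cvg_cst.
  + apply/fine_cvgP; split; first by apply: nearW.
    apply/cvgrPdist_lt => e /small[N hN]; exists N => // n /= /hN h.
    by rewrite sub0r normrN ger0_norm// mulr_ge0// ?fine_ge0// ltW.
- exact/rcvgP.
Qed.

End Fixed.

Section Theory.
Variable E : normedModType K.
Hypothesis cE : rcomplete E.
Implicit Types F : G -> E.
Local Notation I := (@bochner_integral R s G mu E).

Lemma int_close F A (t : seq (set (borel G) * E)) (B : set (borel G)) (e : R) :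
  supported F A ->
  0 <= e -> integrable_list mu t -> measurable B -> (mu B < +oo)%E ->
  (forall x, rnorm (F x - simple_fun t x) <= e) ->
  (forall x, ~ B x -> F x = simple_fun t x) ->
  rnorm (I F - simple_integral mu t) <= e * fine (mu B).
Proof.
move=> sF; apply: is_bochner_integral_close; last by case: sF.
by have [v hv] := bochner_exists cE sF; exact: (xgetPex 0 (ex_intro _ v hv)).
Qed.

(** The workhorse for identities between integrals: on a partition fine enough for both sides, the
    identity becomes one between finite sums. *)
Lemma riemann_close F A P (e : R) : supported F A -> 0 <= e -> tagged_partition A P ->
  (forall a, a \in P -> forall x, a.1 x -> rnorm (F x - F a.2) <= e) ->
  rnorm (I F - riemann P F) <= e * fine (mu A).
Proof.
move=> sF e0 tP he; have [cF cA FA] := sF; rewrite riemannE.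
apply: (int_close sF e0).
- exact: tagged_list_integrable tP.
- exact: compact_borel.
- exact: finmu.
- exact: tagged_list_close tP FA he.
- by move=> x nA; rewrite FA// (simple_fun_tagged_out _ tP).
Qed.

End Theory.
End BochnerIntegral.

Section IntegralTheory.
Variables (R : realType) (G : topologicalGroupType).
Variable mu : {measure set (borel G) -> \bar R}.
Hypothesis hausG : hausdorff_space G.
Hypothesis finmu : forall A : set G, compact A -> (mu A < +oo)%E.
Local Notation pieces := (seq (set (borel G) * G)).
Local Notation int F := (bochner_integral mu F).
Local Notation vol A := (fine (mu A)).

Definition Rint (f : G -> R) : R :=
  @bochner_integral R RealScalars G mu (R^o) f.

Lemma rcompleteR : @rcomplete R RealScalars (R^o).
Proof. exact: (@rcomplete_scalar R RealScalars). Qed.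

Lemma supported_sub s (E : normedModType (scalar_field R s)) (F : G -> E) A B :
  supported F A -> compact B -> A `<=` B -> supported F B.
Proof. by move=> [cF cA FA] cB AB; split => // x nB; apply: FA => /AB. Qed.

Lemma supportedU s (E : normedModType (scalar_field R s)) (F : G -> E) A B :
  supported F A -> compact B -> supported F (A `|` B).
Proof.
by move=> [cF cA FA] cB; split => //; [exact: compactU|move=> x nAB; apply: FA => Ax; apply: nAB; left].
Qed.

Lemma supportedUr s (E : normedModType (scalar_field R s)) (F : G -> E) A B :
  supported F A -> compact B -> supported F (B `|` A).
Proof. by rewrite setUC; exact: supportedU. Qed.

Lemma partition2 s1 s2 (E1 : normedModType (scalar_field R s1))
    (E2 : normedModType (scalar_field R s2)) (F1 : G -> E1) (F2 : G -> E2) A (e : R) :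
  continuous F1 -> continuous F2 -> compact A -> 0 < e ->
  exists P, tagged_partition A P /\ forall a, a \in P -> forall x, a.1 x ->
    rnorm (F1 x - F1 a.2) <= e /\ rnorm (F2 x - F2 a.2) <= e.
Proof.
move=> c1 c2 cA e0; have [x _|P [tP h]] := exists_tagged_partition hausG
   (N := fun x => [set y | rnorm (F1 x - F1 y) < e] `&` [set y | rnorm (F2 x - F2 y) < e]) cA.
  apply: filterI; first by have /cvg_rnormP/(_ _ e0) := c1 x.
  by have /cvg_rnormP/(_ _ e0) := c2 x.
exists P; split => // a aP x /(h _ aP) /= [/ltW h1 /ltW h2].
by rewrite rnormBC (rnormBC (F2 x)).
Qed.

Lemma partition1 s (E : normedModType (scalar_field R s)) (F : G -> E) A (e : R) :
  continuous F -> compact A -> 0 < e ->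
  exists P, tagged_partition A P /\ forall a, a \in P -> forall x, a.1 x ->
    rnorm (F x - F a.2) <= e.
Proof.
move=> c1 cA e0; have [P [tP h]] := partition2 c1 c1 cA e0.
by exists P; split => // a aP x /(h _ aP)[].
Qed.

Lemma vol_ge0 (A : set (borel G)) : 0 <= vol A. Proof. exact: fine_ge0. Qed.

Lemma le0_eps (x c : R) : 0 <= c -> (forall e, 0 < e -> x <= e * c) -> x <= 0.
Proof.
move=> c0 h; apply/ler_addgt0Pr => e e0; rewrite add0r.
have c1 : 0 < c + 1 by rewrite ltr_wpDl.
apply: le_trans (h (e / (c + 1)) _) _; first by rewrite divr_gt0.
by rewrite mulrAC ler_pdivrMr// ler_pM2l// lerDl.
Qed.

Lemma rnorm_le0 s (E : normedModType (scalar_field R s)) (x : E) : rnorm x <= 0 -> x = 0.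
Proof. by move=> h; apply: rnorm_eq0; apply: le_anti; rewrite h rnorm_ge0. Qed.

Lemma eq_eps s (E : normedModType (scalar_field R s)) (x y : E) (c : R) :
  0 <= c -> (forall e, 0 < e -> rnorm (x - y) <= e * c) -> x = y.
Proof. by move=> c0 h; apply/eqP; rewrite -subr_eq0; apply/eqP/rnorm_le0/(le0_eps c0). Qed.

Lemma bounded_continuous s1 s2 (E1 : normedModType (scalar_field R s1))
    (E2 : normedModType (scalar_field R s2)) (T : E1 -> E2) (c : R) :
  {morph T : x y / x + y} -> (forall x, rnorm (T x) <= c * rnorm x) -> continuous T.
Proof.
move=> TD Tc x; apply/cvg_rnormP => e e0.
have c1 : 0 < `|c| + 1 by rewrite ltr_wpDl.
apply/nbhs_rnormP; exists (e / (`|c| + 1)); first by rewrite divr_gt0.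
have TB u v : T u - T v = T (u - v) by have := TD (u - v) v; rewrite subrK => ->; rewrite addrK.
move=> y /= yx; rewrite TB; apply: le_lt_trans (Tc _) _.
apply: (@le_lt_trans _ _ ((`|c| + 1) * rnorm (x - y))).
  by rewrite ler_wpM2r ?rnorm_ge0// (le_trans (ler_norm _))// lerDl.
by rewrite mulrC -ltr_pdivlMr.
Qed.

(** [T] may go between spaces over different scalars and need only be real-homogeneous, because it
    is applied to real parts of inner products, to the inclusion [of_real], and to functionals. *)
Lemma int_map s1 s2 (E1 : normedModType (scalar_field R s1))
    (E2 : normedModType (scalar_field R s2)) (T : E1 -> E2) (c : R) (F : G -> E1) A :
  rcomplete E1 -> rcomplete E2 ->
  {morph T : x y / x + y} ->
  (forall a x, T (of_real s1 a *: x) = of_real s2 a *: T x) ->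
  (forall x, rnorm (T x) <= c * rnorm x) ->
  supported F A -> supported (T \o F) A /\ T (int F) = int (T \o F).
Proof.
move=> cE1 cE2 TD TZ Tc sF; have [cF cA FA] := sF.
have T0 : T 0 = 0 by rewrite -(scale0r 0) -of_real0 TZ of_real0 scale0r.
have TB u v : T u - T v = T (u - v) by have := TD (u - v) v; rewrite subrK => ->; rewrite addrK.
have Tc' x : rnorm (T x) <= `|c| * rnorm x.
  by apply: le_trans (Tc x) _; rewrite ler_wpM2r ?rnorm_ge0// ler_norm.
have cT := bounded_continuous TD Tc.
have sTF : supported (T \o F) A.
  split => //; first by move=> x; apply: continuous_comp; [exact: cF|exact: cT].
  by move=> x /FA /= ->.
split=> //; apply: (@eq_eps _ _ _ _ ((`|c| + `|c|) * vol A)).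
  by rewrite mulr_ge0 ?addr_ge0 ?vol_ge0.
move=> e e0; have [P [tP hP]] := partition1 cF cA e0.
have h1 := riemann_close hausG finmu cE1 sF (ltW e0) tP hP.
have h2 : rnorm (int (T \o F) - riemann mu P (T \o F)) <= (`|c| * e) * vol A.
  apply: (riemann_close hausG finmu cE2 sTF _ tP).
    by rewrite mulr_ge0// ltW.
  move=> a aP x ax /=; rewrite TB; apply: le_trans (Tc' _) _.
  by rewrite ler_wpM2l//; exact: hP.
have TR : T (riemann mu P F) = riemann mu P (T \o F).
  by rewrite /riemann (big_morph T TD T0); apply: eq_bigr => a _; rewrite TZ.
apply: le_trans (rnorm_triangle _ (T (riemann mu P F)) _) _.
rewrite mulrDl mulrDr lerD//.
  rewrite TB; apply: le_trans (Tc' _) _.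
  by rewrite mulrCA ler_wpM2l.
by rewrite TR rnormBC; rewrite mulrA [e * _]mulrC.
Qed.

Section Linear.
Variable s : scalars.
Variable E : normedModType (scalar_field R s).
Hypothesis cE : rcomplete E.
Implicit Types F : G -> E.

Lemma supportedD F1 F2 A : supported F1 A -> supported F2 A ->
  supported (fun x => F1 x + F2 x) A.
Proof.
move=> [c1 cA h1] [c2 _ h2]; split => //.
  by move=> x; apply: cvgD; [exact: c1|exact: c2].
by move=> x nA; rewrite h1// h2// addr0.
Qed.

Lemma supportedZ (a : scalar_field R s) F A : supported F A ->
  supported (fun x => a *: F x) A.
Proof.
move=> [c1 cA h1]; split => //; first by move=> x; apply: cvgZr; exact: c1.
by move=> x nA; rewrite h1// scaler0.
Qed.

Lemma intD F1 F2 A : supported F1 A -> supported F2 A ->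
  int (fun x => F1 x + F2 x) = int F1 + int F2.
Proof.
move=> s1 s2; have s12 := supportedD s1 s2.
have [c1 cA _] := s1; have [c2 _ _] := s2.
apply: (@eq_eps _ _ _ _ (4 * vol A)); first by rewrite mulr_ge0 ?vol_ge0.
move=> e e0; have [P [tP hP]] := partition2 c1 c2 cA e0.
have h1 := riemann_close hausG finmu cE s1 (ltW e0) tP (fun a aP x ax => (hP a aP x ax).1).
have h2 := riemann_close hausG finmu cE s2 (ltW e0) tP (fun a aP x ax => (hP a aP x ax).2).
have h3 : rnorm (int (fun x => F1 x + F2 x) - riemann mu P (fun x => F1 x + F2 x)) <= (e + e) * vol A.
  apply: (riemann_close hausG finmu cE s12 _ tP); first by rewrite addr_ge0// ltW.
  move=> a aP x ax; have [k1 k2] := hP a aP x ax.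
  by rewrite opprD addrACA; apply: le_trans (rnormD _ _) _; rewrite lerD.
have rD : riemann mu P (fun x => F1 x + F2 x) = riemann mu P F1 + riemann mu P F2.
  by rewrite /riemann -big_split; apply: eq_bigr => a _; rewrite scalerDr.
apply: le_trans (rnorm_triangle _ (riemann mu P (fun x => F1 x + F2 x)) _) _.
rewrite (_ : e * (4 * vol A) = (e + e) * vol A + (e * vol A + e * vol A)); last by ring.
rewrite lerD// rD opprD addrACA; apply: le_trans (rnormD _ _) _.
by rewrite lerD// rnormBC.
Qed.

Lemma intZ (a : scalar_field R s) F A : supported F A ->
  int (fun x => a *: F x) = a *: int F.
Proof.
move=> sF; have [|||_ ->//] := @int_map s s E E ( *:%R a) (rnorm (a : (scalar_field R s)^o)) F A cE cE _ _ _ sF.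
- by move=> x y; rewrite scalerDr.
- by move=> b x; rewrite !scalerA mulrC.
- by move=> x; rewrite rnormZ.
Qed.

Lemma intN F A : supported F A -> int (fun x => - F x) = - int F.
Proof.
move=> sF; rewrite -scaleN1r -(intZ _ sF); congr bochner_integral.
by apply/funext => x; rewrite scaleN1r.
Qed.

Lemma supportedN F A : supported F A -> supported (fun x => - F x) A.
Proof.
move=> sF; have := supportedZ (-1) sF.
by congr supported; apply/funext => x; rewrite scaleN1r.
Qed.

Lemma intB F1 F2 A : supported F1 A -> supported F2 A ->
  int (fun x => F1 x - F2 x) = int F1 - int F2.
Proof.
by move=> s1 s2; rewrite (intD s1 (supportedN s2)) (intN s2).
Qed.

Lemma supported0 A : compact A -> supported (fun _ : G => (0 : E)) A.
Proof. by move=> cA; split => // x; exact: cvg_cst. Qed.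

Lemma int0 : int (fun _ : G => (0 : E)) = 0.
Proof.
have s0 : supported (fun _ : G => (0 : E)) set0 by apply: supported0; exact: compact0.
have := intZ 0 s0; rewrite [RHS]scale0r => h; rewrite -[RHS]h.
by congr bochner_integral; apply/funext => x; rewrite scaler0.
Qed.

Lemma supported_sum (J : Type) (r : seq J) (Fs : J -> G -> E) A :
  compact A -> (forall j, supported (Fs j) A) ->
  supported (fun x => \sum_(j <- r) Fs j x) A.
Proof.
move=> cA sF; elim: r => [|j r IH].
  by under eq_fun do rewrite big_nil; exact: supported0.
by under eq_fun do rewrite big_cons; exact: supportedD.
Qed.

Lemma int_sum (J : Type) (r : seq J) (Fs : J -> G -> E) A :
  compact A -> (forall j, supported (Fs j) A) ->
  int (fun x => \sum_(j <- r) Fs j x) = \sum_(j <- r) int (Fs j).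
Proof.
move=> cA sF; elim: r => [|j r IH].
  by under eq_fun do rewrite big_nil; rewrite big_nil int0.
under eq_fun do rewrite big_cons.
by rewrite (intD (sF j) (supported_sum r cA sF)) big_cons IH.
Qed.

Lemma rnorm_int_le F A (c : R) : supported F A -> 0 <= c ->
  (forall x, rnorm (F x) <= c) -> rnorm (int F) <= c * vol A.
Proof.
move=> sF c0 hc; have [cF cA FA] := sF.
have := @int_close R s G mu hausG finmu E cE F A [::] A c sF c0.
rewrite /simple_integral big_nil subr0; apply => //.
- exact: compact_borel.
- exact: finmu.
- by move=> x; rewrite /simple_fun big_nil subr0.
- by move=> x nA; rewrite FA// /simple_fun big_nil.
Qed.

Lemma supported_rnorm F A : supported F A ->
  @supported R RealScalars G (R^o) (fun x => rnorm (F x)) A.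
Proof.
move=> [cF cA FA]; split => //; last by move=> x nA; rewrite FA// rnorm0.
move=> x; apply/cvgrPdist_lt => e e0.
have /cvg_rnormP/(_ _ e0) := cF x; apply: filterS => y h.
exact: le_lt_trans (rnorm_dist _ _) h.
Qed.

Lemma rnorm_int F A : supported F A -> rnorm (int F) <= Rint (fun x => rnorm (F x)).
Proof.
move=> sF; have sN := supported_rnorm sF; have [cF cA FA] := sF.
rewrite -subr_le0; apply: (@le0_eps _ (2 * vol A)); first by rewrite mulr_ge0 ?vol_ge0.
move=> e e0; have [P [tP hP]] := partition1 cF cA e0.
have h1 := riemann_close hausG finmu cE sF (ltW e0) tP hP.
have h2 : `|Rint (fun x => rnorm (F x)) - @riemann R RealScalars G mu (R^o) P (fun x => rnorm (F x))| <= e * vol A.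
  apply: (riemann_close hausG finmu rcompleteR sN (ltW e0) tP) => a aP x ax.
  by apply: le_trans (hP a aP x ax); exact: rnorm_dist.
have h3 : rnorm (riemann mu P F) <= @riemann R RealScalars G mu (R^o) P (fun x => rnorm (F x)).
  apply: le_trans (rnorm_sum _ _ _) _; apply: ler_sum => a _.
  by rewrite rnormZr ger0_norm// fine_ge0.
have h4 : rnorm (int F) <= rnorm (riemann mu P F) + e * vol A.
  rewrite -lerBlDl; apply: le_trans h1; apply: le_trans (ler_norm _) _.
  exact: rnorm_dist.
move: h2; rewrite ler_norml => /andP[h2 _].
rewrite lerBlDr; apply: le_trans h4 _; apply: le_trans (lerD h3 (lexx _)) _.
rewrite lerNl opprB lerBlDr in h2; apply: le_trans (lerD h2 (lexx _)) _.
by rewrite mulrA -[e * 2]mulrC mulr2n mulrDl mul1r mulrDl addrAC.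
Qed.

End Linear.

Lemma Rint_le (f g : G -> R) A : @supported R RealScalars G (R^o) f A ->
  @supported R RealScalars G (R^o) g A -> (forall x, f x <= g x) -> Rint f <= Rint g.
Proof.
move=> sf sg fg; rewrite -subr_ge0.
have -> : Rint g - Rint f = Rint (fun x => @rnorm R RealScalars (R^o) (g x - f x)).
  rewrite (_ : (fun x => _) = (fun x => g x - f x)); first exact/esym/(intB rcompleteR sg sf).
  by apply/funext => x; rewrite /rnorm /= ger0_norm// subr_ge0.
have sgf := supportedD sg (supportedN sf).
exact: le_trans (rnorm_ge0 _) (rnorm_int rcompleteR sgf).
Qed.

End IntegralTheory.

(** * Haar measure *)

Section ParametricIntegral.
Variables (R : realType) (G : topologicalGroupType).
Variable mu : {measure set (borel G) -> \bar R}.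
Hypothesis hausG : hausdorff_space G.
Hypothesis finmu : forall A : set G, compact A -> (mu A < +oo)%E.
Variable s : scalars.
Variable E : normedModType (scalar_field R s).
Hypothesis cE : rcomplete E.
Local Notation int F := (bochner_integral mu F).
Local Notation vol A := (fine (mu A)).

Lemma unif_nbhs (T : topologicalType) (F : T -> G -> E) (B : set G) :
  continuous (fun z : T * G => F z.1 z.2) -> compact B ->
  (forall x y, ~ B y -> F x y = 0) ->
  forall x (e : R), 0 < e -> nbhs x [set x' | forall y, rnorm (F x y - F x' y) <= e].
Proof.
move=> cF cB FB x e e0.
have : nbhs x [set x' | B `<=` [set y | rnorm (F x y - F x' y) <= e]].
  move/compact_near_coveringP : cB => /(_ T (nbhs x)
    (fun x' y => rnorm (F x y - F x' y) <= e)) /=; apply.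
  move=> y _; have e2 : 0 < e / 2 by rewrite divr_gt0.
  have h1 : F z.2 z.1 @[z --> (y, x)] --> F x y.
    apply: (@cvg_comp _ _ _ (fun z : G * T => (z.2, z.1)) (fun z => F z.1 z.2)); last exact: (cF (x, y)).
    by apply: cvg_pair; [exact: cvg_snd|exact: cvg_fst].
  have h2 : F x z.1 @[z --> (y, x)] --> F x y.
    apply: (@cvg_comp _ _ _ (fun z : G * T => (x, z.1)) (fun z => F z.1 z.2)); last exact: (cF (x, y)).
    by apply: cvg_pair; [exact: cvg_cst|exact: cvg_fst].
  move/cvg_rnormP: h1 => /(_ _ e2); move/cvg_rnormP: h2 => /(_ _ e2).
  apply: filterS2 => -[y' x'] /= k1 k2; apply/ltW.
  apply: le_lt_trans (rnorm_triangle _ (F x y) _) _.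
  by rewrite (splitr e) ltrD// rnormBC.
apply: filterS => x' /= h y; have [/h//|nB] := pselect (B y).
by rewrite !FB// subrr rnorm0 ltW.
Qed.

Lemma section_continuous (T : topologicalType) (F : T -> G -> E) x :
  continuous (fun z : T * G => F z.1 z.2) -> continuous (F x).
Proof.
move=> cF y; apply: (@cvg_comp _ _ _ (fun y => (x, y)) (fun z => F z.1 z.2)); last exact: (cF (x, y)).
by apply: cvg_pair; [exact: cvg_cst|exact: cvg_id].
Qed.

Lemma int_param_continuous (T : topologicalType) (F : T -> G -> E) (B : set G) :
  continuous (fun z : T * G => F z.1 z.2) -> compact B ->
  (forall x y, ~ B y -> F x y = 0) -> continuous (fun x => int (F x)).
Proof.
move=> cF cB FB.
have sF x : supported (F x) B.
  by split => //; [exact: section_continuous|move=> y; exact: FB].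
move=> x; apply/cvg_rnormP => e e0.
have c1 : 0 < vol B + 1 by rewrite ltr_wpDl// fine_ge0.
have d0 : 0 < e / (vol B + 1) by rewrite divr_gt0.
apply: filterS (unif_nbhs cF cB FB x d0) => x' /= h.
rewrite -(intB hausG finmu cE (sF x) (sF x')).
have := rnorm_int_le hausG finmu cE (supportedD (sF x) (supportedN (sF x'))) (ltW d0) h.
by move=> /le_lt_trans; apply; rewrite mulrAC ltr_pdivrMr// ltr_pM2l// ltrDl.
Qed.

(** No product measure is used. Only the [x] variable is partitioned, finely enough that [F x] is
    uniformly close to [F] at the tag; a finite sum in [x] commutes with the integral in [y]. *)
Lemma fubini_Cc (F : G -> G -> E) (A B : set G) :
  continuous (fun z : G * G => F z.1 z.2) -> compact A -> compact B ->
  (forall x y, ~ A x -> F x y = 0) -> (forall x y, ~ B y -> F x y = 0) ->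
  int (fun x => int (fun y => F x y)) = int (fun y => int (fun x => F x y)).
Proof.
move=> cF cA cB FA FB.
have cF' : continuous (fun z : G * G => F z.2 z.1).
  move=> [y x]; apply: (@cvg_comp _ _ _ (fun z : G * G => (z.2, z.1)) (fun z => F z.1 z.2)); last exact: (cF (x, y)).
  by apply: cvg_pair; [exact: cvg_snd|exact: cvg_fst].
have sx x : supported (F x) B.
  by split => //; [exact: section_continuous|move=> y; exact: FB].
have sy y : supported (fun x => F x y) A.
  by split => //; [exact: (section_continuous (F := fun y x => F x y))|move=> x; exact: FA].
have sJ : supported (fun x => int (F x)) A.
  split => //; first exact: int_param_continuous cF cB FB.
  by move=> x nA; rewrite (_ : F x = fun=> 0) ?(int0 hausG finmu cE)//; apply/funext => y; exact: FA.
have sJ' : supported (fun y => int (fun x => F x y)) B.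
  split => //; first by apply: (int_param_continuous (F := fun y x => F x y) cF' cA) => y x; exact: FA.
  by move=> y nB; rewrite (_ : (fun x => F x y) = fun=> 0) ?(int0 hausG finmu cE)//; apply/funext => x; exact: FB.
apply: (@eq_eps _ _ _ _ _ (2 * (vol A * vol B))); first by rewrite !mulr_ge0 ?fine_ge0.
move=> e e0.
have [x _|P [tP hP]] := exists_tagged_partition hausG
   (N := fun x => [set x' | forall y, rnorm (F x y - F x' y) <= e]) cA.
  exact: (unif_nbhs cF cB FB x e0).
have h1 : rnorm (int (fun x => int (F x)) - riemann mu P (fun x => int (F x))) <= (e * vol B) * vol A.
  apply: (riemann_close hausG finmu cE sJ _ tP); first by rewrite mulr_ge0 ?fine_ge0// ltW.
  move=> a aP x ax; rewrite -(intB hausG finmu cE (sx _) (sx _)).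
  apply: (rnorm_int_le hausG finmu cE (supportedD (sx _) (supportedN (sx _))) (ltW e0)) => y.
  by rewrite rnormBC; exact: hP.
have sR : supported (fun y => riemann mu P (fun x => F x y)) B.
  by apply: supported_sum => // a; apply: supportedZ.
have h2 : riemann mu P (fun x => int (F x)) = int (fun y => riemann mu P (fun x => F x y)).
  rewrite /riemann (int_sum hausG finmu cE _ cB); last by move=> a; apply: supportedZ.
  by apply: eq_bigr => a _; rewrite (intZ hausG finmu cE _ (sx _)).
have h3 : rnorm (int (fun y => riemann mu P (fun x => F x y)) - int (fun y => int (fun x => F x y))) <= (e * vol A) * vol B.
  rewrite -(intB hausG finmu cE sR sJ').
  apply: (rnorm_int_le hausG finmu cE (supportedD sR (supportedN sJ'))).
    by rewrite mulr_ge0 ?fine_ge0// ltW.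
  move=> y; rewrite rnormBC; apply: (riemann_close hausG finmu cE (sy y) (ltW e0) tP).
  by move=> a aP x ax; rewrite rnormBC; exact: hP.
apply: le_trans (rnorm_triangle _ (riemann mu P (fun x => int (F x))) _) _.
rewrite (_ : e * (2 * (vol A * vol B)) = (e * vol B) * vol A + (e * vol A) * vol B); last by ring.
by rewrite lerD// h2.
Qed.

End ParametricIntegral.

Section HaarMeasure.
Variables (R : realType) (G : topologicalGroupType).
Variable mu : {measure set (borel G) -> \bar R}.
Hypothesis hausG : hausdorff_space G.
Hypothesis lcG : locally_compact [set: G].
Hypothesis haar_mu : left_haar mu.
Local Notation int F := (bochner_integral mu F).
Local Notation vol A := (fine (mu A)).

Lemma haar_compact (A : set G) : compact A -> (mu A < +oo)%E.
Proof. by case: haar_mu => _ _ + _ _; apply. Qed.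

Lemma haar_lmulg g (A : set (borel G)) : measurable A ->
  mu [set (g * x)%g | x in (A : set G)] = mu A.
Proof. by case: haar_mu => _ + _ _ _; apply. Qed.

Lemma measurable_lmulg g (A : set (borel G)) : measurable A ->
  measurable ([set (g * x)%g | x in (A : set G)] : set (borel G)).
Proof.
move=> mA; have : measurable_fun [set: borel G] ((fun x : G => g^-1 * x)%g : borel G -> borel G).
  apply: (@measurability _ _ (borel G) (borel G) setT _ (@open G)) => // _ [U oU <-]; rewrite setTI.
  apply: open_borel; move: (U) oU; apply/continuousP.
  exact: lmulg_continuous.
by move=> /(_ measurableT _ mA); rewrite setTI lmulg_image.
Qed.

Lemma supported_lmulg s (E : normedModType (scalar_field R s)) (F : G -> E) A g :
  supported F A -> supported (fun x => F (g^-1 * x)%g) [set (g * x)%g | x in A].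
Proof.
move=> [cF cA FA]; split; last by move=> x; rewrite lmulg_image => /FA.
  by move=> x; apply: (@continuous_comp _ _ _ (fun x => g^-1 * x)%g F); [exact: lmulg_continuous|exact: cF].
exact: compact_lmulg.
Qed.

(** Translating the pieces of a partition for [F] gives a simple function close to the translate of
    [F], with the same integral because [mu] is invariant. *)
Lemma int_lmulg s (E : normedModType (scalar_field R s)) (F : G -> E) A g :
  rcomplete E -> supported F A -> int (fun x => F (g^-1 * x)%g) = int F.
Proof.
move=> cE sF; have [cF cA FA] := sF; have sgF := supported_lmulg g sF.
have [_ cgA _] := sgF.
apply: (@eq_eps _ _ _ _ _ (2 * vol A)); first by rewrite mulr_ge0 ?fine_ge0.
move=> e e0; have [P [tP hP]] := partition1 hausG cF cA e0.
have h1 := riemann_close hausG haar_compact cE sF (ltW e0) tP hP.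
pose t : seq (set (borel G) * E) := [seq ([set (g * x)%g | x in (a.1 : set G)], F a.2) | a <- P].
have tE : simple_integral mu t = riemann mu P F.
  rewrite /simple_integral /riemann big_map; apply: eq_big_seq => a aP /=.
  by rewrite haar_lmulg//; case: tP => /(_ _ aP)[].
have sE x : simple_fun t x = simple_fun (tagged_list P F) (g^-1 * x)%g.
  rewrite /simple_fun !big_map; apply: eq_bigr => a _ /=; rewrite !indicE.
  congr ((nat_of_bool _)%:R *: _).
  by rewrite lmulg_image; apply/idP/idP => /set_mem ?; apply/mem_set.
have ht : integrable_list mu t.
  move=> a /mapP[b bP ->] /=; have [mb bA _] := tP.1 b bP.
  split; first exact: measurable_lmulg.
  rewrite haar_lmulg//; apply: le_lt_trans (haar_compact cA).
  by apply: le_measure => //; apply/mem_set => //; exact: compact_borel.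
have h2 : rnorm (int (fun x => F (g^-1 * x)%g) - simple_integral mu t) <= e * vol A.
  have -> : vol A = vol [set (g * x)%g | x in A] by rewrite haar_lmulg//; exact: compact_borel.
  apply: (int_close hausG haar_compact cE sgF (ltW e0) ht); [exact: compact_borel|exact: haar_compact| |].
    by move=> x; rewrite sE; exact: (tagged_list_close (ltW e0) tP FA hP).
  move=> x; rewrite lmulg_image/= => nA.
  by rewrite sE (simple_fun_tagged_out _ tP)// FA.
apply: le_trans (rnorm_triangle _ (riemann mu P F) _) _.
rewrite (_ : e * (2 * vol A) = e * vol A + e * vol A); last by ring.
by apply: lerD; [rewrite -tE|rewrite rnormBC].
Qed.

(** If [U] were null, every compact set, being covered by finitely many translates of [U], would be
    null, and inner regularity of the open set [G] would give [mu G = 0]. *)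
Lemma haar_open_gt0 (U : set G) : open U -> U !=set0 -> (0 < mu U)%E.
Proof.
move=> oU [u Uu]; rewrite lt_neqAle measure_ge0 andbT eq_sym; apply/negP => /eqP mU0.
have K0 (A : set G) : compact A -> mu A = 0%E.
  move=> cA; have [x Ax|t [tA At]] := compact_open_cover (P := fun x => [set (x * u^-1 * y)%g | y in U]) cA.
    apply: open_nbhs_nbhs; split; first exact: open_lmulg.
    by exists u => //; rewrite mulgVK.
  have : (mu A <= mu (\big[setU/set0]_(x <- t) [set (x * u^-1 * y)%g | y in U] : set (borel G)))%E.
    apply: le_measure; first by apply/mem_set; exact: compact_borel.
      apply/mem_set; apply: bigsetU_measurable => x _; apply: measurable_lmulg; exact: open_borel.
    by move=> x /At [y yt]; rewrite -bigcup_seq => h; exists y.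
  have -> : mu (\big[setU/set0]_(x <- t) [set (x * u^-1 * y)%g | y in U] : set (borel G)) = 0%E.
    elim: {tA At} t => [|x t IH]; first by rewrite big_nil measure0.
    rewrite big_cons; apply/eqP; rewrite -measure_le0.
    apply: le_trans (measureU2 _ _ _) _; first by apply: measurable_lmulg; exact: open_borel.
      by apply: bigsetU_measurable => y _; apply: measurable_lmulg; exact: open_borel.
    have h1 : (mu [set (x * u^-1 * y)%g | y in U] <= 0)%E.
      by rewrite -mU0 le_eqVlt; apply/orP; left; apply/eqP; apply: haar_lmulg; exact: open_borel.
    have h2 : (mu (\big[setU/set0]_(x <- t) [set (x * u^-1 * y)%g | y in U] : set (borel G)) <= 0)%E.
      by rewrite measure_le0; apply/eqP.
    by apply: le_trans (leeD h1 h2) _; rewrite adde0.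
  by rewrite measure_le0 => /eqP.
case: haar_mu => /eqP muG _ _ _ /(_ setT openT) h; apply: muG; apply/eqP.
rewrite h; apply/eqP; apply: le_anti; apply/andP; split.
  by apply: ge_ereal_sup => _ [A /= [cA _] <-]; rewrite K0.
by rewrite -h.
Qed.

(* Steinhaus: if w translates A off itself, an open set containing A and wA has
   measure at least 2 mu(A). *)
Lemma nbhs1_setpow (S : set G) : compact_generating S -> exists n, nbhs 1%g (setpow S n).
Proof.
move=> genS; have cn n : compact (setpow S n) by exact: setpow_compact.
have mn n : measurable (setpow S n : set (borel G)) by exact: (compact_borel hausG (cn n)).
have [n n0] : exists n, (0 < mu (setpow S n))%E.
  apply: contrapT => /forallNP h.
  have z n : mu (setpow S n) = 0%E.
    by apply/eqP; rewrite eq_le measure_ge0 andbT leNgt; apply/negP/h.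
  case: haar_mu => /eqP muG _ _ _ _; apply: muG; apply/eqP.
  have -> : [set: G] = \bigcup_n setpow S n by case: genS => _ _ _ ->.
  rewrite -measure_le0; have := measure_sigma_subadditive mu mn
    (bigcup_measurable (fun k _ => mn k)) (@subset_refl _ _).
  by move=> /le_trans; apply; rewrite eseries0// => k _ _; rewrite z.
set A : set (borel G) := setpow S n.
have fA : mu A \is a fin_num by rewrite ge0_fin_numE// haar_compact//; exact: cn.
have [U [oU AU] UA] : exists2 U : set G, open U /\ A `<=` U & (mu U < mu A + mu A)%E.
  case: haar_mu => _ _ _ /(_ A (mn n)) h _.
  have : (ereal_inf [set mu U | U in [set U : set G | open U /\ A `<=` U]] < mu A + mu A)%E.
    by rewrite -h lteDl.
  by move=> /ereal_inf_lt[_ [U hU <-] ?]; exists U.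
have hw : nbhs (1%g : G) [set w | A `<=` [set x | U (w * x)%g]].
  move/compact_near_coveringP : (cn n) => /(_ G (nbhs 1%g) (fun w x => U (w * x)%g)) /=; apply.
  move=> x Ax; have : nbhs (1%g * x)%g U by rewrite mul1g; apply: open_nbhs_nbhs; split => //; exact: AU.
  have h : (fun z : G * G => (z.2 * z.1)%g) @ (x, 1%g : G) --> (1 * x)%g.
    by apply: mulg_cvg; [exact: cvg_snd|exact: cvg_fst].
  exact: h.
exists (n + n)%N; apply: filterS hw => w /= wAU.
have [[x [Ax [y Ay yx]]]|dis] := pselect (exists x, A x /\ exists2 y, A y & (w * y)%g = x).
  have -> : w = (x * y^-1)%g by rewrite -yx mulgK.
  apply: (setpowD Ax).
  exact: setpow_inv.
exfalso; move: UA; apply/negP; rewrite -leNgt.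
pose wA : set (borel G) := [set (w * x)%g | x in (A : set G)].
have mwA : measurable wA by apply: measurable_lmulg; exact: mn.
rewrite -{1}(haar_lmulg w (mn n)) -/wA -measureU//; last first.
  rewrite -subset0 => x [[y Ay yx] Ax]; apply: dis; exists x; split => //.
  by exists y.
  by exact: mn.
apply: le_measure; [apply/mem_set; apply: measurableU => //; exact: mn|apply/mem_set; exact: open_borel|].
by move=> x [[y Ay <-]|/AU//]; exact: wAU.
Qed.

(** Converts compactness into a bound on word length. This is how operators and cocycles of the
    class are bounded on compact sets by constants that do not depend on the representation. *)
Lemma compact_sub_setpow (S : set G) (A : set G) : compact_generating S -> compact A ->
  exists n, A `<=` setpow S n.
Proof.
move=> genS cA; have [n hn] := nbhs1_setpow genS.
have [x _|t [_ At]] := compact_open_cover (P := fun x => [set y | setpow S n (x^-1 * y)%g]) cA.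
  exact: nbhs_lmulg.
exists (\max_(x <- t) word_length S x + n)%N => y /At[x xt h].
rewrite -(mulVKg x y); apply: setpowD => //.
apply: (setpow_le genS _ (word_lengthP genS x)).
by rewrite (big_rem x)//= leq_maxl.
Qed.

End HaarMeasure.

Section HaarBump.
Variables (R : realType) (G : topologicalGroupType).
Variable mu : {measure set (borel G) -> \bar R}.
Hypothesis hausG : hausdorff_space G.
Hypothesis lcG : locally_compact [set: G].
Hypothesis haar_mu : left_haar mu.
Let finmu := haar_compact haar_mu.

(** The open set [V] where [f] exceeds half of [f x] has positive measure. On a partition with
    oscillation [e <= d/2], the tag of a piece meeting [V] has value at least [d/2], so the Riemann
    sum is at least [d/2 * mu V]; the error is at most [e * mu A]. *)
Lemma Rint_gt0 (f : G -> R) A x : @supported R RealScalars G (R^o) f A ->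
  (forall x, 0 <= f x) -> 0 < f x -> 0 < Rint mu f.
Proof.
move=> sf f0 fx; have [cf cA fA] := sf.
pose d := f x / 2; have d0 : 0 < d by rewrite divr_gt0.
pose V : set (borel G) := [set y | d < f y].
have oV : @open G V.
  rewrite (_ : V = f @^-1` [set r | d < r])//.
  by move/continuousP : cf; apply; exact: open_gt.
have mV : measurable V by exact: open_borel.
have V0 : (0 < mu V)%E.
  apply: (haar_open_gt0 hausG haar_mu oV); exists x.
  by rewrite /V /= /d ltr_pdivrMr// ltr_pMr// ltr1n.
have VA : V `<=` (A : set (borel G)).
  move=> y /= Vy; apply: contrapT => /fA fy.
  by move: Vy; rewrite /V /= fy ltNge (ltW d0).
have mA : measurable (A : set (borel G)) by exact: compact_borel.
have fV : (mu V < +oo)%E.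
  by apply: le_lt_trans (finmu cA); apply: le_measure => //; apply/mem_set.
have v0 : 0 < fine (mu V) by rewrite fine_gt0// V0 fV.
have key (e : R) : 0 < e -> e <= d / 2 ->
    d / 2 * fine (mu V) - e * fine (mu A) <= Rint mu f.
  move=> e0 ed; have [P [tP hP]] := @partition1 R G hausG RealScalars (R^o) f A e cf cA e0.
  have := riemann_close hausG finmu (@rcompleteR R) sf (ltW e0) tP hP.
  rewrite {1}/rnorm /= ler_norml => /andP[+ _]; rewrite lerBrDr addrC => h.
  apply: le_trans h; rewrite lerD2r /riemann /=.
  have cover : (mu V <= \sum_(a <- P) mu (V `&` a.1))%E.
    have : V `<=` \big[setU/set0]_(a <- P) (V `&` a.1).
      move=> y Vy; rewrite -bigcup_seq; have [P1 [a [P2 [-> ay _]]]] := tP.2 y (VA _ Vy).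
      by exists a => //=; rewrite mem_cat mem_head orbT.
    have mP a : a \in P -> measurable (V `&` a.1).
      by move=> /(tP.1 _)[ma _ _]; exact: measurableI.
    have mU : measurable (\big[setU/set0]_(a <- P) (V `&` a.1)).
      by rewrite big_seq_cond; apply: bigsetU_measurable => a /andP[/mP].
    move=> h; apply: (@le_trans _ _ (mu (\big[setU/set0]_(a <- P) (V `&` a.1)))).
      by apply: le_measure => //; apply/mem_set.
    elim: (P) mP {h mU} => [|a Q IH] mP; first by rewrite !big_nil measure0.
    have mP' b : b \in Q -> measurable (V `&` b.1) by move=> bQ; apply: mP; rewrite inE bQ orbT.
    rewrite !big_cons; apply: le_trans (measureU2 _ _ _) _.
    - by apply: mP; rewrite mem_head.
    - by rewrite big_seq_cond; apply: bigsetU_measurable => b /andP[/mP'].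
    - by rewrite leeD2l// IH.
  have fVa a : a \in P -> mu (V `&` a.1) \is a fin_num.
    move=> /(tP.1 _)[ma _ _]; rewrite ge0_fin_numE//; apply: le_lt_trans fV.
    by apply: le_measure => //; apply/mem_set => //; exact: measurableI.
  have cover' : fine (mu V) <= \sum_(a <- P) fine (mu (V `&` a.1)).
    rewrite -lee_fin fineK ?ge0_fin_numE//; apply: le_trans cover _.
    rewrite -sumEFin big_seq_cond [leRHS]big_seq_cond; apply: lee_sum => a /andP[aP _].
    by rewrite fineK// fVa.
  apply: le_trans (ler_wpM2l _ cover') _; first by rewrite divr_ge0// ltW.
  rewrite mulr_sumr big_seq_cond [leRHS]big_seq_cond; apply: ler_sum => a /andP[aP _].
  have [ma aA _] := tP.1 a aP.
  have [[y [Vy ay]]|dis] := pselect ((V `&` a.1) !=set0); last first.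
    have -> : V `&` a.1 = set0 by apply/eqP; apply: contrapT => /negP/set0P.
    rewrite measure0 /= mulr0.
    suff : 0 <= fine (mu a.1) * f a.2 by [].
    by rewrite mulr_ge0// fine_ge0.
  suff : d / 2 * fine (mu (V `&` a.1)) <= fine (mu a.1) * f a.2 by [].
  rewrite mulrC; apply: ler_pM; [exact: fine_ge0|by rewrite divr_ge0// ltW| |].
    apply: fine_le; first exact: fVa.
      rewrite ge0_fin_numE//; apply: le_lt_trans (finmu cA).
      by apply: le_measure => //; apply/mem_set.
    by apply: le_measure => //; apply/mem_set => //; exact: measurableI.
  have := hP a aP y ay; rewrite /rnorm /= ler_norml => /andP[_ h].
  rewrite lerBlDr in h.
  have : d <= e + f a.2 by apply: le_trans h; exact: ltW Vy.
  rewrite {1}(splitr d) => k; rewrite -(lerD2l (d / 2)); apply: le_trans k _.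
  by rewrite lerD2r.
(* The first bound is what [key] requires; the second keeps the error [e * mu A] below half of the
   main term [d/2 * mu V]. *)
pose e := Num.min (d / 2) (d / 4 * fine (mu V) / (fine (mu A) + 1)).
have a1 : 0 < fine (mu A) + 1 by rewrite ltr_wpDl// fine_ge0.
have e0 : 0 < e by rewrite lt_min !divr_gt0// ?mulr_gt0// divr_gt0.
apply: lt_le_trans (key e e0 _); last by rewrite ge_min lexx.
rewrite subr_gt0; apply: (@le_lt_trans _ _ (d / 4 * fine (mu V))).
  apply: (@le_trans _ _ (e * (fine (mu A) + 1))).
    by rewrite ler_wpM2l ?(ltW e0)// lerDl.
  by rewrite -ler_pdivlMr// ge_min lexx orbT.
by rewrite ltr_pM2r// ltr_pM2l// ltf_pV2 ?posrE// ltr_nat.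
Qed.

Lemma RintZ (c : R) (f : G -> R) A : @supported R RealScalars G (R^o) f A ->
  Rint mu (fun x => c * f x) = c * Rint mu f.
Proof. exact: (intZ hausG finmu (@rcompleteR R) (c : scalar_field R RealScalars)). Qed.

Lemma normalized_bump : exists (f : G -> R) (A : set G),
  [/\ @supported R RealScalars G (R^o) f A, forall x, 0 <= f x, 0 < f 1%g & Rint mu f = 1].
Proof.
have [phi [A [cphi phi0 cA phiA phi1]]] := bump_function R hausG lcG.
have sphi : @supported R RealScalars G (R^o) phi A by [].
have p1 : 0 < phi 1%g by rewrite phi1.
have i0 := Rint_gt0 sphi phi0 p1.
exists (fun x => (Rint mu phi)^-1 * phi x), A; split.
- exact: (supportedZ ((Rint mu phi)^-1 : scalar_field R RealScalars) sphi).
- by move=> x; rewrite mulr_ge0// invr_ge0 ltW.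
- by rewrite mulr_gt0// invr_gt0.
- by rewrite (RintZ _ sphi) mulVf// gt_eqF.
Qed.

End HaarBump.

(** * Integrated representations *)

Section CompactlySupported.
Variables (R : realType) (G : topologicalGroupType) (s : scalars).
Local Notation K := (scalar_field R s).

Lemma CcP (f : G -> K) : Cc f <-> exists A, @supported R s G (K^o) f A.
Proof.
by split=> [[cf [A cA fA]]|[A [cf cA fA]]]; [exists A|split => //; exists A].
Qed.

Lemma of_real_supported (f : G -> R) A :
  @supported R RealScalars G (R^o) f A -> @supported R s G (K^o) (fun x => of_real s (f x)) A.
Proof.
move=> [cf cA fA]; split => //; last by move=> x /fA ->; rewrite of_real0.
move=> x; apply/(@cvg_rnormP R s (K^o)) => e e0.
have /(@cvg_rnormP R RealScalars (R^o))/(_ _ e0) := cf x; apply: filterS => y.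
by rewrite /= -of_realB /rnorm /= normr_of_real of_realK.
Qed.

Lemma supported_lscale (E : normedModType K) (f : G -> K) (F : G -> E) A :
  @supported R s G (K^o) f A -> continuous F -> supported (fun x => f x *: F x) A.
Proof.
move=> [cf cA fA] cF; split => //; last by move=> x /fA ->; rewrite scale0r.
by move=> x; apply: cvgZ; [exact: cf|exact: cF].
Qed.

End CompactlySupported.

Section RepTheory.
Variables (R : realType) (G : topologicalGroupType) (s : scalars).
Variable mu : {measure set (borel G) -> \bar R}.
Hypothesis hausG : hausdorff_space G.
Hypothesis haar_mu : left_haar mu.
Let finmu := haar_compact haar_mu.
Local Notation K := (scalar_field R s).
Local Notation r2k := (@of_real R s).
Local Notation int F := (bochner_integral mu F).
Local Notation vol A := (fine (mu A)).

Section OneRep.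
Variable E : completeNormedModType K.
Variable pi : representation G E.
Let cE := @completeNormedMod_rcomplete R s E.

Lemma rep_bound1 g : exists2 c : R, 0 <= c & forall x, rnorm (pi g x) <= c * rnorm x.
Proof. exact/continuous_linear_bounded/rep_bounded. Qed.

Lemma rep_int g (F : G -> E) A : supported F A ->
  pi g (int F) = int (fun x => pi g (F x)).
Proof.
move=> sF; have [c _ hc] := rep_bound1 g.
have [|||_ h] := @int_map R G mu hausG finmu s s E E (pi g) c F A cE cE _ _ _ sF.
- exact: linearD.
- by move=> a x; rewrite linearZ.
- exact: hc.
- exact: h.
Qed.

Lemma rep_supported (f : G -> K) A x : @supported R s G (K^o) f A ->
  supported (fun g => f g *: pi g x) A.
Proof. by move=> sf; apply: supported_lscale => //; exact: rep_continuous. Qed.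

Lemma rep_integralD f A x y : @supported R s G (K^o) f A ->
  rep_integral mu pi f (x + y) = rep_integral mu pi f x + rep_integral mu pi f y.
Proof.
move=> sf; rewrite /rep_integral -(intD hausG finmu cE (rep_supported x sf) (rep_supported y sf)).
by congr bochner_integral; apply/funext => g; rewrite linearD scalerDr.
Qed.

Lemma rep_integralZ f A (a : K) x : @supported R s G (K^o) f A ->
  rep_integral mu pi f (a *: x) = a *: rep_integral mu pi f x.
Proof.
move=> sf; rewrite /rep_integral -(intZ hausG finmu cE _ (rep_supported x sf)).
by congr bochner_integral; apply/funext => g; rewrite linearZ /= !scalerA mulrC.
Qed.

Lemma rep_integralB f A x y : @supported R s G (K^o) f A ->
  rep_integral mu pi f (x - y) = rep_integral mu pi f x - rep_integral mu pi f y.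
Proof.
by move=> sf; rewrite (rep_integralD _ _ sf) -scaleN1r (rep_integralZ _ _ sf) scaleN1r.
Qed.

Lemma rep_integral0 f A : @supported R s G (K^o) f A -> rep_integral mu pi f 0 = 0.
Proof.
by move=> sf; have := rep_integralZ 0 0 sf; rewrite !scale0r.
Qed.

Lemma rep_integral_subf f h A B x : @supported R s G (K^o) f A -> @supported R s G (K^o) h B ->
  rep_integral mu pi (fun g => f g - h g) x = rep_integral mu pi f x - rep_integral mu pi h x.
Proof.
move=> sf sh; have [_ cA _] := sf; have [_ cB _] := sh.
have sf' := supportedU sf cB; have sh' := supportedUr sh cA.
rewrite /rep_integral -(intB hausG finmu cE (rep_supported x sf') (rep_supported x sh')).
by congr bochner_integral; apply/funext => g; rewrite scalerBl.
Qed.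

Lemma rep_integral_le f A (c M : R) x : @supported R s G (K^o) f A -> 0 <= c -> 0 <= M ->
  (forall g, rnorm (f g : K^o) <= c) ->
  (forall g, A g -> rnorm (pi g x) <= M) ->
  rnorm (rep_integral mu pi f x) <= c * M * vol A.
Proof.
move=> sf c0 M0 hc hM; have [cf cA fA] := sf.
apply: (rnorm_int_le hausG finmu cE (rep_supported x sf)); first by rewrite mulr_ge0.
move=> g; rewrite rnormZ; have [Ag|nA] := pselect (A g).
  by rewrite ler_pM ?rnorm_ge0// hM.
by rewrite fA// rnorm0 mul0r mulr_ge0.
Qed.

End OneRep.

Lemma convolution_supported (f h : G -> K) A B :
  @supported R s G (K^o) f A -> @supported R s G (K^o) h B ->
  @supported R s G (K^o) (convolution mu f h) [set (x * y)%g | x in A & y in B].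
Proof.
move=> [cf cA fA] [ch cB hB]; split.
- apply: (@int_param_continuous R G mu hausG finmu s (K^o) (@rcomplete_scalar R s) G (fun x y => f y * h (y^-1 * x)%g : K^o) A) => //.
    move=> [x y]; apply: (@cvgM K); last 1 first.
      apply: (@cvg_comp _ _ _ (fun z : G * G => z.2^-1 * z.1)%g h); last exact: ch.
      by apply: mulg_cvg; [apply: invg_cvg; exact: cvg_snd|exact: cvg_fst].
    by apply: (@cvg_comp _ _ _ (fun z : G * G => z.2) f); [exact: cvg_snd|exact: cf].
  by move=> x y /fA ->; rewrite mul0r.
- exact: compact_mulg.
- move=> x nx; rewrite /convolution /haar_integral (_ : (fun y => _) = fun=> 0).
    exact: (int0 hausG finmu (@rcomplete_scalar R s)).
  apply/funext => y; have [Ay|/fA ->] := pselect (A y); last by rewrite mul0r.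
  rewrite (hB (y^-1 * x)%g) ?mulr0// => Bx; apply: nx; exists y => //.
  by exists (y^-1 * x)%g => //; rewrite mulVKg.
Qed.

Lemma convolution_Cc (f h : G -> K) : Cc f -> Cc h -> Cc (convolution mu f h).
Proof.
by move=> /CcP[A sf] /CcP[B sh]; apply/CcP; eexists; exact: convolution_supported sf sh.
Qed.

(** Exchange the two integrals, then translate the inner one by [y], which turns [pi k] into [pi y]
    composed with [pi k]. *)
Lemma rep_convolution (E : completeNormedModType K) (pi : representation G E) (f h : G -> K) A B x :
  @supported R s G (K^o) f A -> @supported R s G (K^o) h B ->
  rep_integral mu pi (convolution mu f h) x = rep_integral mu pi f (rep_integral mu pi h x).
Proof.
move=> sf sh; have [cf cA fA] := sf; have [ch cB hB] := sh.
have cE := @completeNormedMod_rcomplete R s E.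
pose AB := [set (x * y)%g | x in A & y in B].
have cAB : compact AB by exact: compact_mulg.
pose Phi (y k : G) : E := (f y * h (y^-1 * k)%g) *: pi k x.
have cPhi : continuous (fun z : G * G => Phi z.1 z.2).
  move=> [y k]; apply: cvgZ.
    apply: (@cvgM K).
      by apply: (@cvg_comp _ _ _ (fun z : G * G => z.1) f); [exact: cvg_fst|exact: cf].
    apply: (@cvg_comp _ _ _ (fun z : G * G => z.1^-1 * z.2)%g h); last exact: ch.
    by apply: mulg_cvg; [apply: invg_cvg; exact: cvg_fst|exact: cvg_snd].
  apply: (@cvg_comp _ _ _ (fun z : G * G => z.2) (fun k => pi k x)); first exact: cvg_snd.
  exact: rep_continuous.
have Phi1 y k : ~ A y -> Phi y k = 0 by move=> /fA fy; rewrite /Phi fy mul0r scale0r.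
have Phi2 y k : ~ AB k -> Phi y k = 0.
  move=> nk; have [Ay|/Phi1//] := pselect (A y).
  rewrite /Phi (hB (y^-1 * k)%g) ?mulr0 ?scale0r// => By; apply: nk.
  by exists y => //; exists (y^-1 * k)%g => //; rewrite mulVKg.
have -> : rep_integral mu pi (convolution mu f h) x = int (fun k => int (fun y => Phi y k)).
  congr bochner_integral; apply/funext => k.
  have sk : @supported R s G (K^o) (fun y => f y * h (y^-1 * k)%g) A.
    split => //; last by move=> y /fA ->; rewrite mul0r.
    move=> y; apply: (@cvgM K); first exact: cf.
    apply: (@cvg_comp _ _ _ (fun y => y^-1 * k)%g h); last exact: ch.
    by apply: mulg_cvg; [apply: invg_cvg; exact: cvg_id|exact: cvg_cst].
  have [|||_ h'] := @int_map R G mu hausG finmu s s (K^o) E (fun a : K^o => (a : K) *: pi k x) (rnorm (pi k x)) _ A (@rcomplete_scalar R s) cE _ _ _ sk.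
  - by move=> a b; rewrite scalerDl.
  - by move=> a b; rewrite scalerA.
  - by move=> a; rewrite rnormZ mulrC.
  - exact: h'.
rewrite -(fubini_Cc hausG finmu cE cPhi cA cAB Phi1 Phi2).
congr bochner_integral; apply/funext => y.
have sB := rep_supported pi x sh.
rewrite /rep_integral (rep_int pi y sB).
have spB : supported (fun k => pi y (h k *: pi k x)) B.
  have [cs _ sB'] := sB; split => //; last by move=> k /sB' ->; rewrite linear0.
  by move=> k; apply: (@cvg_comp _ _ _ (fun k => h k *: pi k x) (pi y)); [exact: cs|exact: rep_bounded].
rewrite -(int_lmulg hausG haar_mu y cE spB).
rewrite -(intZ hausG finmu cE (f y) (supported_lmulg y spB)).
congr bochner_integral; apply/funext => k.
by rewrite linearZ /= scalerA -repM mulVKg.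
Qed.

(* The trivial representation turns statements about representations into
   statements about Haar integrals. *)
Definition trivial_rep (E : completeNormedModType K) : representation G E.
Proof.
refine (@Representation R G s E (fun=> idfun) _ _ _ _) => //.
- by move=> g x; exact: cvg_id.
- by move=> x g; exact: cvg_cst.
Defined.

Lemma haar_integral_trivial (f : G -> K) :
  haar_integral mu f = rep_integral mu (trivial_rep (scalar_complete R s)) f (1 : K^o).
Proof.
rewrite /haar_integral /rep_integral; congr (@bochner_integral _ _ _ _ _ _).
by apply/funext => g; rewrite /= [RHS]mulr1.
Qed.

Lemma rep_integral_invariant (E : completeNormedModType K) (pi : representation G E) f A x :
  @supported R s G (K^o) f A -> invariants pi x ->
  rep_integral mu pi f x = haar_integral mu f *: x.
Proof.
move=> sf inv; have cE := @completeNormedMod_rcomplete R s E.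
have [|||_ h'] := @int_map R G mu hausG finmu s s (K^o) E (fun a : K^o => (a : K) *: x) (rnorm x) _ A (@rcomplete_scalar R s) cE _ _ _ sf.
- by move=> a b; rewrite scalerDl.
- by move=> a b; rewrite scalerA.
- by move=> a; rewrite rnormZ mulrC.
rewrite h' /rep_integral; congr bochner_integral.
by apply/funext => g; rewrite inv.
Qed.

Lemma haar_convolution f h A B :
  @supported R s G (K^o) f A -> @supported R s G (K^o) h B ->
  haar_integral mu (convolution mu f h) = haar_integral mu f * haar_integral mu h.
Proof.
move=> sf sh; rewrite haar_integral_trivial (rep_convolution _ _ sf sh).
rewrite (rep_integral_invariant (pi := trivial_rep _) sh); last by move=> g.
by rewrite (rep_integral_invariant (pi := trivial_rep _) sf)// scalerA [LHS]mulr1.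
Qed.

Lemma haar_of_real (f : G -> R) A : @supported R RealScalars G (R^o) f A ->
  haar_integral mu (fun x => of_real s (f x)) = of_real s (Rint mu f).
Proof.
move=> sf.
have [|||_ h'] := @int_map R G mu hausG finmu RealScalars s (R^o) (K^o) (fun a : R => of_real s a) 1 _ A (@rcompleteR R) (@rcomplete_scalar R s) _ _ _ sf.
- by move=> a b; rewrite of_realD.
- by move=> a b; rewrite of_realM.
- by move=> a; rewrite mul1r /rnorm /= normr_of_real of_realK.
- exact: esym h'.
Qed.

End RepTheory.

(** * Weighted sup-norm spaces *)

(* A weighted sup-norm space: functions h with |h t| <= c * w t, cut down by a
   closed linear condition.  Duals of normed spaces (t a vector, w its norm) and
   Hilbert completions (t a formal combination of points) are both of this form. *)
Record weighted_data (R : realType) (s : scalars) := WeightedData {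
  widx : Type;
  weight : widx -> R;
  weight_ge0 : forall t, 0 <= weight t;
  wpred : set (widx -> scalar_field R s);
  wpred0 : wpred (fun=> 0);
  wpredP : forall a f g, wpred f -> wpred g -> wpred (fun t => a * f t + g t);
  wpred_closed : forall f, (forall e : R, 0 < e -> exists2 g, wpred g &
    forall t, rnorm (f t - g t : (scalar_field R s)^o) <= e * weight t) -> wpred f
}.

Section WeightedSpace.
Variables (R : realType) (s : scalars).
Local Notation K := (scalar_field R s).
Local Notation rabs a := (@rnorm R s (K^o) a).
Variable D : weighted_data R s.
Local Notation T := (widx D).
Local Notation w := (@weight R s D).

Definition wbounded (f : T -> K) (c : R) := 0 <= c /\ forall t, rabs (f t) <= c * w t.

Definition wspace_pred : pred (T -> K) :=
  fun f => `[< (exists c, wbounded f c) /\ wpred f >].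

Lemma wspace_submod : submod_closed wspace_pred.
Proof.
split; first apply/asboolP.
  split; last exact: wpred0.
  by exists 0; split => // t; rewrite rnorm0 mul0r.
move=> a f g /asboolP[[c [c0 hc]] Pf] /asboolP[[d [d0 hd]] Pg]; apply/asboolP.
split; last exact: wpredP.
exists (rabs a * c + d); split; first by rewrite addr_ge0// mulr_ge0// rnorm_ge0.
move=> t; apply: le_trans (rnormD _ _) _; rewrite mulrDl lerD//.
by rewrite (@rnormZ _ _ (K^o)) -mulrA ler_wpM2l ?rnorm_ge0.
Qed.

HB.instance Definition _ := GRing.isSubmodClosed.Build K (T -> K) wspace_pred wspace_submod.

Record wspace := WSpace { wfun :> T -> K; wfunP : wfun \in wspace_pred }.
HB.instance Definition _ := [isSub for wfun].
HB.instance Definition _ := [Choice of wspace by <:].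
HB.instance Definition _ := [SubChoice_isSubLmodule of wspace by <:].

Definition wnorm (f : wspace) : R := inf [set c | wbounded f c].

Lemma wspaceP (f : wspace) : (exists c, wbounded f c) /\ wpred (f : T -> K).
Proof. exact/asboolP/(wfunP f). Qed.

Lemma wnorm_le (f : wspace) c : wbounded f c -> wnorm f <= c.
Proof. by move=> fc; apply: ge_inf => //; exists 0 => d []. Qed.

Lemma wnorm_ge0 (f : wspace) : 0 <= wnorm f.
Proof.
by have [[c fc] _] := wspaceP f; apply: lb_le_inf; [exists c|move=> d []].
Qed.

Lemma wnormP (f : wspace) t : rabs (f t) <= wnorm f * w t.
Proof.
have [[c fc] _] := wspaceP f.
have := weight_ge0 (w:=D) t.
rewrite le_eqVlt => /orP[/eqP wt0|wt0].
  by case: fc => _ /(_ t); rewrite -wt0 !mulr0.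
rewrite -ler_pdivrMr//; apply: lb_le_inf; first by exists c.
by move=> d [_ /(_ t)]; rewrite ler_pdivrMr.
Qed.

Let knorm (f : wspace) : K := of_real s (wnorm f).

Lemma wspaceD (f g : wspace) t : (f + g) t = f t + g t. Proof. by []. Qed.
Lemma wspaceZ a (f : wspace) t : (a *: f) t = a * f t. Proof. by []. Qed.
Lemma wspace_eq (f g : wspace) : (forall t, f t = g t) -> f = g.
Proof. by move=> h; apply/val_inj/funext. Qed.

Let knormD f g : knorm (f + g) <= knorm f + knorm g.
Proof.
rewrite -of_realD of_real_le; apply: wnorm_le; split.
  by rewrite addr_ge0 ?wnorm_ge0.
by move=> t; rewrite wspaceD mulrDl; apply: le_trans (rnormD _ _) _; rewrite lerD ?wnormP.
Qed.

Let knormZ a f : knorm (a *: f) = `|a| * knorm f.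
Proof.
have le b h : wnorm (b *: h) <= rabs b * wnorm h.
  apply: wnorm_le; split; first by rewrite mulr_ge0 ?rnorm_ge0 ?wnorm_ge0.
  move=> t; rewrite wspaceZ (@rnormZ _ _ (K^o)) -mulrA ler_wpM2l ?rnorm_ge0//.
  exact: wnormP.
rewrite (_ : `|a| = of_real s (rabs a)); last by rewrite -(@normE R s (K^o)).
rewrite -of_realM; congr of_real; apply: le_anti; rewrite le/=.
have [->|a0] := eqVneq a 0; first by rewrite rnorm0 mul0r wnorm_ge0.
have ra : 0 < rabs a by exact: (@rnorm_gt0 R s (K^o)).
rewrite -ler_pdivlMl//.
apply: (@le_trans _ _ (wnorm (a^-1 *: (a *: f)))); first by rewrite scalerA mulVf// scale1r.
apply: le_trans (le _ _) _; rewrite ler_wpM2r ?wnorm_ge0//.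
rewrite -[leRHS]mul1r ler_pdivlMr// -(@rnormZ _ _ (K^o)) [_ *: _]mulVf//.
by rewrite -of_real1 /rnorm normr_of_real of_realK normr1.
Qed.

Let knorm_eq0 f : knorm f = 0 -> f = 0.
Proof.
rewrite -of_real0 => /of_real_inj f0; apply: wspace_eq => t.
apply: (@rnorm_le0 R s (K^o)).
by apply: le_trans (wnormP f t) _; rewrite f0 mul0r.
Qed.

HB.instance Definition _ := Lmodule_isNormed.Build K wspace knormD knormZ knorm_eq0.

Lemma rnorm_wspace (f : wspace) : rnorm f = wnorm f.
Proof. by rewrite /rnorm /= of_realK. Qed.

(** The limit is taken pointwise. The Cauchy estimate is uniform relative to the weight, so it
    survives in the limit, and [wpred_closed] then places the limit in the space. *)
Lemma wspace_rcomplete : rcomplete (wspace : normedModType K).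
Proof.
move=> u cu.
have cut t : exists l : K^o, rcvg (fun n => u n t : K^o) l.
  apply: (@rcomplete_scalar R s) => e e0.
  have w1 : 0 < w t + 1 by rewrite ltr_wpDl// weight_ge0.
  have [N hN] := cu (e / (w t + 1)) (divr_gt0 e0 w1).
  exists N => m n Nm Nn; have h := hN m n Nm Nn; rewrite rnorm_wspace in h.
  apply: le_lt_trans (wnormP (u m - u n) t) _.
  apply: (@le_lt_trans _ _ (wnorm (u m - u n) * (w t + 1))).
    by rewrite ler_wpM2l ?wnorm_ge0// lerDl.
  by rewrite -ltr_pdivlMr.
have [l hl] := choice cut.
have key (e : R) : 0 < e -> exists N, forall n, (N <= n)%N -> forall t, rabs (u n t - l t) <= e * w t.
  move=> e0; have [N hN] := cu _ e0; exists N => n Nn t.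
  apply: (@rcvg_le R s (K^o) (fun m => u n t - u (N + m)%N t)).
    apply: (rcvgD (E := K^o)); first exact: (@rcvg_cst R s (K^o)).
    apply: (rcvgN (E := K^o)) => d /(hl t)[M hM]; exists M => m Mm.
    by apply: hM; rewrite (leq_trans Mm)// leq_addl.
  move=> m; have h := hN n (N + m)%N Nn (leq_addr _ _); rewrite rnorm_wspace in h.
  apply: le_trans (wnormP (u n - u (N + m)%N) t) _.
  by rewrite ler_wpM2r ?weight_ge0// ltW.
have Pl : l \in wspace_pred.
  apply/asboolP; split; last first.
    apply: wpred_closed => e /key[N hN]; exists (u N); first by have [] := wspaceP (u N).
    by move=> t; rewrite (@rnormBC R s (K^o)) hN.
  have [N hN] := key 1 ltr01; have [[c [c0 hc]] _] := wspaceP (u N).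
  exists (1 + c); split; first by rewrite addr_ge0.
  move=> t; rewrite -(subrK (u N t) (l t)) mulrDl.
  apply: (le_trans (@rnormD R s (K^o) _ _)); rewrite lerD// (@rnormBC R s (K^o)).
  exact: hN.
exists (WSpace Pl) => e e0; have e2 : 0 < e / 2 by rewrite divr_gt0.
have [N hN] := key _ e2; exists N => n Nn; rewrite rnorm_wspace.
apply: (@le_lt_trans _ _ (e / 2)); last by rewrite ltr_pdivrMr// ltr_pMr// ltr1n.
apply: wnorm_le; split; first exact: ltW.
exact: hN.
Qed.

HB.instance Definition _ :=
  Uniform_isComplete.Build wspace (rcomplete_cauchy_cvg wspace_rcomplete).

End WeightedSpace.

(** * Positive semidefinite kernels *)

Section JordanVonNeumann.
Variable R : realType.

(** The defect [phi r - r * phi 1] is additive and vanishes at integers. Multiplied by [n+1] it is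
    therefore the defect at the fractional part of [(n+1) r], which is bounded independently of [n];
    hence it is zero. *)
Lemma additive_bounded_linear (phi : R -> R) (C : R) :
  {morph phi : x y / x + y} -> (forall r, 0 <= r -> r <= 1 -> `|phi r| <= C) ->
  forall r, phi r = r * phi 1.
Proof.
move=> phiD phiC.
have phi0 : phi 0 = 0 by apply: (addrI (phi 0)); rewrite -phiD !addr0.
have phiN r : phi (- r) = - phi r.
  by apply/eqP; rewrite -addr_eq0 -phiD addNr phi0.
have phin n r : phi (n%:R * r) = n%:R * phi r.
  by elim: n => [|n IH]; rewrite ?mul0r ?phi0// -natr1 !mulrDl !mul1r phiD IH.
have pos r : 0 <= r -> phi r = r * phi 1.
  move=> r0; apply/eqP; rewrite -subr_eq0 -normr_eq0 eq_le normr_ge0 andbT.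
  pose c := `|phi 1| + C.
  have c0 : 0 <= c by rewrite addr_ge0// (le_trans (normr_ge0 _) (phiC 0 _ _)).
  have step n : n.+1%:R * `|phi r - r * phi 1| <= c.
    pose m := Num.truncn (n.+1%:R * r).
    have /andP[m1 m2] : m%:R <= n.+1%:R * r < m.+1%:R by rewrite truncn_itv// mulr_ge0.
    have -> : n.+1%:R * `|phi r - r * phi 1| =
        `|phi (n.+1%:R * r - m%:R) - (n.+1%:R * r - m%:R) * phi 1|.
      have phim : phi m%:R = m%:R * phi 1 by rewrite -phin mulr1.
      have phiA : phi (n.+1%:R * r) = phi (n.+1%:R * r - m%:R) + m%:R * phi 1.
        by rewrite -phim -phiD subrK.
      rewrite -{1}(@ger0_norm _ n.+1%:R)// -normrM mulrBr -phin phiA.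
      by congr `|_|; ring.
    have d0 : 0 <= n.+1%:R * r - m%:R by rewrite subr_ge0.
    have d1 : n.+1%:R * r - m%:R <= 1 by rewrite lerBlDl natr1 ltW.
    apply: le_trans (ler_normB _ _) _; rewrite addrC /c lerD//; last exact: phiC.
    by rewrite normrM ger0_norm// ler_piMl.
  apply/ler_addgt0Pr => e e0; rewrite add0r.
  have := step (Num.truncn (c / e)); rewrite mulrC -ler_pdivlMr//.
  move=> /le_trans; apply; rewrite ler_pdivrMr//.
  by rewrite mulrC -ler_pdivrMr// ltW// truncnS_gt.
move=> r; have [/pos//|r0] := leP 0 r.
by rewrite -[in LHS](opprK r) phiN pos ?oppr_ge0 ?ltW// mulNr opprK.
Qed.

Variables (s : scalars) (V : lmodType (scalar_field R s)) (q : V -> R).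
Hypothesis q_ge0 : forall v, 0 <= q v.
Hypothesis q_hom : forall r v, q (of_real s r *: v) = r ^+ 2 * q v.
Hypothesis q_para : forall u v, q (u + v) + q (u - v) = 2 * (q u + q v).

(** The inner product when [s] is real, and its real part when [s] is complex. *)
Definition polar (u v : V) : R := (q (u + v) - q (u - v)) / 4.

Let qN v : q (- v) = q v.
Proof. by have := q_hom (-1) v; rewrite of_realN of_real1 scaleN1r sqrrN expr1n mul1r. Qed.

Let q0 : q 0 = 0.
Proof. by have := q_hom 0 0; rewrite of_real0 scale0r expr0n mul0r. Qed.

Lemma polarC u v : polar u v = polar v u.
Proof. by rewrite /polar (addrC u v) -(qN (u - v)) opprB. Qed.

Lemma polar_diag u : polar u u = q u.
Proof.
rewrite /polar subrr q0 subr0; have := q_para u u; rewrite subrr q0 addr0 => ->.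
by field.
Qed.

Let polar0 z : polar 0 z = 0.
Proof. by rewrite /polar add0r sub0r qN subrr mul0r. Qed.

Let polar_para x y z : polar (x + y) z + polar (x - y) z = 2 * polar x z.
Proof.
rewrite /polar -mulrDl mulrA; congr (_ / 4).
have h1 := q_para (x + z) y; have h2 := q_para (x - z) y.
rewrite (addrAC x y z) (addrAC x (- y) z) (addrAC x y (- z)) (addrAC x (- y) (- z)).
lra.
Qed.

(** Jordan and von Neumann's argument: [polar_para] at the half-sum and half-difference of [u] and
    [u'] gives twice the value at the half-sum, and [polar_para] with two equal arguments identifies
    this with the value at [u + u']. *)
Lemma polarDl u u' z : polar (u + u') z = polar u z + polar u' z.
Proof.
pose h : scalar_field R s := of_real s 2^-1.
have hh (v : V) : h *: v + h *: v = v.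
  have h2 : 2^-1 + 2^-1 = 1 :> R by field.
  by rewrite -scalerDl -of_realD h2 of_real1 scale1r.
have e1 : h *: (u + u') + h *: (u - u') = u.
  rewrite !scalerDr scalerN addrACA subrr addr0; exact: hh.
have e2 : h *: (u + u') - h *: (u - u') = u'.
  by rewrite !scalerDr scalerN opprD opprK addrACA subrr add0r hh.
have := polar_para (h *: (u + u')) (h *: (u - u')) z; rewrite e1 e2 => ->.
have := polar_para (h *: (u + u')) (h *: (u + u')) z.
by rewrite hh subrr polar0 addr0.
Qed.

Lemma polarDr u v z : polar z (u + v) = polar z u + polar z v.
Proof. by rewrite polarC polarDl !(polarC z). Qed.

Lemma polar_bound u v : `|polar u v| <= (q u + q v) / 2.
Proof.
have h := q_para u v; have h1 := q_ge0 (u + v); have h2 := q_ge0 (u - v).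
rewrite /polar ler_norml; apply/andP; split; lra.
Qed.

Lemma polarZl r u v : polar (of_real s r *: u) v = r * polar u v.
Proof.
have := @additive_bounded_linear (fun r => polar (of_real s r *: u) v) ((q u + q v) / 2).
rewrite of_real1 scale1r; apply.
  by move=> x y; rewrite of_realD scalerDl polarDl.
move=> x x0 x1; apply: le_trans (polar_bound _ _) _.
rewrite ler_pM2r ?invr_gt0// lerD2r q_hom ler_piMl ?q_ge0//.
by rewrite -(expr1n _ 2) ler_pXn2r// nnegrE.
Qed.

Lemma polarZr r u v : polar u (of_real s r *: v) = r * polar u v.
Proof. by rewrite polarC polarZl polarC. Qed.

Lemma polarNl u v : polar (- u) v = - polar u v.
Proof. by have := polarZl (-1) u v; rewrite of_realN of_real1 scaleN1r mulN1r. Qed.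

Lemma polar_suml (J : Type) (r : seq J) (F : J -> V) v :
  polar (\sum_(j <- r) F j) v = \sum_(j <- r) polar (F j) v.
Proof. exact: (big_morph (polar^~ v) (fun x y => polarDl x y v) (polar0 v)). Qed.

Lemma polar_sumr (J : Type) (r : seq J) (F : J -> V) v :
  polar v (\sum_(j <- r) F j) = \sum_(j <- r) polar v (F j).
Proof. by rewrite polarC polar_suml; apply: eq_bigr => j _; rewrite polarC. Qed.

Lemma polar_sub u v : q (u - v) = q u + q v - 2 * polar u v.
Proof.
have h := q_para u v; rewrite /polar mulrA mulrAC.
have -> : 2 / 4 = 2^-1 :> R by field.
lra.
Qed.

End JordanVonNeumann.

Lemma cvg_sumR (R : realType) (T : Type) (F : set_system T) (FF : Filter F)
    (I : Type) (r : seq I) (f : I -> T -> R) (l : I -> R) :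
  (forall i, f i x @[x --> F] --> l i) ->
  (\sum_(i <- r) f i x) @[x --> F] --> \sum_(i <- r) l i.
Proof.
move=> fl; elim: r => [|i r IH].
  by under eq_fun do rewrite big_nil; rewrite big_nil; exact: cvg_cst.
by under eq_fun do rewrite big_cons; rewrite big_cons; apply: cvgD.
Qed.

Section PositiveKernels.
Variables (R : realType) (X : choiceType).
Implicit Types (k : X -> X -> R) (t u : seq (R * X)).

Definition quad k t u : R := \sum_(a <- t) \sum_(b <- u) a.1 * b.1 * k a.2 b.2.

Definition psd k := (forall x y, k x y = k y x) /\ (forall t, 0 <= quad k t t).

Lemma quad_catl k t t' u : quad k (t ++ t') u = quad k t u + quad k t' u.
Proof. by rewrite /quad big_cat. Qed.

Lemma quad_catr k t u u' : quad k t (u ++ u') = quad k t u + quad k t u'.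
Proof. by rewrite /quad -big_split; apply: eq_bigr => a _; rewrite big_cat. Qed.

Lemma quadC k t u : (forall x y, k x y = k y x) -> quad k t u = quad k u t.
Proof.
move=> kC; rewrite /quad exchange_big; apply: eq_bigr => a _.
by apply: eq_bigr => b _; rewrite kC (mulrC a.1).
Qed.

Lemma quad_scalel k c t u : quad k [seq (c * a.1, a.2) | a <- t] u = c * quad k t u.
Proof.
rewrite /quad big_map mulr_sumr; apply: eq_bigr => a _; rewrite mulr_sumr.
by apply: eq_bigr => b _ /=; rewrite !mulrA.
Qed.

Lemma discriminant (a b c : R) : 0 <= a ->
  (forall l, 0 <= l ^+ 2 * a + 2 * l * b + c) -> b ^+ 2 <= a * c.
Proof.
move=> a0 h; have [a00|a_neq] := eqVneq a 0.
  rewrite a00 mul0r; have [->|b0] := eqVneq b 0; first by rewrite expr0n.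
  (* When [a = 0] the form is affine in [l]; for [b != 0] this [l] gives it the value -1. *)
  have := h (- (c + 1) / (2 * b)); rewrite a00 mulr0 add0r.
  have -> : 2 * (- (c + 1) / (2 * b)) * b + c = -1 by field.
  by rewrite oppr_ge0 ler10.
have a1 : 0 < a by rewrite lt_def a_neq.
have := h (- b / a).
have -> : (- b / a) ^+ 2 * a + 2 * (- b / a) * b + c = (a * c - b ^+ 2) / a by field.
by rewrite pmulr_lge0 ?invr_gt0// subr_ge0.
Qed.

Lemma psd_diag k x : psd k -> 0 <= k x x.
Proof.
by move=> [_ /(_ [:: (1, x)])]; rewrite /quad !big_seq1 /= !mul1r.
Qed.

Lemma psd_CS k t u : psd k -> quad k t u ^+ 2 <= quad k t t * quad k u u.
Proof.
move=> [kC kp]; apply: discriminant => // l.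
have := kp ([seq (l * a.1, a.2) | a <- t] ++ u).
rewrite !quad_catl !quad_catr !quad_scalel (quadC u _ kC) !quad_scalel.
rewrite (quadC t [seq _ | _ <- _] kC) quad_scalel.
suff -> : l ^+ 2 * quad k t t + 2 * l * quad k t u + quad k u u =
  l * (l * quad k t t) + l * quad k t u + (l * quad k t u + quad k u u) by [].
by ring.
Qed.

(* One step of the Cholesky decomposition; when [k x0 x0 = 0] the correction
   vanishes by Cauchy-Schwarz, consistently with [x / 0 = 0]. *)
Lemma psd_cholesky_step k x0 : psd k ->
  psd (fun x y => k x y - k x x0 * k y x0 / k x0 x0).
Proof.
move=> pk; have [kC kp] := pk; split=> [x y|t]; first by rewrite kC (mulrC (k x x0)).
have -> : quad (fun x y => k x y - k x x0 * k y x0 / k x0 x0) t t =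
    quad k t t - quad k t [:: (1, x0)] ^+ 2 / k x0 x0.
  rewrite expr2 -mulrA /quad mulr_suml -sumrB; apply: eq_bigr => a _.
  rewrite big_seq1 /= mulr1 mulr_suml mulr_sumr -sumrB; apply: eq_bigr => b _.
  by rewrite big_seq1 /= mulr1 mulrBr; congr (_ - _); ring.
have d0 := psd_diag x0 pk; have := psd_CS t [:: (1, x0)] pk.
have -> : quad k [:: (1, x0)] [:: (1, x0)] = k x0 x0 by rewrite /quad !big_seq1 /= !mul1r.
have [->|dn] := eqVneq (k x0 x0) 0; first by rewrite invr0 !mulr0 subr0.
have d1 : 0 < k x0 x0 by rewrite lt_def dn.
by rewrite subr_ge0 ler_pdivrMr.
Qed.

(** Cholesky decomposition, one point at a time. Finite Gram representations are all that the Schur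
    product theorem below requires. *)
Lemma psd_gram (xs : seq X) k : psd k ->
  exists fs : seq (X -> R), forall x y, x \in xs -> y \in xs ->
    k x y = \sum_(f <- fs) f x * f y.
Proof.
elim: xs k => [|x0 xs IH] k pk; first by exists [::].
have [fs hfs] := IH _ (psd_cholesky_step x0 pk).
have [kC _] := pk; have d0 := psd_diag x0 pk.
have k0 x : k x0 x0 = 0 -> k x x0 = 0.
  move=> k00; have := psd_CS [:: (1, x)] [:: (1, x0)] pk.
  rewrite /quad !big_seq1 /= !mul1r k00 mulr0 => h.
  by apply/eqP; rewrite -sqrf_eq0 eq_le h sqr_ge0.
pose f0 x := k x x0 / Num.sqrt (k x0 x0).
(* The reduced kernel vanishes in the row of [x0], but the functions of the induction hypothesis are
   arbitrary there when [x0] is not in [xs]; they are reset to 0. *)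
exists (f0 :: [seq (fun x => if x == x0 then 0 else f x) | f <- fs]) => x y.
have f0E a b : f0 a * f0 b = k a x0 * k b x0 / k x0 x0.
  by rewrite /f0 mulrACA -invfM -expr2 sqr_sqrtr.
have f0x b : f0 x0 * f0 b = k x0 b.
  rewrite f0E; have [k00|kn] := eqVneq (k x0 x0) 0.
    by rewrite k00 !mul0r (kC x0) k0.
  by rewrite mulrAC divff// mul1r kC.
rewrite big_cons big_map !inE => /orP[/eqP ->|xs_x] /orP[/eqP ->|xs_y].
- by rewrite f0x big1 ?addr0// => f _; rewrite eqxx mul0r.
- by rewrite f0x big1 ?addr0// => f _; rewrite eqxx mul0r.
- by rewrite mulrC f0x big1 ?addr0 1?kC// => f _; rewrite eqxx mulr0.
have [->|xn] := eqVneq x x0; first by rewrite f0x big1 ?addr0// => f _; rewrite mul0r.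
have [->|yn] := eqVneq y x0; first by rewrite mulrC f0x big1 ?addr0 1?kC// => f _; rewrite mulr0.
by rewrite -hfs// f0E addrC subrK.
Qed.

(** Schur's product theorem: writing [k1] as a Gram sum, the form of the product is a sum of forms
    of [k2] with coefficients rescaled by the Gram functions. *)
Lemma psd_mul k1 k2 : psd k1 -> psd k2 -> psd (fun x y => k1 x y * k2 x y).
Proof.
move=> p1 p2; have [k1C _] := p1; have [k2C k2p] := p2; split=> [x y|t].
  by rewrite k1C k2C.
have [fs hfs] := psd_gram [seq a.2 | a <- t] p1.
have -> : quad (fun x y => k1 x y * k2 x y) t t =
    \sum_(f <- fs) quad k2 [seq (a.1 * f a.2, a.2) | a <- t] [seq (a.1 * f a.2, a.2) | a <- t].
  rewrite /quad; under [RHS]eq_bigr do rewrite big_map.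
  rewrite [RHS]exchange_big /=; apply: eq_big_seq => a at_.
  under [RHS]eq_bigr do rewrite big_map.
  rewrite [RHS]exchange_big /=; apply: eq_big_seq => b bt.
  rewrite hfs ?map_f// mulr_suml mulr_sumr; apply: eq_bigr => f _.
  by ring.
by apply: sumr_ge0 => f _; exact: k2p.
Qed.

Lemma psd_add k1 k2 : psd k1 -> psd k2 -> psd (fun x y => k1 x y + k2 x y).
Proof.
move=> [k1C p1] [k2C p2]; split=> [x y|t]; first by rewrite k1C k2C.
rewrite (_ : quad _ t t = quad k1 t t + quad k2 t t) ?addr_ge0//.
rewrite /quad -big_split; apply: eq_bigr => a _; rewrite -big_split.
by apply: eq_bigr => b _; rewrite mulrDr.
Qed.

Lemma psd_scale c k : 0 <= c -> psd k -> psd (fun x y => c * k x y).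
Proof.
move=> c0 [kC kp]; split=> [x y|t]; first by rewrite kC.
rewrite (_ : quad _ t t = c * quad k t t) ?mulr_ge0//.
rewrite /quad mulr_sumr; apply: eq_bigr => a _; rewrite mulr_sumr.
by apply: eq_bigr => b _; ring.
Qed.

Lemma psd_rank1 (f : X -> R) : psd (fun x y => f x * f y).
Proof.
split=> [x y|t]; first by rewrite mulrC.
rewrite (_ : quad _ t t = (\sum_(a <- t) a.1 * f a.2) ^+ 2) ?sqr_ge0//.
rewrite expr2 /quad mulr_suml; apply: eq_bigr => a _; rewrite mulr_sumr.
by apply: eq_bigr => b _; ring.
Qed.

Lemma psd_lim (ks : nat -> X -> X -> R) k : (forall n, psd (ks n)) ->
  (forall x y, ks n x y @[n --> \oo] --> k x y) -> psd k.
Proof.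
move=> pks kl; split=> [x y|t].
  have h : ks n x y @[n --> \oo] --> k y x.
    rewrite (_ : (fun n => ks n x y) = (fun n => ks n y x)); first exact: kl.
    by apply/funext => n; case: (pks n).
  exact: (cvg_unique _ (kl x y) h).
have : quad (ks n) t t @[n --> \oo] --> quad k t t.
  apply: cvg_sumR => a; apply: cvg_sumR => b.
  by apply: cvgM; [exact: cvg_cst|exact: kl].
move=> h; rewrite -(cvg_lim _ h)//; apply: limr_ge; first by apply/cvg_ex; eexists; exact: h.
by apply: nearW => n; case: (pks n).
Qed.

Lemma psd_exp k : psd k -> psd (fun x y => expR (k x y)).
Proof.
move=> pk; pose ks n x y := \sum_(0 <= i < n) exp_coeff (k x y) i.
have pX n : psd (fun x y => k x y ^+ n).
  elim: n => [|n IH]; first by apply: (psd_lim (ks := fun _ x y => 1 * 1)) => [m|x y];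
    [exact: (psd_rank1 (fun=> 1))|rewrite mulr1; exact: cvg_cst].
  by under eq_fun do under eq_fun do rewrite exprS; exact: psd_mul.
apply: (psd_lim (ks := ks)) => [n|x y].
  elim: n => [|n IH].
    rewrite /ks; under eq_fun do under eq_fun do rewrite big_geq//.
    have := psd_scale (lexx 0) pk; by under eq_fun do under eq_fun do rewrite mul0r.
  rewrite /ks; under eq_fun do under eq_fun do rewrite big_nat_recr//=.
  apply: psd_add => //; rewrite /exp_coeff /=.
  have -> : (fun x y => k x y ^+ n / n`!%:R) = (fun x y => n`!%:R^-1 * k x y ^+ n).
    by apply/funext => x; apply/funext => y; rewrite mulrC.
  by apply: psd_scale => //; rewrite invr_ge0.
by have := @is_cvg_series_exp_coeff R (k x y).
Qed.

(** The easy half of Schoenberg's theorem. Expanding the square distance leaves a rank-one kernel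
    times the exponential of a positive multiple of [k]. *)
Lemma psd_exp_neg k (t : R) : psd k -> 0 <= t ->
  psd (fun x y => expR (- t * (k x x + k y y - 2 * k x y))).
Proof.
move=> pk t0.
have -> : (fun x y => expR (- t * (k x x + k y y - 2 * k x y))) =
   (fun x y => (expR (- t * k x x) * expR (- t * k y y)) * expR (2 * t * k x y)).
  apply/funext => x; apply/funext => y; rewrite -!expRD; congr expR.
  by ring.
apply: psd_mul; first exact: (psd_rank1 (fun x => expR (- t * k x x))).
apply: psd_exp; apply: psd_scale => //; exact: mulr_ge0.
Qed.

End PositiveKernels.

(** * Hilbert spaces of kernels *)

Section HilbertInnerProduct.
Variables (R : realType).
Local Notation C := (scalar_field R ComplexScalars).
Variable E : normedModType C.
Hypothesis para : forall x y : E,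
  rnorm (x + y) ^+ 2 + rnorm (x - y) ^+ 2 = 2 * (rnorm x ^+ 2 + rnorm y ^+ 2).

Let q (x : E) : R := rnorm x ^+ 2.
Let q_ge0 x : 0 <= q x. Proof. exact: sqr_ge0. Qed.
Let q_hom r x : q (of_real ComplexScalars r *: x) = r ^+ 2 * q x.
Proof. by rewrite /q rnormZr exprMn real_normK// num_real. Qed.
Let B := polar q.
Let iC : C := ('i : R[i])%C.

(** Linear in the first variable and conjugate-linear in the second: the imaginary part of the
    product of [x] and [y] is then the real part of the product of [x] and [i y]. *)
Definition complex_ip (x y : E) : R[i] := (B x y +i* B x (iC *: y))%C.

Let q_i (x : E) : q (iC *: x) = q x.
Proof.
rewrite /q rnormZ (_ : rnorm _ = 1) ?mul1r//.
by rewrite /rnorm /= /Num.norm /= expr0n expr1n add0r sqrtr1.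
Qed.

Let iiN (x : E) : iC *: (iC *: x) = - x.
Proof. by rewrite scalerA -expr2 [iC ^+ 2]sqr_i scaleN1r. Qed.

Let B_i (x y : E) : B (iC *: x) (iC *: y) = B x y.
Proof. by rewrite /B /polar -scalerDr -scalerBr !q_i. Qed.

Let B_il (x y : E) : B (iC *: x) y = - B x (iC *: y).
Proof. by rewrite -(B_i (iC *: x)) iiN /B (@polarNl R ComplexScalars E q q_ge0 q_hom para). Qed.

Let ipD (x x' y : E) : complex_ip (x + x') y = complex_ip x y + complex_ip x' y.
Proof. by rewrite /complex_ip /B !(@polarDl R ComplexScalars E q q_hom para). Qed.

Let ipC (x y : E) : complex_ip x y = Num.conj (complex_ip y x).
Proof.
rewrite /complex_ip /=; apply/eqP; rewrite eq_complex /=; apply/andP; split.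
  by rewrite /B (@polarC R ComplexScalars E q q_hom).
by rewrite /B (@polarC R ComplexScalars E q q_hom x) -/B B_il.
Qed.

Let scale_complex (a : R[i]) (x : E) :
  (a : C) *: x = of_real ComplexScalars (complex.Re a) *: x + of_real ComplexScalars (complex.Im a) *: (iC *: x).
Proof.
rewrite scalerA -scalerDl; congr (_ *: _); case: a => a b /=.
by apply/eqP; rewrite eq_complex /= !mul0r !mulr0 mulr1 !subr0 !addr0 add0r !eqxx.
Qed.

Let ipZ (a : R[i]) (x y : E) : complex_ip ((a : C) *: x) y = a * complex_ip x y.
Proof.
have r_ip (r : R) z : complex_ip (of_real ComplexScalars r *: z) y = r%:C%C * complex_ip z y.
  rewrite /complex_ip /B !(@polarZl R ComplexScalars E q q_ge0 q_hom para).
  by apply/eqP; rewrite eq_complex /= !mul0r subr0 addr0 !eqxx.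
have i_ip z : complex_ip (iC *: z) y = ('i)%C * complex_ip z y.
  rewrite /complex_ip B_il B_i.
  by apply/eqP; rewrite eq_complex /= !mul0r !mul1r sub0r add0r !eqxx.
rewrite scale_complex ipD !r_ip i_ip mulrA -mulrDl; congr (_ * _).
case: a => a b /=; apply/eqP; rewrite eq_complex /=.
by rewrite !mul0r !mulr0 mulr1 !subr0 !addr0 add0r !eqxx.
Qed.

Let ipBl (y : E) : zmod_morphism (complex_ip^~ y : E -> C).
Proof.
move=> x x' /=; rewrite ipD -scaleN1r (ipZ (-1)).
by rewrite mulN1r.
Qed.

Let ipBr (x : E) : zmod_morphism (complex_ip x : E -> C).
Proof.
move=> y y'; rewrite ipC (ipBl x y y') rmorphB /= -!ipC.
by [].
Qed.

Let ipZl (y : E) : scalable_for ( *%R : C -> C -> C) (complex_ip^~ y : E -> C).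
Proof. by move=> a x; exact: ipZ. Qed.

Let ipZr (x : E) : scalable_for ((@Num.conj R[i] \; *%R) : C -> C -> C) (complex_ip x : E -> C).
Proof. by move=> a y; rewrite ipC ipZ rmorphM /= -ipC. Qed.

HB.instance Definition _ := isBilinear.Build C E E C
  ( *%R : C -> C -> C) ((@Num.conj R[i] \; *%R) : C -> C -> C)
  (complex_ip : E -> E -> C) ipBl ipBr ipZl ipZr.

Let ip_herm (x y : E) : complex_ip x y = (-1) ^+ false * Num.conj (complex_ip y x).
Proof. by rewrite expr0 mul1r ipC. Qed.

HB.instance Definition _ := isHermitianSesquilinear.Build C E false (@Num.conj R[i]) (complex_ip : E -> E -> C) ip_herm.

Lemma complex_ip_diag (x : E) : complex_ip x x = (rnorm x ^+ 2)%:C%C.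
Proof.
rewrite /complex_ip /B (@polar_diag R ComplexScalars E q q_hom para); congr (_ +i* _)%C.
have := B_il x x; rewrite /B (@polarC R ComplexScalars E q q_hom) => h.
apply/eqP; rewrite -[_ == 0](mulrn_eq0 _ 2) mulr2n {1}h addNr.
exact: eqxx.
Qed.

Let ip_dot (x : E) : x != 0 -> 0 < (complex_ip x x : C).
Proof.
move=> x0; rewrite complex_ip_diag -[0]/(0%:C)%C ltcR exprn_gt0//.
exact: rnorm_gt0.
Qed.

HB.instance Definition _ := isDotProduct.Build C E (complex_ip : E -> E -> C) ip_dot.

Lemma hilbert_ip : exists ip : {dot E for (@Num.conj R[i])},
  (forall x, `|x| ^+ 2 = ip x x) /\
  (forall T : {linear E -> E}, (forall x, rnorm (T x) = rnorm x) ->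
     forall x y, ip (T x) (T y) = ip x y).
Proof.
exists (Dot.clone C E (@Num.conj R[i]) (complex_ip : E -> E -> C) _); split.
  by move=> x; rewrite -[RHS]/(complex_ip x x) complex_ip_diag normE /= rmorphXn.
move=> T isoT x y; rewrite -[LHS]/(complex_ip (T x) (T y)) -[RHS]/(complex_ip x y) /complex_ip /B /polar /q.
by rewrite -linearZ -!linearD -!linearB !isoT.
Qed.

End HilbertInnerProduct.

Section KernelHilbertSpace.
Variables (R : realType) (G : topologicalGroupType) (k : G -> G -> R).
Hypothesis pk : psd k.
Hypothesis k_inv : forall g x y, k (g * x)%g (g * y)%g = k x y.
Hypothesis k_cont : forall x y (e : R), 0 < e ->
  nbhs (1%g : G) [set g | `|k (g * x)%g y - k x y| < e].
Local Notation C := (scalar_field R ComplexScalars).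
Local Notation rabs a := (@rnorm R ComplexScalars (C^o) a).
Local Notation L := (seq (R[i] * G)).

Definition sesq (t u : L) : R[i] :=
  \sum_(a <- t) \sum_(b <- u) a.1 * Num.conj b.1 * (k a.2 b.2)%:C%C.

Definition cscale (c : R[i]) (t : L) : L := [seq (c * a.1, a.2) | a <- t].
Definition ctrans (g : G) (t : L) : L := [seq (a.1, (g * a.2)%g) | a <- t].

Lemma sesq_catl t t' u : sesq (t ++ t') u = sesq t u + sesq t' u.
Proof. by rewrite /sesq big_cat. Qed.

Lemma sesq_herm t u : sesq t u = Num.conj (sesq u t).
Proof.
rewrite /sesq rmorph_sum /= exchange_big /=; apply: eq_bigr => a _.
rewrite rmorph_sum; apply: eq_bigr => b _ /=; case: pk => kC _.
rewrite !rmorphM /= conjCK; rewrite (kC a.2) (mulrC a.1^*).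
by congr (_ * _); apply/eqP; rewrite eq_complex /= oppr0 !eqxx.
Qed.

Lemma sesq_catr t u u' : sesq t (u ++ u') = sesq t u + sesq t u'.
Proof. by rewrite 3!(sesq_herm t) sesq_catl rmorphD. Qed.

Lemma sesq_scalel c t u : sesq (cscale c t) u = c * sesq t u.
Proof.
rewrite /sesq big_map mulr_sumr; apply: eq_bigr => a _; rewrite mulr_sumr.
by apply: eq_bigr => b _ /=; rewrite !mulrA.
Qed.

Lemma sesq_scaler c t u : sesq t (cscale c u) = Num.conj c * sesq t u.
Proof. by rewrite 2!(sesq_herm t) sesq_scalel rmorphM. Qed.

Lemma sesq_trans g t u : sesq (ctrans g t) (ctrans g u) = sesq t u.
Proof.
rewrite /sesq big_map; apply: eq_bigr => a _; rewrite big_map.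
by apply: eq_bigr => b _ /=; rewrite k_inv.
Qed.

Lemma ctransM g h t : ctrans g (ctrans h t) = ctrans (g * h)%g t.
Proof. by rewrite /ctrans -map_comp; apply: eq_map => a /=; rewrite mulgA. Qed.

Lemma ctrans1 t : ctrans 1%g t = t.
Proof. by rewrite /ctrans -[RHS]map_id; apply: eq_map => -[c x] /=; rewrite mul1g. Qed.

Lemma ctransV g t u : sesq (ctrans (g^-1)%g t) u = sesq t (ctrans g u).
Proof. by rewrite -(sesq_trans g) ctransM mulgV ctrans1. Qed.

Let reL (t : L) : seq (R * G) := [seq (complex.Re a.1, a.2) | a <- t].
Let imL (t : L) : seq (R * G) := [seq (complex.Im a.1, a.2) | a <- t].
Let B t u : R := quad k (reL t) (reL u) + quad k (imL t) (imL u).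

Let Re_sesq t u : complex.Re (sesq t u) = B t u.
Proof.
have ReD := @re_scalarD R ComplexScalars; rewrite /re_scalar in ReD.
rewrite /B /sesq (big_morph _ ReD (erefl : complex.Re 0 = 0)) /quad !big_map -big_split.
apply: eq_bigr => a _; rewrite (big_morph _ ReD (erefl : complex.Re 0 = 0)) !big_map -big_split.
apply: eq_bigr => b _ /=; case: a => -[a1 a2] x; case: b => -[b1 b2] y /=.
by ring.
Qed.

Definition lweight (t : L) : R := Num.sqrt (complex.Re (sesq t t)).

Let B_ge0 t : 0 <= B t t.
Proof. by case: pk => _ p; rewrite addr_ge0. Qed.

Lemma lweight_ge0 t : 0 <= lweight t. Proof. exact: sqrtr_ge0. Qed.

Lemma lweight_sqr t : lweight t ^+ 2 = complex.Re (sesq t t).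
Proof. by rewrite sqr_sqrtr// Re_sesq. Qed.

Lemma sesq_diag t : sesq t t = ((lweight t ^+ 2)%:C)%C.
Proof.
rewrite lweight_sqr; have := sesq_herm t t; case: (sesq t t) => a b /= [] h.
apply/eqP; rewrite eq_complex /= eqxx /=.
by rewrite -[_ == 0](mulrn_eq0 _ 2) mulr2n {1}h addNr.
Qed.

Let B_CS t u : B t u ^+ 2 <= B t t * B u u.
Proof.
apply: discriminant => // l.
have := B_ge0 (cscale (l%:C)%C t ++ u); rewrite -!Re_sesq.
rewrite sesq_catl !sesq_catr !sesq_scalel !sesq_scaler (sesq_herm u t) /=.
case: (sesq t t) => a1 a2; case: (sesq t u) => b1 b2; case: (sesq u u) => c1 c2 /=.
set X := (X in 0 <= X); set Y := (Y in _ -> 0 <= Y).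
suff -> : X = Y by []. by rewrite /X /Y; ring.
Qed.

Let rabs_sqr (z : R[i]) : z * Num.conj z = ((rabs z ^+ 2)%:C)%C.
Proof.
by rewrite -[LHS]normCK (@normE R ComplexScalars (C^o) z) -rmorphXn.
Qed.

(** Rotating [t] by a unit phase makes [sesq t u] a nonnegative real without changing the weight of
    [t], which reduces the claim to the inequality [B_CS] for real parts. *)
Lemma sesq_CS t u : rabs (sesq t u) <= lweight t * lweight u.
Proof.
set z := sesq t u; have [->|z0] := eqVneq z 0.
  by rewrite rnorm0 mulr_ge0 ?lweight_ge0.
have r0 : 0 < rabs z by exact: (@rnorm_gt0 R ComplexScalars (C^o)).
pose l : R[i] := ((rabs z)^-1)%:C%C * Num.conj z.
have lz : sesq (cscale l t) u = (rabs z)%:C%C.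
  rewrite sesq_scalel /l -mulrA (mulrC _ (sesq t u)) -/z rabs_sqr -rmorphM /=.
  by congr (_%:C)%C; rewrite expr2 mulrA mulVf ?mul1r// gt_eqF.
have ll : sesq (cscale l t) (cscale l t) = sesq t t.
  rewrite sesq_scalel sesq_scaler mulrA [X in X * _](_ : _ = 1) ?mul1r//.
  have rC (r : R) : Num.conj (r%:C%C : R[i]) = r%:C%C.
    by apply/eqP; rewrite eq_complex /= oppr0 !eqxx.
  rewrite /l rmorphM /= conjCK; rewrite rC.
  rewrite mulrACA (mulrC _ z) rabs_sqr -!rmorphM /=.
  by rewrite (_ : _ * _ = 1 :> R)//; field; rewrite gt_eqF.
have := B_CS (cscale l t) u; rewrite -!Re_sesq lz ll /= -!lweight_sqr -exprMn.
by rewrite ler_pXn2r// nnegrE; [exact: (@rnorm_ge0 R ComplexScalars (C^o))|rewrite mulr_ge0 ?lweight_ge0].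
Qed.

(* The reproducing kernel Hilbert space of [k], realized as the closure of the
   functionals [sesq _ u] on formal combinations of points. *)
Definition kpred : set (L -> C) := [set f | forall e : R, 0 < e ->
  exists u, forall t, rabs (f t - sesq t u) <= e * lweight t].

Let kpred0 : kpred (fun=> 0).
Proof.
move=> e e0; exists [::] => t; rewrite /sesq big1 ?subrr ?rnorm0.
  by rewrite mulr_ge0 ?lweight_ge0// ltW.
by move=> a _; rewrite big_nil.
Qed.

Let kpredP (a : C) f g : kpred f -> kpred g -> kpred (fun t => a * f t + g t).
Proof.
move=> Pf Pg e e0.
have a1 : 0 < rabs a + 1 by rewrite ltr_wpDl// rnorm_ge0.
have [u hu] := Pf (e / 2 / (rabs a + 1)) (divr_gt0 (divr_gt0 e0 (ltr0n _ 2)) a1).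
have [v hv] := Pg (e / 2) (divr_gt0 e0 (ltr0n _ 2)).
exists (cscale (Num.conj (a : R[i])) u ++ v) => t.
rewrite sesq_catr sesq_scaler conjCK opprD addrACA -mulrBr.
apply: le_trans (@rnormD R ComplexScalars (C^o) _ _) _.
rewrite (splitr e) mulrDl lerD//.
rewrite [X in X <= _](@rnormZ R ComplexScalars (C^o)).
apply: le_trans (ler_wpM2l (rnorm_ge0 _) (hu t)) _.
rewrite mulrA ler_wpM2r ?lweight_ge0// mulrCA ler_piMr//.
  by rewrite divr_ge0// ltW.
by rewrite ler_pdivrMr// mul1r lerDl.
Qed.

Let kpred_closed f : (forall e : R, 0 < e -> exists2 g, kpred g &
    forall t, rnorm (f t - g t : C^o) <= e * lweight t) -> kpred f.
Proof.
move=> h e e0; have e2 : 0 < e / 2 by rewrite divr_gt0.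
have [g Pg fg] := h _ e2; have [u gu] := Pg _ e2.
exists u => t; rewrite -(subrKA (g t)); apply: le_trans (@rnormD R ComplexScalars (C^o) _ _) _.
by rewrite (splitr e) mulrDl lerD.
Qed.

Definition kdata : weighted_data R ComplexScalars :=
  @WeightedData R ComplexScalars L lweight lweight_ge0 kpred kpred0 kpredP kpred_closed.

Definition khilbert : completeNormedModType C := wspace kdata.

Let vec_subproof u : ((fun t => sesq t u) : widx kdata -> C) \in @wspace_pred _ _ kdata.
Proof.
apply/asboolP; split.
  exists (lweight u); split; first exact: lweight_ge0.
  by move=> t; rewrite mulrC; exact: sesq_CS.
move=> e e0; exists u => t; rewrite subrr rnorm0.
by rewrite mulr_ge0 ?lweight_ge0// ltW.
Qed.

Definition kvec (u : L) : khilbert := WSpace (vec_subproof u).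

(** Cauchy-Schwarz bounds the norm from above; evaluating the functional at [u] itself bounds it
    from below. *)
Lemma rnorm_kvec u : rnorm (kvec u) = lweight u.
Proof.
rewrite rnorm_wspace; apply: le_anti; apply/andP; split.
  apply: wnorm_le; split; first exact: lweight_ge0.
  by move=> t; rewrite mulrC; exact: sesq_CS.
have h : rabs (sesq u u) <= wnorm (kvec u : wspace kdata) * lweight u.
  exact: (wnormP (kvec u : wspace kdata) u).
have e1 : rabs (sesq u u) = lweight u * lweight u.
  rewrite sesq_diag -expr2 -[RHS]ger0_norm ?sqr_ge0//.
  by apply: (@of_real_inj R ComplexScalars); rewrite -normr_of_real -(@normE R ComplexScalars (C^o)).
rewrite e1 in h.
have [->|u0] := eqVneq (lweight u) 0; first exact: wnorm_ge0.
by move: h; rewrite ler_pM2r// lt_def u0 lweight_ge0.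
Qed.

Lemma kvec_cat u v : kvec (u ++ v) = kvec u + kvec v.
Proof. by apply: wspace_eq => t; rewrite wspaceD /= sesq_catr. Qed.

(** The conjugate appears because the elements of the space are functionals of the first variable of
    [sesq], so that [kvec] is conjugate-linear in the combination. *)
Lemma kvec_scale (c : R[i]) u : kvec (cscale c u) = (Num.conj c : C) *: kvec u.
Proof. by apply: wspace_eq => t; rewrite wspaceZ /= sesq_scaler. Qed.

Lemma kvec_dense (f : khilbert) (e : R) : 0 < e -> exists u, rnorm (f - kvec u) <= e.
Proof.
move=> e0; have [_ /(_ _ e0)[u hu]] := wspaceP (f : wspace kdata).
by exists u; rewrite rnorm_wspace; apply: wnorm_le; split; [exact: ltW|exact: hu].
Qed.

Let kvec_seq (f : khilbert) : exists u : nat -> L, rcvg (fun n => kvec (u n)) f.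
Proof.
have /choice[u hu] n : exists u, rnorm (f - kvec u) <= n.+1%:R^-1.
  by apply: kvec_dense; rewrite invr_gt0.
exists u => e e0; exists (Num.truncn e^-1) => n Nn.
rewrite rnormBC; apply: le_lt_trans (hu n) _.
rewrite invf_plt ?posrE//; apply: lt_le_trans (truncnS_gt _) _.
by rewrite ler_nat ltnS.
Qed.

Lemma rcvg_rnorm s (E : normedModType (scalar_field R s)) (u : nat -> E) l :
  rcvg u l -> (fun n => rnorm (u n)) @ \oo --> rnorm l.
Proof.
move=> ul; apply/cvgrPdist_lt => e /ul[N hN]; exists N => // n /= /hN h.
by rewrite rnormBC in h; apply: le_lt_trans (rnorm_dist _ _) h.
Qed.

Lemma kvec_sub u v : kvec u - kvec v = kvec (u ++ cscale (-1) v).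
Proof.
rewrite kvec_cat kvec_scale rmorphN rmorph1.
by rewrite scaleN1r.
Qed.

Lemma khilbert_para (f g : khilbert) :
  rnorm (f + g) ^+ 2 + rnorm (f - g) ^+ 2 = 2 * (rnorm f ^+ 2 + rnorm g ^+ 2).
Proof.
have [u uf] := kvec_seq f; have [v vg] := kvec_seq g.
have para n : rnorm (kvec (u n) + kvec (v n)) ^+ 2 + rnorm (kvec (u n) - kvec (v n)) ^+ 2 =
    2 * (rnorm (kvec (u n)) ^+ 2 + rnorm (kvec (v n)) ^+ 2).
  rewrite kvec_sub -kvec_cat !rnorm_kvec !lweight_sqr !sesq_catl !sesq_catr !sesq_scalel !sesq_scaler.
  rewrite rmorphN rmorph1; case: (sesq (u n) (u n)) => a1 a2; case: (sesq (v n) (v n)) => b1 b2.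
  case: (sesq (u n) (v n)) => c1 c2; case: (sesq (v n) (u n)) => d1 d2 /=.
  by ring.
have sq s (E : normedModType (scalar_field R s)) (x : nat -> E) l :
  rcvg x l -> (fun n => rnorm (x n) ^+ 2) @ \oo --> rnorm l ^+ 2.
  by move=> /rcvg_rnorm h; rewrite expr2; under eq_fun do rewrite expr2; exact: cvgM.
have h1 := cvgD (sq _ _ _ _ (rcvgD uf vg)) (sq _ _ _ _ (rcvgD uf (rcvgN vg))).
have h2 : (fun n => 2 * (rnorm (kvec (u n)) ^+ 2 + rnorm (kvec (v n)) ^+ 2)) @ \oo -->
    2 * (rnorm f ^+ 2 + rnorm g ^+ 2).
  by apply: cvgM; [exact: cvg_cst|apply: cvgD; exact: sq].
have h3 : (fun n => 2 * (rnorm (kvec (u n)) ^+ 2 + rnorm (kvec (v n)) ^+ 2)) @ \oo -->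
    rnorm (f + g) ^+ 2 + rnorm (f - g) ^+ 2.
  by under eq_fun do rewrite -para; exact: h1.
exact: (cvg_unique _ h3 h2).
Qed.

End KernelHilbertSpace.

Section KernelRepresentation.
Variables (R : realType) (G : topologicalGroupType) (k : G -> G -> R).
Hypothesis pk : psd k.
Hypothesis k_inv : forall g x y, k (g * x)%g (g * y)%g = k x y.
Hypothesis k_cont : forall x y (e : R), 0 < e ->
  nbhs (1%g : G) [set g | `|k (g * x)%g y - k x y| < e].
Local Notation C := (scalar_field R ComplexScalars).
Local Notation rabs a := (@rnorm R ComplexScalars (C^o) a).
Local Notation L := (seq (R[i] * G)).
Local Notation H := (khilbert pk).
Local Notation kv u := (kvec pk u).

Lemma lweight_trans g (t : L) : lweight k (ctrans g t) = lweight k t.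
Proof. by rewrite /lweight (sesq_trans k_inv). Qed.

Let ktrans_subproof g (f : H) :
  ((fun t => (f : wspace (kdata pk)) (ctrans (g^-1)%g t)) : widx (kdata pk) -> C) \in @wspace_pred _ _ (kdata pk).
Proof.
have [[c [c0 hc]] Pf] := wspaceP (f : wspace (kdata pk)).
apply/asboolP; split.
  exists c; split => // t; apply: le_trans (hc _) _.
  by rewrite /= lweight_trans.
move=> e e0; have [u hu] := Pf e e0; exists (ctrans g u) => t.
by rewrite -(ctransV k_inv); apply: le_trans (hu _) _; rewrite lweight_trans.
Qed.

Definition ktrans g (f : H) : H := WSpace (ktrans_subproof g f).

Let ktrans_linear g : linear (ktrans g).
Proof. by move=> a f h; apply: wspace_eq => t. Qed.

HB.instance Definition _ g := GRing.isLinear.Build C H H ( *:%R ) (ktrans g) (ktrans_linear g).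

Lemma ktransE g (f : H) t : (ktrans g f : wspace (kdata pk)) t = (f : wspace (kdata pk)) (ctrans (g^-1)%g t).
Proof. by []. Qed.

Lemma ktransB g (f h : H) : ktrans g (f - h) = ktrans g f - ktrans g h.
Proof. exact: (linearB (ktrans g)). Qed.

Lemma ktransM g h f : ktrans (g * h)%g f = ktrans g (ktrans h f).
Proof. by apply: wspace_eq => t; rewrite !ktransE ctransM invgM. Qed.

Lemma ktrans1 f : ktrans 1%g f = f.
Proof. by apply: wspace_eq => t; rewrite !ktransE invg1 ctrans1. Qed.

Lemma ktrans_kvec g u : ktrans g (kv u) = kv (ctrans g u).
Proof. by apply: wspace_eq => t; rewrite !ktransE /= (ctransV k_inv). Qed.

Lemma rnorm_ktrans g f : rnorm (ktrans g f) = rnorm f.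
Proof.
have le h f' : rnorm (ktrans h f') <= rnorm f'.
  rewrite !rnorm_wspace; apply: wnorm_le; split; first exact: wnorm_ge0.
  move=> t; rewrite ktransE; apply: le_trans (wnormP _ _) _.
  by rewrite /= lweight_trans.
apply: le_anti; rewrite le/=.
by rewrite -{1}(ktrans1 f) -(mulVg g) ktransM le.
Qed.

(** By invariance the squared distance is twice the squared norm of [u] minus twice the real part of
    [sesq (ctrans g u) u], a finite sum of values of [k] that are continuous in [g]. *)
Lemma kvec_continuous u (e : R) : 0 < e ->
  nbhs (1%g : G) [set g | rnorm (kv (ctrans g u) - kv u) < e].
Proof.
move=> e0.
pose F g := \sum_(a <- u) \sum_(b <- u) complex.Re (a.1 * Num.conj b.1) * k (g * a.2)%g b.2.
have FE g : complex.Re (sesq k (ctrans g u) u) = F g.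
  have ReD := @re_scalarD R ComplexScalars; rewrite /re_scalar in ReD.
  rewrite /F /sesq (big_morph _ ReD (erefl : complex.Re 0 = 0)) big_map.
  apply: eq_bigr => a _; rewrite (big_morph _ ReD (erefl : complex.Re 0 = 0)).
  by apply: eq_bigr => b _; rewrite [LHS]/=; case: (a.1 * _) => x y /=; rewrite mulr0 subr0.
have cF : F @ nbhs (1%g : G) --> F 1%g.
  apply: cvg_sumR => a; apply: cvg_sumR => b; apply: cvgM; first exact: cvg_cst.
  apply/cvgrPdist_lt => d d0; apply: filterS (k_cont a.2 b.2 d0) => g /=.
  by rewrite mul1g distrC.
have e1 : 0 < e ^+ 2 / 2 by rewrite divr_gt0// exprn_gt0.
move/cvgrPdist_lt : cF => /(_ _ e1); apply: filterS => g /= h.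
have -> : kv (ctrans g u) - kv u = kv (ctrans g u ++ cscale (-1) u) by exact: kvec_sub.
change (rnorm (kv (ctrans g u ++ cscale (-1) u)) < e); rewrite rnorm_kvec.
rewrite -(ltr_pXn2r (n := 2))// ?nnegrE ?lweight_ge0 ?ltW//.
rewrite lweight_sqr// sesq_catl !sesq_catr// !sesq_scalel !sesq_scaler// (sesq_trans k_inv).
rewrite (sesq_herm pk u (ctrans g u)) rmorphN rmorph1.
have := FE g; have := FE 1%g; rewrite ctrans1.
case: (sesq k u u) => a1 a2 /=; case: (sesq k (ctrans g u) u) => b1 b2 /= Fa Fb.
move: h; rewrite -Fa -Fb => h.
have h' := le_lt_trans (ler_norm _) h; move: h'.
rewrite /=; lra.
Qed.

Definition krep : representation G H.
Proof.
refine (@Representation R G ComplexScalars H (fun g => (ktrans g : {linear H -> H})) _ ktrans1 ktransM _).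
- move=> g; apply/continuous_linear_bounded; exists 1 => // f.
  by rewrite mul1r rnorm_ktrans.
- move=> f g; apply/cvg_rnormP => e e0.
  have e3 : 0 < e / 3 by rewrite divr_gt0.
  have [u hu] := kvec_dense f e3.
  have := nbhs_lmulg g (kvec_continuous u e3).
  apply: filterS => h hh.
  have {}hh : rnorm (kv (ctrans (g^-1 * h)%g u) - kv u) < e / 3 by exact: hh.
  change (rnorm (ktrans g f - ktrans h f) < e).
  rewrite -(rnorm_ktrans (g^-1)%g) ktransB -!ktransM mulVg ktrans1.
  rewrite rnormBC; apply: le_lt_trans (rnorm_triangle _ (ktrans (g^-1 * h)%g (kv u)) _) _.
  rewrite -ktransB rnorm_ktrans; apply: le_lt_trans (lerD hu (rnorm_triangle _ (kv u) _)) _.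
  rewrite ktrans_kvec (rnormBC (kv u) f).
  rewrite [X in _ < X](_ : e = e / 3 + (e / 3 + e / 3)); last by field.
  exact: ler_ltD (lexx _) (ltr_leD hh hu).
Defined.

Lemma krep_unitary : unitary krep.
Proof.
have [ip [ip1 ip2]] := hilbert_ip (@khilbert_para _ _ _ pk).
exists ip; split => // g x y; apply: (ip2 (ktrans g)) => z.
exact: rnorm_ktrans.
Qed.

Lemma khilbert_additive (f : H) (t u : L) :
  (f : wspace (kdata pk)) (t ++ u) = (f : wspace (kdata pk)) t + (f : wspace (kdata pk)) u.
Proof.
apply: (@eq_eps R ComplexScalars (C^o) _ _ (lweight k (t ++ u) + (lweight k t + lweight k u))).
  by rewrite !addr_ge0 ?lweight_ge0.
move=> e e0; have [_ /(_ _ e0)[v hv]] := wspaceP (f : wspace (kdata pk)).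
set F := (f : widx (kdata pk) -> C).
have -> : F (t ++ u) - (F t + F u) = (F (t ++ u) - sesq k (t ++ u) v) - ((F t - sesq k t v) + (F u - sesq k u v)).
  by rewrite sesq_catl; ring.
apply: le_trans (@rnormB R ComplexScalars (C^o) _ _) _; rewrite mulrDr lerD//.
apply: le_trans (@rnormD R ComplexScalars (C^o) _ _) _; rewrite mulrDr lerD//.
Qed.

Lemma khilbert_scalable (f : H) c (t : L) :
  (f : wspace (kdata pk)) (cscale c t) = (c : C) * (f : wspace (kdata pk)) t.
Proof.
apply: (@eq_eps R ComplexScalars (C^o) _ _ (lweight k (cscale c t) + rabs c * lweight k t)).
  by rewrite addr_ge0 ?lweight_ge0// mulr_ge0 ?lweight_ge0// rnorm_ge0.
move=> e e0; have [_ /(_ _ e0)[v hv]] := wspaceP (f : wspace (kdata pk)).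
set F := (f : widx (kdata pk) -> C).
have -> : F (cscale c t) - (c : C) * F t = (F (cscale c t) - sesq k (cscale c t) v) - (c : C) * (F t - sesq k t v).
  by rewrite sesq_scalel; ring.
apply: le_trans (@rnormB R ComplexScalars (C^o) _ _) _; rewrite [X in _ <= X]mulrDr lerD//.
rewrite [X in X <= _](@rnormZ R ComplexScalars (C^o)) mulrCA ler_wpM2l ?rnorm_ge0//.
Qed.

(* Since G acts transitively on itself, an invariant functional is a multiple of
   the total mass, and its boundedness says that a constant can be subtracted
   from the kernel. *)
Lemma krep_no_invariants :
  (forall d : R, 0 < d -> ~ psd (fun x y => k x y - d)) ->
  forall f : H, invariants krep f -> f = 0.
Proof.
move=> kmax f inv.
set F := (f : widx (kdata pk) -> C); pose a : C := F [:: (1, 1%g)].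
have Fx (c : R[i]) x : F [:: (c, x)] = (c : C) * a.
  have := khilbert_scalable f c [:: (1, x)]; rewrite /cscale /= mulr1 -/F => ->.
  congr (_ * _); have := congr1 (fun h : H => (h : wspace (kdata pk)) [:: (1, x)]) (inv x).
  by rewrite /= -/F mulVg => <-.
have FA (t u : L) : F (t ++ u) = F t + F u by exact: khilbert_additive.
have FE (t : L) : F t = (\sum_(b <- t) b.1) * a.
  elim: t => [|[c x] t IH].
    by have := khilbert_scalable f 0 [::]; rewrite big_nil !mul0r.
  by rewrite -cat1s FA Fx IH big_cons mulrDl.
have [a0|an] := eqVneq a 0.
  by apply: wspace_eq => t; rewrite -/F FE a0 mulr0.
exfalso; have ra : 0 < rabs a by exact: (@rnorm_gt0 R ComplexScalars (C^o)).
pose N := wnorm (f : wspace (kdata pk)).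
have N0 : 0 < N.
  have := wnormP (f : wspace (kdata pk)) [:: (1, 1%g)].
  rewrite -/F -/a -/N => h; rewrite lt_def wnorm_ge0 andbT; apply/eqP => N0.
  by move: h; rewrite N0 mul0r leNgt ra.
(* A combination of total mass [m] satisfies [|m| |a| <= N * lweight]; squared, this says that
   [d * m^2] is at most the form of [k], so [d] can be subtracted. *)
pose d := (rabs a / N) ^+ 2.
apply: (kmax d); first by rewrite exprn_gt0// divr_gt0.
case: (pk) => kC kp; split=> [x y|t]; first by rewrite kC.
pose tc : L := [seq (b.1%:C%C, b.2) | b <- t].
have Qt : lweight k tc ^+ 2 = quad k t t.
  rewrite lweight_sqr// /sesq /quad /tc. rewrite !big_map.
  have ReD := @re_scalarD R ComplexScalars; rewrite /re_scalar in ReD.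
  rewrite (big_morph _ ReD (erefl : complex.Re 0 = 0)).
  apply: eq_bigr => b _; rewrite big_map (big_morph _ ReD (erefl : complex.Re 0 = 0)).
  by apply: eq_bigr => c _ /=; ring.
have Ft : F tc = (\sum_(b <- t) b.1)%:C%C * a.
  by rewrite FE /tc big_map rmorph_sum.
have : rabs (F tc) <= N * lweight k tc by exact: wnormP.
rewrite Ft [X in X <= _ -> _](@rnormZ R ComplexScalars (C^o)) {1}/rnorm (normr_of_real ComplexScalars) of_realK => h.
have -> : quad (fun x y => k x y - d) t t = quad k t t - (\sum_(b <- t) b.1) ^+ 2 * d.
  rewrite /quad expr2 !mulr_suml -sumrB; apply: eq_bigr => b _.
  rewrite mulr_sumr mulr_suml -sumrB; apply: eq_bigr => c _.
  by rewrite mulrBr.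
rewrite subr_ge0 -Qt /d expr_div_n mulrA ler_pdivrMr ?exprn_gt0//.
have : (`|\sum_(b <- t) b.1| * rabs a) ^+ 2 <= (N * lweight k tc) ^+ 2.
  rewrite ler_pXn2r// nnegrE; first by rewrite mulr_ge0 ?rnorm_ge0.
  by rewrite mulr_ge0 ?lweight_ge0// ltW.
by rewrite !exprMn real_normK ?num_real// [N ^+ 2 * _]mulrC.
Qed.

End KernelRepresentation.

(** * Averaging under a spectral gap *)

Section Contraction.
Variables (R : realType) (G : topologicalGroupType).
Variable mu : {measure set (borel G) -> \bar R}.
Hypothesis hausG : hausdorff_space G.
Hypothesis haar_mu : left_haar mu.
Let finmu := haar_compact haar_mu.
Local Notation int F := (bochner_integral mu F).
Local Notation Rsupported f A := (@supported R RealScalars G (R^o) f A).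

Lemma supported_bounded s (E : normedModType (scalar_field R s)) (F : G -> E) A :
  supported F A -> exists2 c : R, 0 <= c & forall x, rnorm (F x) <= c.
Proof.
move=> [cF cA FA].
have [x _|t [_ tA]] := compact_open_cover (P := fun y => [set x | rnorm (F y - F x) < 1]) cA.
  by have /cvg_rnormP/(_ _ ltr01) := cF x.
have c0 (u : seq G) : 0 <= \sum_(y <- u) (rnorm (F y) + 1).
  by apply: sumr_ge0 => y _; rewrite addr_ge0// rnorm_ge0.
exists (\sum_(y <- t) (rnorm (F y) + 1)) => // x.
have [/tA[y yt /= h]|nA] := pselect (A x); last by rewrite FA// rnorm0.
rewrite (big_rem y)//=; apply: (@le_trans _ _ (rnorm (F y) + 1)); last by rewrite lerDl.
rewrite -[F x](subKr (F y)); apply: le_trans (rnormB _ _) _.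
by rewrite lerD2l ltW.
Qed.

(** [f1] is a normalised finite sum of translates of [f0] that is bounded below on the compact set
    [K']. This set carries [f0] and all its translates by [Q], so bounded functions supported there,
    in particular [f0] and the differences, lie below a multiple of [f1]. *)
Lemma dominating_bump (Q : set G) (f0 : G -> R) (A0 : set G) : compact Q ->
  Rsupported f0 A0 -> (forall x, 0 <= f0 x) -> 0 < f0 1%g ->
  exists (f1 : G -> R) (A1 : set G) (a : R),
    [/\ Rsupported f1 A1, forall x, 0 <= f1 x, Rint mu f1 = 1, 0 < a &
      (forall x, f0 x <= a * f1 x) /\
      forall q x, Q q -> `|f0 (q^-1 * x)%g - f0 x| <= a * f1 x].
Proof.
move=> cQ sf f0_ge0 f01; have [cf cA fA] := sf.
have [M M0 hM] := supported_bounded sf.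
have hM' x : f0 x <= M by have := hM x; rewrite /rnorm /= ger0_norm.
pose d := f0 1%g / 2; have d0 : 0 < d by rewrite divr_gt0.
pose K' := [set (x * y)%g | x in Q & y in A0] `|` A0.
have cK : compact K' by apply: compactU => //; exact: compact_mulg.
have V1 : nbhs (1%g : G) [set x | d < f0 x].
  have /cvgrPdist_lt/(_ _ d0) := cf 1%g; apply: filterS => x /= h.
  have := le_lt_trans (ler_norm _) h; rewrite ltrBlDr {1}(splitr (f0 1%g)) -/d.
  by rewrite ltrD2l.
have [x _|t [_ tK]] := compact_open_cover (P := fun x => [set y | d < f0 (x^-1 * y)%g]) cK.
  exact: nbhs_lmulg V1.
pose phi y := \sum_(x <- t) f0 (x^-1 * y)%g.
pose At := \bigcup_(x in [set` t]) [set (x * y)%g | y in A0].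
have cAt : compact At.
  rewrite /At bigcup_seq; elim: (t) => [|x u IH]; first by rewrite big_nil; exact: compact0.
  by rewrite big_cons; apply: compactU => //; exact: compact_lmulg.
have sphi : Rsupported phi At.
  split => //.
    move=> y; apply: cvg_sumR => x.
    by apply: (@cvg_comp _ _ _ (fun y => x^-1 * y)%g f0); [exact: lmulg_continuous|exact: cf].
  move=> y nA; rewrite /phi big_seq big1// => x xt; apply: fA => A0y; apply: nA.
  by exists x => //; exists (x^-1 * y)%g => //; rewrite mulVKg.
have phi_ge0 y : 0 <= phi y by apply: sumr_ge0.
have phiK y : K' y -> d <= phi y.
  move=> /tK[x xt /= h]; rewrite /phi (big_rem x)//=; apply: le_trans (ltW h) _.
  by rewrite lerDl; apply: sumr_ge0.
have K1 : K' 1%g.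
  by right; apply: contrapT => /fA f00; move: f01; rewrite f00 ltxx.
have I0 : 0 < Rint mu phi.
  by apply: (Rint_gt0 hausG haar_mu sphi phi_ge0 (x := 1%g)); apply: lt_le_trans (phiK _ K1).
pose I := Rint mu phi.
have nK x : 0 <= (M + 1) * I / d by rewrite divr_ge0 ?mulr_ge0 ?addr_ge0 // ltW.
have dom u x : 0 <= u -> u <= M -> (~ K' x -> u = 0) -> u <= (M + 1) * I / d * (I^-1 * phi x).
  move=> u0 uM uK; have -> : (M + 1) * I / d * (I^-1 * phi x) = (M + 1) * (phi x / d).
    by field; rewrite !gt_eqF.
  have [Kx|/uK ->] := pselect (K' x); last first.
    by rewrite mulr_ge0 ?addr_ge0// divr_ge0// ltW.
  apply: le_trans uM _; apply: (@le_trans _ _ (M + 1)); first by rewrite lerDl.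
  by rewrite ler_peMr ?addr_ge0// ler_pdivlMr// mul1r phiK.
exists (fun x => I^-1 * phi x), At, ((M + 1) * I / d); split.
- exact: (supportedZ (I^-1 : scalar_field R RealScalars) sphi).
- by move=> x; rewrite mulr_ge0// invr_ge0 ltW.
- by rewrite (RintZ hausG haar_mu _ sphi) mulVf// gt_eqF.
- by rewrite divr_gt0// mulr_gt0// ltr_wpDl.
split=> [x|q x Qq].
  apply: dom => // nK'; apply: fA => Ax; apply: nK'; by right.
apply: dom => //.
  rewrite ler_norml; apply/andP; split.
    by rewrite lerNl opprB lerBlDr; apply: le_trans (hM' x) _; rewrite lerDl.
  by rewrite lerBlDr; apply: le_trans (hM' _) _; rewrite lerDl.
move=> nK'; rewrite !fA ?subrr ?normr0// => Ax; apply: nK'; first by right.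
by left; exists q => //; exists (q^-1 * x)%g => //; rewrite mulVKg.
Qed.

Section OneRepresentation.
Variable s : scalars.
Local Notation K := (scalar_field R s).
Local Notation r2k := (@of_real R s).
Variables (H : completeNormedModType K) (pi : representation G H).
Hypothesis para : forall x y : H,
  rnorm (x + y) ^+ 2 + rnorm (x - y) ^+ 2 = 2 * (rnorm x ^+ 2 + rnorm y ^+ 2).
Hypothesis iso : forall g x, rnorm (pi g x) = rnorm x.
Let cH := @completeNormedMod_rcomplete R s H.
Let q (x : H) : R := rnorm x ^+ 2.
Let q_ge0 x : 0 <= q x. Proof. exact: sqr_ge0. Qed.
Let q_hom r (x : H) : q (r2k r *: x) = r ^+ 2 * q x.
Proof. by rewrite /q rnormZr exprMn real_normK// num_real. Qed.
Let B := @polar R s H q.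

Let B_CS x z : `|B x z| <= rnorm x * rnorm z.
Proof.
have h : B x z ^+ 2 <= q x * q z.
  apply: discriminant => // l.
  have := q_ge0 (r2k l *: x + z).
  rewrite -{1}(@polar_diag R s H q q_hom para) (@polarDl R s H q q_hom para) !(@polarDr R s H q q_hom para).
  rewrite !(@polarZl R s H q q_ge0 q_hom para) !(@polarZr R s H q q_ge0 q_hom para).
  rewrite !(@polar_diag R s H q q_hom para) (@polarC R s H q q_hom z x) -/B => h.
  suff -> : l ^+ 2 * q x + 2 * l * B x z + q z = l * (l * q x) + l * B x z + (l * B x z + q z) by [].
  by ring.
rewrite -(ler_pXn2r (n := 2))// ?nnegrE ?mulr_ge0 ?rnorm_ge0//.
rewrite real_normK; last exact: num_real.
by rewrite [X in _ <= X]exprMn; exact: h.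
Qed.

Variables (f1 : G -> R) (A1 : set G).
Hypotheses (sf1 : Rsupported f1 A1) (f1_ge0 : forall x, 0 <= f1 x) (int_f1 : Rint mu f1 = 1).
Local Notation avg y := (rep_integral mu pi (fun g => r2k (f1 g)) y).

(* The variance of [pi g y] under the probability density [f1] is
   [|y|^2 - |z|^2]; the first moment is bounded by AM-GM with parameter [l]. *)
Lemma first_moment_le y (z := avg y) (l : R) : 0 < l ->
  Rint mu (fun g => rnorm (r2k (f1 g) *: (pi g y - z))) <=
  l / 2 + (rnorm y ^+ 2 - rnorm z ^+ 2) / (2 * l).
Proof.
move=> l0; have sk := of_real_supported s sf1.
pose F g := r2k (f1 g) *: pi g y.
have sF : supported F A1 by exact: rep_supported.
have sF1 : supported (fun g => r2k (f1 g) *: (pi g y - z)) A1.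
  apply: supported_lscale => // x; apply: cvgB; first exact: rep_continuous.
  exact: cvg_cst.
have TB : {morph (fun x => B x z) : x y / x + y} by move=> u v; exact: polarDl.
have [||sBF hBF] := @int_map R G mu hausG finmu s RealScalars H (R^o) (fun x => B x z) (rnorm z) F A1 cH (@rcompleteR R) TB _ _ sF.
- by move=> a x; rewrite /B (@polarZl R s H q q_ge0 q_hom para).
- by move=> x; rewrite mulrC; exact: B_CS.
have BF : Rint mu (fun g => B (F g) z) = q z.
  by rewrite -(@polar_diag R s H q q_hom para z) -[RHS]/(B z z) {2}/z hBF.
pose c := l / 2 + (q y + q z) / (2 * l).
have s1 := @supportedZ R G RealScalars (R^o) c f1 A1 sf1.
have s2 := @supportedZ R G RealScalars (R^o) (- l^-1) _ A1 sBF.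
have sU := @supportedD R G RealScalars (R^o) _ _ A1 s1 s2.
apply: (@le_trans _ _ (Rint mu (fun g => c * f1 g + - l^-1 * B (F g) z))).
  apply: (Rint_le hausG finmu (supported_rnorm sF1) sU) => g.
  rewrite rnormZr ger0_norm//.
  have -> : c * f1 g + - l^-1 * B (F g) z = f1 g * (l / 2 + q (pi g y - z) / (2 * l)).
    rewrite /F /B (@polarZl R s H q q_ge0 q_hom para) (@polar_sub R s H q para).
    rewrite /c /q iso -/(q _); field; by rewrite gt_eqF.
  rewrite ler_wpM2l//; set v := rnorm _; rewrite -subr_ge0.
  have -> : l / 2 + q (pi g y - z) / (2 * l) - v = (l - v) ^+ 2 / (2 * l).
    by rewrite /q -/v; field; rewrite gt_eqF.
  by rewrite divr_ge0 ?sqr_ge0// mulr_ge0// ltW.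
have -> : Rint mu (fun g => c * f1 g + - l^-1 * B (F g) z) = c * Rint mu f1 + - l^-1 * Rint mu (fun g => B (F g) z).
  rewrite -(RintZ hausG haar_mu c sf1) -(RintZ hausG haar_mu (- l^-1) sBF).
  exact: (@intD R G mu hausG finmu RealScalars (R^o) (@rcompleteR R) _ _ A1 s1 s2).
rewrite int_f1 BF /c /q le_eqVlt; apply/orP; left; apply/eqP.
by field; rewrite gt_eqF.
Qed.

Variables (f0 : G -> R) (A0 : set G) (Q : set G) (a d : R).
Hypotheses (sf0 : Rsupported f0 A0) (f0_ge0 : forall x, 0 <= f0 x) (int_f0 : Rint mu f0 = 1).
Hypotheses (a0 : 0 < a) (d0 : 0 < d) (f01 : forall x, f0 x <= a * f1 x).
Hypothesis f0Q : forall q x, Q q -> `|f0 (q^-1 * x)%g - f0 x| <= a * f1 x.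
Hypothesis gap : forall y, exists2 g, Q g & d * rnorm y <= rnorm (pi g y - y).

Let c := (d^-1 + 1) * a.

(** Let [z] and [w] be the averages of the orbit of [y] against [f1] and [f0], and [m] the mean
    distance of the orbit to [z] under [f1]. Domination gives [|w - z| <= a m] and, for [g] in [Q],
    [|pi g w - w| <= a m]; the gap at [w] then gives [|w| <= a m / d], so [|z| <= c m]. Since [m^2]
    is at most the variance [|y|^2 - |z|^2], the claim follows. *)
Lemma averaging_contracts y : (1 + c ^+ 2) * rnorm (avg y) ^+ 2 <= c ^+ 2 * rnorm y ^+ 2.
Proof.
set z := avg y; pose m := Rint mu (fun g => rnorm (r2k (f1 g) *: (pi g y - z))).
have cdiff : continuous (fun g => pi g y - z).
  by move=> x; apply: cvgB; [exact: rep_continuous|exact: cvg_cst].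
have s1 := supported_lscale (of_real_supported s sf1) cdiff.
have dom (u : G -> R) (A : set G) : Rsupported u A -> (forall x, `|u x| <= a * f1 x) ->
    rnorm (int (fun g => r2k (u g) *: (pi g y - z))) <= a * m.
  move=> su hu; have s2 := supported_lscale (of_real_supported s su) cdiff.
  have [_ cA _] := su; have [_ cA1 _] := sf1.
  apply: le_trans (rnorm_int hausG finmu cH s2) _.
  have sN := supported_rnorm s1.
  rewrite /m -(RintZ hausG haar_mu a sN).
  apply: (Rint_le hausG finmu (supportedU (supported_rnorm s2) cA1) (supportedUr (@supportedZ R G RealScalars (R^o) a _ _ sN) cA)) => g.
  suff : rnorm (r2k (u g) *: (pi g y - z)) <= a * rnorm (r2k (f1 g) *: (pi g y - z)) by [].
  rewrite !rnormZr mulrA ler_wpM2r ?rnorm_ge0// (ger0_norm (f1_ge0 g)).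
  exact: hu.
pose w := rep_integral mu pi (fun g => r2k (f0 g)) y.
(* Replacing the orbit by its deviation from [z] subtracts only the total mass times [z]: this mass
   is 1 for [f0] and 0 for the difference of [f0] with a translate. *)
have int_cst (u : G -> R) (A : set G) : Rsupported u A ->
    int (fun g => r2k (u g) *: (pi g y - z)) = rep_integral mu pi (fun g => r2k (u g)) y - r2k (Rint mu u) *: z.
  move=> su; have sk := of_real_supported s su.
  have sz : supported (fun g => r2k (u g) *: z) A by apply: supported_lscale => // x; exact: cvg_cst.
  rewrite -(haar_of_real s hausG haar_mu su).
  have -> : haar_integral mu (fun x => r2k (u x)) *: z = int (fun g => r2k (u g) *: z).
    by rewrite -(@rep_integral_invariant R G s mu hausG haar_mu H (trivial_rep G H) _ A z sk).
  rewrite /rep_integral -(intB hausG finmu cH (rep_supported pi y sk) sz).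
  by congr bochner_integral; apply/funext => g; rewrite scalerBr.
have wz : rnorm (w - z) <= a * m.
  have := dom f0 A0 sf0; rewrite (int_cst _ _ sf0) int_f0 of_real1 scale1r; apply.
  by move=> x; rewrite ger0_norm.
have wq g : Q g -> rnorm (pi g w - w) <= a * m.
  move=> Qg; have sg := @supported_lmulg R G RealScalars (R^o) f0 A0 g sf0.
  have [_ cA _] := sf0; have [_ cgA _] := sg.
  have su := @supportedD R G RealScalars (R^o) _ _ _ (supportedU sg cA) (supportedN (supportedUr sf0 cgA)).
  have := dom _ _ su (fun x => f0Q x Qg); rewrite (int_cst _ _ su).
  have -> : Rint mu (fun x => f0 (g^-1 * x)%g - f0 x) = 0.
    rewrite [LHS](@intB R G mu hausG finmu RealScalars (R^o) (@rcompleteR R) _ _ _ (supportedU sg cA) (supportedUr sf0 cgA)).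
    by rewrite (@int_lmulg R G mu hausG haar_mu RealScalars (R^o) f0 A0 g (@rcompleteR R) sf0) subrr.
  rewrite of_real0 scale0r subr0.
  suff -> : rep_integral mu pi (fun x => r2k (f0 (g^-1 * x)%g - f0 x)) y = pi g w - w by [].
  have sk := of_real_supported s sf0; have skg := of_real_supported s sg.
  rewrite (_ : (fun x => r2k (f0 (g^-1 * x)%g - f0 x)) = fun x => r2k (f0 (g^-1 * x)%g) - r2k (f0 x)); last first.
    by apply/funext => x; rewrite of_realB.
  rewrite (rep_integral_subf hausG haar_mu pi y skg sk); congr (_ - _).
  rewrite /w /rep_integral (rep_int hausG haar_mu pi g (rep_supported pi y sk)).
  have spi : supported (fun x => pi g (r2k (f0 x) *: pi x y)) A0.
    have [c1 c2 c3] := rep_supported pi y sk; split => //.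
      by move=> x; apply: (@cvg_comp _ _ _ (fun x => r2k (f0 x) *: pi x y) (pi g)); [exact: c1|exact: rep_bounded].
    by move=> x /c3 ->; rewrite linear0.
  rewrite -(int_lmulg hausG haar_mu g cH spi); congr bochner_integral.
  by apply/funext => x; rewrite linearZ /= -repM mulVKg.
have [g Qg hg] := gap w.
have m0 : 0 <= a * m by exact: le_trans (rnorm_ge0 _) wz.
have zle : rnorm z <= c * m.
  rewrite -[z](subKr w); apply: le_trans (rnormB _ _) _.
  rewrite /c mulrDl mul1r mulrDl -mulrA lerD//.
  by rewrite -ler_pdivrMl ?invr_gt0// invrK; apply: le_trans hg (wq g Qg).
have c_gt0 : 0 < c by rewrite mulr_gt0// addr_gt0// invr_gt0.
have D_ge0 : 0 <= rnorm y ^+ 2 - rnorm z ^+ 2.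
  rewrite leNgt; apply/negP => D0.
  pose l := - (rnorm y ^+ 2 - rnorm z ^+ 2).
  have l0 : 0 < l by rewrite oppr_gt0.
  (* for small l the AM-GM bound would be negative *)
  have sq0 : 0 < Num.sqrt l / 2 by rewrite divr_gt0// sqrtr_gt0.
  have := first_moment_le y sq0; rewrite -/z -/m.
  have -> : rnorm y ^+ 2 - rnorm z ^+ 2 = - (Num.sqrt l ^+ 2) by rewrite sqr_sqrtr ?ltW// opprK.
  have -> : - Num.sqrt l ^+ 2 / (2 * (Num.sqrt l / 2)) = - Num.sqrt l.
    by field; rewrite gt_eqF// sqrtr_gt0.
  have m_ge0 : 0 <= m by rewrite -(pmulr_rge0 _ a0).
  have q0 : 0 < Num.sqrt l by rewrite sqrtr_gt0.
  apply/negP; rewrite -ltNge; apply: lt_le_trans m_ge0.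
  by rewrite subr_lt0 -mulrA gtr_pMr// -invfM -natrM invf_lt1 ?ltr1n.
(* The optimal parameter in [first_moment_le] is [l = sqrt D]; for [D = 0] it is not admissible and
   arbitrarily small [l] are used instead. *)
have mD : m ^+ 2 <= rnorm y ^+ 2 - rnorm z ^+ 2.
  set D := _ - _ in D_ge0 *.
  have [D0|Dn] := eqVneq D 0.
    rewrite D0; have m_le0 : m <= 0.
      apply/ler_addgt0Pr => e e0; rewrite add0r.
      have e2 : 0 < 2 * e by rewrite mulr_gt0.
      have := first_moment_le y e2; rewrite -/z -/m -/D D0 mul0r addr0.
      by rewrite mulrC mulKf.
    have -> : m = 0 by apply: le_anti; rewrite m_le0 -(pmulr_rge0 _ a0).
    by rewrite expr0n.
  have D1 : 0 < D by rewrite lt_def Dn.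
  have sD : 0 < Num.sqrt D by rewrite sqrtr_gt0.
  have half (r : R) : 0 < r -> D = r ^+ 2 -> r / 2 + D / (2 * r) = r.
    by move=> r0 ->; field; rewrite gt_eqF.
  have := first_moment_le y sD; rewrite -/z -/m -/D half// ?sqr_sqrtr//.
  move=> h; rewrite -(sqr_sqrtr D_ge0) ler_pXn2r// nnegrE; last exact: ltW.
  by rewrite -(pmulr_rge0 _ a0).
have z2 : rnorm z ^+ 2 <= c ^+ 2 * m ^+ 2.
  rewrite -exprMn ler_pXn2r// nnegrE ?rnorm_ge0//.
  exact: le_trans (rnorm_ge0 _) zle.
have := le_trans z2 (ler_wpM2l (sqr_ge0 c) mD).
by rewrite mulrBr mulrDl mul1r lerBrDr.
Qed.

End OneRepresentation.
End Contraction.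

Lemma lweight_real (R : realType) (G : topologicalGroupType) (k : G -> G -> R) (t : seq (R * G)) :
  psd k -> lweight k [seq (b.1%:C%C, b.2) | b <- t] ^+ 2 = quad k t t.
Proof.
move=> pk; rewrite lweight_sqr// /sesq /quad !big_map.
have ReD := @re_scalarD R ComplexScalars; rewrite /re_scalar in ReD.
rewrite (big_morph _ ReD (erefl : complex.Re 0 = 0)).
apply: eq_bigr => b _; rewrite big_map (big_morph _ ReD (erefl : complex.Re 0 = 0)).
by apply: eq_bigr => c _ /=; ring.
Qed.

Section MaximalConstant.
Variables (R : realType) (X : choiceType).

Lemma quad_sub_const (k : X -> X -> R) c (t : seq (R * X)) :
  quad (fun x y => k x y - c) t t = quad k t t - c * (\sum_(b <- t) b.1) ^+ 2.
Proof.
rewrite /quad expr2 mulr_suml mulr_sumr -sumrB; apply: eq_bigr => b _.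
rewrite !mulr_sumr -sumrB; apply: eq_bigr => e _.
by ring.
Qed.

Lemma quad_comb (k1 k2 : X -> X -> R) c1 c2 (t : seq (R * X)) :
  quad (fun x y => c1 * k1 x y + c2 * k2 x y) t t = c1 * quad k1 t t + c2 * quad k2 t t.
Proof.
rewrite /quad !mulr_sumr -big_split; apply: eq_bigr => b _ /=.
rewrite !mulr_sumr -big_split; apply: eq_bigr => e _ /=.
by ring.
Qed.

(** The admissible constants are bounded by a diagonal value and form a closed set, so their
    supremum is admissible. Maximality is what rules out invariant vectors in
    [krep_no_invariants]. *)
Lemma psd_maximal_constant (k : X -> X -> R) (x0 : X) : psd k ->
  exists2 c, psd (fun x y => k x y - c) &
    forall d : R, 0 < d -> ~ psd (fun x y => k x y - c - d).
Proof.
move=> pk; pose A := [set c | 0 <= c /\ psd (fun x y => k x y - c)].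
have [kC kp] := pk.
have A0 : A 0.
  by split => //; under eq_fun do under eq_fun do rewrite subr0.
have Aub c : A c -> c <= k x0 x0.
  by move=> [_ /(psd_diag x0)]; rewrite subr_ge0.
have supA : has_sup A by split; [exists 0|exists (k x0 x0)].
have s0 : 0 <= sup A by apply: (sup_upper_bound supA).
have As : psd (fun x y => k x y - sup A).
  split=> [x y|t]; first by rewrite kC.
  rewrite quad_sub_const subr_ge0; set S := _ ^+ 2.
  have S0 : 0 <= S by exact: sqr_ge0.
  apply/ler_addgt0Pr => e e0.
  have S1 : 0 < S + 1 by rewrite ltr_wpDl.
  have [c [c0 [_ /(_ t)]]] := sup_adherent (divr_gt0 e0 S1) supA.
  rewrite quad_sub_const -/S subr_ge0 => h1 h2.
  have : (sup A - e / (S + 1)) * S <= c * S by rewrite ler_wpM2r// ltW.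
  move=> /le_trans/(_ h1); rewrite mulrBl lerBlDr => /le_trans; apply.
  rewrite lerD2l mulrAC ler_pdivrMr// ler_pM2l// lerDl//.
exists (sup A) => // d d0 pd.
have : A (sup A + d).
  split; first by rewrite addr_ge0// ltW.
  by under eq_fun do under eq_fun do rewrite opprD addrA.
by move=> /(sup_upper_bound supA); rewrite gerDl leNgt d0.
Qed.

End MaximalConstant.

(** * The kernels exp(-t psi) of an invariant squared distance psi *)

Section SchoenbergKernel.
Variables (R : realType) (G : topologicalGroupType) (b : G -> G -> R).
Hypothesis pb : psd b.
(** The squared distance of the Gram vectors of [b]. Invariance is assumed of it and not of [b],
    because an affine isometric action moves the origin. *)
Definition sqdist (x y : G) : R := b x x + b y y - 2 * b x y.
Hypothesis sqdist_inv : forall g x y, sqdist (g * x)%g (g * y)%g = sqdist x y.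
Hypothesis sqdist_cont : forall e : R, 0 < e -> nbhs (1%g : G) [set g | sqdist g 1%g < e].

Lemma sqdist_ge0 x y : 0 <= sqdist x y.
Proof.
case: pb => bC /(_ [:: (1, x); (-1, y)]).
rewrite /quad !big_cons !big_nil /= !addr0 (bC y x) /sqdist => h.
suff -> : b x x + b y y - 2 * b x y = 1 * 1 * b x x + 1 * -1 * b x y + (-1 * 1 * b x y + -1 * -1 * b y y) by [].
by ring.
Qed.

Lemma sqdist_diag x : sqdist x x = 0. Proof. by rewrite /sqdist; ring. Qed.

Definition schoenberg (t : R) (x y : G) : R := expR (- t * sqdist x y).

Lemma schoenberg_psd t : 0 <= t -> psd (schoenberg t).
Proof. exact: psd_exp_neg. Qed.

Lemma schoenberg_diag t x : schoenberg t x x = 1.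
Proof. by rewrite /schoenberg sqdist_diag mulr0 expR0. Qed.

Lemma schoenberg_le t x y : 1 - schoenberg t x y <= t * sqdist x y.
Proof.
rewrite lerBlDl /schoenberg mulNr; have := expR_ge1Dx (- (t * sqdist x y)).
by rewrite lerBlDr.
Qed.

Lemma schoenberg_inv t g x y : schoenberg t (g * x)%g (g * y)%g = schoenberg t x y.
Proof. by rewrite /schoenberg sqdist_inv. Qed.

(** Cauchy-Schwarz between the difference of the point masses at [g x] and [x] and the point mass at
    [y] bounds the squared variation by [2 t] times the squared distance from [g x] to [x]. By
    invariance that distance is the one from the conjugate of [g] by [x] to 1. The extra 1 in
    [2 t + 1] allows [t = 0]. *)
Lemma schoenberg_cont t x y (e : R) : 0 <= t -> 0 < e ->
  nbhs (1%g : G) [set g | `|schoenberg t (g * x)%g y - schoenberg t x y| < e].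
Proof.
move=> t0 e0; have d0 : 0 < e ^+ 2 / (2 * t + 1).
  by rewrite divr_gt0 ?exprn_gt0// ltr_wpDl// mulr_ge0.
have := nbhs1_conj x (sqdist_cont d0); apply: filterS => g /= h.
have := psd_CS [:: (1, (g * x)%g); (-1, x)] [:: (1, y)] (schoenberg_psd t0).
rewrite /quad !big_cons !big_nil /= !addr0 !schoenberg_diag.
have [kC _] := schoenberg_psd t0; rewrite (kC x (g * x)%g).
set A := schoenberg t (g * x)%g y; set B := schoenberg t x y; set D := schoenberg t (g * x)%g x.
rewrite !mulr1 !mul1r !mulN1r opprK => CS.
have D1 : 1 - D <= t * sqdist (x^-1 * (g * x))%g 1%g.
  rewrite -(sqdist_inv x) mulVKg mulg1; exact: schoenberg_le.
rewrite -(ltr_pXn2r (n := 2))// ?nnegrE ?(ltW e0)// real_normK ?num_real//.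
apply: (le_lt_trans CS); apply: (@le_lt_trans _ _ (2 * t * sqdist (x^-1 * (g * x))%g 1%g)).
  have -> : 1 - D + (- D + 1) = 2 * (1 - D) by ring.
  by rewrite -mulrA ler_pM2l.
apply: (@le_lt_trans _ _ ((2 * t + 1) * sqdist (x^-1 * (g * x))%g 1%g)).
  by rewrite ler_wpM2r ?sqdist_ge0// lerDl.
by rewrite mulrC -ltr_pdivlMr// ltr_wpDl// mulr_ge0.
Qed.

(* [exp(-t psi) = 1 - t psi + O(t^2)], so that the energy of the kernel
   [exp(-t psi)] on combinations of total mass 0 is [2 t] times that of [b],
   up to [O(t^2)]. *)
Lemma schoenberg_expansion (v : seq (R * G)) : \sum_(a <- v) a.1 = 0 ->
  exists2 c : R, 0 <= c & forall t, 0 < t ->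
    2 * quad b v v <= quad (schoenberg t) v v / t + t * c.
Proof.
move=> v0; exists (\sum_(a <- v) \sum_(a' <- v) `|a.1 * a'.1| * sqdist a.2 a'.2 ^+ 2).
  by apply: sumr_ge0 => a _; apply: sumr_ge0 => a' _; rewrite mulr_ge0// sqr_ge0.
move=> t t0.
have row (F : R * G -> R) : \sum_(a <- v) \sum_(a' <- v) a.1 * a'.1 * F a' = 0.
  rewrite (eq_bigr (fun a => a.1 * \sum_(a' <- v) a'.1 * F a')).
    by rewrite -mulr_suml v0 mul0r.
  by move=> a _; rewrite mulr_sumr; apply: eq_bigr => a' _; rewrite mulrA.
(* Total mass 0 annihilates the terms that depend on one of the two points only; the same reason
   makes the subtraction of 1 in [e2] free. *)
have e1 : 2 * quad b v v = - quad sqdist v v.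
  have col (F : R * G -> R) : \sum_(a <- v) \sum_(a' <- v) a.1 * a'.1 * F a = 0.
    rewrite exchange_big -[RHS](row F) /=; apply: eq_bigr => a _; apply: eq_bigr => a' _.
    by rewrite (mulrC a.1).
  have -> : quad sqdist v v = \sum_(a <- v) \sum_(a' <- v) a.1 * a'.1 * b a.2 a.2 +
      (\sum_(a <- v) \sum_(a' <- v) a.1 * a'.1 * b a'.2 a'.2 - 2 * quad b v v).
    rewrite /quad mulr_sumr -sumrB -big_split; apply: eq_bigr => a _ /=.
    rewrite mulr_sumr -sumrB -big_split; apply: eq_bigr => a' _ /=.
    by rewrite /sqdist; ring.
  by rewrite (col (fun a => b a.2 a.2)) (row (fun a => b a.2 a.2)) !add0r opprK.
have e2 : - quad sqdist v v - quad (schoenberg t) v v / t =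
    \sum_(a <- v) \sum_(a' <- v) a.1 * a'.1 * (- sqdist a.2 a'.2 - (schoenberg t a.2 a'.2 - 1) / t).
  rewrite -[RHS]/(quad (fun x y => - sqdist x y - (schoenberg t x y - 1) / t) v v).
  have -> : (fun x y => - sqdist x y - (schoenberg t x y - 1) / t) =
      (fun x y => (-1) * sqdist x y + (- t^-1) * schoenberg t x y - - t^-1).
    by apply/funext => x; apply/funext => y; field; rewrite gt_eqF.
  rewrite quad_sub_const v0 expr0n mulr0 subr0 quad_comb.
  by field; rewrite gt_eqF.
rewrite e1 -lerBlDl e2 mulr_sumr; apply: ler_sum => a _; rewrite mulr_sumr; apply: ler_sum => a' _.
apply: le_trans (ler_norm _) _; rewrite normrM mulrCA ler_wpM2l//.
set p := sqdist _ _; have p0 : 0 <= p by exact: sqdist_ge0.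
have tp : 0 <= t * p by rewrite mulr_ge0// ltW.
(* Both bounds come from [1 + u <= exp u], at [u = - t p] and, after inversion, at [u = t p]. *)
have lo : 1 - t * p <= schoenberg t a.2 a'.2.
  by rewrite lerBlDr -lerBlDl; exact: schoenberg_le.
have hi : schoenberg t a.2 a'.2 <= (1 + t * p)^-1.
  rewrite /schoenberg -/p mulNr expRN lef_pV2 ?posrE ?expR_gt0//; first exact: expR_ge1Dx.
  by rewrite ltr_wpDr.
rewrite ler_norml; apply/andP; split.
  apply: (@le_trans _ _ (- p - ((1 + t * p)^-1 - 1) / t)); last first.
    by rewrite lerD2l lerN2 ler_pM2r ?invr_gt0// lerD2r.
  have q0 : 0 < 1 + t * p by rewrite ltr_wpDr.
  rewrite -subr_ge0 opprK.
  have -> : - p - ((1 + t * p)^-1 - 1) / t + t * p ^+ 2 = t * p ^+ 2 * (t * p / (1 + t * p)).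
    by field; rewrite !gt_eqF.
  by rewrite !mulr_ge0 ?sqr_ge0 ?invr_ge0// ltW.
apply: (@le_trans _ _ 0); last by rewrite mulr_ge0 ?sqr_ge0// ltW.
by rewrite subr_le0 ler_pdivlMr// lerBrDr mulNr addrC mulrC.
Qed.

End SchoenbergKernel.

(** The signed measure [g nu - nu]. Its total mass is 0, so constants subtracted from a kernel do
    not change its energy. *)
Definition displacement (R : realType) (G : topologicalGroupType) (nu : seq (R * G)) (g : G) :=
  [seq (a.1, (g * a.2)%g) | a <- nu] ++ [seq (- a.1, a.2) | a <- nu].

(** * Weights of small displacement, obtained from property (T) *)

Section AveragingWeights.
Variables (R : realType) (G : topologicalGroupType).
Variable mu : {measure set (borel G) -> \bar R}.
Hypothesis hausG : hausdorff_space G.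
Hypothesis haar_mu : left_haar mu.
Let finmu := haar_compact haar_mu.
Local Notation C := (scalar_field R ComplexScalars).
Local Notation Rsupported f A := (@supported R RealScalars G (R^o) f A).
Local Notation vol A := (fine (mu A)).

Lemma real_convolution s (f h : G -> R) A : Rsupported f A -> continuous h ->
  (fun x => of_real s (@convolution R G RealScalars mu f h x)) =
  @convolution R G s mu (fun x => of_real s (f x)) (fun x => of_real s (h x)).
Proof.
move=> [cf cA fA] ch; apply/funext => x.
have sx : Rsupported (fun y => f y * h (y^-1 * x)%g) A.
  split => //; last by move=> y /fA ->; rewrite mul0r.
  move=> y; apply: (@cvgM R); first exact: cf.
  apply: (@cvg_comp _ _ _ (fun y => y^-1 * x)%g h); last exact: ch.
  by apply: mulg_cvg; [apply: invg_cvg; exact: cvg_id|exact: cvg_cst].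
rewrite -[LHS]/(of_real s (Rint mu (fun y => f y * h (y^-1 * x)%g))) -(haar_of_real s hausG haar_mu sx).
by congr haar_integral; apply/funext => y; rewrite of_realM.
Qed.

(** The convolution power with exponent [n+1], so that exponent 1 is [n = 0] and no unit for
    convolution is involved. *)
Definition conv_iter (f : G -> R) (n : nat) : G -> R :=
  iter n (@convolution R G RealScalars mu f) f.

Lemma conv_iterP (f : G -> R) A n : Rsupported f A -> Rint mu f = 1 ->
  exists B, [/\ Rsupported (conv_iter f n) B,
    (forall x, 0 <= f x) -> forall x, 0 <= conv_iter f n x,
    Rint mu (conv_iter f n) = 1 &
    forall s (E : completeNormedModType (scalar_field R s)) (pi : representation G E) y,
      rep_integral mu pi (fun x => of_real s (conv_iter f n x)) y =
      iter n.+1 (rep_integral mu pi (fun x => of_real s (f x))) y].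
Proof.
move=> sf f1; elim: n => [|n [B [sB p0 p1 pE]]]; first by exists A.
have sc := convolution_supported hausG haar_mu sf sB.
exists [set (x * y)%g | x in A & y in B]; split.
- exact: sc.
- move=> f0 x; have [cf cA fA] := sf; have [cB _ _] := sB.
  have sx : Rsupported (fun y => f y * conv_iter f n (y^-1 * x)%g) A.
    split => //; last by move=> y /fA ->; rewrite mul0r.
    move=> y; apply: (@cvgM R); first exact: cf.
    apply: (@cvg_comp _ _ _ (fun y => y^-1 * x)%g (conv_iter f n)); last exact: cB.
    by apply: mulg_cvg; [apply: invg_cvg; exact: cvg_id|exact: cvg_cst].
  have := @Rint_le R G mu hausG finmu (fun=> 0) _ A (@supported0 R G RealScalars (R^o) A cA) sx.
  rewrite {1}/Rint (@int0 R G mu hausG finmu RealScalars (R^o) (@rcompleteR R)); apply.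
  by move=> y; rewrite mulr_ge0// p0.
- rewrite -[LHS]/(haar_integral mu (@convolution R G RealScalars mu f (conv_iter f n))).
  rewrite (haar_convolution hausG haar_mu sf sB).
  by rewrite -[X in X * _]/(Rint mu f) -[X in _ * X]/(Rint mu (conv_iter f n)) f1 p1 mulr1.
- move=> s E pi y; have [cB _ _] := sB.
  rewrite [X in rep_integral mu pi X](real_convolution s sf cB).
  rewrite (rep_convolution hausG haar_mu pi y (of_real_supported s sf) (of_real_supported s sB)).
  by rewrite pE.
Qed.

Variables (Q : set G) (d : R).
Hypotheses (cQ : compact Q) (d0 : 0 < d).
Hypothesis hT : forall (H : completeNormedModType C) (pi : representation G H),
  unitary pi ->
  (exists x : H, forall q, Q q -> rnorm (pi q x - x) < d * rnorm x) ->
  exists2 x : H, x != 0 & invariants pi x.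
Hypothesis lcG : locally_compact [set: G].

Section Gap.
Variable k : G -> G -> R.
Hypothesis pk : psd k.
Hypothesis k_inv : forall g x y, k (g * x)%g (g * y)%g = k x y.
Hypothesis k_cont : forall x y (e : R), 0 < e ->
  nbhs (1%g : G) [set g | `|k (g * x)%g y - k x y| < e].
Hypothesis k_max : forall e : R, 0 < e -> ~ psd (fun x y => k x y - e).
Local Notation pi := (krep pk k_inv k_cont).

(** The contrapositive of property (T): maximality of the constant excludes invariant vectors, so no
    vector is moved little by all of [Q]. *)
Lemma kernel_gap (y : khilbert pk) : exists2 q, Q q & d * rnorm y <= rnorm (pi q y - y).
Proof.
apply: contrapT => h.
have [x x0 inv] : exists2 x : khilbert pk, x != 0 & invariants pi x.
  apply: hT; first exact: krep_unitary.
  exists y => q Qq; rewrite ltNge; apply/negP => hq; apply: h.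
  by exists q.
by move: x0; rewrite (krep_no_invariants k_max inv) eqxx.
Qed.

Definition kcomb (v : seq (R * G)) : khilbert pk :=
  \sum_(a <- v) of_real ComplexScalars a.1 *: pi a.2 (kvec pk [:: (1, 1%g)]).

Lemma kcombE v : kcomb v = kvec pk [seq (a.1%:C%C, a.2) | a <- v].
Proof.
elim: v => [|a v IH].
  rewrite /kcomb big_nil; apply: wspace_eq => t.
  have z : sesq k t [::] = 0 by rewrite /sesq big1// => b _; rewrite big_nil.
  exact/esym/z.
have rC (r : R) : Num.conj (r%:C%C : R[i]) = r%:C%C.
  by apply/eqP; rewrite eq_complex /= oppr0 !eqxx.
have e : of_real ComplexScalars a.1 *: pi a.2 (kvec pk [:: (1, 1%g)]) = kvec pk [:: (a.1%:C%C, a.2)].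
  have -> : [:: ((a.1)%:C%C, a.2)] = cscale (a.1)%:C%C (ctrans a.2 [:: (1, 1%g)]) :> seq (R[i] * G).
    by rewrite /cscale /ctrans /= mulr1 mulg1.
  by rewrite kvec_scale rC -(ktrans_kvec pk k_inv).
rewrite /kcomb big_cons -/(kcomb v) IH e.
exact/esym/(kvec_cat pk [:: _]).
Qed.

Lemma rnorm_kcomb v : rnorm (kcomb v) ^+ 2 = quad k v v.
Proof. by rewrite kcombE rnorm_kvec lweight_real. Qed.

End Gap.

(* Riemann sums of a high convolution power of a bump: the convolution power
   nearly annihilates vectors in representations without invariant vectors, and
   the modulus of continuity [eta] on [W] makes the Riemann sums accurate. *)
Lemma averaging_weights (kap M : R) : 0 < kap -> 0 <= M ->
  exists2 eta : R, 0 < eta & forall W : set G, nbhs (1%g : G) W ->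
  exists nu : seq (R * G), \sum_(a <- nu) a.1 = 1 /\
  forall b : G -> G -> R, psd b ->
    (forall g x y, sqdist b (g * x)%g (g * y)%g = sqdist b x y) ->
    (forall e : R, 0 < e -> nbhs (1%g : G) [set g | sqdist b g 1%g < e]) ->
    (forall q, Q q -> sqdist b q 1%g <= M ^+ 2) ->
    (forall w, W w -> sqdist b w 1%g <= eta ^+ 2) ->
    forall g, quad b (displacement nu g) (displacement nu g) <= 16 * kap ^+ 2.
Proof.
move=> kap0 M0.
have [f0 [A0 [sf0 f0_ge0 f01 If0]]] := normalized_bump hausG lcG haar_mu.
have [f1 [A1 [a [sf1 f1_ge0 If1 a0 [dom domQ]]]]] := dominating_bump hausG haar_mu cQ sf0 f0_ge0 f01.
(* [th] is the contraction factor of [averaging_contracts]. It depends on [Q], [d] and the two bumps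
   only, not on the kernel, so one power [m] serves all kernels. *)
pose c := (d^-1 + 1) * a; pose th := Num.sqrt (c ^+ 2 / (1 + c ^+ 2)).
have c1 : 0 < 1 + c ^+ 2 by rewrite ltr_wpDr// sqr_ge0.
have th0 : 0 <= th by exact: sqrtr_ge0.
have th1 : th < 1.
  rewrite -sqrtr1 ltr_sqrt// ltr_pdivrMr// mul1r ltrDr//.
have [m hm] : exists m, th ^+ m.+1 * (M / d) <= kap / 2.
  have Md : 0 < M / d + 1 by rewrite ltr_wpDl// divr_ge0// ltW.
  have thn : `|th| < 1 by rewrite ger0_norm.
  have k2 : 0 < kap / 2 / (M / d + 1) by rewrite !divr_gt0.
  have /cvgrPdist_lt/(_ _ k2)[N _ hN] := cvg_expr thn; exists N.
  have := hN N.+1 (leqnSn N); rewrite /= sub0r normrN ger0_norm ?exprn_ge0// ltr_pdivlMr// => /ltW.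
  by apply: le_trans; rewrite ler_wpM2l ?exprn_ge0// lerDl.
have [A [sh /(_ f1_ge0) h_ge0 Ih hE]] := conv_iterP m sf1 If1.
set h := conv_iter f1 m in sh h_ge0 Ih hE; have [ch cA hA] := sh.
have [cB cB0 hcB] := supported_bounded sh.
have {}hcB x : h x <= cB by have := hcB x; rewrite /rnorm /= ger0_norm.
pose V := vol A; have V0 : 0 <= V by exact: fine_ge0.
have V1 : 0 < V + 1 by rewrite ltr_wpDl.
have Md0 : 0 <= M / d by rewrite divr_ge0// ltW.
(* The Riemann sum errs through the variation of the orbit, controlled by [eta2], and through that
   of [h], controlled by [eta1]; each is allowed [kap / 4], and the convolution power itself the
   remaining [kap / 2]. *)
pose eta2 := kap / (4 * (V + 1) * (cB + 1)).
have eta20 : 0 < eta2 by rewrite divr_gt0// !mulr_gt0// ltr_wpDl.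
(* The second term of the minimum keeps the total mass [N] of the Riemann sum at least 1/2, so that
   dividing by it costs at most a factor 2. *)
pose eta1 := Num.min (kap / (4 * (V + 1) * (M / d + 1))) ((2 * (V + 1))^-1).
have eta10 : 0 < eta1.
  by rewrite lt_min divr_gt0//= ?invr_gt0 !mulr_gt0// ltr_wpDl.
exists eta2 => // W W1.
have [x _|P [tP hP]] := exists_tagged_partition hausG
    (N := fun x => [set y | W (x^-1 * y)%g] `&` [set y | `|h x - h y| < eta1]) cA.
  apply: filterI; first exact: nbhs_lmulg.
  by have /cvgrPdist_lt/(_ _ eta10) := ch x.
pose nu0 : seq (R * G) := [seq (vol p.1 * h p.2, p.2) | p <- P].
pose N := \sum_(p <- nu0) p.1.
have N12 : 2^-1 <= N.
  have := riemann_close hausG finmu (@rcompleteR R) sh (ltW eta10) tP.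
  rewrite -[X in rnorm (X - _)]/(Rint mu h) Ih.
  have -> : @riemann R RealScalars G mu (R^o) P h = N.
    by rewrite /N /nu0 big_map.
  move=> hh; have := hh _; rewrite {1}/rnorm /= => {}hh.
  have /(le_trans (ler_norm _)) : `|1 - N| <= eta1 * V.
    apply: hh => p pP x px; have [_ /= /ltW] := hP p pP x px.
    by rewrite /rnorm /= distrC.
  have : eta1 * V <= 2^-1.
    apply: (@le_trans _ _ ((2 * (V + 1))^-1 * (V + 1))).
      by rewrite ler_pM// ?(ltW eta10)// ?ge_min ?lexx ?orbT// lerDl.
    by rewrite invfM mulfVK// gt_eqF.
  move=> le1 le2; have := le_trans le2 le1; have half : 2^-1 + 2^-1 = 1 :> R by field.
  by rewrite lerBlDr -{1}half lerD2l.
have Npos : 0 < N by apply: lt_le_trans N12; rewrite invr_gt0.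
exists [seq (N^-1 * p.1, p.2) | p <- nu0]; split.
  by rewrite big_map -mulr_sumr -/N mulVf// gt_eqF.
move=> b pb binv bcont bQ bW g.
set v := displacement _ g.
have v0 : \sum_(p <- v) p.1 = 0.
  rewrite /v /displacement big_cat !big_map /= -big_split /= big1// => p _.
  by rewrite addrN.
have [cst cst0 hcst] := schoenberg_expansion pb v0.
(* By the expansion it is enough to bound the energy of [schoenberg b t] by [16 kap^2 * 2 t] for
   each [t > 0]: the error term is a multiple of [t] and disappears in the limit. *)
rewrite -subr_le0; apply: (@le0_eps _ _ (cst / 2)); first by rewrite divr_ge0.
move=> t t0; have t_ge0 := ltW t0; rewrite lerBlDr -(ler_pM2l (x := 2))//.
apply: le_trans (hcst t t0) _.
rewrite addrC mulrDr; have -> : 2 * (t * (cst / 2)) = t * cst by field.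
rewrite lerD2l ler_pdivrMr//.
pose kt := schoenberg b t.
have pkt : psd kt by exact: schoenberg_psd.
have [ct pk kmax] := psd_maximal_constant 1%g pkt.
pose k x y := kt x y - ct.
have k_inv g' x y : k (g' * x)%g (g' * y)%g = k x y by rewrite /k /kt schoenberg_inv.
have k_cont x y (e : R) : 0 < e -> nbhs (1%g : G) [set g | `|k (g * x)%g y - k x y| < e].
  move=> e0; have := schoenberg_cont pb binv bcont x y t_ge0 e0.
  by apply: filterS => g' /=; rewrite /k opprB addrA subrK.
pose pi := krep pk k_inv k_cont.
pose y := kvec pk [:: (1, 1%g)].
have gap := @kernel_gap k pk k_inv k_cont kmax.
(* All norms below carry the factor [r], whose square [2 t] cancels against the [t] of the
   expansion. *)
pose r := Num.sqrt (2 * t).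
have r0 : 0 <= r by exact: sqrtr_ge0.
have r2 : r ^+ 2 = 2 * t by rewrite sqr_sqrtr// mulr_ge0.
have comb := rnorm_kcomb pk k_inv k_cont.
have dist g1 g2 (e : R) : 0 <= e -> sqdist b g1 g2 <= e ^+ 2 -> rnorm (pi g1 y - pi g2 y) <= r * e.
  move=> e0 he; rewrite -(ler_pXn2r (n := 2))// ?nnegrE ?mulr_ge0 ?rnorm_ge0//.
  have -> : pi g1 y - pi g2 y = kcomb pk k_inv k_cont [:: (1, g1); (-1, g2)].
    by rewrite /kcomb !big_cons big_nil addr0 of_realN of_real1 scale1r scaleN1r.
  rewrite comb quad_sub_const !big_cons big_nil /= addr0 subrr expr0n mulr0 subr0.
  rewrite /quad !big_cons !big_nil /= !addr0 /kt !schoenberg_diag.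
  have [kC _] := pkt; rewrite -/(kt g1 g2) -/(kt g2 g1) (kC g2 g1).
  have := schoenberg_le b t g1 g2; rewrite -/(kt g1 g2) => h1.
  have : t * sqdist b g1 g2 <= t * e ^+ 2 by rewrite ler_pM2l.
  rewrite exprMn r2; move: h1; clear; move: (kt g1 g2) (sqdist b g1 g2) => u w h1 h2.
  have -> : 1 * 1 * 1 + 1 * -1 * u + (-1 * 1 * u + -1 * -1 * 1) = 2 * (1 - u) by ring.
  by rewrite -mulrA ler_pM2l//; apply: le_trans h2.
(* The vector of the identity has norm 1 for [kt], but for [k] it is moved by at most [r * M] on
   [Q], so the gap forces its norm below [r * (M / d)]. *)
have ynorm : rnorm y <= r * (M / d).
  have [q Qq hq] := gap y; rewrite mulrA ler_pdivlMr// mulrC.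
  apply: le_trans hq _; have := dist q 1%g M M0 (bQ q Qq).
  by rewrite /pi rep1.
have iso g' x : rnorm (pi g' x) = rnorm x by exact: rnorm_ktrans.
have contract x : rnorm (rep_integral mu pi (fun x => of_real ComplexScalars (f1 x)) x) <= th * rnorm x.
  have := @averaging_contracts R G mu hausG haar_mu ComplexScalars (khilbert pk) pi (@khilbert_para _ _ _ pk) iso
    f1 A1 sf1 f1_ge0 If1 f0 A0 Q a d sf0 f0_ge0 If0 a0 d0 dom domQ gap x.
  rewrite -/c => hc.
  rewrite -(ler_pXn2r (n := 2))// ?nnegrE ?mulr_ge0 ?rnorm_ge0//.
  rewrite exprMn /th sqr_sqrtr ?divr_ge0 ?sqr_ge0 ?(ltW c1)//.
  by rewrite mulrAC ler_pdivlMr// mulrC.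
have contract_iter n x : rnorm (iter n (rep_integral mu pi (fun x => of_real ComplexScalars (f1 x))) x) <= th ^+ n * rnorm x.
  elim: n => [|n IH]; first by rewrite mul1r.
  rewrite iterS; apply: le_trans (contract _) _.
  by rewrite exprS -mulrA ler_wpM2l.
pose z := rep_integral mu pi (fun x => of_real ComplexScalars (h x)) y.
have znorm : rnorm z <= r * (kap / 2).
  rewrite /z hE; apply: le_trans (contract_iter _ _) _.
  apply: le_trans (ler_wpM2l (exprn_ge0 _ th0) ynorm) _.
  by rewrite mulrCA ler_wpM2l.
pose F x := of_real ComplexScalars (h x) *: pi x y.
have sF : supported F A by apply: rep_supported; exact: of_real_supported.
have Fosc p : p \in P -> forall x, p.1 x -> rnorm (F x - F p.2) <= eta1 * (r * (M / d)) + cB * (r * eta2).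
  move=> pP x px; have [Wx /ltW hx] := hP p pP x px.
  have {}hx : `|h p.2 - h x| <= eta1 by exact: hx.
  have -> : F x - F p.2 = of_real ComplexScalars (h x - h p.2) *: pi x y + of_real ComplexScalars (h p.2) *: (pi x y - pi p.2 y).
    by rewrite /F of_realB scalerBl scalerBr addrA subrK.
  apply: le_trans (rnormD _ _) _; rewrite !rnormZr iso lerD//.
    by rewrite ler_pM ?rnorm_ge0// distrC.
  rewrite ger0_norm// ler_pM ?rnorm_ge0//; apply: dist; first exact: ltW.
  rewrite -(binv (p.2^-1)%g) mulVg; apply: bW; exact: Wx.
have e_ge0 : 0 <= eta1 * (r * (M / d)) + cB * (r * eta2).
  have e10 := ltW eta10; have e20 := ltW eta20.
  by apply: addr_ge0; apply: mulr_ge0 => //; exact: mulr_ge0.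
have cH := @completeNormedMod_rcomplete R ComplexScalars (khilbert pk).
have zc := riemann_close hausG finmu cH sF e_ge0 tP Fosc.
have RE : riemann mu P F = kcomb pk k_inv k_cont nu0.
  rewrite /riemann /kcomb /nu0 big_map; apply: eq_bigr => p _.
  by rewrite /F scalerA -of_realM.
rewrite RE -/V -[X in rnorm (X - _)]/z in zc.
have nu0norm : rnorm (kcomb pk k_inv k_cont nu0) <= r * kap.
  rewrite -[kcomb _ _ _ nu0](subKr z); apply: le_trans (rnormB _ _) _.
  apply: le_trans (lerD znorm zc) _.
  have e1V : eta1 * (M / d) * V <= kap / 4.
    apply: (@le_trans _ _ (kap / (4 * (V + 1) * (M / d + 1)) * (M / d + 1) * (V + 1))).
      apply: ler_pM => //; [by rewrite mulr_ge0// ltW| |by rewrite lerDl].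
      by apply: ler_pM => //; [exact: ltW|by rewrite ge_min lexx|rewrite lerDl].
    rewrite le_eqVlt; apply/orP; left; apply/eqP.
    by field; rewrite !gt_eqF// ltr_wpDl// mulr_ge0.
  have e2V : cB * eta2 * V <= kap / 4.
    apply: (@le_trans _ _ ((cB + 1) * eta2 * (V + 1))).
      apply: ler_pM => //; [by rewrite mulr_ge0// ltW| |by rewrite lerDl].
      by apply: ler_pM => //; [exact: ltW|rewrite lerDl].
    rewrite le_eqVlt; apply/orP; left; apply/eqP; rewrite /eta2.
    by field; rewrite !gt_eqF// ltr_wpDl.
  have -> : r * (kap / 2) + (eta1 * (r * (M / d)) + cB * (r * eta2)) * V =
      r * (kap / 2 + (eta1 * (M / d) * V + cB * eta2 * V)) by ring.
  rewrite ler_wpM2l//; have -> : kap = kap / 2 + (kap / 4 + kap / 4) by field.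
  by rewrite {1}(_ : (kap / 2 + (kap / 4 + kap / 4)) / 2 = kap / 2) ?lerD2l ?lerD//; field.
(* The displacement has total mass 0, so it does not see the constant [ct] that separates [k] from
   [kt]. *)
have qv : quad kt v v = rnorm (kcomb pk k_inv k_cont v) ^+ 2.
  by rewrite comb quad_sub_const v0 expr0n mulr0 subr0.
have vE : kcomb pk k_inv k_cont v = of_real ComplexScalars N^-1 *: (pi g (kcomb pk k_inv k_cont nu0) - kcomb pk k_inv k_cont nu0).
  rewrite scalerBr /kcomb /v /displacement big_cat; congr (_ + _).
    rewrite linear_sum scaler_sumr !big_map; apply: eq_bigr => p _.
    by rewrite [in RHS]linearZ [RHS]scalerA -[in RHS]of_realM -[in RHS]repM.
  rewrite -scalerN -sumrN scaler_sumr !big_map; apply: eq_bigr => p _.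
  by rewrite [RHS]scalerN [in RHS]scalerA -[in RHS]of_realM -[RHS]scaleNr -[in RHS]of_realN.
rewrite -/kt qv vE rnormZr ger0_norm; last by rewrite invr_ge0 ltW.
have b1 : rnorm (pi g (kcomb pk k_inv k_cont nu0) - kcomb pk k_inv k_cont nu0) <= 2 * (r * kap).
  apply: le_trans (rnormB _ _) _; rewrite iso.
  by rewrite mulr2n mulrDl mul1r lerD.
have Ninv : N^-1 <= 2 by rewrite -[2]invrK lef_pV2// posrE invr_gt0.
(* One factor 2 comes from dividing by [N], the other from the two terms of the displacement;
   [(4 r kap)^2] is [16 kap^2 * 2 t]. *)
apply: (@le_trans _ _ ((2 * (2 * (r * kap))) ^+ 2)).
  rewrite ler_pXn2r// ?nnegrE ?mulr_ge0 ?invr_ge0 ?rnorm_ge0 ?(ltW kap0) ?(ltW Npos)//.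
  by apply: ler_pM => //; rewrite ?invr_ge0 ?rnorm_ge0// ltW.
rewrite le_eqVlt; apply/orP; left; apply/eqP.
by rewrite !exprMn r2; ring.
Qed.

End AveragingWeights.

(** * Ultralimits of almost Hilbert spaces *)

Section UltraLimit.
Variables (R : realType) (U : set_system nat) (UU : UltraFilter U).
Hypothesis Uoo : \oo `<=` U.

Definition ulim (f : nat -> R) : R := lim (f @ U).

(** The image of an ultrafilter is an ultrafilter, and an ultrafilter that contains a compact
    interval converges. *)
Lemma ulim_cvg (f : nat -> R) c : (forall n, `|f n| <= c) -> f @ U --> ulim f.
Proof.
move=> fc; have Uf : UltraFilter (f @ U).
  split; first exact: fmap_proper_filter.
  move=> F FF UF; rewrite predeqE => A; split; last exact: UF.
  move=> FA; have [//|FnA] := in_ultra_setVsetC (f @^-1` A) UU.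
  by have [x [Ax nAx]] := filter_ex (filterI FA (UF (~` A) FnA)).
have cpt : compact `[(- c), c]%classic by exact: segment_compact.
have FA : (f @ U) `[(- c), c]%classic.
  apply: (@filterS _ U _ setT); last exact: filterT.
  by move=> n _ /=; rewrite in_itv/= -ler_norml.
rewrite compact_ultra in cpt; have [l [_ fl]] := cpt _ Uf FA.
by apply/cvg_ex; exists l.
Qed.

Lemma cvg_oo_U (f : nat -> R) (l : R) : f @ \oo --> l -> f @ U --> l.
Proof. by move=> fl A lA; apply: Uoo; exact: fl. Qed.

Lemma ulim_unique (f : nat -> R) (l : R) : f @ U --> l -> ulim f = l.
Proof. by move=> fl; apply: cvg_lim => //; exact: Rhausdorff. Qed.

Lemma ulim_le (f g : nat -> R) (l m : R) : f @ U --> l -> g @ U --> m ->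
  (forall n, f n <= g n) -> l <= m.
Proof.
move=> fl gm fg.
by apply: (ler_cvg_to fl gm); apply: (@filterS _ U _ setT) => //; exact: filterT.
Qed.

End UltraLimit.

Section LimitKernel.
Variables (R : realType) (s : scalars) (G : topologicalGroupType).
Local Notation K := (scalar_field R s).
Local Notation r2k := (@of_real R s).
Variables (E : nat -> completeNormedModType K) (u : forall n, G -> E n).
Hypothesis para : forall n, almost_parallelogram (n.+1%:R^-1) (E n).
Hypothesis bounded : forall x, exists c : R, forall n, rnorm (u n x) <= c.
Variables (U : set_system nat) (UU : UltraFilter U).
Hypothesis Uoo : \oo `<=` U.
Local Notation lim_ f := (ulim U f).

Let comb n (t : seq (R * G)) : E n := \sum_(a <- t) r2k a.1 *: u n a.2.
Let q (t : seq (R * G)) : R := lim_ (fun n => rnorm (comb n t) ^+ 2).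

Let comb_bounded t : exists2 c : R, 0 <= c & forall n, rnorm (comb n t) <= c.
Proof.
elim: t => [|[a x] t [c c0 hc]].
  by exists 0 => // n; rewrite /comb big_nil rnorm0.
have [d hd] := bounded x; exists (`|a| * `|d| + c); first by rewrite addr_ge0// mulr_ge0.
move=> n; rewrite /comb big_cons; apply: le_trans (rnormD _ _) _; rewrite lerD//.
by rewrite rnormZr ler_wpM2l//; apply: le_trans (hd n) _; exact: ler_norm.
Qed.

Let q_cvg t : (fun n => rnorm (comb n t) ^+ 2) @ U --> q t.
Proof.
have [c c0 hc] := comb_bounded t; apply: (@ulim_cvg _ _ _ _ (c ^+ 2)) => n.
by rewrite ger0_norm ?sqr_ge0// ler_pXn2r// ?nnegrE ?rnorm_ge0.
Qed.

Let q_ge0 t : 0 <= q t.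
Proof.
by apply: (ulim_le UU (cvg_cst (0 : R)) (@q_cvg t)) => n; exact: sqr_ge0.
Qed.

Let small : (fun n : nat => (n.+1%:R^-1 : R)) @ U --> 0.
Proof. by apply: (cvg_oo_U Uoo); exact: cvg_harmonic. Qed.

(* The limit of the squared norms satisfies the parallelogram law exactly, so by
   Jordan-von Neumann it is a quadratic form on combinations of points. *)
Definition limit_kernel (x y : G) : R :=
  (q [:: (1, x)] + q [:: (1, y)] - q [:: (1, x); (-1, y)]) / 2.

Section FinitePoints.
Variables (N : nat) (x : 'I_N -> G).

Let combV n (c : 'rV[R]_N) : E n := \sum_i r2k (c 0 i) *: u n (x i).
Let lst (c : 'rV[R]_N) : seq (R * G) := [seq (c 0 i, x i) | i <- enum 'I_N].
Let combVE n c : combV n c = comb n (lst c).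
Proof. by rewrite /comb /lst big_map big_enum. Qed.
Let qV (c : 'rV[R]_N) : R := q (lst c).
Let qV_cvg c : (fun n => rnorm (combV n c) ^+ 2) @ U --> qV c.
Proof. by have := @q_cvg (lst c); under eq_fun do rewrite -combVE. Qed.

Let combVD n c d : combV n (c + d) = combV n c + combV n d.
Proof. by rewrite /combV -big_split; apply: eq_bigr => i _; rewrite mxE of_realD scalerDl. Qed.

Let combVZ n (a : R) c : combV n (a *: c) = r2k a *: combV n c.
Proof. by rewrite /combV scaler_sumr; apply: eq_bigr => i _; rewrite mxE of_realM scalerA. Qed.

Let combVB n c d : combV n (c - d) = combV n c - combV n d.
Proof. by rewrite combVD -scaleN1r combVZ of_realN of_real1 scaleN1r. Qed.

Let qV_hom (a : R) c : qV (a *: c) = a ^+ 2 * qV c.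
Proof.
apply: ulim_unique => //; under eq_fun do rewrite -combVE combVZ rnormZr exprMn real_normK ?num_real//.
by apply: cvgM; [exact: cvg_cst|exact: qV_cvg].
Qed.

Let qV_le c d : qV (c + d) + qV (c - d) <= 2 * (qV c + qV d).
Proof.
have h1 : (fun n => 2^-1 * (rnorm (combV n (c + d)) ^+ 2 + rnorm (combV n (c - d)) ^+ 2)) @ U -->
    2^-1 * (qV (c + d) + qV (c - d)).
  by apply: cvgM; [exact: cvg_cst|apply: cvgD; exact: qV_cvg].
have h2 : (fun n => (1 + n.+1%:R^-1) * (rnorm (combV n c) ^+ 2 + rnorm (combV n d) ^+ 2)) @ U -->
    (1 + 0) * (qV c + qV d).
  apply: cvgM; first by apply: cvgD; [exact: cvg_cst|exact: small].
  by apply: cvgD; exact: qV_cvg.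
have := ulim_le UU h1 h2; rewrite addr0 mul1r => h.
rewrite -ler_pdivrMl//; apply: h => n.
by rewrite combVD combVB; exact: para.
Qed.

(** One inequality in the parallelogram law implies the other, by substituting [c + d] and
    [c - d]. *)
Let qV_para c d : qV (c + d) + qV (c - d) = 2 * (qV c + qV d).
Proof.
apply: le_anti; rewrite qV_le/=; have := qV_le (c + d) (c - d).
have -> : c + d + (c - d) = 2 *: c by rewrite addrACA subrr addr0 scaler_nat mulr2n.
have -> : c + d - (c - d) = 2 *: d by rewrite opprB addrC addrA subrK scaler_nat mulr2n.
rewrite !qV_hom.
have -> : 2 ^+ 2 * qV c + 2 ^+ 2 * qV d = 2 * (2 * (qV c + qV d)) :> R by ring.
by rewrite ler_pM2l.
Qed.

Let ei (i : 'I_N) : 'rV[R]_N := delta_mx 0 i.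

Let combV_ei n i : combV n (ei i) = u n (x i).
Proof.
rewrite /combV (bigD1 i)//= big1 ?addr0; last first.
  by move=> j ji; rewrite mxE eqxx (negbTE ji) of_real0 scale0r.
by rewrite mxE !eqxx of_real1 scale1r.
Qed.

Let qV_ei i : qV (ei i) = q [:: (1, x i)].
Proof.
apply: ulim_unique => //; under eq_fun do rewrite -combVE combV_ei.
have := @q_cvg [:: (1, x i)].
by under eq_fun do rewrite /comb big_seq1 of_real1 scale1r.
Qed.

Let qV_eij i j : qV (ei i - ei j) = q [:: (1, x i); (-1, x j)].
Proof.
apply: ulim_unique => //; under eq_fun do rewrite -combVE combVB !combV_ei.
have := @q_cvg [:: (1, x i); (-1, x j)].
by under eq_fun do rewrite /comb !big_cons big_nil addr0 of_realN of_real1 scale1r scaleN1r.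
Qed.

Let qV_ge0 c : 0 <= qV c. Proof. exact: q_ge0. Qed.

(** Lists of weighted points do not form a vector space, so polarisation is carried out on row
    vectors of coefficients over finitely many points. The points may repeat, which lets any list be
    treated by indexing its entries. *)
Lemma limit_kernel_finite (c : 'rV[R]_N) :
  q [seq (c 0 i, x i) | i <- enum 'I_N] =
  \sum_i \sum_j c 0 i * c 0 j * limit_kernel (x i) (x j).
Proof.
pose V : lmodType (scalar_field R RealScalars) := 'rV[R]_N.
have hom (a : R) (v : V) : qV (of_real RealScalars a *: v) = a ^+ 2 * qV v by exact: qV_hom.
have kE i j : polar (qV : V -> R) (ei i) (ei j) = limit_kernel (x i) (x j).
  have := @polar_sub R RealScalars V qV qV_para (ei i) (ei j).
  rewrite qV_eij !qV_ei /limit_kernel => ->.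
  by field.
have cE : c = \sum_i of_real RealScalars (c 0 i) *: (ei i : V).
  by rewrite {1}(row_sum_delta c).
rewrite -[LHS]/(qV c) -(@polar_diag R RealScalars V qV hom qV_para).
rewrite {1 2}cE (@polar_suml R RealScalars V qV hom qV_para); apply: eq_bigr => i _.
rewrite (@polar_sumr R RealScalars V qV hom qV_para); apply: eq_bigr => j _.
rewrite (@polarZl R RealScalars V qV qV_ge0 hom qV_para) (@polarZr R RealScalars V qV qV_ge0 hom qV_para).
by rewrite mulrA kE.
Qed.

End FinitePoints.

Lemma quad_limit_kernel t : quad limit_kernel t t = q t.
Proof.
case: t => [|a0 t0]; first by rewrite /quad big_nil; apply/esym/ulim_unique => //;
  under eq_fun do rewrite /comb big_nil rnorm0 expr0n; exact: cvg_cst.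
set t := a0 :: t0.
pose x (i : 'I_(size t)) := (nth a0 t i).2.
pose c : 'rV[R]_(size t) := \row_i (nth a0 t i).1.
have := limit_kernel_finite x c.
have -> : [seq (c 0 i, x i) | i <- enum 'I_(size t)] = t.
  rewrite (eq_map (g := fun i : 'I_(size t) => nth a0 t i)); last first.
    by move=> i; rewrite mxE /x; case: (nth a0 t i).
  by rewrite (map_comp (nth a0 t) (val : 'I_(size t) -> nat)) val_enum_ord map_nth_iota0// take_size.
move=> ->; rewrite /quad (big_nth a0) big_mkord; apply: eq_bigr => i _.
rewrite (big_nth a0) big_mkord; apply: eq_bigr => j _.
by rewrite !mxE.
Qed.

Lemma limit_kernel_psd : psd limit_kernel.
Proof.
split=> [x y|t]; last by rewrite quad_limit_kernel.
rewrite /limit_kernel [q [:: (1, x)] + _]addrC; congr ((_ - _) / 2).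
apply: ulim_unique => //; have := @q_cvg [:: (1, y); (-1, x)].
under eq_fun => n.
  rewrite /comb !big_cons !big_nil addr0 of_realN of_real1 scale1r scaleN1r rnormBC.
  over.
by under [in X in _ -> X]eq_fun do rewrite /comb !big_cons !big_nil addr0 of_realN of_real1 scale1r scaleN1r.
Qed.

Lemma quad_limit_cvg t :
  (fun n => rnorm (\sum_(a <- t) r2k a.1 *: u n a.2) ^+ 2) @ U --> quad limit_kernel t t.
Proof. by rewrite quad_limit_kernel; exact: q_cvg. Qed.

Lemma sqdist_limit_cvg x y :
  (fun n => rnorm (u n x - u n y) ^+ 2) @ U --> sqdist limit_kernel x y.
Proof.
have -> : sqdist limit_kernel x y = quad limit_kernel [:: (1, x); (-1, y)] [:: (1, x); (-1, y)].
  rewrite /quad !big_cons !big_nil /= /sqdist; case: limit_kernel_psd => kC _.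
  by rewrite (kC y x); ring.
have := @quad_limit_cvg [:: (1, x); (-1, y)].
by under eq_fun do rewrite !big_cons big_nil addr0 of_realN of_real1 scale1r scaleN1r.
Qed.

End LimitKernel.

(** * Cocycles *)

Section GrowthClass.
Variables (R : realType) (s : scalars) (G : topologicalGroupType) (S : set G).
Local Notation K := (scalar_field R s).
Local Notation r2k := (@of_real R s).

Definition growth_class (e : R) : rep_class R G s :=
  reps_of_growth (@almost_parallelogram R s e) (fun g => e * (word_length S g)%:R).

Lemma growth_class_para e E (pi : representation G E) :
  growth_class e pi -> almost_parallelogram e E.
Proof.
move=> [[E' para [T [iso _]]] _] x y; have := para (T x) (T y).
by rewrite -linearD -linearB !iso.
Qed.

Lemma growth_class_le e E (pi : representation G E) g x : growth_class e pi ->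
  rnorm (pi g x) <= expR (e * (word_length S g)%:R) * rnorm x.
Proof.
move=> [_ /(_ g) h]; apply: (opnorm_leP (expR_ge0 _) _).1 h x => a y.
by rewrite linearZ.
Qed.

Lemma growth_class_intro e E (pi : representation G E) : almost_parallelogram e E ->
  (forall g x, rnorm (pi g x) <= expR (e * (word_length S g)%:R) * rnorm x) ->
  growth_class e pi.
Proof.
move=> para h; split.
  exists E => //; exists (idfun : {linear E -> E}); split => // y; by exists y.
move=> g; apply: (opnorm_leP (expR_ge0 _) _).2 (h g) => a y.
by rewrite linearZ.
Qed.

Lemma growth_class_mono e e' E (pi : representation G E) : e <= e' ->
  growth_class e pi -> growth_class e' pi.
Proof.
move=> ee h; apply: growth_class_intro => [x y|g x].
  apply: le_trans (growth_class_para h x y) _.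
  by rewrite ler_wpM2r ?addr_ge0 ?sqr_ge0// lerD2l.
apply: le_trans (growth_class_le g x h) _; rewrite ler_wpM2r ?rnorm_ge0//.
by rewrite ler_expR ler_wpM2r.
Qed.

Lemma growth_class_ball e E (pi : representation G E) n g x : 0 <= e -> e <= 1 ->
  growth_class e pi -> setpow S n g -> rnorm (pi g x) <= expR n%:R * rnorm x.
Proof.
move=> e0 e1 h gn; apply: le_trans (growth_class_le g x h) _.
rewrite ler_wpM2r ?rnorm_ge0// ler_expR.
apply: (@le_trans _ _ (1 * (word_length S g)%:R)); first by rewrite ler_wpM2r.
by rewrite mul1r ler_nat; exact: word_length_le.
Qed.

Definition unit_cocycle e E (pi : representation G E) (b : G -> E) :=
  [/\ growth_class e pi, cocycle pi b & forall x, S x -> rnorm (b x) <= 1].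

(** Bounds a unit cocycle on [setpow S n]: each further generator contributes at most 1 and
    stretches the rest by at most [expR 1], because [e <= 1]. *)
Fixpoint cocycle_bound (n : nat) : R :=
  if n is m.+1 then 1 + expR 1 * cocycle_bound m else 0.

Lemma cocycle_bound_ge0 n : 0 <= cocycle_bound n.
Proof.
by elim: n => // n IH; apply: addr_ge0 => //; apply: mulr_ge0 => //; exact: expR_ge0.
Qed.

Lemma cocycle1 (E : completeNormedModType K) (pi : representation G E) (b : G -> E) : cocycle pi b -> b 1%g = 0.
Proof.
move=> [_ bM]; have := bM 1%g 1%g; rewrite rep1 mulg1 => h.
by apply: (addIr (b 1%g)); rewrite add0r -h.
Qed.

Lemma cocycle_le e c (E : completeNormedModType K) (pi : representation G E) (b : G -> E) n g :
  0 <= e -> e <= 1 -> growth_class e pi -> cocycle pi b -> (forall x, S x -> rnorm (b x) <= c) ->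
  setpow S n g -> rnorm (b g) <= c * cocycle_bound n.
Proof.
move=> e0 e1 hpi hb hS; elim: n g => [|n IH] g.
  by move=> ->; rewrite (cocycle1 hb) rnorm0 mulr0.
move=> [x Sx [y Sy <-]]; have [_ bM] := hb; rewrite bM.
apply: le_trans (rnormD _ _) _; rewrite mulrDr mulr1 lerD ?hS//.
apply: le_trans (growth_class_ball (n := 1) _ e0 e1 hpi _) _; first exact/setpow1P.
by rewrite mulrCA ler_wpM2l ?expR_ge0// IH.
Qed.

Lemma unit_cocycle_le e (E : completeNormedModType K) (pi : representation G E) (b : G -> E) n g :
  0 <= e -> e <= 1 -> unit_cocycle e pi b -> setpow S n g -> rnorm (b g) <= cocycle_bound n.
Proof.
by move=> e0 e1 [hpi hb hS] gn; rewrite -[leRHS]mul1r; exact: cocycle_le hpi hb hS gn.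
Qed.

Hypothesis genS : compact_generating S.
Hypothesis hausG : hausdorff_space G.
Hypothesis lcG : locally_compact [set: G].
Variable mu : {measure set (borel G) -> \bar R}.
Hypothesis haar_mu : left_haar mu.
Let finmu := haar_compact haar_mu.
Local Notation int F := (bochner_integral mu F).
Local Notation vol A := (fine (mu A)).
Local Notation Rsupported f A := (@supported R RealScalars G (R^o) f A).

Variables (f0 : G -> R) (A0 : set G).
Hypotheses (sf0 : Rsupported f0 A0) (If0 : Rint mu f0 = 1).

(** By [smoothingE] this is the orbit, under the affine action, of the point [smoothing b 1]. Its
    continuity at 1 is inherited from the bump [f0] and hence uniform over all unit cocycles, which
    makes the limit kernel continuous. *)
Definition smoothing (E : normedModType K) (b : G -> E) (g : G) : E :=
  int (fun k => r2k (f0 k) *: b (g * k)%g).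

Section OneCocycle.
Variables (E : completeNormedModType K) (pi : representation G E) (b : G -> E).
Hypothesis hb : cocycle pi b.
Let cE := @completeNormedMod_rcomplete R s E.
Let cb : continuous b. Proof. by case: hb. Qed.
Let bM g h : b (g * h)%g = b g + pi g (b h). Proof. by case: hb => _; exact. Qed.

Lemma cocycle_translate g : continuous (fun k => b (g * k)%g).
Proof. by move=> x; apply: (@cvg_comp _ _ _ (fun k => (g * k)%g) b); [exact: lmulg_continuous|exact: cb]. Qed.

Lemma smoothing_supported g : supported (fun k => r2k (f0 k) *: b (g * k)%g) A0.
Proof. by apply: supported_lscale; [exact: of_real_supported|exact: cocycle_translate]. Qed.

Lemma smoothingE g : smoothing b g = b g + pi g (smoothing b 1%g).
Proof.
have s1 := smoothing_supported 1%g; have sK := of_real_supported s sf0.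
rewrite /smoothing (rep_int hausG haar_mu pi g s1).
have s2 : supported (fun k => r2k (f0 k) *: b g) A0.
  by apply: supported_lscale => // x; exact: cvg_cst.
have s3 : supported (fun k => pi g (r2k (f0 k) *: b (1 * k)%g)) A0.
  have [cs cA s1'] := s1; split => //; last by move=> k /s1' ->; rewrite linear0.
  move=> k; apply: (@cvg_comp _ _ _ (fun k => r2k (f0 k) *: b (1 * k)%g) (pi g)); [exact: cs|exact: rep_bounded].
have -> : b g = int (fun k => r2k (f0 k) *: b g).
  have := rep_integral_invariant hausG haar_mu (pi := trivial_rep G E) (x := b g) sK _.
  rewrite (haar_of_real s hausG haar_mu sf0) If0 of_real1 scale1r => h.
  by apply/esym/h => g'.
rewrite -(intD hausG finmu cE s2 s3); congr bochner_integral; apply/funext => k.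
by rewrite bM mul1g scalerDr linearZ.
Qed.

Lemma smoothing_mul g h : smoothing b (g * h)%g = b g + pi g (smoothing b h).
Proof. by rewrite smoothingE bM repM [smoothing b h]smoothingE linearD addrA. Qed.

Lemma smoothing_sub g h k :
  smoothing b (g * h)%g - smoothing b (g * k)%g = pi g (smoothing b h - smoothing b k).
Proof. by rewrite !smoothing_mul linearB opprD addrACA subrr add0r. Qed.

Variable nu : seq (R * G).
Hypothesis nu1 : \sum_(a <- nu) a.1 = 1.

Definition smoothing_average : E := \sum_(a <- nu) r2k a.1 *: smoothing b a.2.

(** Affine maps commute with combinations of total weight 1, so the action moves [smoothing_average]
    to the same combination of the translated orbit points. *)
Lemma displacement_smoothing g :
  b g + pi g smoothing_average - smoothing_average =
  \sum_(a <- displacement nu g) r2k a.1 *: smoothing b a.2.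
Proof.
rewrite /displacement big_cat !big_map; congr (_ + _); last first.
  by rewrite -sumrN; apply: eq_bigr => a _; rewrite of_realN scaleNr.
under [RHS]eq_bigr do rewrite smoothing_mul scalerDr -linearZ.
rewrite big_split -scaler_suml -linear_sum; congr (_ + _).
suff -> : \sum_(a <- nu) r2k a.1 = 1 by rewrite scale1r.
rewrite -(of_real1 R s) -nu1; elim: (nu) => [|a l IH]; first by rewrite !big_nil of_real0.
by rewrite !big_cons of_realD IH.
Qed.

End OneCocycle.

(** Combines the weights and the bump into a single compactly supported function, so that
    [smoothing_average] is the integral of the cocycle against it. *)
Definition mixture (nu : seq (R * G)) (x : G) : R := \sum_(a <- nu) a.1 * f0 (a.2^-1 * x)%g.

Lemma mixture_integral nu : exists A, [/\ Rsupported (mixture nu) A,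
  Rint mu (mixture nu) = \sum_(a <- nu) a.1 &
  forall (E : completeNormedModType K) (pi : representation G E) (b : G -> E), cocycle pi b ->
    int (fun k => r2k (mixture nu k) *: b k) = smoothing_average b nu].
Proof.
elim: nu => [|a l [A [sA iA bA]]].
  have m0 : mixture [::] = fun=> 0 by apply/funext => x; rewrite /mixture big_nil.
  exists set0; rewrite m0; split.
  - exact: (@supported0 R G RealScalars (R^o) set0 (@compact0 _)).
  - by rewrite big_nil; exact: (@int0 R G mu hausG finmu RealScalars (R^o) (@rcompleteR R)).
  - move=> E pi b hb; rewrite /smoothing_average big_nil.
    under eq_fun do rewrite of_real0 scale0r.
    exact: (int0 hausG finmu (@completeNormedMod_rcomplete R s E)).
have mE : mixture (a :: l) = fun x => a.1 * f0 (a.2^-1 * x)%g + mixture l x.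
  by apply/funext => x; rewrite /mixture big_cons.
have sa' := @supported_lmulg R G RealScalars (R^o) _ _ a.2 sf0.
have sa := @supportedZ R G RealScalars (R^o) a.1 _ _ sa'.
have [_ cA _] := sA; have [_ ca _] := sa.
have s1 := supportedU sa cA; have s2 := supportedUr sA ca.
exists ([set (a.2 * x)%g | x in A0] `|` A); rewrite mE; split.
- exact: (supportedD s1 s2).
- rewrite /Rint (@intD R G mu hausG finmu RealScalars (R^o) (@rcompleteR R) _ _ _ s1 s2) big_cons.
  congr (_ + _); last exact: iA.
  rewrite -[LHS]/(Rint mu (fun x => a.1 * f0 (a.2^-1 * x)%g)) (RintZ hausG haar_mu _ sa').
  rewrite /Rint (@int_lmulg R G mu hausG haar_mu RealScalars (R^o) f0 A0 a.2 (@rcompleteR R) sf0).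
  by rewrite -[X in _ * X]/(Rint mu f0) If0 mulr1.
- move=> E pi b hb; have cE := @completeNormedMod_rcomplete R s E.
  have [cb _] := hb.
  have t1 := supported_lscale (of_real_supported s s1) cb.
  have t2 := supported_lscale (of_real_supported s s2) cb.
  rewrite /smoothing_average big_cons -/(smoothing_average b l) -(bA _ _ _ hb).
  under eq_fun do rewrite of_realD scalerDl.
  rewrite (intD hausG finmu cE t1 t2); congr (_ + _).
  have sb := smoothing_supported hb a.2.
  rewrite /smoothing -(int_lmulg hausG haar_mu a.2 cE sb).
  rewrite -(intZ hausG finmu cE (r2k a.1) (supported_lmulg a.2 sb)).
  by congr bochner_integral; apply/funext => k; rewrite mulVKg scalerA of_realM.
Qed.

End GrowthClass.

(** * Bounds on smoothed cocycles, uniform over the class *)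

Section Smoothing.
Variables (R : realType) (s : scalars) (G : topologicalGroupType) (S : set G).
Local Notation K := (scalar_field R s).
Local Notation r2k := (@of_real R s).
Hypothesis genS : compact_generating S.
Hypothesis hausG : hausdorff_space G.
Hypothesis lcG : locally_compact [set: G].
Variable mu : {measure set (borel G) -> \bar R}.
Hypothesis haar_mu : left_haar mu.
Let finmu := haar_compact haar_mu.
Local Notation int F := (bochner_integral mu F).
Local Notation vol A := (fine (mu A)).
Local Notation Rsupported f A := (@supported R RealScalars G (R^o) f A).
Variables (f0 : G -> R) (A0 : set G).
Hypothesis sf0 : Rsupported f0 A0.
Local Notation smoothing := (smoothing mu f0).

Lemma smoothing_bounded (A : set G) : compact A -> exists2 M : R, 0 <= M &
  forall e (E : completeNormedModType K) (pi : representation G E) (b : G -> E),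
    0 <= e -> e <= 1 -> unit_cocycle S e pi b -> forall g, A g -> rnorm (smoothing b g) <= M.
Proof.
move=> cA; have [_ cA0 f00] := sf0.
have [N hN] := compact_sub_setpow hausG haar_mu genS (compact_mulg cA cA0).
have [c c0 hc] := supported_bounded sf0.
have B0 := cocycle_bound_ge0 R N.
exists (c * cocycle_bound R N * vol A0); first by rewrite !mulr_ge0// fine_ge0.
move=> e E pi b e0 e1 hb g Ag; have [_ hb' _] := hb.
apply: (rnorm_int_le hausG finmu (@completeNormedMod_rcomplete R s E) (smoothing_supported sf0 hb' g)).
  by rewrite mulr_ge0.
move=> k; rewrite rnormZr; have [Ak|/f00 ->] := pselect (A0 k); last first.
  by rewrite normr0 mul0r mulr_ge0.
apply: ler_pM; rewrite ?rnorm_ge0//; first exact: hc.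
by apply: (unit_cocycle_le e0 e1 hb); apply: hN; exists g => //; exists k.
Qed.

(** After a translation of the variable, the difference integrates [b] against the variation of [f0]
    under [w]. Only the uniform continuity of [f0] and the bound on [b] over a compact set enter,
    and both are common to all unit cocycles. *)
Lemma smoothing_equicontinuous (d : R) : 0 < d -> exists2 W : set G, nbhs (1%g : G) W &
  forall e (E : completeNormedModType K) (pi : representation G E) (b : G -> E),
    0 <= e -> e <= 1 -> unit_cocycle S e pi b -> forall w, W w ->
    rnorm (smoothing b w - smoothing b 1%g) <= d.
Proof.
move=> d0; have [cf0 cA0 f00] := sf0.
have [W0 W01 cW0] := compact_nbhs1 lcG.
pose B := [set (x * y)%g | x in W0 & y in A0] `|` A0.
have cB : compact B by apply: compactU => //; exact: compact_mulg.
have [N hN] := compact_sub_setpow hausG haar_mu genS cB.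
have B0 := cocycle_bound_ge0 R N; have V0 : 0 <= vol B by exact: fine_ge0.
have D1 : 0 < cocycle_bound R N * vol B + 1 by rewrite ltr_wpDl// mulr_ge0.
pose h := d / (cocycle_bound R N * vol B + 1); have h0 : 0 < h by exact: divr_gt0.
exists (W0 `&` [set g | forall x : G, `|f0 (g^-1 * x)%g - f0 x| <= h]).
  by apply: filterI => //; exact: (@Cc_unif_continuous R RealScalars G (R^o) lcG f0 A0 cf0 cA0 f00 h h0).
move=> e E pi b e0 e1 hb w [W0w /= hw]; have [_ hb' _] := hb.
have cE := @completeNormedMod_rcomplete R s E.
have sw := smoothing_supported sf0 hb' w; have s1 := smoothing_supported sf0 hb' 1%g.
have wB : [set (w * x)%g | x in A0] `<=` B by move=> _ [x Ax <-]; left; exists w => //; exists x.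
have AB : A0 `<=` B by move=> x; right.
rewrite /smoothing -(int_lmulg hausG haar_mu w cE sw).
rewrite -(intB hausG finmu cE (supported_sub (supported_lmulg w sw) cB wB) (supported_sub s1 cB AB)).
have -> : (fun x => r2k (f0 (w^-1 * x)%g) *: b (w * (w^-1 * x))%g - r2k (f0 x) *: b (1 * x)%g) =
    (fun x => r2k (f0 (w^-1 * x)%g - f0 x) *: b x).
  by apply/funext => x; rewrite mulVKg mul1g of_realB scalerBl.
apply: (@le_trans _ _ (h * cocycle_bound R N * vol B)); last first.
  rewrite /h -mulrA mulrAC ler_pdivrMr// ler_wpM2l ?(ltW d0)// lerDl//.
apply: (rnorm_int_le hausG finmu cE (A := B)); last 2 first.
- by rewrite mulr_ge0// ltW.
- move=> x; rewrite rnormZr; have [Bx|nB] := pselect (B x).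
    apply: ler_pM; rewrite ?rnorm_ge0//.
    by apply: (unit_cocycle_le e0 e1 hb); exact: hN.
  have -> : f0 (w^-1 * x)%g = 0.
    by apply: f00 => Ax; apply: nB; left; exists w => //; exists (w^-1 * x)%g => //; rewrite mulVKg.
  rewrite f00; last by move=> Ax; apply: nB; right.
  by rewrite subrr normr0 mul0r mulr_ge0// ltW.
- have cb : continuous b by case: hb'.
  apply: supported_lscale => //; apply: of_real_supported; split => //.
    move=> x; apply: (@cvgB R); last exact: cf0.
    by apply: (@cvg_comp _ _ _ (fun k => (w^-1 * k)%g) f0); [exact: lmulg_continuous|exact: cf0].
  move=> x nB; rewrite !f00 ?subrr// => Ax; apply: nB; first by right.
  by left; exists w => //; exists (w^-1 * x)%g => //; rewrite mulVKg.
Qed.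

End Smoothing.

(** * Halving the displacement of a cocycle *)

Section Halving.
Variables (R : realType) (s : scalars) (G : topologicalGroupType) (S : set G).
Local Notation K := (scalar_field R s).
Local Notation r2k := (@of_real R s).
Local Notation C := (scalar_field R ComplexScalars).
Hypothesis genS : compact_generating S.
Hypothesis hausG : hausdorff_space G.
Hypothesis lcG : locally_compact [set: G].
Variable mu : {measure set (borel G) -> \bar R}.
Hypothesis haar_mu : left_haar mu.
Let finmu := haar_compact haar_mu.
Local Notation int F := (bochner_integral mu F).
Local Notation Rsupported f A := (@supported R RealScalars G (R^o) f A).
Hypothesis hT : property_T R G.

Section FixedBump.
Variables (f0 : G -> R) (A0 : set G).
Hypotheses (sf0 : Rsupported f0 A0) (If0 : Rint mu f0 = 1).
Local Notation smoothing := (smoothing mu f0).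

(* If every eps failed, the smoothings of the counterexamples for eps = 1/(n+1)
   would have a limit kernel violating [averaging_weights]; note that
   16 / 20^2 < (1 / 4)^2. *)
Lemma small_displacement : exists2 nu : seq (R * G), \sum_(a <- nu) a.1 = 1 &
  forall g, exists eps : R, [/\ 0 < eps, eps <= 1 &
    forall (E : completeNormedModType K) (pi : representation G E) (b : G -> E),
      unit_cocycle S eps pi b ->
      rnorm (\sum_(a <- displacement nu g) r2k a.1 *: smoothing b a.2) <= 4^-1].
Proof.
have [Q [d [cQ d0 hT']]] := hT.
have cQ1 : compact (Q `|` [set 1%g]) by apply: compactU => //; exact: compact_set1.
have [M M0 hM] := smoothing_bounded s genS hausG haar_mu sf0 cQ1.
have k0 : 0 < 20^-1 :> R by [].
have M20 : 0 <= 2 * M by rewrite mulr_ge0.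
have [eta eta0 heta] := averaging_weights hausG haar_mu cQ d0 hT' lcG k0 M20.
have [W W1 hW] := smoothing_equicontinuous s genS hausG lcG haar_mu sf0 eta0.
have [nu [nu1 hnu]] := heta W W1; exists nu => // g.
apply: contrapT => hno.
(* Space, representation and cocycle are bundled so that the axiom of choice returns a sequence of
   counterexamples over varying spaces. *)
pose T := {E : completeNormedModType K & (representation G E * (G -> E))%type}.
pose bad n (t : T) := unit_cocycle S n.+1%:R^-1 (projT2 t).1 (projT2 t).2 /\
  4^-1 < rnorm (\sum_(a <- displacement nu g) r2k a.1 *: smoothing (projT2 t).2 a.2).
have [t ht] : {t : nat -> T & forall n, bad n (t n)}.
  apply: choice => n; apply: contrapT => hn; apply: hno; exists n.+1%:R^-1; split.
  - by rewrite invr_gt0.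
  - by rewrite invf_le1// ler1n.
  - move=> E pi b hb; rewrite leNgt; apply/negP => hlt; apply: hn.
    by exists (existT _ E (pi, b)).
pose E n := projT1 (t n); pose pi n : representation G (E n) := (projT2 (t n)).1.
pose b n : G -> E n := (projT2 (t n)).2.
have {}ht n : unit_cocycle S n.+1%:R^-1 (pi n) (b n) /\
  4^-1 < rnorm (\sum_(a <- displacement nu g) r2k a.1 *: smoothing (b n) a.2) by exact: ht.
have e0 n : 0 <= n.+1%:R^-1 :> R by rewrite invr_ge0.
have e1 n : n.+1%:R^-1 <= 1 :> R by rewrite invf_le1// ler1n.
have ub n := (ht n).1.
have cls n : growth_class S n.+1%:R^-1 (pi n) by case: (ub n).
have coc n : cocycle (pi n) (b n) by case: (ub n).
pose u n : G -> E n := smoothing (b n).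
have para n := growth_class_para (cls n).
have bnd x : exists c : R, forall n, rnorm (u n x) <= c.
  have [c _ hc] := smoothing_bounded s genS hausG haar_mu sf0 (@compact_set1 _ x).
  by exists c => n; exact: hc (e0 n) (e1 n) (ub n) x erefl.
have [U [UU Uoo]] := @ultraFilterLemma nat \oo _.
pose B := limit_kernel u U.
have pB : psd B := limit_kernel_psd para bnd UU Uoo.
have sqd x y : (fun n => rnorm (u n x - u n y) ^+ 2) @ U --> sqdist B x y.
  exact: sqdist_limit_cvg.
have sqd_le x y c : (forall n, rnorm (u n x - u n y) <= c) -> sqdist B x y <= c ^+ 2.
  move=> h; apply: (ulim_le UU (@sqd x y) (cvg_cst (c ^+ 2))) => n.
  rewrite ler_pXn2r// ?nnegrE ?rnorm_ge0//; exact: le_trans (rnorm_ge0 _) (h n).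
(* Translation by [k] distorts distances by at most [exp(l / (n+1))], which tends to 1; the same
   estimate for the inverse of [k] upgrades the inequality to invariance. *)
have sqd_inv k x y : sqdist B (k * x)%g (k * y)%g <= sqdist B x y.
  pose l : R := (word_length S k)%:R.
  have h : (fun n : nat => expR (n.+1%:R^-1 * l) ^+ 2 * rnorm (u n x - u n y) ^+ 2) @ U -->
      expR (0 * l) ^+ 2 * sqdist B x y.
    apply: cvgM => //; apply: (cvg_oo_U Uoo).
    apply: (@cvg_comp _ _ _ _ (fun z : R => z ^+ 2)); last exact: exprn_continuous.
    apply: (@cvg_comp _ _ _ (fun n : nat => n.+1%:R^-1 * l) expR); last exact: continuous_expR.
    by apply: cvgM; [exact: cvg_harmonic|exact: cvg_cst].
  rewrite mul0r expR0 expr1n mul1r in h.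
  apply: (ulim_le UU (@sqd _ _) h) => n.
  rewrite -exprMn ler_pXn2r// ?nnegrE ?mulr_ge0 ?rnorm_ge0 ?expR_ge0//.
  apply: le_trans (growth_class_le k (u n x - u n y) (cls n)).
  rewrite le_eqVlt; apply/orP; left; apply/eqP; congr rnorm.
  exact: (smoothing_sub hausG haar_mu sf0 If0 (coc n)).
have sqd_inv' k x y : sqdist B (k * x)%g (k * y)%g = sqdist B x y.
  apply: le_anti; rewrite sqd_inv/=.
  by have := sqd_inv (k^-1)%g (k * x)%g (k * y)%g; rewrite !mulKg.
have : quad B (displacement nu g) (displacement nu g) <= 16 * 20^-1 ^+ 2.
  apply: hnu => //.
  - move=> e e_gt0; pose dl := Num.min 1 (e / 2).
    have dl0 : 0 < dl by rewrite lt_min ltr01 divr_gt0.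
    have [V V1 hV] := smoothing_equicontinuous s genS hausG lcG haar_mu sf0 dl0.
    apply: filterS V1 => w Vw /=; apply: (@le_lt_trans _ _ (dl ^+ 2)).
      by apply: sqd_le => n; exact: hV (e0 n) (e1 n) (ub n) w Vw.
    apply: (@le_lt_trans _ _ (e / 2)); last by rewrite ltr_pdivrMr// ltr_pMr// ltr1n.
    rewrite expr2; apply: (@le_trans _ _ (1 * (e / 2))); last by rewrite mul1r.
    by apply: ler_pM; rewrite ?(ltW dl0)// ge_min lexx ?orbT.
  - move=> q Qq; apply: sqd_le => n; apply: le_trans (rnormB _ _) _.
    rewrite mulr2n mulrDl mul1r lerD//.
      by apply: hM (e0 n) (e1 n) (ub n) _ _; left.
    by apply: hM (e0 n) (e1 n) (ub n) _ _; right.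
  - by move=> w Ww; apply: sqd_le => n; exact: hW (e0 n) (e1 n) (ub n) w Ww.
apply/negP; rewrite -ltNge; apply: (@lt_le_trans _ _ (4^-1 ^+ 2)).
  have -> : 4^-1 ^+ 2 = 16 * 20^-1 ^+ 2 + (3 / 20) ^+ 2 :> R by field.
  by rewrite ltrDl exprn_gt0// divr_gt0.
apply: (ulim_le UU (cvg_cst (4^-1 ^+ 2 : R)) (@quad_limit_cvg _ _ _ _ _ para bnd _ UU Uoo _)) => n.
by rewrite ler_pXn2r// ?nnegrE ?rnorm_ge0 ?invr_ge0//; apply/ltW; exact: (ht n).2.
Qed.

(** The previous lemma gives an eps for each [g]. Finitely many points [x] of [S] are used: writing
    [g = x h] with [h] near 1, the displacement by [g] is the one by [x] plus the image under [pi x]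
    of the one by [h], which equicontinuity makes small. *)
Lemma uniformly_small_displacement : exists2 nu : seq (R * G), \sum_(a <- nu) a.1 = 1 &
  exists eps : R, [/\ 0 < eps, eps <= 1 &
    forall (E : completeNormedModType K) (pi : representation G E) (b : G -> E),
      unit_cocycle S eps pi b -> forall g, S g ->
      rnorm (\sum_(a <- displacement nu g) r2k a.1 *: smoothing b a.2) <= 2^-1].
Proof.
have [nu nu1 /choice[epsf heps]] := small_displacement; exists nu => //.
(* The terms of the displacement by [h] are images under [pi a.2] of increments of the smoothed
   cocycle near 1; [D] collects the weights and operator bounds, and [expR 1] in [d] accounts for
   [pi x]. *)
pose D := \sum_(a <- nu) `|a.1| * expR (word_length S a.2)%:R.
have D0 : 0 <= D by apply: sumr_ge0 => a _; rewrite mulr_ge0// expR_ge0.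
have eD : 0 < expR 1 * D + 1 by rewrite ltr_wpDl// mulr_ge0// expR_ge0.
pose d := 4^-1 / (expR 1 * D + 1); have d0 : 0 < d by rewrite divr_gt0.
have [W W1 hW] := smoothing_equicontinuous s genS hausG lcG haar_mu sf0 d0.
(* Since [h a = a (a^-1 h a)], it is the conjugates of [h] by the points of [nu] that must be close
   to 1. *)
pose W' := [set w | forall a, a \in nu -> W (a.2^-1 * (w * a.2))%g].
have W'1 : nbhs (1%g : G) W'.
  rewrite /W'; elim: (nu) => [|a l IH]; first exact: nearW.
  apply: filterS (filterI (nbhs1_conj a.2 W1) IH) => w [/= w1 w2] a'.
  by rewrite inE => /orP[/eqP ->//|/w2].
have [cS _ _ _] := genS.
have [t [tS hcov]] := compact_open_cover (P := fun x => [set y | W' (x^-1 * y)%g]) cS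
  (fun x _ => nbhs_lmulg x W'1).
have [eps [eps0 eps1 heps']] : exists eps : R, [/\ 0 < eps, eps <= 1 & forall x, x \in t -> eps <= epsf x].
  elim: (t) => [|x l [e [e0 e1 IH]]]; first by exists 1.
  have [x0 _ _] := heps x.
  exists (Num.min e (epsf x)); split; first by rewrite lt_min e0.
    by rewrite ge_min e1.
  move=> y; rewrite inE => /orP[/eqP ->|/IH h]; first by rewrite ge_min lexx orbT.
  by rewrite ge_min h.
exists eps; split => // E pi b ub g Sg.
have [cls hb _] := ub; have [_ bM] := hb.
have [x xt Wx] := hcov g Sg; have Sx := tS x xt.
pose y := smoothing_average mu f0 b nu.
have dE h := displacement_smoothing hausG haar_mu sf0 If0 hb nu1 h.
rewrite -dE -/y.
have gE : g = (x * (x^-1 * g))%g by rewrite mulVKg.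
have -> : b g + pi g y - y = (b x + pi x y - y) +
    pi x (b (x^-1 * g)%g + pi (x^-1 * g)%g y - y).
  have -> : b g = b x + pi x (b (x^-1 * g)%g) by rewrite -bM -gE.
  have -> : pi g y = pi x (pi (x^-1 * g)%g y) by rewrite -repM -gE.
  rewrite linearB linearD [X in _ = X + _]addrAC [RHS]addrACA subrr addr0.
  by rewrite [RHS]addrAC addrA.
have half : 4^-1 + 4^-1 = 2^-1 :> R by field.
apply: le_trans (rnormD _ _) _; rewrite -half; apply: lerD.
  rewrite dE; have [_ _ h] := heps x; apply: h.
  by case: ub => u1 u2 u3; have u1' := growth_class_mono (heps' x xt) u1; exact: And3 u1' u2 u3.
apply: le_trans (growth_class_ball (n := 1) _ (ltW eps0) eps1 cls _) _; first exact/setpow1P.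
rewrite dE.
apply: (@le_trans _ _ (expR 1 * (d * D))); last first.
  by rewrite mulrCA /d -mulrA ler_piMr ?invr_ge0// ler_pdivrMl// mulr1 lerDl.
rewrite ler_wpM2l ?expR_ge0//.
have -> : \sum_(a <- displacement nu (x^-1 * g)%g) r2k a.1 *: smoothing b a.2 =
    \sum_(a <- nu) r2k a.1 *: pi a.2 (smoothing b (a.2^-1 * (x^-1 * g * a.2))%g - smoothing b 1%g).
  rewrite /displacement big_cat !big_map /= -big_split; apply: eq_bigr => a _.
  rewrite -(smoothing_sub hausG haar_mu sf0 If0 hb) mulVKg mulg1 scalerBr.
  by rewrite of_realN scaleNr.
rewrite /D mulr_sumr big_seq_cond [leRHS]big_seq_cond.
apply: (@le_trans _ _ (\sum_(i <- nu | (i \in nu) && true) rnorm (r2k i.1 *: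
   pi i.2 (smoothing b (i.2^-1 * (x^-1 * g * i.2))%g - smoothing b 1%g)))).
  exact: rnorm_sum.
apply: ler_sum => a /andP[anu _]; rewrite rnormZr mulrCA ler_wpM2l//.
apply: le_trans (growth_class_ball _ (ltW eps0) eps1 cls (word_lengthP genS a.2)) _.
rewrite mulrC ler_wpM2r ?expR_ge0//.
by apply: hW (ltW eps0) eps1 ub _ _; exact: Wx.
Qed.

End FixedBump.

(** Dividing the cocycle by [c] makes it a unit cocycle, and every expression involved is
    homogeneous. The function [f] depends neither on the representation nor on the cocycle, so it
    can serve for fixed points and for the projection alike. *)
Lemma cocycle_halving : exists eps : R, [/\ 0 < eps, eps <= 1 &
  exists (f : G -> R) (A : set G), [/\ Rsupported f A, Rint mu f = 1 &
    forall (E : completeNormedModType K) (pi : representation G E) (b : G -> E) (c : R),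
      growth_class S eps pi -> cocycle pi b -> 0 < c -> (forall g, S g -> rnorm (b g) <= c) ->
      forall g, S g ->
      rnorm (b g + pi g (int (fun k => r2k (f k) *: b k)) - int (fun k => r2k (f k) *: b k))
        <= c / 2]].
Proof.
have [f0 [A0 [sf0 _ _ If0]]] := normalized_bump hausG lcG haar_mu.
have [nu nu1 [eps [eps0 eps1 heps]]] := uniformly_small_displacement sf0 If0.
exists eps; split; [exact: eps0|exact: eps1|].
have [A [sf If bf]] := mixture_integral s hausG haar_mu sf0 If0 nu.
exists (mixture f0 nu), A; split; [exact: sf|by rewrite If|].
move=> E pi b c cls hb c0 hc g Sg; rewrite (bf _ _ _ hb).
pose b' g := r2k c^-1 *: b g.
have [cb bM] := hb.
have hb' : cocycle pi b'.
  split=> [x|x y]; first by apply: cvgZ; [exact: cvg_cst|exact: cb].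
  by rewrite /b' bM scalerDr linearZ.
have ub : unit_cocycle S eps pi b'.
  split => // x Sx; rewrite rnormZr ger0_norm ?invr_ge0 ?(ltW c0)//.
  by rewrite ler_pdivrMl// mulr1 hc.
have := heps _ _ _ ub g Sg.
rewrite -(displacement_smoothing hausG haar_mu sf0 If0 hb' nu1).
have -> : smoothing_average mu f0 b' nu = r2k c^-1 *: smoothing_average mu f0 b nu.
  rewrite /smoothing_average scaler_sumr; apply: eq_bigr => a _.
  rewrite scalerA mulrC -scalerA; congr (_ *: _).
  rewrite /smoothing -(intZ hausG finmu (@completeNormedMod_rcomplete R s E) (r2k c^-1) (smoothing_supported sf0 hb a.2)).
  by congr bochner_integral; apply/funext => k; rewrite /b' !scalerA mulrC.
rewrite /b' linearZ -scalerDr -scalerBr rnormZr ger0_norm ?invr_ge0 ?(ltW c0)//.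
by rewrite ler_pdivrMl.
Qed.

End Halving.

(** * Iterated averaging *)

Lemma le0_pow2 (R : realType) (x c : R) : 0 <= c -> (forall n, x <= c / 2 ^+ n) -> x <= 0.
Proof.
move=> c0 h; apply: (@le0_eps _ _ c) => // e e0.
have h1 : `|2^-1 : R| < 1 by rewrite ger0_norm ?invr_ge0// invf_lt1// ltr1n.
have /cvgrPdist_lt/(_ _ e0)[N _ hN] := cvg_expr h1.
have := hN N (leqnn N); rewrite /= sub0r normrN ger0_norm ?exprn_ge0 ?invr_ge0// => lt.
by apply: le_trans (h N) _; rewrite mulrC ler_wpM2r// -exprVn ltW.
Qed.

Lemma geometric_rcvg (R : realType) (s : scalars) (E : completeNormedModType (scalar_field R s))
    (z : nat -> E) (d : R) : 0 <= d -> (forall n, rnorm (z n.+1 - z n) <= d / 2 ^+ n) ->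
  exists2 l, rcvg z l & forall n, rnorm (z n - l) <= 2 * d / 2 ^+ n.
Proof.
move=> d0 hz.
have p0 n : 0 < 2 ^+ n :> R by rewrite exprn_gt0.
have step n k : rnorm (z (n + k)%N - z n) <= 2 * d / 2 ^+ n - 2 * d / 2 ^+ (n + k).
  elim: k => [|k IH]; first by rewrite addn0 !subrr rnorm0.
  have -> : z (n + k.+1)%N - z n = (z (n + k).+1 - z (n + k)%N) + (z (n + k)%N - z n).
    by rewrite addnS addrA subrK.
  apply: le_trans (rnormD _ _) _; apply: le_trans (lerD (hz _) IH) _.
  rewrite addnS exprS invfM.
  have := p0 (n + k)%N; move: (2 ^+ (n + k)) => u u0.
  by rewrite le_eqVlt; apply/orP; left; apply/eqP; field; rewrite gt_eqF// gt_eqF.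
have step' n k : rnorm (z (n + k)%N - z n) <= 2 * d / 2 ^+ n.
  by apply: le_trans (step n k) _; rewrite lerBlDr lerDl divr_ge0 ?mulr_ge0 ?(ltW (p0 _)).
have cau : rcauchy z.
  move=> e e0; have e40 : 0 < e / 2 by rewrite divr_gt0.
  have [N hN] : exists N, 2 * d / 2 ^+ N < e / 2.
    apply: contrapT => hno.
    have : e / 2 <= 0.
      apply: (@le0_pow2 _ _ (2 * d)) => [|n]; first by rewrite mulr_ge0.
      by rewrite leNgt; apply/negP => h; apply: hno; exists n.
    by rewrite leNgt e40.
  exists N => m n Nm Nn; rewrite -(subnKC Nm) -(subnKC Nn).
  have -> : z (N + (m - N))%N - z (N + (n - N))%N = (z (N + (m - N))%N - z N) - (z (N + (n - N))%N - z N).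
    by rewrite opprB addrA subrK.
  apply: le_lt_trans (rnormB _ _) _; rewrite (splitr e).
  by apply: ltrD; apply: le_lt_trans hN.
have [l zl] := rcauchy_cvg cau; exists l => // n.
apply/ler_addgt0Pr => e e0; have [N hN] := zl e e0.
have -> : z n - l = (z (n + N)%N - l) - (z (n + N)%N - z n) by rewrite opprB [RHS]addrC addrA subrK.
apply: le_trans (rnormB _ _) _; rewrite addrC lerD//.
by apply/ltW/hN; rewrite leq_addl.
Qed.

Section AveragingLimit.
Variables (R : realType) (s : scalars) (G : topologicalGroupType) (S : set G).
Local Notation K := (scalar_field R s).
Local Notation r2k := (@of_real R s).
Hypothesis genS : compact_generating S.
Hypothesis hausG : hausdorff_space G.
Variable mu : {measure set (borel G) -> \bar R}.
Hypothesis haar_mu : left_haar mu.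
Let finmu := haar_compact haar_mu.
Local Notation int F := (bochner_integral mu F).
Local Notation vol A := (fine (mu A)).
Local Notation Rsupported f A := (@supported R RealScalars G (R^o) f A).
Variables (eps : R) (f : G -> R) (A : set G).
Hypotheses (eps0 : 0 < eps) (eps1 : eps <= 1).
Hypotheses (sf : Rsupported f A) (If : Rint mu f = 1).
Hypothesis halving : forall (E : completeNormedModType K) (pi : representation G E) (b : G -> E) (c : R),
  growth_class S eps pi -> cocycle pi b -> 0 < c -> (forall g, S g -> rnorm (b g) <= c) ->
  forall g, S g ->
  rnorm (b g + pi g (int (fun k => r2k (f k) *: b k)) - int (fun k => r2k (f k) *: b k)) <= c / 2.

Lemma average_bound : exists2 c0 : R, 0 <= c0 &
  forall (E : completeNormedModType K) (pi : representation G E) (b : G -> E) (c : R),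
    growth_class S eps pi -> cocycle pi b -> 0 <= c -> (forall g, S g -> rnorm (b g) <= c) ->
    rnorm (int (fun k => r2k (f k) *: b k)) <= c0 * c.
Proof.
have [cf cA fA] := sf; have [N hN] := compact_sub_setpow hausG haar_mu genS cA.
have [c1 c10 hc1] := supported_bounded sf.
have B0 := cocycle_bound_ge0 R N.
exists (c1 * cocycle_bound R N * vol A); first by rewrite !mulr_ge0// fine_ge0.
move=> E pi b c cls hb c_ge0 hc; have [cb _] := hb.
have sb := supported_lscale (of_real_supported s sf) cb.
have -> : c1 * cocycle_bound R N * vol A * c = c1 * (c * cocycle_bound R N) * vol A by ring.
apply: (rnorm_int_le hausG finmu (@completeNormedMod_rcomplete R s E) sb).
  by rewrite !mulr_ge0.
move=> k; rewrite rnormZr; have [Ak|/fA ->] := pselect (A k); last first.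
  by rewrite normr0 mul0r !mulr_ge0.
apply: ler_pM; rewrite ?rnorm_ge0//; first exact: hc1.
exact: cocycle_le (ltW eps0) eps1 cls hb hc (hN k Ak).
Qed.

Section Iteration.
Variables (E : completeNormedModType K) (pi : representation G E) (b : G -> E).
Hypothesis cls : growth_class S eps pi.
Hypothesis hb : cocycle pi b.

(** The cocycle of the same affine action with its origin moved to [x]; it vanishes exactly when [x]
    is fixed. *)
Definition shift_cocycle (x : E) (g : G) : E := b g + pi g x - x.

Lemma shift_cocycleP x : cocycle pi (shift_cocycle x).
Proof.
have [cb bM] := hb; split=> [g|g h].
  apply: cvgB; last exact: cvg_cst.
  by apply: cvgD; [exact: cb|exact: rep_continuous].
rewrite /shift_cocycle bM repM linearB linearD.
rewrite [X in _ = X + _]addrAC [RHS]addrACA subrr addr0.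
by rewrite [RHS]addrAC addrA.
Qed.

Definition averaging_step (x : E) : E := x + int (fun k => r2k (f k) *: shift_cocycle x k).

(** Every step halves the displacement on [S], and the length of a step is at most [c0] times that
    displacement, so the iterates converge geometrically. The explicit rate is what later yields
    convergence in the norm of the completion. *)
Lemma averaging_iter (c0 c : R) x0 : 0 <= c0 ->
  (forall (b' : G -> E) (c : R), cocycle pi b' -> 0 <= c -> (forall g, S g -> rnorm (b' g) <= c) ->
    rnorm (int (fun k => r2k (f k) *: b' k)) <= c0 * c) ->
  0 < c -> (forall g, S g -> rnorm (shift_cocycle x0 g) <= c) ->
  exists x, [/\ forall g, b g + pi g x = x, rcvg (fun n => iter n averaging_step x0) x &
    forall n, rnorm (iter n averaging_step x0 - x) <= 2 * (c0 * c) / 2 ^+ n].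
Proof.
move=> c00 hc0 c_gt0 hc; pose z n := iter n averaging_step x0.
have p0 n : 0 < 2 ^+ n :> R by rewrite exprn_gt0.
have zb n g : S g -> rnorm (shift_cocycle (z n) g) <= c / 2 ^+ n.
  elim: n g => [|n IH] g Sg; first by rewrite expr0 divr1 hc.
  rewrite exprSr invfM mulrA.
  have := halving cls (shift_cocycleP (z n)) (divr_gt0 c_gt0 (p0 n)) IH Sg.
  congr (rnorm _ <= _); rewrite /z iterS -/(z n) {2}/shift_cocycle /averaging_step.
  set y := int _; rewrite /shift_cocycle linearD opprD !addrA; congr (_ - _).
  by rewrite addrAC.
have dz n : rnorm (z n.+1 - z n) <= (c0 * c) / 2 ^+ n.
  rewrite /z iterS -/(z n) /averaging_step addrC addKr -mulrA.
  apply: hc0 (shift_cocycleP (z n)) _ (zb n).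
  by rewrite divr_ge0 ?ltW.
have d0 : 0 <= c0 * c by rewrite mulr_ge0// ltW.
have [x zx hx] := geometric_rcvg d0 dz; exists x; split => //.
(* The displacement of the limit differs from that of the [n]-th iterate by at most [expR 1 + 1]
   times their distance; both terms are O(2^-n). Vanishing on [S] then spreads to [G] by
   [cocycle_le] with constant 0. *)
have xS g : S g -> rnorm (shift_cocycle x g) <= 0.
  move=> Sg; apply: (@le0_pow2 _ _ (c + (expR 1 + 1) * (2 * (c0 * c)))) => [|n].
    apply: addr_ge0; first exact: ltW.
    by apply: mulr_ge0; [apply: addr_ge0 => //; exact: expR_ge0|exact: mulr_ge0].
  have -> : shift_cocycle x g = shift_cocycle (z n) g - (pi g (z n - x) - (z n - x)).
    rewrite /shift_cocycle (linearB (pi g)); move: (b g) (pi g x) (pi g (z n)) => u v w.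
    rewrite !opprB [RHS]addrA [X in _ = X + _]addrA subrK.
    by rewrite [RHS]addrAC [X in _ = X - _]addrACA subrr addr0.
  apply: le_trans (rnormB _ _) _; rewrite mulrDl lerD ?zb//.
  apply: le_trans (rnormB _ _) _; rewrite -mulrA mulrDl mul1r lerD//.
  apply: le_trans (growth_class_ball (n := 1) _ (ltW eps0) eps1 cls _) _; first exact/setpow1P.
  by rewrite ler_wpM2l ?expR_ge0.
move=> g.
have := cocycle_le (ltW eps0) eps1 cls (shift_cocycleP x) xS (word_lengthP genS g).
by rewrite mul0r => /rnorm_le0/eqP; rewrite subr_eq0 => /eqP.
Qed.

Lemma compact_cocycle_bound : exists2 c : R, 0 < c & forall g, S g -> rnorm (b g) <= c.
Proof.
have [cS _ _ _] := genS; have [cb _] := hb.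
have [|t [tS hcov]] := compact_open_cover (P := fun x => [set y | rnorm (b x - b y) < 1]) cS.
  by move=> x _; have /cvg_rnormP/(_ _ ltr01) := cb x.
have [c c0 hc] : exists2 c : R, 0 < c & forall x, x \in t -> rnorm (b x) <= c.
  elim: (t) => [|x l [c c0 IH]]; first by exists 1.
  exists (Num.max c (rnorm (b x))); first by rewrite lt_max c0.
  by move=> y; rewrite inE => /orP[/eqP ->|/IH h]; rewrite le_max ?h// lexx orbT.
exists (c + 1); first by rewrite addr_gt0.
move=> g /hcov[x xt /ltW hx]; rewrite -[b g](subKr (b x)).
by apply: le_trans (rnormB _ _) _; rewrite lerD// hc.
Qed.

Lemma affine_fixed_point : exists x, forall g, b g + pi g x = x.
Proof.
have [c0 c00 hc0] := average_bound.
have [c c_gt0 hc] := compact_cocycle_bound.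
have [||||x [hx _ _]] := @averaging_iter c0 c 0.
- exact: c00.
- by move=> b' c' hb' c'0 hc'; exact: hc0 cls hb' c'0 hc'.
- exact: c_gt0.
- by move=> g Sg; rewrite /shift_cocycle linear0 addr0 subr0; exact: hc.
by exists x.
Qed.

End Iteration.

Local Notation avg pi := (rep_integral mu pi (fun k => r2k (f k))).

Definition invariant_projection (E : completeNormedModType K) (pi : representation G E) (x : E) : E :=
  xget 0 [set y | rcvg (fun n => iter n (avg pi) x) y].

(** Because the integral of [f] is 1, for the linear action the subtracted copy of [x] cancels the
    [x] that is added back, and the averaging step is the operator of [f]. *)
Lemma averaging_step0 (E : completeNormedModType K) (pi : representation G E) x :
  averaging_step pi (fun=> 0) x = avg pi x.
Proof.
have cE := @completeNormedMod_rcomplete R s E.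
have sK := of_real_supported s sf.
have s2 : supported (fun k => r2k (f k) *: x) A.
  by apply: supported_lscale => // y; exact: cvg_cst.
have i2 : int (fun k => r2k (f k) *: x) = x.
  have := rep_integral_invariant hausG haar_mu (pi := trivial_rep G E) (x := x) sK _.
  rewrite (haar_of_real s hausG haar_mu sf) If of_real1 scale1r => h.
  by apply: h => g'.
rewrite /averaging_step /shift_cocycle.
under eq_fun do rewrite add0r scalerBr.
by rewrite (intB hausG finmu cE (rep_supported pi x sK) s2) i2 addrC subrK.
Qed.

Lemma invariant_projectionP : exists2 c0 : R, 0 <= c0 &
  forall (E : completeNormedModType K) (pi : representation G E) x, growth_class S eps pi ->
    [/\ invariants pi (invariant_projection pi x),
      rcvg (fun n => iter n (avg pi) x) (invariant_projection pi x) &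
      forall n, rnorm (iter n (avg pi) x - invariant_projection pi x) <= c0 * rnorm x / 2 ^+ n].
Proof.
have [c0 c00 hc0] := average_bound.
exists (2 * c0 * (expR 1 + 1)); first by apply: mulr_ge0; [exact: mulr_ge0|apply: addr_ge0 => //; exact: expR_ge0].
move=> E pi x cls.
have c0pi (b' : G -> E) (c : R) : cocycle pi b' -> 0 <= c -> (forall g, S g -> rnorm (b' g) <= c) ->
    rnorm (int (fun k => r2k (f k) *: b' k)) <= c0 * c.
  exact: hc0 cls.
have hb : cocycle pi (fun=> 0).
  by split=> [y|g h]; [exact: cvg_cst|rewrite linear0 addr0].
have iterE n : iter n (averaging_step pi (fun=> 0)) x = iter n (avg pi) x.
  by apply: eq_iter => y; exact: averaging_step0.
have main c : 0 < c -> (expR 1 + 1) * rnorm x <= c ->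
  [/\ invariants pi (invariant_projection pi x),
      rcvg (fun n => iter n (avg pi) x) (invariant_projection pi x) &
      forall n, rnorm (iter n (avg pi) x - invariant_projection pi x) <= 2 * (c0 * c) / 2 ^+ n].
  move=> c_gt0 hc.
  have [|y [inv yl ylim]] := @averaging_iter E pi _ cls hb c0 c x c00 c0pi c_gt0.
    move=> g Sg; rewrite /shift_cocycle add0r; apply: le_trans (rnormB _ _) _.
    apply: le_trans hc; rewrite mulrDl mul1r lerD//.
    have g1 : setpow S 1 g by exact/setpow1P.
    exact: growth_class_ball (ltW eps0) eps1 cls g1.
  have {}yl : rcvg (fun n => iter n (avg pi) x) y by under eq_fun do rewrite -iterE.
  have -> : invariant_projection pi x = y.
    rewrite /invariant_projection; case: xgetP => [z _ zl|/(_ y)//].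
    exact: rcvg_uniq zl yl.
  split=> // [g|n]; first by have := inv g; rewrite add0r.
  by rewrite -iterE.
(* The natural bound [(expR 1 + 1) * rnorm x] for the displacement is zero when [x = 0], while
   halving requires a positive constant; this case is settled directly. *)
have [x0|] := ltP 0 (rnorm x); last first.
  move=> /rnorm_le0 x0; have [|h1 h2 h3] := main 1 ltr01.
    by rewrite x0 rnorm0 mulr0.
  have l0 : rcvg (fun n => iter n (avg pi) x) 0.
    suff -> : (fun n => iter n (avg pi) x) = fun=> 0 by exact: rcvg_cst.
    apply/funext => n; rewrite x0; elim: n => // n IH; rewrite iterS IH.
    exact: (rep_integral0 hausG haar_mu pi (of_real_supported s sf)).
  split=> // n; rewrite (rcvg_uniq h2 l0) subr0 x0 rnorm0 mulr0 mul0r.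
  suff -> : iter n (avg pi) 0 = 0 by rewrite rnorm0.
  elim: n => // n IH; rewrite iterS IH.
  exact: (rep_integral0 hausG haar_mu pi (of_real_supported s sf)).
have c_gt0 : 0 < (expR 1 + 1) * rnorm x by rewrite mulr_gt0// addr_gt0// expR_gt0.
have [h1 h2 h3] := main _ c_gt0 (lexx _); split => // n.
by rewrite -2!mulrA; move: (h3 n); rewrite -!mulrA.
Qed.

End AveragingLimit.

(** * Kazhdan projections *)

Lemma ereal_cvg0P (R : realType) (a : nat -> \bar R) : (forall n, (0 <= a n)%E) ->
  a @ \oo --> 0%E <-> forall e : R, 0 < e -> exists N, forall n, (N <= n)%N -> (a n <= e%:E)%E.
Proof.
move=> a0; split=> [acv e e0|h B [d /= d0 hB]].
  have [|N _ hN] := acv [set x | (x <= e%:E)%E]; last by exists N => n /hN.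
  by exists e => // r /=; rewrite sub0r normrN lee_fin => /ltW/(le_trans (ler_norm _)).
have d20 : 0 < d / 2 by rewrite divr_gt0.
have [N hN] := h _ d20; exists N => // n /hN.
have := a0 n; rewrite /=; case: (a n) => // r; rewrite !lee_fin => r0 rd.
apply: hB; rewrite /= sub0r normrN ger0_norm//; apply: le_lt_trans rd _.
by rewrite ltr_pdivrMr// ltr_pMr// ltr1n.
Qed.

Lemma ereal_cauchy_cvg (R : realType) (a : nat -> \bar R) (c : R) :
  (\forall n \near \oo, (0 <= a n <= c%:E)%E) ->
  (forall e : R, 0 < e -> exists N, forall m n, (N <= m)%N -> (N <= n)%N -> (a m <= a n + e%:E)%E) ->
  cvgn a.
Proof.
move=> [N0 _ hN0] hc.
have fa n : (N0 <= n)%N -> a n \is a fin_num.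
  by move=> /hN0/andP[h1 h2]; rewrite ge0_fin_numE//; apply: le_lt_trans h2 _; rewrite ltry.
have cau : @rcauchy R RealScalars (R^o) (fine \o a).
  move=> e e0; have e20 : 0 < e / 2 by rewrite divr_gt0.
  have [N hN] := hc _ e20; exists (maxn N N0) => m n.
  rewrite !geq_max => /andP[Nm N0m] /andP[Nn N0n].
  have := hN m n Nm Nn; have := hN n m Nn Nm.
  rewrite -(fineK (fa _ N0m)) -(fineK (fa _ N0n)) -!EFinD !lee_fin => h1 h2.
  apply: (@le_lt_trans _ _ (e / 2)); last by rewrite ltr_pdivrMr// ltr_pMr// ltr1n.
  by rewrite /rnorm /= ler_norml lerBlDl h2 andbT lerNl opprB lerBlDl.
have [l /rcvgP al] := @rcompleteR R _ cau.
apply/cvg_ex; exists l%:E; apply/fine_cvgP; split; last exact: al.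
by exists N0 => // n; exact: fa.
Qed.

Section OperatorNorm.
Variables (R : realType) (s : scalars) (G : topologicalGroupType) (S : set G).
Local Notation K := (scalar_field R s).
Hypothesis hausG : hausdorff_space G.
Variable mu : {measure set (borel G) -> \bar R}.
Hypothesis haar_mu : left_haar mu.
Variable eps : R.
Hypotheses (eps0 : 0 < eps).
Local Notation F := (@growth_class R s G S eps).
Local Notation "pi # f" := (rep_integral mu pi f) (at level 50).

Lemma scalar_parallelogram (x y : scalar_complete R s) :
  2^-1 * (rnorm (x + y) ^+ 2 + rnorm (x - y) ^+ 2) = rnorm x ^+ 2 + rnorm y ^+ 2.
Proof.
have rE (a b : R) : 2^-1 * ((a + b) ^+ 2 + (a - b) ^+ 2) = a ^+ 2 + b ^+ 2 by field.
rewrite /rnorm; move: x y; rewrite /scalar_complete; case: s => /= x y.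
  by rewrite !real_normK ?num_real.
case: x => a b; case: y => c d; rewrite /= !sqr_sqrtr ?addr_ge0 ?sqr_ge0//.
by field.
Qed.

(** Shows that the class is inhabited: the supremum that defines [Fnorm] would otherwise be taken
    over the empty set and equal minus infinity. *)
Lemma trivial_rep_growth : F (trivial_rep G (scalar_complete R s)).
Proof.
apply: growth_class_intro => [x y|g x].
  rewrite scalar_parallelogram ler_peMl ?addr_ge0 ?sqr_ge0//.
  by rewrite lerDl ltW.
rewrite ler_peMl ?rnorm_ge0//; apply: le_trans (expR_ge1Dx _); rewrite lerDl.
by rewrite mulr_ge0// ltW.
Qed.

(** Replaces the extended-real supremum by a pointwise estimate uniform over the class; equivalence
    and Cauchy sequences are handled in this form below. *)
Lemma FnormP (h : G -> K) (c : R) : Cc h -> 0 <= c ->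
  (Fnorm mu F h <= c%:E)%E <->
  forall (E : completeNormedModType K) (pi : representation G E) x, F pi ->
    rnorm ((pi # h) x) <= c * rnorm x.
Proof.
move=> /CcP[A sh] c0.
have hom (E : completeNormedModType K) (pi : representation G E) (a : R) x :
    (pi # h) (of_real s a *: x) = of_real s a *: (pi # h) x.
  exact: (rep_integralZ hausG haar_mu pi _ x sh).
split=> [hc E pi x Fpi|hc].
  have : (opnorm (pi # h) <= c%:E)%E.
    by apply: le_trans hc; apply: ereal_sup_ubound; exists E, pi.
  by move=> /(opnorm_leP c0 (hom E pi))/(_ x).
apply: ge_ereal_sup => _ [E [pi [Fpi ->]]].
by apply/(opnorm_leP c0 (hom E pi)) => x; exact: hc.
Qed.

Lemma Fnorm_ge0 h : (0 <= Fnorm mu F h)%E.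
Proof.
apply: (@le_trans _ _ (opnorm (trivial_rep G (scalar_complete R s) # h))); first exact: opnorm_ge0.
apply: ereal_sup_ubound; exists (scalar_complete R s), (trivial_rep G (scalar_complete R s)).
by split => //; exact: trivial_rep_growth.
Qed.

Lemma CcB (f h : G -> K) : Cc f -> Cc h -> Cc (f \- h).
Proof.
move=> [cf [A cA fA]] [ch [B cB hB]]; split.
  by move=> x; apply: (@cvgB K); [exact: cf|exact: ch].
exists (A `|` B); first exact: compactU.
move=> x nx /=; rewrite fA ?hB ?subrr// => xAB; apply: nx; [by right|by left].
Qed.

Lemma rep_integral_subCc (E : completeNormedModType K) (pi : representation G E) (f h : G -> K) x :
  Cc f -> Cc h -> (pi # (f \- h)) x = (pi # f) x - (pi # h) x.
Proof.
by move=> /CcP[A sf] /CcP[B sh]; exact: (rep_integral_subf hausG haar_mu pi x sf sh).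
Qed.

Lemma FequivP (u v : nat -> G -> K) : (forall n, Cc (u n)) -> (forall n, Cc (v n)) ->
  Fequiv mu F u v <-> forall e : R, 0 < e -> exists N, forall n, (N <= n)%N ->
    forall (E : completeNormedModType K) (pi : representation G E) x, F pi ->
    rnorm ((pi # (u n)) x - (pi # (v n)) x) <= e * rnorm x.
Proof.
move=> cu cv; rewrite /Fequiv ereal_cvg0P; last by move=> n; exact: Fnorm_ge0.
have cuv n := CcB (cu n) (cv n).
split=> h e e0; have [N hN] := h e e0; exists N => n Nn.
  move=> E pi x Fpi; rewrite -rep_integral_subCc//.
  exact: (FnormP (cuv n) (ltW e0)).1 (hN n Nn) _ _ _ Fpi.
apply: (FnormP (cuv n) (ltW e0)).2 => E pi x Fpi.
by rewrite rep_integral_subCc//; exact: hN.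
Qed.

Lemma FcauchyP (u : nat -> G -> K) : Fcauchy mu F u <-> (forall n, Cc (u n)) /\
  forall e : R, 0 < e -> exists N, forall m n, (N <= m)%N -> (N <= n)%N ->
    forall (E : completeNormedModType K) (pi : representation G E) x, F pi ->
    rnorm ((pi # (u m)) x - (pi # (u n)) x) <= e * rnorm x.
Proof.
split=> -[cu h]; split=> // e e0.
  have [N hN] := h e e0; exists N => m n Nm Nn E pi x Fpi; rewrite -rep_integral_subCc//.
  exact: (FnormP (CcB (cu m) (cu n)) (ltW e0)).1 (ltW (hN m n Nm Nn)) _ _ _ Fpi.
have e20 : 0 < e / 2 by rewrite divr_gt0.
have [N hN] := h _ e20; exists N => m n Nm Nn; apply: (@le_lt_trans _ _ (e / 2)%:E).
  apply: (FnormP (CcB (cu m) (cu n)) (ltW e20)).2 => E pi x Fpi.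
  by rewrite rep_integral_subCc//; exact: hN.
by rewrite lte_fin ltr_pdivrMr// ltr_pMr// ltr1n.
Qed.

Lemma Fclass_eq (u v : nat -> G -> K) : (forall n, Cc (u n)) -> (forall n, Cc (v n)) ->
  Fequiv mu F u v -> Fclass mu F u = Fclass mu F v.
Proof.
suff sub (u' v' : nat -> G -> K) : (forall n, Cc (u' n)) -> (forall n, Cc (v' n)) ->
    Fequiv mu F u' v' -> Fclass mu F u' `<=` Fclass mu F v'.
  move=> cu cv uv; apply/seteqP; split; first exact: (sub _ _ cu cv uv).
  apply: (sub _ _ cv cu); apply/(FequivP cv cu) => e e0; have [N hN] := (FequivP cu cv).1 uv e e0.
  by exists N => n Nn E pi x Fpi; rewrite rnormBC hN.
move=> cu cv /(FequivP cu cv) uv w [cw]; have [cw' _] := (FcauchyP _).1 cw.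
move=> /(FequivP cw' cu) wu; split=> //; apply/(FequivP cw' cv) => e e0.
have e20 : 0 < e / 2 by rewrite divr_gt0.
have [N hN] := uv _ e20; have [M hM] := wu _ e20; exists (maxn N M) => n.
rewrite geq_max => /andP[Nn Mn] E pi x Fpi.
apply: le_trans (rnorm_triangle _ ((pi # (u' n)) x) _) _.
by rewrite (splitr e) mulrDl; apply: lerD; [exact: hM|exact: hN].
Qed.

Hypothesis genS : compact_generating S.
Hypothesis eps1 : eps <= 1.

Lemma rep_integral_bounded (h : G -> K) : Cc h -> exists2 c : R, 0 <= c &
  forall (E : completeNormedModType K) (pi : representation G E) x, F pi ->
    rnorm ((pi # h) x) <= c * rnorm x.
Proof.
move=> /CcP[A sh]; have [_ cA _] := sh.
have [N hN] := compact_sub_setpow hausG haar_mu genS cA.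
have [c c0 hc] := supported_bounded sh.
exists (c * expR N%:R * fine (mu A)); first by rewrite !mulr_ge0 ?expR_ge0// fine_ge0.
move=> E pi x Fpi.
have -> : c * expR N%:R * fine (mu A) * rnorm x = c * (expR N%:R * rnorm x) * fine (mu A) by ring.
apply: (rep_integral_le hausG haar_mu sh c0) => [|//|g Ag].
  by rewrite mulr_ge0 ?expR_ge0 ?rnorm_ge0.
exact: growth_class_ball (ltW eps0) eps1 Fpi (hN g Ag).
Qed.

Lemma Fcauchy_bounded (u : nat -> G -> K) : Fcauchy mu F u -> exists2 c : R, 0 <= c &
  exists N, forall n, (N <= n)%N ->
  forall (E : completeNormedModType K) (pi : representation G E) x, F pi ->
    rnorm ((pi # (u n)) x) <= c * rnorm x.
Proof.
move=> /FcauchyP[cu h]; have [N hN] := h 1 ltr01.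
have [c c0 hc] := rep_integral_bounded (cu N).
exists (1 + c); first exact: addr_ge0.
exists N => n Nn E pi x Fpi.
have := hN n N Nn (leqnn N) E pi x Fpi => h1.
rewrite -[(pi # (u n)) x](subrK ((pi # (u N)) x)).
by apply: le_trans (rnormD _ _) _; rewrite mulrDl lerD// hc.
Qed.

End OperatorNorm.

Section KazhdanProjection.
Variables (R : realType) (s : scalars) (G : topologicalGroupType) (S : set G).
Local Notation K := (scalar_field R s).
Local Notation r2k := (@of_real R s).
Hypothesis genS : compact_generating S.
Hypothesis hausG : hausdorff_space G.
Variable mu : {measure set (borel G) -> \bar R}.
Hypothesis haar_mu : left_haar mu.
Local Notation int F := (bochner_integral mu F).
Local Notation Rsupported f A := (@supported R RealScalars G (R^o) f A).
Variables (eps : R) (f : G -> R) (A : set G).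
Hypotheses (eps0 : 0 < eps) (eps1 : eps <= 1).
Hypotheses (sf : Rsupported f A) (If : Rint mu f = 1).
Hypothesis halving : forall (E : completeNormedModType K) (pi : representation G E) (b : G -> E) (c : R),
  growth_class S eps pi -> cocycle pi b -> 0 < c -> (forall g, S g -> rnorm (b g) <= c) ->
  forall g, S g ->
  rnorm (b g + pi g (int (fun k => r2k (f k) *: b k)) - int (fun k => r2k (f k) *: b k)) <= c / 2.
Local Notation F := (@growth_class R s G S eps).
Local Notation "pi # f" := (rep_integral mu pi f) (at level 50).
Local Notation avg pi := (rep_integral mu pi (fun k => r2k (f k))).
Local Notation P := (@invariant_projection R s G mu f _).
Let hP := invariant_projectionP genS hausG haar_mu eps0 eps1 sf If halving.

Lemma projection_invariants (E : completeNormedModType K) (pi : representation G E) x :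
  F pi -> invariants pi (P pi x).
Proof. by move=> Fpi; have [c0 c00 h] := hP; have [] := h E pi x Fpi. Qed.

Lemma projection_id (E : completeNormedModType K) (pi : representation G E) x :
  F pi -> invariants pi x -> P pi x = x.
Proof.
move=> Fpi inv; have [c0 c00 h] := hP; have [_ hx _] := h E pi x Fpi.
apply: (rcvg_uniq hx); suff -> : (fun n => iter n (avg pi) x) = fun=> x by exact: rcvg_cst.
apply/funext; elim => // n IH; rewrite iterS IH.
rewrite (rep_integral_invariant hausG haar_mu (of_real_supported s sf) inv).
by rewrite (haar_of_real s hausG haar_mu sf) If of_real1 scale1r.
Qed.

Lemma projection_bounded : exists2 c : R, 0 <= c &
  forall (E : completeNormedModType K) (pi : representation G E) x, F pi ->
  rnorm (P pi x) <= c * rnorm x.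
Proof.
have [c0 c00 h] := hP; exists (1 + c0); first exact: addr_ge0.
move=> E pi x Fpi; have [_ _ /(_ 0%N)] := h E pi x Fpi; rewrite expr0 divr1 => hx.
rewrite -[P pi x](subKr x); apply: le_trans (rnormB _ _) _.
by rewrite mulrDl mul1r lerD.
Qed.

Lemma avg_iterD (E : completeNormedModType K) (pi : representation G E) n (a : K) x y :
  iter n (avg pi) (a *: x + y) = a *: iter n (avg pi) x + iter n (avg pi) y.
Proof.
have sK := of_real_supported s sf.
elim: n => // n IH; rewrite !iterS IH.
by rewrite (rep_integralD hausG haar_mu pi _ _ sK) (rep_integralZ hausG haar_mu pi _ _ sK).
Qed.

Lemma projection_linear (E : completeNormedModType K) (pi : representation G E) :
  F pi -> exists T : {linear E -> E}, continuous T /\ forall x, T x = P pi x.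
Proof.
move=> Fpi; have [c0 c00 h] := hP.
have lin : linear (P pi).
  move=> a x y; have [_ hx _] := h E pi x Fpi; have [_ hy _] := h E pi y Fpi.
  have [_ hxy _] := h E pi (a *: x + y) Fpi.
  apply: (rcvg_uniq hxy).
  under eq_fun do rewrite avg_iterD.
  by apply: rcvgD => //; exact: rcvgZ.
pose L := GRing.isLinear.Build K E E *:%R (P pi) lin.
pose T : {linear E -> E} := HB.pack (P pi) L.
exists T; split => //; apply/continuous_linear_bounded.
by have [c c_ge0 hc] := projection_bounded; exists c => // x; exact: hc.
Qed.

Definition converges_to_projection (v : nat -> G -> K) : Prop :=
  (forall n, Cc (v n)) /\
  forall e : R, 0 < e -> exists N, forall n, (N <= n)%N ->
    forall (E : completeNormedModType K) (pi : representation G E) x, F pi ->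
    rnorm ((pi # (v n)) x - P pi x) <= e * rnorm x.

Definition averaging_sequence (n : nat) (x : G) : K := r2k (conv_iter mu f n x).

Lemma averaging_sequenceP n : exists B, [/\ @supported R s G (K^o) (averaging_sequence n) B,
  haar_integral mu (averaging_sequence n) = 1 &
  forall (E : completeNormedModType K) (pi : representation G E) x,
    (pi # (averaging_sequence n)) x = iter n.+1 (avg pi) x].
Proof.
have [B [sB _ IB hB]] := conv_iterP hausG haar_mu n sf If.
exists B; split.
- exact: of_real_supported.
- by rewrite /averaging_sequence (haar_of_real s hausG haar_mu sB) IB of_real1.
- by move=> E pi x; exact: hB.
Qed.

Lemma averaging_sequence_cvg : converges_to_projection averaging_sequence.
Proof.
split=> [n|e e0].
  by have [B [sB _ _]] := averaging_sequenceP n; apply/CcP; exists B.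
have [c0 c00 h] := hP.
have [N hN] : exists N, c0 / 2 ^+ N <= e.
  apply: contrapT => hno; have : e <= 0.
    apply: (@le0_pow2 _ _ c0) => // n; rewrite leNgt; apply/negP => lt; apply: hno.
    by exists n; exact: ltW.
  by rewrite leNgt e0.
exists N => n Nn E pi x Fpi; have [B [_ _ ->]] := averaging_sequenceP n.
have [_ _ hx] := h E pi x Fpi; apply: le_trans (hx n.+1) _.
rewrite mulrAC ler_wpM2r ?rnorm_ge0//; apply: le_trans hN.
rewrite ler_wpM2l// lef_pV2 ?posrE ?exprn_gt0// ler_eXn2l ?ltr1n//.
by apply: leq_trans Nn _.
Qed.

Local Notation U := averaging_sequence.
Let cU n : Cc (U n). Proof. by case: averaging_sequence_cvg. Qed.

(** Identifies the representatives of the projection as the sequences whose operators converge to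
    [P] uniformly over the class, so that the required properties hold for every representative at
    once. *)
Lemma Fclass_averaging v : Fclass mu F U v <-> converges_to_projection v.
Proof.
have [_ hU] := averaging_sequence_cvg.
split=> [[/(FcauchyP S hausG haar_mu eps _)[cv _]]|[cv hv]].
  move=> /(FequivP S hausG haar_mu eps0 cv cU) vU; split; first exact: cv.
  move=> e e0.
  have e20 : 0 < e / 2 by rewrite divr_gt0.
  have [N hN] := vU _ e20; have [M hM] := hU _ e20; exists (maxn N M) => n.
  rewrite geq_max => /andP[Nn Mn] E pi x Fpi.
  apply: le_trans (rnorm_triangle _ ((pi # (U n)) x) _) _.
  by rewrite (splitr e) mulrDl; apply: lerD; [exact: hN|exact: hM].
split.
  apply/(FcauchyP S hausG haar_mu eps v); split; first exact: cv.
  move=> e e0.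
  have e20 : 0 < e / 2 by rewrite divr_gt0.
  have [N hN] := hv _ e20; exists N => m n Nm Nn E pi x Fpi.
  apply: le_trans (rnorm_triangle _ (P pi x) _) _.
  rewrite (splitr e) mulrDl; apply: lerD; first exact: hN.
  by rewrite rnormBC; exact: hN.
apply/(FequivP S hausG haar_mu eps0 cv cU) => e e0.
have e20 : 0 < e / 2 by rewrite divr_gt0.
have [N hN] := hv _ e20; have [M hM] := hU _ e20; exists (maxn N M) => n.
rewrite geq_max => /andP[Nn Mn] E pi x Fpi.
apply: le_trans (rnorm_triangle _ (P pi x) _) _.
rewrite (splitr e) mulrDl; apply: lerD; first exact: hN.
by rewrite rnormBC; exact: hM.
Qed.

Definition averaging_projection : set (nat -> G -> K) := Fclass mu F U.

Lemma averaging_projection_completion : completion mu F averaging_projection.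
Proof.
by exists U => //; have [+ _] := (Fclass_averaging U).2 averaging_sequence_cvg.
Qed.

Lemma convolution_rep (E : completeNormedModType K) (pi : representation G E) (u v : G -> K) x :
  Cc u -> Cc v -> (pi # (convolution mu u v)) x = (pi # u) ((pi # v) x).
Proof.
by move=> /CcP[B su] /CcP[D sv]; exact: (rep_convolution hausG haar_mu pi x su sv).
Qed.

Lemma rep_integralB_Cc (E : completeNormedModType K) (pi : representation G E) (u : G -> K) x y :
  Cc u -> (pi # u) (x - y) = (pi # u) x - (pi # u) y.
Proof. by move=> /CcP[B su]; exact: (rep_integralB hausG haar_mu pi x y su). Qed.

Lemma averaging_projection_idem :
  completion_mul mu F averaging_projection averaging_projection = averaging_projection.
Proof.
have key u v : converges_to_projection u -> converges_to_projection v ->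
    Fclass mu F (fun n => convolution mu (u n) (v n)) = averaging_projection.
  move=> [cu hu] [cv hv]; have [_ hU] := averaging_sequence_cvg.
  have cuv n := convolution_Cc hausG haar_mu (cu n) (cv n).
  apply: (Fclass_eq hausG haar_mu eps0 cuv cU); apply/(FequivP S hausG haar_mu eps0 cuv cU) => e e0.
  have [c c_ge0 hc] := projection_bounded.
  (* The errors add up to [2 d (c + 1)], which the second bound keeps below [e]; the bound by 1
     serves to control the norm of the image of [x] under [v n]. *)
  pose d := Num.min 1 (e / (4 * (c + 2))).
  have c2 : 0 < 4 * (c + 2) by rewrite mulr_gt0// ltr_wpDl.
  have d0 : 0 < d by rewrite lt_min ltr01 divr_gt0.
  have [N1 h1] := hu _ d0; have [N2 h2] := hv _ d0; have [N3 h3] := hU _ d0.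
  exists (maxn N1 (maxn N2 N3)) => n; rewrite !geq_max => /and3P[n1 n2 n3] E pi x Fpi.
  rewrite (convolution_rep _ _ (cu n) (cv n)).
  have Px : P pi (P pi x) = P pi x by apply: projection_id => //; exact: projection_invariants.
  have vx : rnorm ((pi # (v n)) x) <= (1 + c) * rnorm x.
    rewrite -[(pi # (v n)) x](subrK (P pi x)); apply: le_trans (rnormD _ _) _.
    rewrite mulrDl; apply: lerD; last exact: hc.
    apply: le_trans (h2 n n2 E pi x Fpi) _; rewrite ler_wpM2r ?rnorm_ge0//.
    by rewrite ge_min lexx.
  have [T [_ TP]] := projection_linear Fpi.
  have b1 := h1 n n1 E pi ((pi # (v n)) x) Fpi.
  have b2 : rnorm (P pi ((pi # (v n)) x) - P pi x) <= c * (d * rnorm x).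
    have -> : P pi ((pi # (v n)) x) - P pi x = P pi ((pi # (v n)) x - P pi x).
      by rewrite -!TP linearB !TP Px.
    apply: le_trans (hc _ _ _ Fpi) _.
    by apply: ler_wpM2l => //; exact: h2.
  have b3 := h3 n n3 E pi x Fpi.
  apply: le_trans (rnorm_triangle _ (P pi ((pi # (v n)) x)) _) _.
  apply: le_trans (lerD b1 (rnorm_triangle _ (P pi x) _)) _.
  rewrite [X in _ + (_ + X)]rnormBC.
  apply: le_trans (lerD (ler_wpM2l (ltW d0) vx) (lerD b2 b3)) _.
  have -> : d * ((1 + c) * rnorm x) + (c * (d * rnorm x) + d * rnorm x) = d * (2 * (c + 1)) * rnorm x by ring.
  rewrite ler_wpM2r ?rnorm_ge0//.
  apply: (@le_trans _ _ (e / (4 * (c + 2)) * (4 * (c + 2)))); last by rewrite divfK// gt_eqF.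
  apply: ler_pM; rewrite ?(ltW d0) ?mulr_ge0 ?addr_ge0//.
    by rewrite ge_min lexx orbT.
  by apply: ler_pM; rewrite ?addr_ge0// ?ler_nat// lerD2l ler1n.
apply/seteqP; split=> w.
  move=> [u [v [/Fclass_averaging hu /Fclass_averaging hv]]].
  by rewrite (key u v hu hv).
move=> hw; exists U, U; have hU := (Fclass_averaging U).2 averaging_sequence_cvg.
split; [exact: hU|exact: hU|].
by rewrite (key U U averaging_sequence_cvg averaging_sequence_cvg).
Qed.

Lemma averaging_projection_closure :
  in_closure mu F averaging_projection [set h | Cc h /\ haar_integral mu h = 1].
Proof.
move=> e e0; have [_ hU] := averaging_sequence_cvg.
have e40 : 0 < e / 4 by rewrite divr_gt0.
have [N hN] := hU _ e40; exists (U N).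
  by have [B [sB IB _]] := averaging_sequenceP N; split; [exact: cU|exact: IB].
move=> v /Fclass_averaging[cv hv].
have cvN n := CcB (cv n) (cU N).
have [M hM] := hv _ e40.
have small n : (M <= n)%N -> (Fnorm mu F (v n \- U N)%R <= (e / 2)%:E)%E.
  move=> Mn; have e20 : 0 <= e / 2 by rewrite divr_ge0// ltW.
  apply: (FnormP S hausG haar_mu eps (cvN n) e20).2 => E pi x Fpi.
  rewrite (rep_integral_subCc hausG haar_mu pi x (cv _) (cU _)).
  apply: le_trans (rnorm_triangle _ (P pi x) _) _.
  have -> : e / 2 = e / 4 + e / 4 by field.
  rewrite mulrDl; apply: lerD; first exact: hM.
  by rewrite rnormBC; exact: hN.
(* [in_closure] speaks of [limn], which is meaningful only for a convergent sequence; a bound on the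
   terms would not suffice without convergence. *)
have cvgv : cvgn (fun n => Fnorm mu F (v n \- U N)%R).
  apply: (@ereal_cauchy_cvg _ _ (e / 2)).
    by exists M => // n /= Mn; rewrite (Fnorm_ge0 S mu eps0)/= small.
  move=> d d0; have d20 : 0 < d / 2 by rewrite divr_gt0.
  have [M' hM'] := hv _ d20; exists (maxn M M') => m n.
  rewrite !geq_max => /andP[Mm Mm'] /andP[Mn Mn'].
  have := small n Mn; have := Fnorm_ge0 S mu eps0 (v n \- U N)%R.
  case rE : (Fnorm _ _ (v n \- U N)%R) => [r| |]//; rewrite !lee_fin => r0 re.
  have rd : 0 <= r + d by rewrite addr_ge0// ltW.
  rewrite -EFinD; apply: (FnormP S hausG haar_mu eps (cvN m) rd).2 => E pi x Fpi.
  rewrite (rep_integral_subCc hausG haar_mu pi x (cv _) (cU _)).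
  have rr : (Fnorm mu F (v n \- U N)%R <= r%:E)%E by rewrite rE.
  have := (FnormP S hausG haar_mu eps (cvN n) r0).1 rr E pi x Fpi.
  rewrite (rep_integral_subCc hausG haar_mu pi x (cv _) (cU _)) => h1.
  have h2 : rnorm ((pi # (v m)) x - (pi # (v n)) x) <= d * rnorm x.
    apply: le_trans (rnorm_triangle _ (P pi x) _) _.
    rewrite (splitr d) mulrDl; apply: lerD; first exact: hM'.
    by rewrite rnormBC; exact: hM'.
  apply: le_trans (rnorm_triangle _ ((pi # (v n)) x) _) _.
  by rewrite mulrDl addrC; exact: lerD.
apply: (@le_lt_trans _ _ (e / 2)%:E); last by rewrite lte_fin ltr_pdivrMr// ltr_pMr// ltr1n.
by apply: lime_le => //; exists M => // n /= Mn; exact: small.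
Qed.

Lemma averaging_projection_kazhdan : kazhdan_projection mu F averaging_projection.
Proof.
split.
- exact: averaging_projection_completion.
- exact: averaging_projection_idem.
- exact: averaging_projection_closure.
move=> E pi Fpi; have [T [cT TP]] := projection_linear Fpi; exists T; split.
- split=> // v /Fclass_averaging[cv hv].
  apply/ereal_cvg0P => [n|e e0]; first exact: opnorm_ge0.
  have [N hN] := hv _ e0; exists N => n Nn.
  apply: (opnorm_leP (ltW e0) _).2 => [a x|x].
    have /CcP[B sB] := cv n.
    by rewrite (rep_integralZ hausG haar_mu pi _ x sB) linearZ scalerBr.
  by rewrite TP; exact: hN.
- by move=> x; rewrite !TP; apply: projection_id => //; exact: projection_invariants.
- apply/seteqP; split=> [_ [x _ <-]|x inv]; first by rewrite TP; exact: projection_invariants.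
  by exists x => //; rewrite TP projection_id.
Qed.

End KazhdanProjection.

(** * Dual representations *)

Section DualSpace.
Variables (R : realType) (s : scalars) (G : topologicalGroupType) (S : set G).
Local Notation K := (scalar_field R s).
Local Notation r2k := (@of_real R s).
Local Notation rabs a := (@rnorm R s (K^o) a).
Variable eps : R.
Hypothesis eps0 : 0 < eps.
Hypothesis eps1 : eps <= 1.
Hypothesis genS : compact_generating S.
Variables (E : completeNormedModType K) (pi : representation G E).
Hypothesis cls : growth_class S eps pi.
Variable B : R.
Hypothesis B0 : 0 <= B.
Hypothesis locB : nbhs (1%g : G) [set g | forall x, rnorm (pi g x) <= B * rnorm x].

(** On the full dual the contragredient action need not be strongly continuous. The functionals
    whose orbit is norm-continuous form a closed invariant subspace on which it is; their
    boundedness is supplied by [wspace]. *)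
Definition dual_pred : set (E -> K) := [set xi |
  (forall (a : K) x y, xi (a *: x + y) = a * xi x + xi y) /\
  forall e : R, 0 < e ->
    nbhs (1%g : G) [set g | forall x, rabs (xi (pi g x) - xi x) <= e * rnorm x]].

Lemma dual_pred0 : dual_pred (fun=> 0).
Proof.
split=> [a x y|e e0]; first by rewrite mulr0 addr0.
by apply: nearW => g x; rewrite subrr rnorm0 mulr_ge0 ?rnorm_ge0// ltW.
Qed.

Lemma dual_predP (a : K) f g : dual_pred f -> dual_pred g -> dual_pred (fun t => a * f t + g t).
Proof.
move=> [fl fc] [gl gc]; split=> [b x y|e e0]; first by rewrite fl gl; ring.
have a1 : 0 < 2 * (rabs a + 1) by rewrite mulr_gt0// ltr_wpDl// rnorm_ge0.
have e1 : 0 < e / (2 * (rabs a + 1)) by rewrite divr_gt0.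
have e2 : 0 < e / 2 by rewrite divr_gt0.
apply: filterS (filterI (fc _ e1) (gc _ e2)) => h [hf hg] x.
have -> : a * f (pi h x) + g (pi h x) - (a * f x + g x) =
  a * (f (pi h x) - f x) + (g (pi h x) - g x) by ring.
apply: le_trans (@rnormD R s (K^o) _ _) _; rewrite [X in _ <= X * _](splitr e) mulrDl.
apply: lerD; last exact: hg.
rewrite [leLHS](@rnormZ R s (K^o)).
apply: (@le_trans _ _ ((rabs a + 1) * (e / (2 * (rabs a + 1)) * rnorm x))).
  by apply: ler_pM; rewrite ?rnorm_ge0 ?lerDl//; exact: hf.
rewrite mulrA ler_wpM2r ?rnorm_ge0// le_eqVlt; apply/orP; left; apply/eqP.
by field; rewrite gt_eqF// ltr_wpDl// rnorm_ge0.
Qed.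

(** Approximating [f] by [g] at the moved vector costs the norm of [pi k x], which the bound [B]
    near 1 controls uniformly in [k]. *)
Lemma dual_pred_closed f : (forall e : R, 0 < e -> exists2 g, dual_pred g &
    forall t, rnorm (f t - g t : K^o) <= e * rnorm t) -> dual_pred f.
Proof.
move=> h; split=> [a x y|e e0].
  apply: (@eq_eps R s (K^o) _ _ (rnorm (a *: x + y) + (rabs a * rnorm x + rnorm y))).
    by rewrite !addr_ge0 ?mulr_ge0 ?rnorm_ge0.
  move=> e /h[g [gl _] hg].
  have -> : f (a *: x + y) - (a * f x + f y) =
    (f (a *: x + y) - g (a *: x + y)) - (a * (f x - g x) + (f y - g y)) by rewrite gl; ring.
  apply: le_trans (@rnormB R s (K^o) _ _) _; rewrite [leRHS]mulrDr; apply: lerD; first exact: hg.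
  apply: le_trans (@rnormD R s (K^o) _ _) _; rewrite [leRHS]mulrDr; apply: lerD; last exact: hg.
  by rewrite [leLHS](@rnormZ R s (K^o)) mulrCA ler_wpM2l ?rnorm_ge0//; exact: hg.
have c1 : 0 < B + 2 by rewrite ltr_wpDl.
have e1 : 0 < e / (B + 2) by rewrite divr_gt0.
have [g [_ gc] hg] := h _ e1.
apply: filterS (filterI locB (gc _ e1)) => k [kB kg] x.
have -> : f (pi k x) - f x = (f (pi k x) - g (pi k x)) + ((g (pi k x) - g x) - (f x - g x)) by ring.
apply: le_trans (@rnormD R s (K^o) _ _) _.
apply: (@le_trans _ _ (e / (B + 2) * (B * rnorm x) + (e / (B + 2) * rnorm x + e / (B + 2) * rnorm x))).
  apply: lerD.
    by apply: le_trans (hg _) _; rewrite ler_wpM2l ?(ltW e1).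
  apply: le_trans (@rnormB R s (K^o) _ _) _. apply: lerD; [exact: kg|exact: hg].
rewrite le_eqVlt; apply/orP; left; apply/eqP.
by field; rewrite gt_eqF.
Qed.

Definition dual_data : weighted_data R s :=
  @WeightedData R s E (@rnorm R s E) (@rnorm_ge0 R s E) dual_pred dual_pred0 dual_predP dual_pred_closed.

Definition dual_space : completeNormedModType K := wspace dual_data.

Definition pairing (xi : dual_space) (x : E) : K := (xi : wspace dual_data) x.

Lemma pairing_lin xi (a : K) x y : pairing xi (a *: x + y) = a * pairing xi x + pairing xi y.
Proof. by have [_ [+ _]] := wspaceP (xi : wspace dual_data); exact. Qed.

Lemma pairing0 xi : pairing xi 0 = 0.
Proof. by have := pairing_lin xi (-1) 0 0; rewrite scaler0 addr0 mulN1r addNr. Qed.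

Lemma pairingZ xi a x : pairing xi (a *: x) = a * pairing xi x.
Proof. by have := pairing_lin xi a x 0; rewrite pairing0 !addr0. Qed.

Lemma pairingD xi x y : pairing xi (x + y) = pairing xi x + pairing xi y.
Proof. by have := pairing_lin xi 1 x y; rewrite scale1r mul1r. Qed.

Lemma pairingB xi x y : pairing xi (x - y) = pairing xi x - pairing xi y.
Proof. by rewrite -scaleN1r pairingD pairingZ mulN1r. Qed.

Lemma pairing_le xi x : rabs (pairing xi x) <= rnorm xi * rnorm x.
Proof. by have := wnormP (xi : wspace dual_data) x; rewrite rnorm_wspace. Qed.

Lemma pairing_orbit xi (e : R) : 0 < e ->
  nbhs (1%g : G) [set g | forall x, rabs (pairing xi (pi g x) - pairing xi x) <= e * rnorm x].
Proof. by have [_ [_ +]] := wspaceP (xi : wspace dual_data); exact. Qed.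

Lemma dual_eq (xi eta : dual_space) : (forall x, pairing xi x = pairing eta x) -> xi = eta.
Proof. by move=> h; apply: wspace_eq. Qed.

Lemma dual_norm_le (xi : dual_space) c : 0 <= c ->
  (forall x, rabs (pairing xi x) <= c * rnorm x) -> rnorm xi <= c.
Proof. by move=> c0 h; rewrite rnorm_wspace; apply: wnorm_le. Qed.

Lemma dual_intro (f : E -> K) (c : R) : 0 <= c -> dual_pred f ->
  (forall x, rabs (f x) <= c * rnorm x) ->
  exists xi : dual_space, forall x, pairing xi x = f x.
Proof.
move=> c0 fP fc.
have h : (f : widx dual_data -> K) \in @wspace_pred _ _ dual_data.
  by apply/asboolP; split => //; exists c.
by exists (WSpace h).
Qed.

Lemma unit_phase (z : K) : exists2 a : K, rabs a = 1 & a * z = r2k (rabs z).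
Proof.
have [->|z0] := eqVneq z 0.
  exists 1; last by rewrite mulr0 rnorm0 of_real0.
  by rewrite -of_real1 /rnorm normr_of_real of_realK normr1.
have r0 : rabs z != 0 by rewrite gt_eqF//; exact: (@rnorm_gt0 R s (K^o)).
exists (r2k (rabs z) / z); last by rewrite divfK.
apply: (mulIf r0); rewrite mul1r -[LHS](@rnormZ R s (K^o)).
rewrite [_ *: _]divfK//; rewrite /rnorm normr_of_real of_realK ger0_norm//.
exact: (@rnorm_ge0 R s (K^o)).
Qed.

(** With phases [a] and [b] that make both pairings nonnegative, the sum is [xi] at [a x + b y] plus
    [eta] at [a x - b y]. Cauchy-Schwarz in the plane then separates the functionals from the
    vectors, and the almost parallelogram law of [E] bounds the latter. *)
Lemma pairing_parallelogram (xi eta : dual_space) x y :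
  (rabs (pairing (xi + eta) x) + rabs (pairing (xi - eta) y)) ^+ 2 <=
  2 * (1 + eps) * (rnorm xi ^+ 2 + rnorm eta ^+ 2) * (rnorm x ^+ 2 + rnorm y ^+ 2).
Proof.
have [a a1 ax] := unit_phase (pairing (xi + eta) x).
have [b b1 by_] := unit_phase (pairing (xi - eta) y).
have D (z : E) : pairing (xi + eta) z = pairing xi z + pairing eta z by [].
have N (z : E) : pairing (xi - eta) z = pairing xi z - pairing eta z by [].
set p := rabs _ + rabs _.
have pE : r2k p = pairing xi (a *: x + b *: y) + pairing eta (a *: x - b *: y).
  rewrite of_realD -ax -by_ D N pairingD pairingB !pairingZ; ring.
have p0 : 0 <= p by rewrite addr_ge0 ?(@rnorm_ge0 R s (K^o)).
pose u := rnorm (a *: x + b *: y); pose v := rnorm (a *: x - b *: y).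
have le1 : p <= rnorm xi * u + rnorm eta * v.
  have -> : p = rabs (r2k p) by rewrite /rnorm normr_of_real of_realK ger0_norm.
  rewrite pE; apply: le_trans (@rnormD R s (K^o) _ _) _.
  by apply: lerD; exact: pairing_le.
have le2 : 2^-1 * (u ^+ 2 + v ^+ 2) <= (1 + eps) * (rnorm x ^+ 2 + rnorm y ^+ 2).
  have := growth_class_para cls (a *: x) (b *: y).
  by rewrite -/u -/v !rnormZ a1 b1 !mul1r.
have u0 : 0 <= u := rnorm_ge0 _; have v0 : 0 <= v := rnorm_ge0 _.
apply: (@le_trans _ _ ((rnorm xi * u + rnorm eta * v) ^+ 2)).
  by rewrite ler_pXn2r// nnegrE addr_ge0// mulr_ge0 ?rnorm_ge0.
apply: (@le_trans _ _ ((rnorm xi ^+ 2 + rnorm eta ^+ 2) * (u ^+ 2 + v ^+ 2))).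
  rewrite -subr_ge0; have -> : (rnorm xi ^+ 2 + rnorm eta ^+ 2) * (u ^+ 2 + v ^+ 2) -
    (rnorm xi * u + rnorm eta * v) ^+ 2 = (rnorm xi * v - rnorm eta * u) ^+ 2 by ring.
  exact: sqr_ge0.
have -> : 2 * (1 + eps) * (rnorm xi ^+ 2 + rnorm eta ^+ 2) * (rnorm x ^+ 2 + rnorm y ^+ 2) =
  (rnorm xi ^+ 2 + rnorm eta ^+ 2) * (2 * ((1 + eps) * (rnorm x ^+ 2 + rnorm y ^+ 2))) by ring.
by rewrite ler_wpM2l ?addr_ge0 ?sqr_ge0// -ler_pdivrMl.
Qed.

(** The norm of a functional need not be attained, so any smaller [c] replaces it; scaling the
    vector to norm [c] makes the pairing at least [c^2]. The value [c = 0] covers the zero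
    functional. *)
Lemma almost_attained (xi : dual_space) (c : R) : 0 <= c -> c = 0 \/ c < rnorm xi ->
  exists2 x : E, rnorm x = c & c ^+ 2 <= rabs (pairing xi x).
Proof.
move=> c0 [->|cx].
  by exists 0; rewrite ?rnorm0// expr0n; exact: (@rnorm_ge0 R s (K^o)).
have [x hx] : exists x : E, c * rnorm x < rabs (pairing xi x).
  apply: contrapT => hno; move: cx; rewrite ltNge => /negP; apply.
  apply: dual_norm_le => // x; rewrite leNgt; apply/negP => h; apply: hno.
  by exists x.
have x0 : 0 < rnorm x.
  rewrite lt_def rnorm_ge0 andbT; apply/eqP => x0; move: hx.
  have -> : x = 0 by apply: rnorm_le0; rewrite x0.
  by rewrite pairing0 !rnorm0 mulr0 ltxx.
have t0 : 0 <= c / rnorm x by rewrite divr_ge0// ltW.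
exists (r2k (c / rnorm x) *: x).
  by rewrite rnormZr ger0_norm// divfK// gt_eqF.
rewrite pairingZ -[_ * _]/(_ *: (_ : K^o)) (@rnormZr R s (K^o)) ger0_norm//.
rewrite expr2 -mulrA ler_wpM2l// mulrC ler_pdivlMr//; exact: ltW.
Qed.

Lemma sqr_le_approx (A X : R) : 0 <= A ->
  (forall c, 0 <= c -> c = 0 \/ c < A -> c ^+ 2 <= X) -> A ^+ 2 <= X.
Proof.
move=> A0 h; rewrite leNgt; apply/negP => XA.
have X0 : 0 <= X by have := h 0 (lexx _) (or_introl erefl); rewrite expr0n.
have sX : Num.sqrt X < A.
  by rewrite -(ltr_pXn2r (n := 2))// ?nnegrE ?sqrtr_ge0// sqr_sqrtr.
pose c := (Num.sqrt X + A) / 2.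
have s0 := sqrtr_ge0 X.
have c1 : Num.sqrt X < c by rewrite ltr_pdivlMr// mulr_natr mulr2n ltrD2l.
have c2 : c < A by rewrite ltr_pdivrMr// mulr_natr mulr2n ltrD2r.
have c0 : 0 <= c by apply: ltW; exact: le_lt_trans c1.
have := h c c0 (or_intror c2); rewrite leNgt => /negP; apply.
by rewrite -{1}(sqr_sqrtr X0) ltr_pXn2r ?nnegrE.
Qed.

(** The class is self-dual with the same constant. For vectors of norms [c] and [d] that almost norm
    [xi + eta] and [xi - eta], the previous inequality reads [(c^2 + d^2)^2 <= M (c^2 + d^2)];
    cancel and let [c], [d] tend to the norms. *)
Lemma dual_para : almost_parallelogram eps dual_space.
Proof.
move=> xi eta; rewrite ler_pdivrMl// mulrA.
set M := 2 * _ * _.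
have M0 : 0 <= M by rewrite !mulr_ge0 ?addr_ge0 ?sqr_ge0// ltW.
rewrite -lerBrDr; apply: sqr_le_approx; first exact: rnorm_ge0.
move=> c c0 hc; rewrite lerBrDr addrC -lerBrDr; apply: sqr_le_approx; first exact: rnorm_ge0.
move=> d d0 hd; rewrite lerBrDr addrC.
have [x xc hx] := almost_attained c0 hc; have [y yd hy] := almost_attained d0 hd.
have := pairing_parallelogram xi eta x y; rewrite -/M xc yd => h.
have T0 : 0 <= c ^+ 2 + d ^+ 2 by rewrite addr_ge0 ?sqr_ge0.
have : (c ^+ 2 + d ^+ 2) ^+ 2 <= M * (c ^+ 2 + d ^+ 2).
  apply: le_trans h; rewrite ler_pXn2r ?nnegrE ?addr_ge0 ?sqr_ge0 ?(@rnorm_ge0 R s (K^o))//.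
  exact: lerD.
move: T0; rewrite le_eqVlt => /orP[/eqP <- //|T0].
by rewrite expr2 ler_pM2r.
Qed.

Lemma dual_action_subproof g (xi : dual_space) :
  ((fun x => pairing xi (pi (g^-1)%g x)) : widx dual_data -> K) \in @wspace_pred _ _ dual_data.
Proof.
have [c c0 hc] := rep_bound1 pi (g^-1)%g.
apply/asboolP; split.
  exists (rnorm xi * c); split; first by rewrite mulr_ge0 ?rnorm_ge0.
  move=> x; apply: le_trans (pairing_le _ _) _.
  by rewrite -mulrA ler_wpM2l ?rnorm_ge0.
split=> [a x y|e e0]; first by rewrite linearP pairing_lin.
have c1 : 0 < c + 1 by rewrite ltr_wpDl.
have e1 : 0 < e / (c + 1) by rewrite divr_gt0.
(* Moving [pi h] past the inverse of [pi g] conjugates [h], hence the conjugated neighbourhood. *)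
apply: filterS (nbhs1_conj g (pairing_orbit xi e1)) => h /= hh x.
have -> : pi (g^-1)%g (pi h x) = pi (g^-1 * (h * g))%g (pi (g^-1)%g x).
  by rewrite -!repM -!mulgA mulgV mulg1.
apply: le_trans (hh _) _; rewrite mulrAC ler_pdivrMr// -mulrA ler_wpM2l ?(ltW e0)//.
apply: le_trans (hc x) _; by rewrite mulrC ler_wpM2l ?rnorm_ge0// lerDl.
Qed.

Definition dual_action g (xi : dual_space) : dual_space := WSpace (dual_action_subproof g xi).

Lemma dual_actionE g xi x : pairing (dual_action g xi) x = pairing xi (pi (g^-1)%g x).
Proof. by []. Qed.

Lemma dual_action_linear g : linear (dual_action g).
Proof. by move=> a xi eta; apply: dual_eq. Qed.

HB.instance Definition _ g :=
  GRing.isLinear.Build K dual_space dual_space ( *:%R ) (dual_action g) (dual_action_linear g).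

Lemma dual_action_le g xi :
  rnorm (dual_action g xi) <= expR (eps * (word_length S g)%:R) * rnorm xi.
Proof.
apply: dual_norm_le => [|x]; first by rewrite mulr_ge0 ?expR_ge0 ?rnorm_ge0.
rewrite dual_actionE; apply: le_trans (pairing_le _ _) _.
rewrite mulrAC mulrC ler_wpM2r ?rnorm_ge0// -(word_lengthV genS).
exact: growth_class_le.
Qed.

Lemma dual_actionM g h xi : dual_action (g * h)%g xi = dual_action g (dual_action h xi).
Proof. by apply: dual_eq => x; rewrite !dual_actionE invgM repM. Qed.

Lemma dual_action1 xi : dual_action 1%g xi = xi.
Proof. by apply: dual_eq => x; rewrite dual_actionE invg1 rep1. Qed.

Definition dual_rep : representation G dual_space.
Proof.
refine (@Representation R G s dual_space
  (fun g => (dual_action g : {linear dual_space -> dual_space})) _ dual_action1 dual_actionM _).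
- move=> g; apply/continuous_linear_bounded; exists (expR (eps * (word_length S g)%:R)).
    exact: expR_ge0.
  by move=> xi; exact: dual_action_le.
- move=> xi g; apply/cvg_rnormP => e e0.
  pose c := expR (eps * (word_length S g)%:R); have c0 : 0 < c by exact: expR_gt0.
  have e1 : 0 < e / (2 * c) by rewrite divr_gt0// mulr_gt0.
  have := nbhs_lmulg g (nbhs1_inv (pairing_orbit xi e1)).
  apply: filterS => h /= hh.
  have -> : dual_action g xi - dual_action h xi = dual_action g (xi - dual_action (g^-1 * h)%g xi).
    apply: dual_eq => x.
    change (pairing xi (pi (g^-1)%g x) - pairing xi (pi (h^-1)%g x) =
      pairing xi (pi (g^-1)%g x) - pairing xi (pi ((g^-1 * h)^-1)%g (pi (g^-1)%g x))).
    by rewrite -repM -invgM mulVKg.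
  apply: le_lt_trans (dual_action_le _ _) _; rewrite -/c.
  apply: (@le_lt_trans _ _ (c * (e / (2 * c)))).
    rewrite ler_wpM2l ?(ltW c0)//; apply: dual_norm_le => [|x]; first exact: ltW.
    have -> : pairing (xi - dual_action (g^-1 * h)%g xi) x =
      pairing xi x - pairing xi (pi (g^-1 * h)^-1%g x) by [].
    by rewrite (@rnormBC R s (K^o)); exact: hh.
  have -> : c * (e / (2 * c)) = e / 2 by field; rewrite gt_eqF.
  by rewrite ltr_pdivrMr// ltr_pMr// ltr1n.
Defined.

Lemma dual_rep_growth : growth_class S eps dual_rep.
Proof. by apply: growth_class_intro; [exact: dual_para|exact: dual_action_le]. Qed.

End DualSpace.

(** * The Hahn-Banach theorem *)

Section HahnBanach.
Variables (R : realType) (s : scalars) (E : normedModType (scalar_field R s)).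
Local Notation r2k := (@of_real R s).

Definition sublinear (p : E -> R) : Prop :=
  (forall x y, p (x + y) <= p x + p y) /\
  (forall (a : R) x, 0 < a -> p (r2k a *: x) <= a * p x).

Lemma sublinear0 p : sublinear p -> p 0 = 0.
Proof.
move=> [_ pZ]; apply: le_anti; have h2 := pZ 2 0 (ltr0n _ 2).
have h1 : p 0 <= 2^-1 * p 0 by have := pZ 2^-1 0; rewrite scaler0; apply; rewrite invr_gt0.
rewrite scaler0 in h2; move: (p 0) h1 h2 => a; lra.
Qed.

Lemma sublinear_opp p x : sublinear p -> 0 <= p x + p (- x).
Proof. by move=> sp; have [pD _] := sp; have := pD x (- x); rewrite subrr sublinear0. Qed.

Lemma sublinearZ p (a : R) x : sublinear p -> 0 <= a -> p (r2k a *: x) = a * p x.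
Proof.
move=> sp; have [_ pZ] := sp; rewrite le_eqVlt => /orP[/eqP <-|a0].
  by rewrite of_real0 scale0r mul0r sublinear0.
apply: le_anti; rewrite pZ//=.
have ai : 0 < a^-1 by rewrite invr_gt0.
have := pZ a^-1 (r2k a *: x) ai.
by rewrite scalerA -of_realM mulVf ?gt_eqF// of_real1 scale1r ler_pdivlMl.
Qed.

(* A sublinear functional that is minimal equals all of its tilts and is
   therefore additive. *)
Definition tilt (p : E -> R) (v x : E) : R :=
  inf [set p (x + r2k t *: v) - t * p v | t in [set t : R | 0 <= t]].

Section Tilt.
Variables (p : E -> R) (v : E).
Hypothesis sp : sublinear p.

Lemma tilt_le x (t : R) : 0 <= t -> tilt p v x <= p (x + r2k t *: v) - t * p v.
Proof.
move=> t0; apply: ge_inf; last by exists t.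
exists (- p (- x)) => _ [u /= u0 <-].
have [pD _] := sp; have := pD (x + r2k u *: v) (- x).
by rewrite addrAC subrr add0r sublinearZ// => h; rewrite lerBrDr addrC lerBlDr.
Qed.

Lemma le_tilt x c : (forall t : R, 0 <= t -> c <= p (x + r2k t *: v) - t * p v) -> c <= tilt p v x.
Proof.
move=> h; apply: lb_le_inf; last by move=> _ [t /= t0 <-]; exact: h.
by exists (p (x + r2k 0 *: v) - 0 * p v); exists 0 => /=.
Qed.

Lemma tilt_le0 x : tilt p v x <= p x.
Proof. by have := tilt_le x (lexx 0); rewrite of_real0 scale0r addr0 mul0r subr0. Qed.

Lemma tilt_sublinear : sublinear (tilt p v).
Proof.
have [pD _] := sp; split=> [x y|a x a0].
  rewrite -lerBlDr; apply: le_tilt => t t0.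
  rewrite lerBlDr -lerBlDl; apply: le_tilt => u u0.
  rewrite lerBlDl; apply: le_trans (tilt_le (x + y) (addr_ge0 t0 u0)) _.
  rewrite of_realD scalerDl addrACA mulrDl.
  rewrite [leRHS]addrACA -opprD lerD2r; exact: pD.
rewrite -ler_pdivrMl//; apply: le_tilt => t t0.
rewrite ler_pdivrMl//; apply: le_trans (tilt_le _ (mulr_ge0 (ltW a0) t0)) _.
by rewrite of_realM -scalerA -scalerDr sublinearZ ?(ltW a0)// mulrBr mulrA.
Qed.

End Tilt.

(** Zorn's lemma for the reversed pointwise order. A chain has its infimum as bound, which is
    sublinear because two members of the chain can be replaced by the smaller one. *)
Lemma minimal_sublinear (p0 : E -> R) : sublinear p0 -> exists p : E -> R,
  [/\ sublinear p, forall x, p x <= p0 x &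
      forall q, sublinear q -> (forall x, q x <= p x) -> q = p].
Proof.
move=> sp0; pose T := {p : E -> R | sublinear p /\ forall x, p x <= p0 x}.
pose r (a b : T) : bool := `[< forall x, sval b x <= sval a x >].
have [||||t ht] := @Zorn T r.
- by move=> t; apply/asboolP.
- move=> b a c /asboolP ab /asboolP bc; apply/asboolP => x.
  exact: le_trans (bc x) (ab x).
- move=> [a ha] [b hb] /asboolP ab /asboolP ba; apply: eq_exist.
  by apply/funext => x; apply: le_anti; rewrite ab ba.
- move=> A totA; have [[a0 Aa0]|nA] := pselect (A !=set0); last first.
    exists (exist _ p0 (conj sp0 (fun x => lexx _))) => a Aa.
    by exfalso; apply: nA; exists a.
  (* The infimum is finite: sublinearity gives [0 <= a x + a (- x)], so every [a] below [p0] is at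
     least [- p0 (- x)]. *)
  pose q x := inf [set sval a x | a in A].
  have lbd x : has_lbound [set sval a x | a in A].
    exists (- p0 (- x)) => _ [a Aa <-]; have [sa ap] := svalP a.
    rewrite lerNl; apply: le_trans (ap _); rewrite -subr_ge0 opprK addrC.
    exact: sublinear_opp.
  have qle a x : A a -> q x <= sval a x by move=> Aa; apply: ge_inf => //; exists a.
  have le_q x c : (forall a, A a -> c <= sval a x) -> c <= q x.
    move=> h; apply: lb_le_inf; first by exists (sval a0 x), a0.
    by move=> _ [a Aa <-]; exact: h.
  have sq : sublinear q.
    split=> [x y|a x a_gt0].
      rewrite -lerBlDr; apply: (le_q x) => a Aa; rewrite lerBlDr -lerBlDl; apply: (le_q y) => b Ab.
      rewrite lerBlDl; have [[aD _] _] := svalP a; have [[bD _] _] := svalP b.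
      have [/asboolP ab|/asboolP ba] := totA a b Aa Ab.
        by apply: le_trans (qle b _ Ab) _; apply: le_trans (bD x y) _; rewrite lerD2r.
      by apply: le_trans (qle a _ Aa) _; apply: le_trans (aD x y) _; rewrite lerD2l.
    rewrite -ler_pdivrMl//; apply: le_q => b Ab; rewrite ler_pdivrMl//.
    by apply: le_trans (qle b _ Ab) _; have [[_ bZ] _] := svalP b; exact: bZ.
  have qp x : q x <= p0 x.
    by apply: le_trans (qle a0 x Aa0) _; have [_ ->] := svalP a0.
  by exists (exist _ q (conj sq qp)) => a Aa; apply/asboolP => x; exact: qle.
have [st tp] := svalP t; exists (sval t); split => // q sq qt.
have qp x : q x <= p0 x by exact: le_trans (qt x) (tp x).
have := ht (exist _ q (conj sq qp)) => /(_ _)/(congr1 sval); apply.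
by apply/asboolP.
Qed.

(** A minimal sublinear functional below the norm is additive, since it coincides with each of its
    tilts. Starting from the norm tilted along [u] fixes its value at [u]. *)
Lemma real_separation (u : E) : exists r : E -> R,
  [/\ forall x y, r (x + y) = r x + r y, forall (a : R) x, r (r2k a *: x) = a * r x,
      forall x, `|r x| <= rnorm x & rnorm u <= r u].
Proof.
have sN : sublinear (@rnorm R s E).
  by split=> [x y|a x a0]; [exact: rnormD|rewrite rnormZr ger0_norm// ltW].
have [p [sp pN pmin]] := minimal_sublinear (tilt_sublinear u sN).
(* At [- u], moving by [u] reaches the origin, so the tilted norm there is at most [- rnorm u]; by
   oddness the functional is at least [rnorm u] at [u]. *)
have pu : p (- u) <= - rnorm u.
  apply: le_trans (pN _) _; apply: le_trans (tilt_le u sN (- u) ler01) _.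
  by rewrite of_real1 scale1r addNr rnorm0 mul1r add0r.
have {}pN x : p x <= rnorm x := le_trans (pN x) (tilt_le0 u sN x).
have [pD _] := sp.
have add x v : p (x + v) = p x + p v.
  apply: le_anti; rewrite pD/=.
  have e : tilt p v = p by apply: pmin; [exact: tilt_sublinear|exact: tilt_le0].
  have := tilt_le v sp x (ler01 : 0 <= 1); rewrite e of_real1 scale1r mul1r.
  by rewrite lerBrDr.
have pN1 x : p (- x) = - p x.
  by apply/eqP; rewrite -addr_eq0 -add addNr sublinear0.
exists p; split => //.
- move=> a x; have [a0|a0] := leP 0 a; first exact: sublinearZ.
  have na : 0 <= - a by rewrite oppr_ge0 ltW.
  by rewrite -[a in LHS]opprK of_realN scaleNr pN1 sublinearZ// mulNr opprK.
- move=> x; rewrite ler_norml pN andbT lerNl -pN1 -[leRHS]rnormN; exact: pN.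
- by rewrite -lerN2 -pN1.
Qed.

End HahnBanach.

(** Over the complex numbers the real functional [r] is completed to [r(x) - i r(i x)]. The factor 2
    comes from bounding the real and imaginary parts separately. *)
Lemma functional_separation (R : realType) (s : scalars) (E : normedModType (scalar_field R s)) (u : E) :
  exists f : E -> scalar_field R s,
  [/\ forall (a : scalar_field R s) x y, f (a *: x + y) = a * f x + f y,
      forall x, @rnorm R s ((scalar_field R s)^o) (f x) <= 2 * rnorm x &
      u != 0 -> f u != 0].
Proof.
have [r [rD rZ r_le ru]] := real_separation u.
have ru0 : u != 0 -> r u != 0.
  by move=> u0; rewrite gt_eqF//; apply: lt_le_trans ru; exact: rnorm_gt0.
case: s E u r rD rZ r_le ru ru0 => E u r rD rZ r_le ru ru0.
  exists r; split=> // [a x y|x]; first by rewrite rD rZ.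
  rewrite {1}/rnorm /=; apply: le_trans (r_le x) _.
  by rewrite ler_peMl ?rnorm_ge0// ler1n.
pose iC : scalar_field R ComplexScalars := ('i : R[i])%C.
pose f x : R[i] := (r x +i* - r (iC *: x))%C.
have iE (a : R[i]) : (a : scalar_field R ComplexScalars) =
    of_real ComplexScalars (complex.Re a) + of_real ComplexScalars (complex.Im a) * iC.
  by apply/eqP; rewrite eq_complex /=; case: a => a1 a2 /=; rewrite !mulr0 !mul0r !mulr1 !subr0 !addr0 !add0r !eqxx.
have ii : iC * iC = of_real ComplexScalars (-1).
  by apply/eqP; rewrite eq_complex /= !mulr0 !mul0r !mulr1 !sub0r addr0 !eqxx.
have rM (a : R[i]) x : r ((a : scalar_field R ComplexScalars) *: x) =
    complex.Re a * r x + complex.Im a * r (iC *: x).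
  by rewrite {1}(iE a) scalerDl rD rZ -scalerA rZ.
have riM (a : R[i]) x : r (iC *: ((a : scalar_field R ComplexScalars) *: x)) =
    complex.Re a * r (iC *: x) - complex.Im a * r x.
  rewrite scalerA mulrC -scalerA rM scalerA ii rZ; ring.
exists f; split=> [a x y|x|u0].
- apply/eqP; rewrite eq_complex /f; case: a => a1 a2.
  rewrite scalerDr !rD rM riM /=.
  by apply/andP; split; apply/eqP; ring.
- have h1 := r_le x; have h2 := r_le (iC *: x).
  have n1 : rnorm (iC *: x) = rnorm x.
    rewrite rnormZ; suff -> : @rnorm R ComplexScalars ((scalar_field R ComplexScalars)^o) iC = 1 by rewrite mul1r.
    by rewrite /rnorm /= /Num.norm /= expr0n expr1n add0r sqrtr1.
  rewrite n1 in h2.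
  have -> : @rnorm R ComplexScalars ((scalar_field R ComplexScalars)^o) (f x) =
      Num.sqrt (r x ^+ 2 + r (iC *: x) ^+ 2).
    by rewrite /rnorm /= /Num.norm /= sqrrN.
  have le1 : Num.sqrt (r x ^+ 2 + r (iC *: x) ^+ 2) <= `|r x| + `|r (iC *: x)|.
    rewrite -[leRHS]ger0_norm ?addr_ge0// -sqrtr_sqr ler_wsqrtr// sqrrD.
    by rewrite !real_normK ?num_real// lerD2r lerDl mulrn_wge0// mulr_ge0.
  by apply: le_trans le1 _; rewrite mulr2n mulrDl mul1r lerD.
- by rewrite eq_complex /f /= negb_and ru0.
Qed.

Section InvariantSeparation.
Variables (R : realType) (s : scalars) (G : topologicalGroupType) (S : set G).
Local Notation K := (scalar_field R s).
Local Notation r2k := (@of_real R s).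
Local Notation rabs a := (@rnorm R s (K^o) a).
Hypothesis genS : compact_generating S.
Hypothesis hausG : hausdorff_space G.
Hypothesis lcG : locally_compact [set: G].
Variable mu : {measure set (borel G) -> \bar R}.
Hypothesis haar_mu : left_haar mu.
Let finmu := haar_compact haar_mu.
Local Notation int F := (bochner_integral mu F).
Local Notation vol A := (fine (mu A)).
Variable eps : R.
Hypotheses (eps0 : 0 < eps) (eps1 : eps <= 1).

Lemma growth_class_locally_bounded : exists2 B : R, 0 <= B &
  forall (E : completeNormedModType K) (pi : representation G E), growth_class S eps pi ->
    nbhs (1%g : G) [set g | forall x, rnorm (pi g x) <= B * rnorm x].
Proof.
have [W W1 cW] := compact_nbhs1 lcG.
have [N hN] := compact_sub_setpow hausG haar_mu genS cW.
exists (expR N%:R); first exact: expR_ge0.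
move=> E pi cls; apply: filterS W1 => g Wg x.
exact: growth_class_ball (ltW eps0) eps1 cls (hN g Wg).
Qed.

Variables (E : completeNormedModType K) (pi : representation G E).
Hypothesis cls : growth_class S eps pi.
Let cE := @completeNormedMod_rcomplete R s E.

(* Averaging a functional over translates by a bump makes its orbit norm
   continuous and does not change its values on invariant vectors. *)
Lemma invariant_separation (u : E) : invariants pi u -> u != 0 -> exists f : E -> K,
  [/\ @dual_pred R s G E pi f, f u != 0 & exists2 c : R, 0 <= c & forall x, rabs (f x) <= c * rnorm x].
Proof.
move=> inv u0.
have [h [hl hb /(_ u0) hu]] := functional_separation u.
have [f0 [A0 [sf0 _ _ If0]]] := normalized_bump hausG lcG haar_mu.
have [cf0 cA0 f00] := sf0.
have [W0 W01 cW0] := compact_nbhs1 lcG.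
pose B := [set (x * y)%g | x in W0 & y in A0] `|` A0.
have cB : compact B by apply: compactU => //; exact: compact_mulg.
have [N hN] := compact_sub_setpow hausG haar_mu genS cB.
have V0 : 0 <= vol B by exact: fine_ge0.
pose M := expR N%:R * vol B; have M0 : 0 <= M by rewrite mulr_ge0// expR_ge0.
have cpi x : continuous (fun k => pi (k^-1)%g x).
  move=> k; apply: (@cvg_comp _ _ _ (fun k => (k^-1)%g) (fun k => pi k x)).
    exact: invg_continuous.
  exact: rep_continuous.
have piB k x : B k -> rnorm (pi (k^-1)%g x) <= expR N%:R * rnorm x.
  by move=> Bk; apply: growth_class_ball (ltW eps0) eps1 cls (setpow_inv genS (hN k Bk)).
(* Averaging along inverses makes the replacement of [x] by [pi g x] a translation of the bump, so
   that the uniform continuity of the bump becomes norm continuity of the orbit. *)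
pose avg (phi : G -> R) x := int (fun k => r2k (phi k) *: pi (k^-1)%g x).
have sup (phi : G -> R) x : @supported R RealScalars G (R^o) phi B ->
    supported (fun k => r2k (phi k) *: pi (k^-1)%g x) B.
  by move=> sphi; apply: supported_lscale; [exact: of_real_supported|exact: cpi].
have avg_le (phi : G -> R) c x : @supported R RealScalars G (R^o) phi B -> 0 <= c ->
    (forall k, `|phi k| <= c) -> rnorm (avg phi x) <= c * M * rnorm x.
  move=> sphi c0 hc.
  have -> : c * M * rnorm x = c * (expR N%:R * rnorm x) * vol B by rewrite /M; ring.
  apply: (rnorm_int_le hausG finmu cE (sup phi x sphi)).
    by rewrite mulr_ge0// mulr_ge0 ?expR_ge0 ?rnorm_ge0.
  move=> k; rewrite rnormZr; have [Bk|nB] := pselect (B k).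
    by apply: ler_pM; rewrite ?rnorm_ge0//; exact: piB.
  have [_ _ phi0] := sphi; rewrite (phi0 k nB) normr0 mul0r.
  by rewrite mulr_ge0// mulr_ge0 ?expR_ge0 ?rnorm_ge0.
have sB0 : @supported R RealScalars G (R^o) f0 B.
  by apply: (supported_sub sf0 cB) => x Ax; right.
have [c1 c10 hc1] := supported_bounded sB0.
have h0 : h 0 = 0 by have := hl (-1) 0 0; rewrite scaler0 addr0 mulN1r addNr.
have hB x y : h (x - y) = h x - h y.
  by have := hl (-1) y x; rewrite scaleN1r mulN1r addrC => ->; rewrite addrC.
exists (fun x => h (avg f0 x)); split.
- split=> [a x y|e e0].
    rewrite -hl; congr h; rewrite /avg -(intZ hausG finmu cE a (sup _ x sB0)).
    rewrite -(intD hausG finmu cE (supportedZ a (sup _ x sB0)) (sup _ y sB0)).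
    by congr bochner_integral; apply/funext => k; rewrite linearP scalerDr !scalerA mulrC.
  pose d := e / (2 * (M + 1)).
  have M1 : 0 < 2 * (M + 1) by rewrite mulr_gt0// ltr_wpDl.
  have d0 : 0 < d by rewrite divr_gt0.
  have fin (r : R) : 0 <= r -> 2 * (d * M * r) <= e * r.
    move=> r0; have -> : 2 * (d * M * r) = d * (2 * M) * r by ring.
    rewrite ler_wpM2r//.
    apply: (@le_trans _ _ (d * (2 * (M + 1)))); last by rewrite /d divfK// gt_eqF.
    by rewrite ler_wpM2l ?(ltW d0)// ler_wpM2l// lerDl.
  have near1 := @Cc_unif_continuous R RealScalars G (R^o) lcG f0 A0 cf0 cA0 f00 d d0.
  have W1 := @filterI _ _ (nbhs_filter (1%g : G)) _ _ W01 near1; have near2 := nbhs1_inv W1.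
  apply: filterS near2 => g [W0g hg] x.
  rewrite /= invgK in hg.
  have {}hg k : `|f0 (g * k)%g - f0 k| <= d by exact: hg.
  pose phi k := f0 (g * k)%g - f0 k.
  have sphi : @supported R RealScalars G (R^o) phi B.
    split=> // [k|k nB].
      apply: (@cvgB R); last exact: cf0.
      by apply: (@cvg_comp _ _ _ (fun k => (g * k)%g) f0); [exact: lmulg_continuous|exact: cf0].
    rewrite /phi !f00 ?subrr// => Ax; apply: nB; first by right.
    by left; exists (g^-1)%g => //; exists (g * k)%g => //; rewrite mulKg.
  have sg : @supported R RealScalars G (R^o) (fun k => f0 (g * k)%g) B.
    have := supportedD sphi sB0; congr (supported _ _).
    by apply/funext => k; rewrite /phi subrK.
  have e1 : avg f0 (pi g x) = avg (fun k => f0 (g * k)%g) x.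
    have sF : supported (fun k => r2k (f0 k) *: pi (k^-1)%g (pi g x)) B by exact: sup.
    rewrite /avg -(int_lmulg hausG haar_mu (g^-1)%g cE sF).
    congr bochner_integral; apply/funext => k.
    by rewrite invgK -repM invgM mulgVK.
  rewrite -hB e1 /avg -(intB hausG finmu cE (sup _ x sg) (sup _ x sB0)).
  have -> : (fun k => r2k (f0 (g * k)%g) *: pi (k^-1)%g x - r2k (f0 k) *: pi (k^-1)%g x) =
      (fun k => r2k (phi k) *: pi (k^-1)%g x).
    by apply/funext => k; rewrite /phi of_realB scalerBl.
  apply: le_trans (hb _) _; rewrite -/(avg phi x).
  have le1 := ler_wpM2l (ler0n R 2) (avg_le phi d x sphi (ltW d0) hg).
  exact: le_trans le1 (fin _ (rnorm_ge0 x)).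
- suff -> : avg f0 u = u by [].
  have -> : avg f0 u = int (fun k => r2k (f0 k) *: u).
    by congr bochner_integral; apply/funext => k; rewrite inv.
  have := rep_integral_invariant hausG haar_mu (pi := trivial_rep G E) (x := u) (of_real_supported s sf0) _.
  rewrite (haar_of_real s hausG haar_mu sf0) If0 of_real1 scale1r => e; exact: e.
- exists (2 * (c1 * M)); first by rewrite !mulr_ge0.
  move=> x; apply: le_trans (hb _) _; rewrite -mulrA ler_wpM2l//.
  exact: avg_le.
Qed.

End InvariantSeparation.

(** * Centrality *)

Section Centrality.
Variables (R : realType) (s : scalars) (G : topologicalGroupType) (S : set G).
Local Notation K := (scalar_field R s).
Local Notation r2k := (@of_real R s).
Local Notation rabs a := (@rnorm R s (K^o) a).
Hypothesis genS : compact_generating S.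
Hypothesis hausG : hausdorff_space G.
Hypothesis lcG : locally_compact [set: G].
Variable mu : {measure set (borel G) -> \bar R}.
Hypothesis haar_mu : left_haar mu.
Let finmu := haar_compact haar_mu.
Local Notation int F := (bochner_integral mu F).
Local Notation Rsupported f A := (@supported R RealScalars G (R^o) f A).
Variables (eps : R) (f : G -> R) (A : set G).
Hypotheses (eps0 : 0 < eps) (eps1 : eps <= 1).
Hypotheses (sf : Rsupported f A) (If : Rint mu f = 1).
Hypothesis halving : forall (E : completeNormedModType K) (pi : representation G E) (b : G -> E) (c : R),
  growth_class S eps pi -> cocycle pi b -> 0 < c -> (forall g, S g -> rnorm (b g) <= c) ->
  forall g, S g ->
  rnorm (b g + pi g (int (fun k => r2k (f k) *: b k)) - int (fun k => r2k (f k) *: b k)) <= c / 2.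
Local Notation F := (@growth_class R s G S eps).
Local Notation "pi # f" := (rep_integral mu pi f) (at level 50).
Local Notation avg pi := (rep_integral mu pi (fun k => r2k (f k))).
Local Notation P := (@invariant_projection R s G mu f _).

Lemma projection_rcvg (E : completeNormedModType K) (pi : representation G E) x :
  F pi -> rcvg (fun n => iter n (avg pi) x) (P pi x).
Proof.
have [c0 _ h] := invariant_projectionP genS hausG haar_mu eps0 eps1 sf If halving.
by move=> Fpi; have [] := h E pi x Fpi.
Qed.

(* An invariant vector is detected by an orbit-continuous functional xi, and its
   projection xi' to the invariants of the dual representation satisfies
   xi (P x) = xi' (P x) = xi' x. *)
Lemma projection_translate (E : completeNormedModType K) (pi : representation G E) g x :
  F pi -> P pi (pi g x) = P pi x.
Proof.
move=> cls; have invP y := projection_invariants genS hausG haar_mu eps0 eps1 sf If halving y cls.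
apply/eqP; rewrite -subr_eq0; apply/negPn/negP => u0.
set u := P pi (pi g x) - P pi x in u0.
have inv_u : invariants pi u by move=> h; rewrite /u linearB !invP.
have [phi [phiD phiu [c c0 hc]]] := invariant_separation genS hausG lcG haar_mu eps0 eps1 cls inv_u u0.
have [B B0 hB] := growth_class_locally_bounded s genS hausG lcG haar_mu eps0 eps1.
have locB := hB E pi cls.
have [xi xiE] := dual_intro B0 locB c0 phiD hc.
pose D := dual_space B0 locB.
pose rho : representation G D := dual_rep genS cls B0 locB.
have Frho : F rho by exact: dual_rep_growth.
pose eta : D := P rho xi.
have sK := of_real_supported s sf.
have inv_eta h y : pairing eta (pi h y) = pairing eta y.
  have := projection_invariants genS hausG haar_mu eps0 eps1 sf If halving xi Frho (h^-1)%g.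
  by move=> /(congr1 (fun z : D => pairing z y)); rewrite /rho dual_actionE invgK.
(* The average has total mass 1, so a functional that is constant along the orbit of [y] keeps its
   value. *)
have pair_int (zeta : D) y z : (forall h, pairing zeta (pi h y) = z) -> pairing zeta (avg pi y) = z.
  move=> hz.
  have [|||_ ->] := @int_map R G mu hausG finmu s s E (K^o) (pairing zeta) (rnorm zeta) _ A
    (@completeNormedMod_rcomplete R s E) (@rcomplete_scalar R s) _ _ _ (rep_supported pi y sK).
  - by move=> a b; rewrite pairingD.
  - by move=> a b; rewrite pairingZ.
  - by move=> a; exact: pairing_le.
  have -> : pairing zeta \o (fun h => r2k (f h) *: pi h y) = fun h => r2k (f h) *: (z : K^o).
    by apply/funext => h /=; rewrite pairingZ hz.
  have := rep_integral_invariant hausG haar_mu (pi := trivial_rep G (scalar_complete R s)) (x := z) sK _.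
  rewrite (haar_of_real s hausG haar_mu sf) If of_real1 scale1r => e; exact: e.
have pair_lim (zeta : D) (v : nat -> E) l : rcvg v l -> rcvg (fun n => pairing zeta (v n) : K^o) (pairing zeta l).
  move=> vl e e0; have z1 : 0 < rnorm zeta + 1 by rewrite ltr_wpDl// rnorm_ge0.
  have [N hN] := vl _ (divr_gt0 e0 z1); exists N => n Nn.
  rewrite -pairingB; apply: le_lt_trans (pairing_le _ _) _.
  apply: (@le_lt_trans _ _ ((rnorm zeta + 1) * rnorm (v n - l))).
    by rewrite ler_wpM2r ?rnorm_ge0// lerDl.
  by rewrite mulrC -ltr_pdivlMr// hN.
have etaP y : pairing eta (P pi y) = pairing eta y.
  have h1 := pair_lim eta _ _ (projection_rcvg y cls).
  apply: (rcvg_uniq h1); suff -> : (fun n => pairing eta (iter n (avg pi) y) : K^o) = fun=> pairing eta y.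
    exact: (@rcvg_cst R s (K^o)).
  apply/funext; elim => // n IH; rewrite iterS (pair_int eta _ (pairing eta y))// => h.
  by rewrite inv_eta.
(* On an invariant vector all translates of [xi] agree, so averaging in the dual does not change the
   value, and neither does the limit. *)
have xi_eta y : invariants pi y -> pairing xi y = pairing eta y.
  move=> inv; have h1 := projection_rcvg xi Frho.
  have iterE n : pairing (iter n (avg rho) xi) y = pairing xi y.
    elim: n => // n IH; rewrite iterS.
    have sr := rep_supported rho (iter n (avg rho) xi) sK.
    have [|||_ ->] := @int_map R G mu hausG finmu s s D (K^o) (fun z : D => pairing z y) (rnorm y) _ A
      (@completeNormedMod_rcomplete R s D) (@rcomplete_scalar R s) _ _ _ sr.
    - by [].
    - by [].
    - by move=> z; rewrite mulrC; exact: pairing_le.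
    have -> : (fun z : D => pairing z y) \o (fun h => r2k (f h) *: rho h (iter n (avg rho) xi)) =
        fun h => r2k (f h) *: (pairing xi y : K^o).
      apply/funext => h; rewrite /comp -IH -[in RHS](inv (h^-1)%g); exact: erefl.
    have := rep_integral_invariant hausG haar_mu (pi := trivial_rep G (scalar_complete R s)) (x := pairing xi y) sK _.
    rewrite (haar_of_real s hausG haar_mu sf) If of_real1 scale1r => e; exact: e.
  apply/esym; apply: (@rcvg_uniq R s (K^o) (fun n => pairing (iter n (avg rho) xi) y)).
    move=> e e0; have y1 : 0 < rnorm y + 1 by rewrite ltr_wpDl// rnorm_ge0.
    have [N hN] := h1 _ (divr_gt0 e0 y1); exists N => n Nn.
    have -> : (pairing (iter n (avg rho) xi) y - pairing eta y : K^o) = pairing (iter n (avg rho) xi - eta) y by [].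
    apply: le_lt_trans (pairing_le _ _) _.
    apply: (@le_lt_trans _ _ (rnorm (iter n (avg rho) xi - eta) * (rnorm y + 1))).
      by rewrite ler_wpM2l ?rnorm_ge0// lerDl.
    by rewrite -ltr_pdivlMr// hN.
  by under eq_fun do rewrite iterE; exact: (@rcvg_cst R s (K^o)).
move/negP: phiu; apply; apply/eqP.
rewrite -xiE /u pairingB !xi_eta; [|exact: invP|exact: invP].
by rewrite !etaP inv_eta subrr.
Qed.

(** Bounded linear maps pass under the integral. By invariance on both sides, [P] after [pi k] and
    [pi k] after [P] are both equal to [P]. *)
Lemma projection_rep_integral (E : completeNormedModType K) (pi : representation G E) (h : G -> K) x :
  F pi -> Cc h -> P pi ((pi # h) x) = (pi # h) (P pi x).
Proof.
move=> Fpi /CcP[B sh].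
have [T [cT TP]] := projection_linear genS hausG haar_mu eps0 eps1 sf If halving Fpi.
have [c c0 hc] := (continuous_linear_bounded T).1 cT.
have cE := @completeNormedMod_rcomplete R s E.
rewrite -!TP.
have [|||_ ->] := @int_map R G mu hausG finmu s s E E T c _ B cE cE _ _ _ (rep_supported pi x sh).
- exact: linearD.
- by move=> a y; rewrite linearZ.
- exact: hc.
congr bochner_integral; apply/funext => k /=.
rewrite linearZ !TP projection_translate//; congr (_ *: _).
by rewrite (projection_invariants genS hausG haar_mu eps0 eps1 sf If halving x Fpi).
Qed.

(** For [v] in the class of the projection, both orders of the product act asymptotically as the
    operator of [w n] composed with [P]. The errors are uniform because a Cauchy sequence has
    operators bounded uniformly over the class from some index on. *)
Lemma averaging_projection_central :
  central mu F (averaging_projection S mu eps f).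
Proof.
have key v w : converges_to_projection S mu eps f v -> Fcauchy mu F w ->
    Fclass mu F (fun n => convolution mu (v n) (w n)) =
    Fclass mu F (fun n => convolution mu (w n) (v n)).
  move=> [cv hv] hw; have [cw _] := (FcauchyP S hausG haar_mu eps w).1 hw.
  have cvw n := convolution_Cc hausG haar_mu (cv n) (cw n).
  have cwv n := convolution_Cc hausG haar_mu (cw n) (cv n).
  apply: (Fclass_eq hausG haar_mu eps0 cvw cwv).
  apply/(FequivP S hausG haar_mu eps0 cvw cwv) => e e0.
  have [c c0 [N0 hc]] := Fcauchy_bounded hausG haar_mu eps0 genS eps1 hw.
  have c1 : 0 < 2 * (c + 1) by rewrite mulr_gt0// ltr_wpDl.
  pose d := e / (2 * (c + 1)); have d0 : 0 < d by rewrite divr_gt0.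
  have [N hN] := hv _ d0; exists (maxn N N0) => n.
  rewrite geq_max => /andP[Nn N0n] E pi x Fpi.
  rewrite [X in rnorm (X - _)](convolution_rep hausG haar_mu pi x (cv n) (cw n)).
  rewrite [X in rnorm (_ - X)](convolution_rep hausG haar_mu pi x (cw n) (cv n)).
  have h1 := hN n Nn E pi ((pi # (w n)) x) Fpi.
  have h2 : rnorm ((pi # (w n)) ((pi # (v n)) x) - (pi # (w n)) (P pi x)) <= c * (d * rnorm x).
    rewrite -(rep_integralB_Cc hausG haar_mu pi _ _ (cw n)).
    apply: le_trans (hc n N0n E pi _ Fpi) _; apply: ler_wpM2l => //; exact: hN.
  have h3 := hc n N0n E pi x Fpi.
  rewrite (projection_rep_integral x Fpi (cw n)) in h1.
  apply: le_trans (rnorm_triangle _ ((pi # (w n)) (P pi x)) _) _.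
  rewrite [X in _ + X]rnormBC; apply: le_trans (lerD h1 h2) _.
  apply: le_trans (lerD (ler_wpM2l (ltW d0) h3) (lexx _)) _.
  have -> : d * (c * rnorm x) + c * (d * rnorm x) = d * (2 * c) * rnorm x by ring.
  rewrite ler_wpM2r ?rnorm_ge0//.
  apply: (@le_trans _ _ (d * (2 * (c + 1)))); last by rewrite /d divfK// gt_eqF.
  by rewrite ler_wpM2l ?(ltW d0)// ler_wpM2l// lerDl.
have inP v := Fclass_averaging genS hausG haar_mu eps0 eps1 sf If halving v.
move=> _ [u0 hu0 <-]; apply/seteqP; split=> z [v [w [hv hw]]].
  have [cw _] := hw; have kz := key v w ((inP v).1 hv) cw.
  by rewrite kz => hz; exists w, v; split; [exact: hw|exact: hv|exact: hz].
have [cv _] := hv; have kz := key w v ((inP w).1 hw) cv.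
by rewrite -kz => hz; exists w, v; split; [exact: hw|exact: hv|exact: hz].
Qed.

End Centrality.

Theorem corollary5p5 (R : realType) (s : scalars) (G : topologicalGroupType)
    (hausG : hausdorff_space G) (lcG : locally_compact [set: G])
    (sepG : separable G) (infG : infinite_set [set: G])
    (S : set G) (genS : compact_generating S)
    (mu : {measure set (borel G) -> \bar R}) (haar_mu : left_haar mu)
    (hT : property_T R G) :
  exists2 e : R, 0 < e &
    let F :=
      reps_of_growth (@almost_parallelogram R s e)
        (fun g => e * (word_length S g)%:R) in
    (exists2 p, kazhdan_projection mu F p & central mu F p) /\
    (forall (E : completeNormedModType (scalar_field R s))
       (pi : representation G E), F E pi ->
       forall b : G -> E, cocycle pi b ->
       exists x : E, forall g, affine_action pi b g x = x).
Proof.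
have [e [e0 e1 [f [A [sf If halving]]]]] := cocycle_halving s genS hausG lcG haar_mu hT.
exists e => //; split.
  exists (averaging_projection S mu e f).
    exact: (averaging_projection_kazhdan genS hausG haar_mu e0 e1 sf If halving).
  exact: (averaging_projection_central genS hausG lcG haar_mu e0 e1 sf If halving).
move=> E pi Fpi b hb.
have [x hx] := affine_fixed_point genS hausG haar_mu e0 e1 sf halving Fpi hb.
by exists x => g; rewrite /affine_action addrC.
Qed.
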